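(* Let $d\in\mathbb{N}$, let $\mathcal{M}$ be a $d$-dimensional $C^\infty$ compact Riemannian manifold without boundary, let $1\leqslant p<\infty$, $q=p/(p-1)$ (with $q=\infty$ for $p=1$), and let $k\in\mathbb{N}$ be such that $k\geqslant\frac d2\left(\frac12-\frac1p\right)$. Then for every $x\in\overline{H}^{4k}_q(\mathcal{M})$ there holds the sharp inequality $$\|\Delta^kx\|_2\leqslant\sqrt{\|x\|_p\,\|\Delta^{2k}x\|_q}.$$
   Context: $\mathcal{M}$ is connected and carries its Riemannian volume measure $\mu_g$; $\Delta$ is the positive Laplace–Beltrami operator on $\mathcal{M}$. For $1\leqslant p\leqslant\infty$, $\|x\|_p$ is the usual $L_p$-norm on $\mathcal{M}$ with respect to $\mu_g$ of measurable functions $x:\mathcal{M}\to\mathbb{C}$, and $\overline{L}_p(\mathcal{M})$ is the corresponding space. $\overline{H}^s_p(\mathcal{M})$, $s\in\mathbb{N}$, is the Sobolev space of functions $x:\mathcal{M}\to\mathbb{C}$ with finite semi-norm $\|x\|_{\overline{H}^s_p(\mathcal{M})}:=\|\Delta^{s/2}x\|_p$; thus $\overline{H}^{4k}_q(\mathcal{M})$ consists of the functions $x$ whose (distributional) $\Delta^{2k}x$ belongs to $\overline{L}_q(\mathcal{M})$. Sharp means that the constant $1$ in front of the right-hand side cannot be reduced. *)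

(* Defs.v *)
From HB Require Import structures.
From mathcomp Require Import all_boot all_order all_algebra.
From mathcomp Require Import complex.
From mathcomp Require Import all_classical all_reals all_analysis.

Set Implicit Arguments.
Unset Strict Implicit.
Unset Printing Implicit Defensive.
Import Order.TTheory GRing.Theory Num.Theory.
Import numFieldNormedType.Exports.
Local Open Scope classical_set_scope.
Local Open Scope ring_scope.

Definition partial (R : realType) (d : nat) (a : 'I_d) (f : 'rV[R]_d -> R) :
  'rV[R]_d -> R := fun u => 'D_(delta_mx 0 a) f u.

(* C^oo on V; only meant for V open, so that partial derivatives at points of V
   depend on f restricted to V only. *)
Definition smooth_on (R : realType) (d : nat) (V : set 'rV[R]_d)
    (f : 'rV[R]_d -> R) : Prop :=
  forall (s : seq 'I_d) (u : 'rV[R]_d), V u ->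
    {for u, continuous (foldr (@partial R d) f s)} /\
    forall a : 'I_d, derivable (foldr (@partial R d) f s) u (delta_mx 0 a).

(* The metric tensor is given by its coefficient matrices (g_ab) in the charts,
   subject to the transformation law of covariant 2-tensors. Outside of
   [source i], resp. [chart i @` source i], the values of [chart i], resp. of
   [chart_inv i] and [metric i], are irrelevant. *)
Record riemannian_manifold (R : realType) (d : nat) := RiemannianManifold {
  carrier :> ptopologicalType;
  chart_index : Type;
  source : chart_index -> set carrier;
  chart : chart_index -> carrier -> 'rV[R]_d;
  chart_inv : chart_index -> 'rV[R]_d -> carrier;
  chart_at : carrier -> chart_index;
  metric : chart_index -> 'rV[R]_d -> 'M[R]_d;
  _ : hausdorff_space carrier;
  _ : @second_countable carrier;
  _ : forall t, source (chart_at t) t;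
  _ : forall i, open (source i);
  _ : forall i, open (chart i @` source i);
  _ : forall i t, source i t -> chart_inv i (chart i t) = t;
  _ : forall i t, source i t -> {for t, continuous (chart i)};
  _ : forall i u, (chart i @` source i) u -> {for u, continuous (chart_inv i)};
  _ : forall i j (c : 'I_d),
      smooth_on (chart i @` (source i `&` source j))
                (fun u => chart j (chart_inv i u) 0 c);
  _ : forall i (a b : 'I_d),
      smooth_on (chart i @` source i) (fun u => metric i u a b);
  _ : forall i u, (chart i @` source i) u -> (metric i u)^T = metric i u;
  _ : forall i u (v : 'rV[R]_d), (chart i @` source i) u -> v != 0 ->
      0 < (v *m metric i u *m v^T) 0 0;
  _ : forall i j u (a b : 'I_d), (chart i @` (source i `&` source j)) u ->
      metric i u a b =
      \sum_(c < d) \sum_(e < d)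
         partial a (fun v => chart j (chart_inv i v) 0 c) u *
         partial b (fun v => chart j (chart_inv i v) 0 e) u *
         metric j (chart j (chart_inv i u)) c e
}.

Definition borel (T : ptopologicalType) : measurableType _ :=
  g_sigma_algebraType (@open T).

(* Lebesgue measure on R^d, as the unique Borel measure giving boxes their
   elementary volume. *)
Definition is_lebesgue (R : realType) (d : nat)
    (lam : {measure set (borel 'rV[R]_d) -> \bar R}) : Prop :=
  forall a b : 'rV[R]_d, (forall j, a 0 j <= b 0 j) ->
    lam [set u | forall j, a 0 j <= u 0 j < b 0 j] =
    (\prod_(j < d) (b 0 j - a 0 j))%:E.

(* d mu = sqrt (det g) du^1 ... du^d in every chart *)
Definition is_riemannian_volume (R : realType) (d : nat)
    (M : riemannian_manifold R d)
    (mu : {measure set (borel M) -> \bar R}) : Prop :=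
  exists2 lam : {measure set (borel 'rV[R]_d) -> \bar R}, is_lebesgue lam &
  forall (i : chart_index M) (A : set (borel M)),
    measurable A -> A `<=` source i ->
    mu A = (\int[lam]_(u in chart i @` A) (Num.sqrt (\det (metric i u)))%:E)%E.

Definition smooth (R : realType) (d : nat) (M : riemannian_manifold R d)
    (f : M -> R) : Prop :=
  forall i : chart_index M,
    smooth_on (chart i @` source i) (fun u => f (chart_inv i u)).

(* - (det G)^(-1/2) d_a ((det G)^(1/2) G^{ab} d_b f) *)
Definition laplacian_loc (R : realType) (d : nat) (G : 'rV[R]_d -> 'M[R]_d)
    (f : 'rV[R]_d -> R) (u : 'rV[R]_d) : R :=
  - ((Num.sqrt (\det (G u)))^-1 *
     \sum_(a < d) \sum_(b < d)
       partial a (fun v => Num.sqrt (\det (G v)) * invmx (G v) a b *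
                           partial b f v) u).

(* For smooth f the value does not depend on the chart around t. *)
Definition laplacian (R : realType) (d : nat) (M : riemannian_manifold R d)
    (f : M -> R) (t : M) : R :=
  laplacian_loc (metric (chart_at t))
    (fun u => f (chart_inv (chart_at t) u)) (chart (chart_at t) t).

Section complex_functions.
Context (R : realType) (d : nat) (M : riemannian_manifold R d).
Variable mu : {measure set (borel M) -> \bar R}.
Implicit Types (x y : M -> R[i]) (p : \bar R) (m : nat).

Definition cintegral x : R[i] :=
  Complex (\int[mu]_t complex.Re (x t)) (\int[mu]_t complex.Im (x t)).

Definition cmeasurable x : Prop :=
  measurable_fun [set: borel M] (fun t : borel M => complex.Re (x t)) /\
  measurable_fun [set: borel M] (fun t : borel M => complex.Im (x t)).

Definition cLnorm p x : \bar R :=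
  Lnorm mu p (fun t => (ComplexField.Normc.normc (x t))%:E).

Definition cLspace p x : Prop := cmeasurable x /\ (cLnorm p x < +oo)%E.

(* Delta^m x = y in the sense of distributions; Delta is symmetric with respect
   to the Riemannian volume, and real test functions are enough by linearity. *)
Definition distr_laplacian m x y : Prop :=
  forall phi : M -> R, smooth phi ->
    cintegral (fun t => x t * (iter m (@laplacian R d M) phi t)%:C%C) =
    cintegral (fun t => y t * (phi t)%:C%C).

(* The norm of Delta^m x in L_p: all the integrable y representing Delta^m x are
   almost everywhere equal, and the value is +oo if there is none. *)
Definition laplacian_norm m p x : \bar R :=
  ereal_inf [set cLnorm p y | y in
              [set y | cLspace 1%:E y /\ distr_laplacian m x y]].

(* The Sobolev space H^(2m)_p; functions in L_1 are those which define a
   distribution, M being compact. *)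
Definition sobolev m p x : Prop :=
  cLspace 1%:E x /\ exists2 y, cLspace p y & distr_laplacian m x y.

End complex_functions.

(* Main.v *)
(** For nice [x], integration by parts gives |D^k x|_2^2 = int x D^(2k) x (D the Laplacian), and Hoelder's
inequality the bound. As [x] is only integrable, the identity comes from duality: the condition on [k] yields
|f|_p <= C |D^k f|_2 for smooth [f] of mean zero (from a Faber-Krahn inequality on level sets and the Poincare
inequality), so Riesz' theorem for the functional int y f and the norm |D^k f|_2 solves D^(2k) x' = y with [x']
in L_p and D^k x' in L_2; by elliptic regularity [x - x'] is constant.
For the sharpness let [N] be the best constant in |z|_2^2 <= N |y|_q^2, where z = D^k x and y = D^(2k) x. With [c]
such that the extremal dual function [y'] of [x - c], |y'|_q = 1, has mean zero,
|x - c|_p = int (x - c) y' = int z z' <= N^(1/2) |z|_2. If the inequality holds with constant [C], then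
|z|_2^2 <= C^2 |x - c|_p |y|_q, whence N <= C^4 N. *)
Require Import Defs.
From HB Require Import structures.
From mathcomp Require Import all_boot all_order all_algebra.
From mathcomp Require Import complex.
From mathcomp Require Import all_classical all_reals all_analysis.
From mathcomp Require Import measurable_realfun ess_sup_inf.
From mathcomp Require Import ring lra.
Set Implicit Arguments.
Unset Strict Implicit.
Unset Printing Implicit Defensive.
Import Order.TTheory GRing.Theory Num.Theory.
Import numFieldNormedType.Exports.
Local Open Scope classical_set_scope.
Local Open Scope ring_scope.

Local Notation ev := (delta_mx 0).
Local Notation pd := partial.
Local Notation mfun f := (measurable_fun [set: _] f) (only parsing).

(** The hypothesis on [k] is a critical exponent condition: for p > 2 it says that the real number D
    = 4kp/(p - 2) is at least d, and k steps 1/t = 1/s - 2/D lead from the exponent 2 exactly to p.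
    The Faber-Krahn inequality in dimension d gives the corresponding decay of level sets for every
    real D >= d, the case D = d included. The uniqueness of [x] up to constants is delicate because
    [x] is only in L1 and has to be paired with bounded functions. For smooth f of mean zero,
    Delta^m v = f is solved weakly, and elliptic regularity puts v into all local Sobolev spaces.
    Instead of choosing a smooth representative of v, its localisations are mollified: this yields
    smooth phi_n with Delta^m phi_n uniformly bounded and weakly convergent to f, which suffices
    against an L1 function. The cases p = 1 and p > 1 are unified by letting [y] act only through
    the functional f -> int y f on L^p. Complex functions are split into real and imaginary parts,
    but Hoelder's inequality is applied only after the two identities have been added, so that no
    constant is lost. *)

Definition density (R : realType) (d : nat) (M : riemannian_manifold R d)
  (mu : {measure set (borel M) -> \bar R}) (lam : {measure set (borel 'rV[R]_d) -> \bar R}) : Prop :=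
 forall i (A : set (borel M)), measurable A -> A `<=` source i ->
 mu A = (\int[lam]_(u in chart i @` A) (Num.sqrt (\det (metric i u)))%:E)%E.

(** * Mean value theorem and total differentials *)

Lemma eq_le_ (disp : Order.disp_t) (T : porderType disp) (x y : T) : x = y -> (x <= y)%O.
Proof. by move=> ->. Qed.

Lemma closed_rV (R : realType) n (K : set 'rV[R]_n) : compact K -> closed K.
Proof. by apply: compact_closed; exact: norm_hausdorff. Qed.

Lemma rV_normP (R : realType) n (h : 'rV[R]_n) (e : R) :
 0 <= e -> (forall j, `|h 0 j| <= e) -> `|h| <= e.
Proof.
move=> e0 he; rewrite [`|h|]mx_normrE; apply/bigmax_leP; split => // -[i j] _ /=.
by rewrite (ord1 i).
Qed.

Lemma rV_coord (R : realType) n (h : 'rV[R]_n) j : `|h 0 j| <= `|h|.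
Proof.
rewrite [leRHS]mx_normrE; exact: (@le_bigmax _ _ _ _ (fun ij => `|h ij.1 ij.2|) (0, j)).
Qed.

Lemma is_derive_line (R : realType) n (f : 'rV[R]_n -> R) (u v : 'rV[R]_n) (t : R) :
 derivable f (u + t *: v) v ->
 is_derive t 1 (fun s => f (u + s *: v)) ('D_v f (u + t *: v)).
Proof.
move=> df; have E : (fun h : R => h^-1 *: (((fun s => f (u + s *: v)) \o shift t) (h *: 1) - f (u + t *: v)))
  = (fun h : R => h^-1 *: ((f \o shift (u + t *: v)) (h *: v) - f (u + t *: v))).
 by apply/funext => h /=; rewrite [h *: 1]mulr1 scalerDl addrCA.
split; first by rewrite /derivable E.
by rewrite /derive E.
Qed.

(** The closed bound [|xi| <= |s|] treats both signs of [s] and [s = 0] at once. *)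
Lemma MVT0 (R : realType) (g g' : R -> R) (s : R) :
 (forall t : R, `|t| <= `|s| -> is_derive t 1 g (g' t)) ->
 exists2 xi, `|xi| <= `|s| & g s - g 0 = g' xi * s.
Proof.
move=> dg; have dc (t : R) : `|t| <= `|s| -> {for t, continuous g}.
 by move=> ts; apply/differentiable_continuous/derivable1_diffP; have [] := dg t ts.
have [s0|s0] := leP 0 s.
- have [||xi] := @MVT_segment R g g' 0 s s0.
 + by move=> t; rewrite in_itv/= => /andP[/ltW t0 /ltW ts]; apply: dg; rewrite !ger0_norm.
 + apply: continuous_in_subspaceT => t; rewrite inE/=/= => /andP[t0 ts].
  by apply: dc; rewrite !ger0_norm.
 rewrite/= subr0 => /andP[x0 xs] E; exists xi => //. by rewrite !ger0_norm.
- have [||xi] := @MVT_segment R g g' s 0 (ltW s0).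
 + move=> t; rewrite in_itv/= => /andP[ts /ltW t0]; apply: dg.
  by rewrite !ler0_norm ?(ltW s0)// lerN2 ltW.
 + apply: continuous_in_subspaceT => t; rewrite inE/=/= => /andP[ts t0].
  by apply: dc; rewrite !ler0_norm ?(ltW s0)// lerN2.
 rewrite/= sub0r => /andP[x0 xs] E; exists xi.
  by rewrite !ler0_norm ?(ltW s0)// lerN2.
 by rewrite -opprB E mulrN opprK.
Qed.

(** The candidate for the differential; its linear structure lets [diff_unique] identify it with
    ['d f u]. *)
Definition dotc (R : realType) n (c : 'I_n -> R) (h : 'rV[R]_n) : R :=
 \sum_j c j * h 0 j.

Lemma dotc_linear (R : realType) n (c : 'I_n -> R) : linear (dotc c).
Proof.
move=> k x y; rewrite scaler_sumr -big_split/=; apply: eq_bigr => j _.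
by rewrite !mxE mulrDr/= mulrCA.
Qed.
HB.instance Definition _ (R : realType) n (c : 'I_n -> R) :=
 GRing.isLinear.Build R 'rV[R]_n R _ (dotc c) (dotc_linear c).

Lemma cvg_sumR (R : realType) (I T : Type) (r : seq I) (F : set_system T)
  (f : I -> T -> R) (a : I -> R) : Filter F ->
 (forall i, f i x @[x --> F] --> a i) ->
 \sum_(i <- r) f i x @[x --> F] --> \sum_(i <- r) a i.
Proof. by move=> FF fa; apply: cvg_big => //; exact: add_continuous. Qed.

Lemma dotc_continuous (R : realType) n (c : 'I_n -> R) : continuous (dotc c).
Proof.
move=> x; apply: (@cvg_sumR _ _ _ _ (nbhs x)) => j.
by apply: cvgMl_tmp; exact: coord_continuous.
Qed.

Lemma delta_coord (R : realType) n (a j : 'I_n) :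
 (ev a : 'rV[R]_n) 0 j = (j == a)%:R.
Proof. by rewrite mxE. Qed.

(* The coordinates of the increment are added one at a time. *)
Lemma pd_differentiable (R : realType) n (f : 'rV[R]_n -> R) (u : 'rV[R]_n) :
 (\forall v \near u, forall a, derivable f v (ev a)) ->
 (forall a, {for u, continuous (pd a f)}) -> differentiable f u.
Proof.
move=> df cf; pose c := fun a => pd a f u.
have H : f \o shift u = cst (f u) + dotc c +o_ (0 : 'rV[R]_n) id.
 apply/eqaddoP => e e0; pose e' := e / (n.+1)%:R. have e'0 : 0 < e' by rewrite divr_gt0.
 have /nbhs_ballP[r1 /= r10 Hr1] := df.
 have /nbhs_ballP[r2 /= r20 Hr2] : \forall v \near u, forall a, `|c a - pd a f v| < e'.
  by apply: (@filter_forall _ _ _ (nbhs u)) => a; have /cvgrPdist_lt/(_ _ e'0) := cf a.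
 apply/nbhs_ballP; exists (Num.min r1 r2); first by rewrite /= lt_min r10.
 move=> h; rewrite -ball_normE/= sub0r normrN lt_min => /andP[h1 h2].
 (* [P k] keeps the first [k] coordinates of [h]. Subtracting the linear part inside [W] makes each
    difference [W k.+1 - W k] the error of a mean value theorem in one coordinate. *)
 pose P k : 'rV[R]_n := \row_j (if (j < k)%N then h 0 j else 0). pose W k : R := f (u + P k) - dotc c (P k).
 have -> : (f \o shift u - (cst (f u) + dotc c)) h = W n - W 0%N.
  rewrite /W (_ : P n = h); last by apply/rowP => j; rewrite mxE ltn_ord.
  rewrite (_ : P 0%N = 0); last by apply/rowP => j; rewrite !mxE.
  rewrite addr0 linear0 subr0 -![(_ + _) h]/(_ h + _ h)/= (addrC h). by rewrite opprD addrA addrAC.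
 rewrite -telescope_sumr// big_mkord (le_trans (ler_norm_sum _ _ _))//.
 have -> : e * `|h| = (n.+1)%:R * (e' * `|h|) by rewrite mulrA [_ * (e / _)]mulrC divfK.
 apply: (@le_trans _ _ (\sum_(i < n) e' * `|h|)); last first.
  rewrite sumr_const card_ord -[leLHS]mulr_natl; apply: ler_wpM2r; first by rewrite mulr_ge0// ltW.
  by rewrite ler_nat.
 apply: ler_sum => k _. have PS : P k.+1 = P k + h 0 k *: ev k.
  apply/rowP => j; rewrite !mxE/= ltnS leq_eqVlt -(inj_eq val_inj).
  case: eqP => [jk|_] /=; last by rewrite mulr0 addr0. have -> : j = k by apply/val_inj.
  by rewrite ltnn mulr1 add0r.
 have near t : `|t| <= `|h 0 k| -> `|u - (u + P k + t *: ev k)| <= `|h|.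
  move=> th; rewrite -addrA opprD addrA subrr sub0r normrN. apply: rV_normP => // j; rewrite !mxE/=.
  case: (ltnP j k) => jk.
   have /negPf -> : j != k by rewrite neq_ltn jk. by rewrite mulr0 addr0 rV_coord.
  rewrite add0r; case: eqP => _; rewrite ?mulr1 ?mulr0 ?normr0//. exact: le_trans th (rV_coord _ _).
 have [|xi xih E] := @MVT0 R (fun t => f (u + P k + t *: ev k)) (fun t => pd k f (u + P k + t *: ev k)) (h 0 k).
  move=> t th; apply: is_derive_line; apply: Hr1. by rewrite -ball_normE/=; apply: le_lt_trans h1; exact: near.
 rewrite /W PS addrA [X in `|X|](_ : _ = (f (u + P k + h 0 k *: ev k) - f (u + P k + 0 *: ev k)) -
  dotc c (h 0 k *: ev k)); last first. by rewrite scale0r !addr0; ring.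
 rewrite E linearZ/= [dotc _ _](_ : _ = c k); last first.
  rewrite /dotc (bigD1 k)//= delta_coord eqxx mulr1 big1 ?addr0// => j jk.
  by rewrite delta_coord (negPf jk) mulr0.
 rewrite/= mulrC -mulrBr normrM mulrC ler_pM// ?rV_coord//. rewrite distrC ltW//; apply: Hr2.
 by rewrite -ball_normE/=; apply: le_lt_trans h2; exact: near.
have Hd : 'd f u = dotc c :> ('rV[R]_n -> R) by apply: diff_unique => //; exact: dotc_continuous.
by apply/diff_locallyP; rewrite Hd; split => //; exact: dotc_continuous.
Qed.

(** * Smooth functions: closure properties by induction on their construction *)

Section smooth_class.
Context (R : realType).

Lemma cvg_congr_open n (V : set 'rV[R]_n) (f g : 'rV[R]_n -> R) u : open V -> V u ->
 (forall v, V v -> f v = g v) -> {for u, continuous f} -> {for u, continuous g}.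
Proof.
move=> oV Vu fg cf; change (g v @[v --> u] --> g u); rewrite -(fg _ Vu); apply: cvg_trans cf.
by apply: (@near_eq_cvg _ _ (nbhs u)); near=> v; apply: fg; near: v; exact: open_nbhs_nbhs.
Unshelve. all: by end_near. Qed.

Lemma derivable_congr_open n (V : set 'rV[R]_n) (f g : 'rV[R]_n -> R) u a :
 open V -> V u -> (forall v, V v -> f v = g v) -> derivable f u a -> derivable g u a.
Proof.
move=> oV Vu fg; apply: near_eq_derivable.
by near=> v; apply: fg; near: v; exact: open_nbhs_nbhs.
Unshelve. all: by end_near. Qed.

Lemma pd_eq n (V : set 'rV[R]_n) (f g : 'rV[R]_n -> R) u a :
 open V -> V u -> (forall v, V v -> f v = g v) -> pd a f u = pd a g u.
Proof.
move=> oV Vu fg; apply: near_eq_derive.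
by near=> v; apply: fg; near: v; exact: open_nbhs_nbhs.
Unshelve. all: by end_near. Qed.

Definition C1_at n (f : 'rV[R]_n -> R) u :=
 {for u, continuous f} /\ forall a, derivable f u (ev a).

(** Coinduction: a class closed under partial derivatives consists of smooth functions. A derivative
    only has to agree on [V] with a member of the class, since values off [V] are arbitrary. *)
Lemma smooth_on_coind n (V : set 'rV[R]_n) (Q : ('rV[R]_n -> R) -> Prop) : open V ->
 (forall f, Q f -> (forall u, V u -> C1_at f u) /\
   forall a, exists2 g, Q g & forall u, V u -> pd a f u = g u) ->
 forall f, Q f -> smooth_on V f.
Proof.
move=> oV HQ f Qf s u Vu.
have [g Qg fg] : exists2 g, Q g & forall u, V u -> foldr (@partial R n) f s u = g u.
 elim: s => [|a s [g Qg fg]] /=; first by exists f. have [_ /(_ a)[h Qh gh]] := HQ g Qg.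
 by exists h => // v Vv; rewrite (pd_eq _ oV Vv fg) gh.
have [/(_ u Vu)[cg dg] _] := HQ g Qg.
split=> [|a]; first by apply: (cvg_congr_open oV Vu _ cg) => v Vv; rewrite fg.
by apply: (derivable_congr_open oV Vu _ (dg a)) => v Vv; rewrite fg.
Qed.

Lemma smooth_on_C1 n (V : set 'rV[R]_n) f u : smooth_on V f -> V u -> C1_at f u.
Proof. by move=> sf Vu; exact: (sf [::] u Vu). Qed.

Lemma smooth_on_pd n (V : set 'rV[R]_n) f a : smooth_on V f -> smooth_on V (pd a f).
Proof.
move=> sf s u Vu; have := sf (rcons s a) u Vu.
by rewrite -cats1 foldr_cat.
Qed.

Lemma smooth_onS n (V W : set 'rV[R]_n) f : V `<=` W -> smooth_on W f -> smooth_on V f.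
Proof. by move=> VW sf s u /VW; exact: sf. Qed.

Lemma smooth_on_diff n (V : set 'rV[R]_n) f u : open V -> V u ->
 smooth_on V f -> differentiable f u.
Proof.
move=> oV Vu sf; apply: pd_differentiable.
 near=> v; have [] : C1_at f v; last by []. by apply: (smooth_on_C1 sf); near: v; exact: open_nbhs_nbhs.
by move=> a; have [] := smooth_on_C1 (smooth_on_pd a sf) Vu.
Unshelve. all: by end_near. Qed.

Lemma diff_pd n (f : 'rV[R]_n -> R) u (h : 'rV[R]_n) : differentiable f u ->
 'd f u h = \sum_j h 0 j * pd j f u.
Proof.
move=> df; rewrite [X in 'd f u X](_ : h = \sum_j h 0 j *: ev j).
 rewrite linear_sum; apply: eq_bigr => j _. by rewrite linearZ /= -deriveE.
by rewrite [LHS]row_sum_delta.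
Qed.

Lemma derive_line0 n (W : normedModType R) (g : 'rV[R]_n -> W) (u e : 'rV[R]_n) :
 'D_e g u = 'D_1 (fun t : R => g (t *: e + u)) 0.
Proof.
have E : (fun h : R => h^-1 *: ((g \o shift u) (h *: e) - g u)) =
  (fun h : R => h^-1 *: (((fun t : R => g (t *: e + u)) \o shift 0) (h *: 1) - g (0 *: e + u))).
 by apply/funext => t; rewrite /= scale0r add0r addr0 [t *: 1]mulr1.
by rewrite /derive E.
Qed.

(** [P] is only derivable in the single direction [e]. Restricted to the line through [u] it becomes
    a curve, and a derivable curve is differentiable, so that the chain rule for differentials
    applies. *)
Lemma chain_rule n m (P : 'rV[R]_n -> 'rV[R]_m) (h : 'rV[R]_m -> R) u (e : 'rV[R]_n) :
 (forall j, derivable (fun v => P v 0 j) u e) -> differentiable h (P u) ->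
 is_derive u e (h \o P) (\sum_j 'D_e (fun v => P v 0 j) u * pd j h (P u)).
Proof.
move=> dP dh; have dP' : derivable P u e.
 by apply/derivable_mxP => i j; rewrite (ord1 i).
pose c := fun t : R => P (t *: e + u).
have dc : derivable c 0 1 := (derivable1P P u e).1 dP'.
have c0 : c 0 = P u by rewrite /c scale0r add0r.
have dhc : differentiable (h \o c) 0.
 apply: differentiable_comp; first exact/derivable1_diffP. by rewrite c0.
split; first by apply: (derivable1P (h \o P) u e).2; exact/derivable1_diffP.
have dcc : differentiable c 0 := (derivable1_diffP c 0).1 dc.
rewrite derive_line0 (deriveE _ dhc) diff_comp ?c0//.
have lP : 'D_1 c 0 = 'D_e P u by rewrite (derive_line0 P u e).
rewrite /= -(deriveE _ dcc) lP diff_pd//; apply: eq_bigr => j _.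
by rewrite (derive_mx dP') mxE.
Qed.

(** A syntactic class of smooth functions. Differentiating each constructor once and staying in the
    class ([smc_step]) replaces the Leibniz and chain rules of all orders. In [smc_dom], [S] is a
    class of one-variable functions stable under derivation, such as [flat_class]; [smc_ext] forgets
    the values off [V]. *)
Inductive smc n (V : set 'rV[R]_n) : ('rV[R]_n -> R) -> Prop :=
| smc_base f : smooth_on V f -> smc V f
| smc_ext f g : smc V f -> (forall u, V u -> f u = g u) -> smc V g
| smc_cst c : smc V (fun=> c)
| smc_coord j : smc V (fun u => u 0 j)
| smc_add f g : smc V f -> smc V g -> smc V (fun u => f u + g u)
| smc_mul f g : smc V f -> smc V g -> smc V (fun u => f u * g u)
| smc_inv f : smc V f -> (forall u, V u -> f u != 0) -> smc V (fun u => (f u)^-1)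
| smc_sqrt f : smc V f -> (forall u, V u -> 0 < f u) -> smc V (fun u => Num.sqrt (f u))
| smc_dom (S : (R -> R) -> Prop) h f :
  (forall h, S h -> (forall x, derivable h x 1) /\ S (derive1 h)) -> S h -> smc V f ->
  smc V (fun u => h (f u))
| smc_comp m (W : set 'rV[R]_m) (P : 'rV[R]_n -> 'rV[R]_m) h : open W ->
  (forall u, V u -> W (P u)) -> (forall j, smc V (fun u => P u 0 j)) -> smooth_on W h ->
  smc V (fun u => h (P u)).

Lemma smc_sum n (V : set 'rV[R]_n) (I : Type) (r : seq I) (f : I -> 'rV[R]_n -> R) :
 (forall i, smc V (f i)) -> smc V (fun u => \sum_(i <- r) f i u).
Proof.
move=> sf; elim: r => [|i r IH].
 by apply: (smc_ext (smc_cst V 0)) => u _; rewrite big_nil.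
by apply: (smc_ext (smc_add (sf i) IH)) => u _; rewrite big_cons.
Qed.

Lemma smc_prod n (V : set 'rV[R]_n) (I : Type) (r : seq I) (f : I -> 'rV[R]_n -> R) :
 (forall i, smc V (f i)) -> smc V (fun u => \prod_(i <- r) f i u).
Proof.
move=> sf; elim: r => [|i r IH].
 by apply: (smc_ext (smc_cst V 1)) => u _; rewrite big_nil.
by apply: (smc_ext (smc_mul (sf i) IH)) => u _; rewrite big_cons.
Qed.

Lemma dom_is_derive n (h : R -> R) (f : 'rV[R]_n -> R) u v : derivable h (f u) 1 ->
 derivable f u v -> is_derive u v (h \o f) ('D_v f u * derive1 h (f u)).
Proof.
move=> dh df; pose c := fun t : R => f (t *: v + u).
have dc : derivable c 0 1 := (derivable1P f u v).1 df.
have c0 : c 0 = f u by rewrite /c scale0r add0r.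
have D : is_derive (0 : R) 1 (h \o c) ('D_1 h (c 0) * 'D_1 c 0).
 have dh0 : derivable h (c 0) 1 by rewrite c0.
 exact: (@is_derive1_comp R h c 0 _ _ (derivableP dh0) (derivableP dc)).
split; first by apply: (derivable1P (h \o f) u v).2; case: D.
rewrite derive_line0 (derive_line0 f); case: D => _ ->; rewrite c0 derive1E; exact: mulrC.
Qed.

Lemma smc_step n (V : set 'rV[R]_n) : open V -> forall f, smc V f ->
 (forall u, V u -> C1_at f u) /\
   forall a, exists2 g, smc V g & forall u, V u -> pd a f u = g u.
Proof.
move=> oV f; elim=> {f}.
- move=> f sf; split=> [u Vu|a]; first exact: (smooth_on_C1 sf Vu).
 by exists (pd a f) => //; apply/smc_base/smooth_on_pd.
- move=> f g _ [Cf pf] fg; split=> [u Vu|a].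
  have [cf df] := Cf u Vu; split; first exact: (cvg_congr_open oV Vu fg cf).
  by move=> a; exact: (derivable_congr_open oV Vu fg (df a)).
 have [h sh fh] := pf a; exists h => // u Vu. by rewrite -fh//; apply/esym; exact: (pd_eq _ oV).
- move=> c; split=> [u Vu|a].
  by split=> [|a]; [exact: cst_continuous|exact: derivable_cst].
 exists (fun=> 0); first exact: smc_cst. by move=> u _; exact: derive_cst.
- move=> j; split=> [u Vu|a].
  by split=> [|a]; [exact: coord_continuous|apply/diff_derivable/differentiable_coord].
 exists (fun=> dotc (fun k => (k == j)%:R : R) (ev a)); first exact: smc_cst. move=> u _; rewrite /partial.
 have -> : (fun v : 'rV[R]_n => v 0 j) = dotc (fun k => (k == j)%:R).
  apply/funext => v; rewrite /dotc (bigD1 j)//= eqxx mul1r big1 ?addr0// => k kj. by rewrite (negPf kj) mul0r.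
 have dl w : differentiable (dotc (fun k => (k == j)%:R : R)) w.
  by apply/linear_differentiable; exact: dotc_continuous.
 have dc := @dotc_continuous R n (fun k => (k == j)%:R).
 have E := @deriveE R _ _ (dotc (fun k => (k == j)%:R : R)) u (ev a) (dl u). rewrite E.
 have E2 := @diff_lin R _ _ (dotc (fun k => (k == j)%:R : R)) u dc. by rewrite E2.
- move=> f g sf [Cf pf] sg [Cg pg]; split=> [u Vu|a].
  have [[cf df] [cg dg]] := (Cf u Vu, Cg u Vu). by split=> [|a]; [exact: (cvgD cf cg)|exact: derivableD].
 have [[f' sf' ff'] [g' sg' gg']] := (pf a, pg a). exists (fun u => f' u + g' u); first exact: smc_add.
 move=> u Vu; rewrite -ff'// -gg'//; have [[_ df] [_ dg]] := (Cf u Vu, Cg u Vu). exact: deriveD.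
- move=> f g sf [Cf pf] sg [Cg pg]; split=> [u Vu|a].
  have [[cf df] [cg dg]] := (Cf u Vu, Cg u Vu). by split=> [|a]; [exact: (cvgM cf cg)|exact: derivableM].
 have [[f' sf' ff'] [g' sg' gg']] := (pf a, pg a). exists (fun u => f u * g' u + g u * f' u).
  by apply: smc_add; exact: smc_mul.
 move=> u Vu; rewrite -ff'// -gg'//; have [[_ df] [_ dg]] := (Cf u Vu, Cg u Vu). exact: deriveM.
- move=> f sf [Cf pf] f0; split=> [u Vu|a].
  have [cf df] := Cf u Vu. by split=> [|a]; [exact: (cvgV (f0 u Vu) cf)|exact: (derivableV (f0 u Vu) (df a))].
 have [f' sf' ff'] := pf a. exists (fun u => -1 * ((f u)^-1 * (f u)^-1) * f' u).
  apply: smc_mul => //; apply: smc_mul; first exact: smc_cst. by apply: smc_mul; exact: smc_inv.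
 move=> u Vu; rewrite -ff'//; have [_ df] := Cf u Vu.
 by rewrite [LHS](deriveV (f0 u Vu) (df a)) mulN1r -expr2 exprVn.
- move=> f sf [Cf pf] f0.
 have dsq (u : 'rV[R]_n) (a : 'rV[R]_n) : 0 < f u -> derivable f u a ->
   is_derive u a (Num.sqrt \o f) ('D_a f u * (2 * Num.sqrt (f u))^-1).
  move=> fu0 dfu; have [D1 D2] := is_derive1_sqrt fu0. by rewrite -D2 -derive1E; exact: dom_is_derive.
 split=> [u Vu|a].
  have [cf df] := Cf u Vu; split=> [|a].
   by apply: continuous_comp => //; exact: sqrt_continuous.
  by have [] := dsq u (ev a) (f0 _ Vu) (df a).
 have [f' sf' ff'] := pf a. exists (fun u => f' u * (2 * Num.sqrt (f u))^-1).
  apply: smc_mul => //; apply: smc_inv.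
   by apply: smc_mul; [exact: smc_cst|exact: smc_sqrt].
  by move=> u Vu; rewrite mulf_neq0// gt_eqF// sqrtr_gt0 f0.
 move=> u Vu; rewrite -ff'//; have [_ df] := Cf u Vu. by have [] := dsq u (ev a) (f0 _ Vu) (df a).
- move=> S h f HS Sh sf [Cf pf]; have [dh Sh'] := HS h Sh.
 split=> [u Vu|a].
  have [cf df] := Cf u Vu; split=> [|a].
   apply: continuous_comp => //. by apply/differentiable_continuous/derivable1_diffP.
  by have [] := dom_is_derive (dh (f u)) (df a).
 have [f' sf' ff'] := pf a; exists (fun u => f' u * derive1 h (f u)).
  by apply: smc_mul => //; exact: (smc_dom HS).
 move=> u Vu; rewrite -ff'//; have [_ df] := Cf u Vu. by have [] := dom_is_derive (dh (f u)) (df a).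
- move=> m W P h oW VW sP HP sh; split=> [u Vu|a].
  have dh : differentiable h (P u) by apply: (smooth_on_diff oW _ sh); exact: VW. split=> [|a].
   apply: continuous_comp; last exact: differentiable_continuous.
   have FN : Filter (nbhs u) by exact: nbhs_filter. apply/(@cvgrPdist_le _ _ _ (nbhs u)) => e e0.
   have H j : \forall v \near u, `|P u 0 j - P v 0 j| <= e.
    by have [/(_ u Vu)[cj _] _] := HP j; have /cvgrPdist_le/(_ e e0) := cj.
   apply: (@filterS _ (nbhs u) FN _ _ _ (@filter_forall _ _ _ (nbhs u) FN H)) => v Hv.
   by apply: (rV_normP (ltW e0)) => j; rewrite !mxE.
  have := @chain_rule _ _ P h u (ev a); case=> //. by move=> j; have [/(_ u Vu)[_ ]] := HP j.
 have /choice[g Hg] : forall j, exists g, smc V g /\ forall u, V u -> pd a (fun u => P u 0 j) u = g u.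
  by move=> j; have [_ /(_ a)[g sg Eg]] := HP j; exists g.
 exists (fun u => \sum_j g j u * pd j h (P u)).
  apply: smc_sum => j; apply: smc_mul; first by have [] := Hg j.
  by apply: (smc_comp oW VW sP); exact: smooth_on_pd.
 move=> u Vu; have dh : differentiable h (P u) by apply: (smooth_on_diff oW _ sh); exact: VW.
 have [|//|_ E] := @chain_rule _ _ P h u (ev a).
  by move=> j; have [/(_ u Vu)[_ ]] := HP j.
 by rewrite [LHS]E; apply: eq_bigr => j _; have [_ <-] := Hg j.
Qed.

Lemma smcP n (V : set 'rV[R]_n) f : open V -> smc V f -> smooth_on V f.
Proof. by move=> oV; apply: smooth_on_coind => // g; exact: smc_step. Qed.

End smooth_class.

(** * Symmetry of second derivatives *)

Section schwarz.
Context (R : realType) (n : nat).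
Implicit Types (V : set 'rV[R]_n) (f : 'rV[R]_n -> R).

(** The mean value theorem in direction [a], then in direction [b]. The second difference is
    symmetric in [a] and [b], while the order of the two derivatives depends on which direction is
    treated first. *)
Lemma mixed_difference f u a b (e : R) : 0 < e ->
 (forall v, `|v - u| <= 2 * e ->
   derivable f v (ev a) /\ derivable (pd a f) v (ev b)) ->
 exists2 v, `|v - u| <= 2 * e &
  f (u + e *: ev a + e *: ev b) - f (u + e *: ev a)
  - f (u + e *: ev b) + f u = e * e * pd b (pd a f) v.
Proof.
move=> e0 df; set ea := ev a; set eb := ev b.
have nd (c : 'I_n) (t : R) : `|t *: (ev c : 'rV[R]_n)| <= `|t|.
 apply: rV_normP => // j; rewrite !mxE/=. by case: eqP => _; rewrite ?mulr1 ?mulr0 ?normr0.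
have near (t s : R) : `|t| <= `|e| -> `|s| <= `|e| -> `|u + s *: eb + t *: ea - u| <= 2 * e.
 move=> te se; rewrite -[u + _ + _]addrA [u + _]addrC addrK (le_trans (ler_normD _ _))// mulrDl !mul1r.
 by apply: lerD; rewrite (le_trans (nd _ _))// -[leRHS]gtr0_norm.
have ee : `|e| <= `|e| by [].
have oe : `|0 : R| <= `|e| by rewrite normr0.
have [|xi xie E] := @MVT0 R (fun t => f (u + e *: eb + t *: ea) - f (u + 0 *: eb + t *: ea))
 (fun t => pd a f (u + e *: eb + t *: ea) - pd a f (u + 0 *: eb + t *: ea)) e.
 move=> t te; apply: is_deriveB; apply: is_derive_line.
  exact (df _ (near _ _ te ee)).1.
 exact (df _ (near _ _ te oe)).1.
have near' (t s : R) : `|t| <= `|e| -> `|s| <= `|e| -> `|u + t *: ea + s *: eb - u| <= 2 * e.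
 by move=> te se; rewrite [u + t *: ea + _]addrAC; exact (near t s te se).
have [|eta etae F] := @MVT0 R (fun s => pd a f (u + xi *: ea + s *: eb))
 (fun s => pd b (pd a f) (u + xi *: ea + s *: eb)) e.
 move=> s se; apply: is_derive_line; exact (df _ (near' _ _ xie se)).2.
exists (u + xi *: ea + eta *: eb); first exact: near'.
move: E F; rewrite !scale0r !addr0 [u + e *: eb + xi *: ea]addrAC => E F.
rewrite [u + e *: ea + e *: eb]addrAC; move: E; rewrite F => E.
have -> : e * e * pd b (pd a f) (u + xi *: ea + eta *: eb) =
 pd b (pd a f) (u + xi *: ea + eta *: eb) * e * e by ring.
by rewrite -E; ring.
Qed.

(** The same second difference, read in both orders, gives equal mixed derivatives at two points
    near [u]; continuity moves both points to [u]. *)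
Lemma pdC V f u a b : open V -> V u -> smooth_on V f ->
 pd a (pd b f) u = pd b (pd a f) u.
Proof.
move=> oV Vu sf; apply/eqP; rewrite -subr_eq0 -normr_le0; apply/ler_addgt0Pl => e e0.
rewrite addr0; have e20 : 0 < e / 2 by rewrite divr_gt0.
have cab x y : {for u, continuous (pd x (pd y f))}.
 by have [] := smooth_on_C1 (smooth_on_pd x (smooth_on_pd y sf)) Vu.
have /cvgrPdist_lt/(_ _ e20)/nbhs_ballP[r1 /= r10 H1] := cab a b.
have /cvgrPdist_lt/(_ _ e20)/nbhs_ballP[r2 /= r20 H2] := cab b a.
have /nbhs_ballP[r3 /= r30 H3] : nbhs u V by apply: open_nbhs_nbhs.
pose r := Num.min r1 (Num.min r2 r3); have r0 : 0 < r by rewrite !lt_min r10 r20.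
have rr : r / 3 * 2 < r by lra.
have bl v (r' : R) : `|v - u| <= 2 * (r / 3) -> r <= r' -> ball u r' v.
 move=> vu rr'; rewrite -ball_normE/= distrC; apply: le_lt_trans vu _. by rewrite mulrC (lt_le_trans rr).
have rle : (r <= r1) && (r <= r2) && (r <= r3).
 by rewrite !ge_min !lexx ?orbT.
have /andP[/andP[rr1 rr2] rr3] := rle.
have HV v : `|v - u| <= 2 * (r / 3) -> V v by move=> /bl/(_ rr3); exact: H3.
have r30' : 0 < r / 3 by rewrite divr_gt0.
have [v vu Ev] := @mixed_difference f u a b (r / 3) r30' (fun v vu =>
 conj ((smooth_on_C1 sf (HV v vu)).2 a) ((smooth_on_C1 (smooth_on_pd a sf) (HV v vu)).2 b)).
have [w wu Ew] := @mixed_difference f u b a (r / 3) r30' (fun v vu =>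
 conj ((smooth_on_C1 sf (HV v vu)).2 b) ((smooth_on_C1 (smooth_on_pd b sf) (HV v vu)).2 a)).
have vw : pd b (pd a f) v = pd a (pd b f) w.
 have rr0 : r / 3 * (r / 3) != 0 by rewrite mulf_neq0// gt_eqF.
 have H : r / 3 * (r / 3) * pd b (pd a f) v = r / 3 * (r / 3) * pd a (pd b f) w.
  apply: (etrans (esym Ev)); apply: (etrans _ Ew). rewrite [u + r / 3 *: ev a + r / 3 *: ev b]addrAC.
  by move: (f _) (f _) (f _) (f _) => A B C D; ring.
 exact (mulfI rr0 H).
have := H1 w (bl _ _ wu rr1); have := H2 v (bl _ _ vu rr2); rewrite vw /=.
set A := pd a (pd b f) u; set B := pd b (pd a f) u.
set C := pd _ _ w => h1 h2.
rewrite /= in h1 h2; have T := ler_normB (A - C) (B - C).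
have -> : A - B = (A - C) - (B - C) by clear; ring.
have {}T : `|(A - C) - (B - C)| <= e / 2 + e / 2.
 exact: (le_trans T (lerD (ltW h2) (ltW h1))).
move: T; clear; lra.
Qed.

End schwarz.

(** * A smooth step function *)

Section bump.
Context (R : realType).

Lemma horner_expRN_le (p : {poly R}) :
 exists C : R, forall y : R, 1 <= y -> `|p.[y] * expR (- y)| * y <= C.
Proof.
exists (\sum_(i < size p) `|p`_i| * ((i.+2)`!)%:R) => y y1.
have y0 : 0 < y by apply: lt_le_trans y1.
have E (i : nat) : y ^+ i * expR (- y) * y <= ((i.+2)`!)%:R.
 have := expR_ge1Dxn (i.+1) (ltW y0) => h. have {}h : y ^+ i.+2 <= ((i.+2)`!)%:R * expR y.
  rewrite -ler_pdivrMl// mulrC; apply: le_trans h; rewrite lerDr; exact: ler01.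
 rewrite expRN mulrAC -exprSr ler_pdivrMr ?expR_gt0//; apply: le_trans h. by rewrite ler_peMl// exprn_ge0// ltW.
rewrite horner_coef normrM (ger0_norm (ltW (expR_gt0 _))) -mulrA.
apply: le_trans (ler_wpM2r _ (ler_norm_sum _ _ _)) _; first by rewrite mulr_ge0 ?expR_ge0 ?ltW.
rewrite mulr_suml; apply: ler_sum => i _; rewrite normrM -mulrA.
by rewrite ler_wpM2l// mulrA normrX (gtr0_norm y0).
Qed.

(** The functions P(1/x) exp(-1/x), extended by 0 to x <= 0. They are stable under derivation, which
    acts on the polynomials by P -> X^2 (P - P'), and so form a class for [smc_dom]. *)
Definition flat (p : {poly R}) (x : R) : R :=
 if 0 < x then p.[x^-1] * expR (- x^-1) else 0.

(** The exponential bound for [p * 'X] gains two powers of [h]; hence the difference quotient at 0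
    tends to 0. *)
Lemma flat_le (p : {poly R}) : exists C : R, forall h : R, h <= 1 -> `|flat p h| <= C * h ^+ 2.
Proof.
have [C HC] := horner_expRN_le (p * 'X); exists `|C| => h h1.
rewrite /flat; case: ltP => h0; last by rewrite normr0 mulr_ge0// sqr_ge0.
have hn0 : h != 0 by rewrite gt_eqF.
have hV1 : 1 <= h^-1 by rewrite invf_ge1.
have := HC _ hV1; rewrite hornerM hornerX mulrAC normrM normfV (gtr0_norm h0) => H.
have -> : `|p.[h^-1] * expR (- h^-1)| = (`|p.[h^-1] * expR (- h^-1)| / h / h) * h ^+ 2 by field.
by rewrite ler_wpM2r ?sqr_ge0// (le_trans H)// ler_norm.
Qed.

Lemma flat_is_derive p (x : R) : is_derive x 1 (flat p) (flat ('X^2 * (p - p^`())) x).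
Proof.
have [x0|x0|x0] := ltgtP 0 x.
- have xn0 : x != 0 by rewrite gt_eqF.
 have d1 : is_derive x 1 (fun y : R => y^-1) (- x ^- 2 *: 1).
  exact: (@is_deriveV R id x 1 1 xn0 (is_derive_id x 1)).
 have d2 := @is_derive1_comp R (horner p) (fun y => y^-1) x _ _ (is_derive_poly p x^-1) d1.
 have d3 := @is_deriveN R R R (fun y : R => y^-1) x 1 _ d1.
 have d4 := @is_derive1_comp R expR (- (fun y : R => y^-1)) x _ _ (is_derive_expR _) d3.
 have d5 := @is_deriveM R R _ _ x 1 _ _ d2 d4.
 have N : \forall y \near x, ((horner p \o (fun y => y^-1)) * (expR \o - (fun y : R => y^-1))) y = flat p y.
  near=> y; have y0 : 0 < y by near: y; exact: lt_nbhsr. rewrite /flat y0; reflexivity.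
 apply: (is_derive_eq (@near_eq_is_derive _ _ _ _ (flat p) _ _ _ N d5)).
 rewrite /flat x0 /= hornerM hornerXn hornerD hornerN /GRing.scale/=. by rewrite !mulr1; field.
- have d5 := @is_derive_cst R R R 0 x 1.
 have N : \forall y \near x, (cst 0 : R -> R) y = flat p y.
  near=> y; have y0 : y < 0 by near: y; exact: lt_nbhsl. by rewrite /flat ltNge ltW.
 apply: (is_derive_eq (@near_eq_is_derive _ _ _ _ (flat p) _ _ _ N d5)). by rewrite /flat ltNge ltW.
- rewrite -x0; have [C HC] := flat_le p.
 have L : h^-1 *: ((flat p \o shift 0) (h *: 1) - flat p 0) @[h --> 0^'] --> (0 : R).
  apply/cvgrPdist_le => e e0; near=> h. have hn0 : h != 0 by near: h; exact: nbhs_dnbhs_neq.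
  rewrite sub0r normrN /= addr0 {2}/flat ltxx subr0 [h *: 1]mulr1 normrM normfV. rewrite ler_pdivrMl ?normr_gt0//.
  have h1 : `|h| <= 1 by near: h; exact: dnbhs0_le. apply: le_trans (HC h (le_trans (ler_norm h) h1)) _.
  rewrite -real_normK ?num_real// expr2 mulrA [leRHS]mulrC.
  rewrite ler_wpM2r// (@le_trans _ _ ((`|C| + 1) * `|h|))//.
   have CC : `|C| <= `|C| + 1 by rewrite lerDl.
   by apply: le_trans (ler_wpM2r _ (ler_norm C)) _ => //; exact: ler_wpM2r.
  rewrite -ler_pdivlMl ?ltr_pwDr// mulrC; near: h; apply: dnbhs0_le. by rewrite divr_gt0// ltr_pwDr.
 split; first exact: cvgP L. by rewrite /flat ltxx; exact: cvg_lim L.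
Unshelve. all: by end_near. Qed.

Definition flat_class (h : R -> R) := exists p, h = flat p.

Lemma flat_classP h : flat_class h -> (forall x, derivable h x 1) /\ flat_class (derive1 h).
Proof.
move=> [p ->]; split=> [x|]; first by have [] := flat_is_derive p x.
exists ('X^2 * (p - p^`())); apply/funext => x.
by rewrite derive1E; have [] := flat_is_derive p x.
Qed.

(** The standard smooth transition from 0 on x <= 0 to 1 on x >= 1; the denominator is positive
    because x and 1 - x are not both nonpositive. *)
Definition sstep (x : R) : R := flat 1 x / (flat 1 x + flat 1 (1 - x)).

Lemma flat1_ge0 x : 0 <= flat 1 x.
Proof. by rewrite /flat; case: ifP => // _; rewrite hornerC. Qed.

Lemma flat1_gt0 x : (0 < flat 1 x) = (0 < x).
Proof. by rewrite /flat; case: ifP; rewrite// hornerC mul1r expR_gt0. Qed.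

Lemma sstep_den x : 0 < flat 1 x + flat 1 (1 - x).
Proof.
have [x0|x0] := ltP 0 x.
 by apply: ltr_pwDl; [rewrite flat1_gt0|exact: flat1_ge0].
by apply: ltr_wpDl; [exact: flat1_ge0|rewrite flat1_gt0; lra].
Qed.

Lemma sstep_ge0 x : 0 <= sstep x.
Proof. by rewrite divr_ge0// ?flat1_ge0// ltW// sstep_den. Qed.

Lemma sstep_le1 x : sstep x <= 1.
Proof.
by rewrite ler_pdivrMr ?sstep_den// mul1r lerDl flat1_ge0.
Qed.

Lemma sstep0 x : x <= 0 -> sstep x = 0.
Proof. by move=> x0; rewrite /sstep /flat ltNge x0 mul0r. Qed.

Lemma sstep1 x : 1 <= x -> sstep x = 1.
Proof.
move=> x1; rewrite /sstep.
have -> : flat 1 (1 - x) = 0 by rewrite /flat ; case: leP => //; lra.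
by rewrite addr0 divff// gt_eqF// flat1_gt0; lra.
Qed.

Lemma smc_sstep n (V : set 'rV[R]_n) f :
 smc V f -> smc V (fun u => sstep (f u)).
Proof.
move=> sf; have sfl g : smc V g -> smc V (fun u => flat 1 (g u)).
 by apply: (smc_dom flat_classP); exists 1.
have sg : smc V (fun u => 1 - f u).
 apply: smc_add; first exact: smc_cst. by apply: (smc_ext (smc_mul (smc_cst V (-1)) sf)) => u _; rewrite mulN1r.
apply: smc_mul; first exact: sfl.
apply: smc_inv; first by apply: smc_add; exact: sfl.
by move=> u _; rewrite gt_eqF// sstep_den.
Qed.

(** The quotient rule after cancellation, in a form that is visibly nonnegative: [flat 'X^2] is the
    derivative of [flat 1]. *)
Definition sstep' (x : R) : R :=
 (flat 'X^2 x * flat 1 (1 - x) + flat 1 x * flat 'X^2 (1 - x)) /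
 ((flat 1 x + flat 1 (1 - x)) * (flat 1 x + flat 1 (1 - x))).

Lemma sstep_is_derive (x : R) : is_derive x 1 sstep (sstep' x).
Proof.
have E : 'X^2 * ((1 : {poly R}) - 1^`()) = 'X^2 by rewrite derivC subr0 mulr1.
have d1 := flat_is_derive 1 x; rewrite E in d1.
have d2 : is_derive x 1 (fun y : R => 1 - y) (- 1).
 have := @is_deriveB R R R (cst (1 : R)) id x 1 _ _ (is_derive_cst (1 : R) x 1) (is_derive_id x 1).
 by rewrite sub0r.
have d3 := flat_is_derive 1 (1 - x); rewrite E in d3.
have d4 := @is_derive1_comp R (flat 1) (fun y => 1 - y) x _ _ d3 d2.
have d5 := @is_deriveD R R R _ _ x 1 _ _ d1 d4.
have den0 : (flat 1 + (flat 1 \o (fun y => 1 - y))) x != 0 by rewrite gt_eqF// sstep_den.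
have d6 := @is_deriveV R _ x _ 1 den0 d5.
have d7 := @is_deriveM R R _ _ x 1 _ _ d1 d6.
apply: is_derive_eq d7 _; rewrite /sstep' /GRing.scale/=.
have := sstep_den x; rewrite -![(_ + _) x]/(_ x + _ x)/= => den.
by field.
Qed.

Lemma flatX2_ge0 x : 0 <= flat 'X^2 x.
Proof. by rewrite /flat; case: ifP => // _; rewrite mulr_ge0// hornerXn sqr_ge0. Qed.

Lemma sstep'_ge0 x : 0 <= sstep' x.
Proof.
by rewrite divr_ge0 ?sqr_ge0// addr_ge0// mulr_ge0 ?flat1_ge0 ?flatX2_ge0.
Qed.

(** The derivative is continuous and vanishes off [0, 1]. The bound enters the energy of truncated
    functions. *)
Lemma sstep'_bounded : exists2 B : R, 0 < B & forall x, sstep' x <= B.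
Proof.
have cfl p : continuous (flat p).
 move=> x; apply/differentiable_continuous/derivable1_diffP. by have [] := flat_is_derive p x.
have c1 : continuous (fun x : R => 1 - x).
 by move=> x; apply: cvgB; [exact: cst_continuous|exact: cvg_id].
have cfl' p : continuous (fun x : R => flat p (1 - x)).
 move=> x; exact: (@continuous_comp _ _ _ (fun x : R => 1 - x) (flat p) x (c1 x) (cfl p _)).
have c : continuous sstep'.
 move=> x; have FN : Filter (nbhs x) by exact: nbhs_filter. have cd := cvgD (cfl 1 x) (cfl' 1 x).
 have n0 : (flat 1 x + flat 1 (1 - x)) * (flat 1 x + flat 1 (1 - x)) != 0.
  by rewrite mulf_neq0// gt_eqF// sstep_den.
 have c2 := cvgD (cvgM (cfl 'X^2 x) (cfl' 1 x)) (cvgM (cfl 1 x) (cfl' 'X^2 x)).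
 exact: (cvgM (c2 FN FN FN) (cvgV n0 (cvgM (cd FN) (cd FN)))).
have [x0 _ H] := @EVT_max R sstep' 0 1 ler01 (continuous_subspaceT c).
exists (sstep' x0 + 1) => [|x].
 by apply: ltr_wpDl => //; exact: sstep'_ge0.
have [x01|x01] := boolP (x \in `[0, 1]).
 by rewrite (le_trans (H _ x01))// lerDl.
apply: (@le_trans _ _ 0); last by rewrite addr_ge0// sstep'_ge0.
rewrite /sstep'; move: x01; rewrite in_itv/= negb_and -!ltNge => /orP[x0'|x1].
 by rewrite /flat ltNge (ltW x0')/= !(mul0r, addr0).
have F p : flat p (1 - x) = 0 by rewrite /flat ifF//; lra.
by rewrite !F !(mulr0, mul0r, addr0).
Qed.

End bump.

(** * Borel measurability *)

Section borel_sets.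
Context (R : realType).

Lemma invS_lt (e : R) : 0 < e -> exists k, k.+1%:R^-1 < e.
Proof.
move=> e0; exists (Num.bound e^-1); rewrite invf_plt ?posrE//.
apply: lt_trans (archi_boundP _) _; first by rewrite invr_ge0 ltW.
by rewrite ltr_nat.
Qed.

Lemma borel_open (T : ptopologicalType) (U : set T) : open U -> measurable (U : set (borel T)).
Proof. exact: sub_sigma_algebra. Qed.

Lemma borel_closed (T : ptopologicalType) (U : set T) :
 closed U -> measurable (U : set (borel T)).
Proof.
by move=> cU; rewrite -[U]setCK; apply: measurableC; apply: borel_open; rewrite openC.
Qed.

Lemma meas_continuous_on (T : ptopologicalType) (U : set T) (f : T -> R) : open U ->
 (forall t, U t -> {for t, continuous f}) -> measurable_fun (U : set (borel T)) f.
Proof.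
move=> oU cf; apply: (measurability _ (RGenOInfty.measurableE R)) => _ [_ [x ->] <-].
suff oW : open (U `&` f @^-1` `]x, +oo[%classic : set T) by exact: borel_open.
rewrite openE => t [Ut]; rewrite /= in_itv/= andbT => xt.
apply: filterI; first exact: open_nbhs_nbhs.
have FN : Filter (nbhs t) by exact: nbhs_filter.
apply: (@filterS _ (nbhs t) FN _ _ _ (cvgr_gt _ (cf t Ut) _ xt)) => s /=.
by rewrite in_itv/= andbT.
Qed.

Lemma meas_continuous (T : ptopologicalType) (f : T -> R) :
 continuous f -> measurable_fun [set: borel T] f.
Proof. by move=> cf; apply: (@meas_continuous_on T setT f openT) => t _; exact: cf. Qed.

(** An open set is the union of those cubes with rational centre and radius 1/(k+1) that it
    contains, a countable family, and the preimage of a cube is a finite intersection of coordinate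
    conditions. *)
Lemma meas_into_rV d' (T : measurableType d') n (F : T -> 'rV[R]_n) :
 (forall j, mfun (fun t : T => F t 0 j)) ->
 mfun (F : T -> borel 'rV[R]_n).
Proof.
move=> mF; apply: (@measurability _ _ _ (borel 'rV[R]_n) _ _ (@open 'rV[R]_n) erefl) => _ [U oU <-]; rewrite setTI.
pose I := ('rV[rat]_n * nat)%type.
pose B (i : I) : set 'rV[R]_n := [set v | forall j, `|v 0 j - ratr (i.1 0 j)| < i.2.+1%:R^-1].
(* Cubes not contained in [U] are replaced by the empty set, so that the union runs over a whole
   countable type. *)
pose G (i : I) : set T := if `[< B i `<=` U >] then F @^-1` B i else set0.
have -> : F @^-1` U = \bigcup_i G i.
 apply/seteqP; split=> [t Ut|t [i _]]; last first.
  by rewrite /G; case: asboolP => // BU /BU.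
 have /nbhs_ballP[e /= e0 He] : nbhs (F t) U by exact: open_nbhs_nbhs.
 have [k Hk] := invS_lt (divr_gt0 e0 (ltr0n R 2)). have Hq j : exists q : rat, `|F t 0 j - ratr q| < k.+1%:R^-1.
  have k0 : F t 0 j - k.+1%:R^-1 < F t 0 j + k.+1%:R^-1.
   have : 0 < k.+1%:R^-1 :> R by []. by move: (k.+1%:R^-1) => z; lra.
  have [q] := rat_in_itvoo k0; rewrite in_itv/= => /andP[q1 q2].
  exists q; rewrite ltr_norml; apply/andP; move: (k.+1%:R^-1) q1 q2 => z q1 q2. by split; lra.
 have [q {}Hq] := choice Hq. exists (\row_j q j, k) => //; rewrite /G; case: asboolP => [_|[]].
  by move=> j; rewrite mxE.
 move=> v vB; apply: He; rewrite -ball_normE/=.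
 apply: (@le_lt_trans _ _ (e / 2 + k.+1%:R^-1)); last by move: (k.+1%:R^-1) Hk => z Hk; lra.
 apply: rV_normP => [|j]; first by rewrite addr_ge0// ltW// ?divr_gt0.
 rewrite !mxE; have := vB j; rewrite /= mxE => vj; have := Hq j => tj.
 have -> : F t 0 j - v 0 j = (F t 0 j - ratr (q j)) - (v 0 j - ratr (q j)) by ring.
 apply: (le_trans (ler_normB _ _)); apply: lerD; apply: ltW => //. exact: lt_trans tj Hk.
apply: countable_bigcupT_measurable => [|i].
 exact: countableP.
rewrite /G; case: asboolP => // _; rewrite (_ : _ @^-1` _ =
  \bigcap_(j in [set: 'I_n]) [set t | `|F t 0 j - ratr (i.1 0 j)| < i.2.+1%:R^-1]); last first.
 by apply/seteqP; split=> t Ht j *; apply: Ht.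
apply: fin_bigcap_measurable => [|j _]; first exact: finite_finset.
have mfj : mfun (fun t : T => `|F t 0 j - ratr (i.1 0 j)|).
 by apply: measurableT_comp => //; apply: measurable_funB.
have := mfj measurableT _ (measurable_itv `]-oo, i.2.+1%:R^-1[).
rewrite setTI => H; apply: (eq_ind _ measurable H).
by [].
Qed.

Lemma meas_coord n j : measurable_fun [set: borel 'rV[R]_n] (fun v : 'rV[R]_n => v 0 j).
Proof. by apply: (@meas_continuous 'rV[R]_n); exact: coord_continuous. Qed.

Lemma meas_rVD d' (T : measurableType d') n (F G : T -> borel 'rV[R]_n) :
 mfun F -> mfun G ->
 mfun ((fun t => (F t : 'rV[R]_n) + (G t : 'rV[R]_n)) : T -> borel 'rV[R]_n).
Proof.
move=> mF mG; apply: meas_into_rV => j.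
under eq_fun do rewrite mxE.
by apply: measurable_funD; apply: (measurableT_comp (meas_coord j)).
Qed.

Lemma meas_rVZ d' (T : measurableType d') n (s : T -> R) (F : T -> borel 'rV[R]_n) :
 mfun s -> mfun F ->
 mfun ((fun t => s t *: (F t : 'rV[R]_n)) : T -> borel 'rV[R]_n).
Proof.
move=> mF mG; apply: meas_into_rV => j.
under eq_fun do rewrite mxE.
by apply: measurable_funM => //; apply: (measurableT_comp (meas_coord j)).
Qed.

End borel_sets.

(** * Lebesgue measure: uniqueness and translation invariance *)

Section lebesgue.
Context (R : realType) (n : nat).
Notation V := 'rV[R]_n.
Local Notation BV := (borel V).

Definition box (a b : V) : set V := [set u | forall j, a 0 j <= u 0 j < b 0 j].

Definition boxes : set (set BV) :=
 [set box ab.1 ab.2 | ab in [set ab : V * V | forall j, ab.1 0 j <= ab.2 0 j]].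

Definition cube k : set V := box (const_mx (- k%:R)) (const_mx k%:R).

Lemma meas_box (a b : V) : measurable (box a b : set BV).
Proof.
have -> : box a b = \bigcap_(j in [set: 'I_n]) [set u : BV | a 0 j <= u 0 j < b 0 j].
 by apply/seteqP; split=> u Hu j *; apply: Hu.
apply: fin_bigcap_measurable => [|j _]; first exact: finite_finset.
have := @meas_coord R n j measurableT _ (measurable_itv `[a 0 j, b 0 j[).
rewrite setTI => H; apply: (eq_ind _ measurable H).
by [].
Qed.

Lemma cube_cover : \bigcup_k cube k = [set: V].
Proof.
apply/seteqP; split=> // u _.
exists (Num.bound (`|u|)) => // j; rewrite !mxE.
have := archi_boundP (normr_ge0 u) => Hb.
apply/andP; split.
 rewrite -lerN2 opprK (le_trans _ (ltW Hb))// (le_trans _ (rV_coord _ j))//. by rewrite -normrN ler_norm.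
by rewrite (le_lt_trans _ Hb)// (le_trans _ (rV_coord _ j))// ler_norm.
Qed.

Lemma borel_boxes : @measurable _ BV = <<s boxes >>.
Proof.
apply/seteqP; split; last first.
 apply: smallest_sub; first exact: sigma_algebra_measurable. by move=> _ [[a b] _ <-]; exact: meas_box.
move=> A mA.
suff mid : measurable_fun [set: g_sigma_algebraType boxes] (id : g_sigma_algebraType boxes -> BV).
 by have := mid measurableT _ mA; rewrite setTI.
apply: meas_into_rV => j.
apply: (measurability _ (RGenInftyO.measurableE R)) => _ [_ [x ->] <-]; rewrite setTI.
(* The half-space u_j < x as a union of boxes; the maximum with -k keeps the two bounds in direction
   [j] ordered, as [boxes] requires. *)
rewrite (_ : _ @^-1` _ = \bigcup_k box (const_mx (- k%:R)) (\row_i if i == j then Num.max (- k%:R) x else k%:R)).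
 apply: bigcupT_measurable => k; apply: sub_sigma_algebra.
 exists (const_mx (- k%:R), \row_i if i == j then Num.max (- k%:R) x else k%:R) => //= i.
 rewrite !mxE; case: ifP => _; first by rewrite le_max lexx. by rewrite (@le_trans _ _ 0)//.
apply/seteqP; split=> [u|u [k _]].
 rewrite /= in_itv/= => ux; have := cube_cover; move/seteqP => [_ /(_ u I)[k _ Hk]].
 exists k => // i; have := Hk i; rewrite !mxE => /andP[-> /=]. by case: eqP => [->|//] _; rewrite lt_max ux orbT.
move=> /(_ j); rewrite !mxE eqxx/= lt_max => /andP[k1 /orP[]//].
by rewrite ltNge k1.
Qed.

Context (lam : {measure set BV -> \bar R}) (Hl : is_lebesgue lam).

Lemma lam_box (a b : V) : (forall j, a 0 j <= b 0 j) ->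
 lam (box a b) = (\prod_(j < n) (b 0 j - a 0 j))%:E.
Proof. exact: Hl. Qed.

(** Half-open boxes are stable under intersection, generate the Borel sets and contain an exhaustion
    by cubes of finite measure, so a measure is determined by its values on them. *)
Lemma lam_unique (nu : {measure set BV -> \bar R}) :
 (forall a b : V, (forall j, a 0 j <= b 0 j) -> nu (box a b) = lam (box a b)) ->
 forall A : set BV, measurable A -> nu A = lam A.
Proof.
move=> E A mA; apply/esym/(@measure_unique _ _ _ boxes cube) => //.
- exact: borel_boxes.
- move=> _ _ [[a b] /= ab <-] [[a' b'] /= ab' <-].
 have [E0|/set0P[u [ub ub']]] := eqVneq (box a b `&` box a' b') set0.
  (* The empty set is a degenerate box as soon as there is an index [j]; if n = 0 every box is the
     whole space, so no intersection is empty. *)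
  have [j _|n0] := pickP 'I_n; last first.
   by have : (box a b `&` box a' b') a; [split=> j; have := n0 j|rewrite E0].
  exists (a, a) => //=; rewrite E0; apply/seteqP; split=> // u Hu. by have := Hu j; lra.
 exists (\row_j Num.max (a 0 j) (a' 0 j), \row_j Num.min (b 0 j) (b' 0 j)) => /=.
  move=> j; rewrite !mxE ge_max !le_min. have := ub j; have := ub' j; lra.
 apply/seteqP; split=> v.
  move=> Hv; split=> j; have := Hv j; rewrite !mxE ge_max lt_min; lra.
 move=> [Hv Hv'] j; have := Hv j; have := Hv' j; rewrite !mxE ge_max lt_min; lra.
- move=> k; exists (const_mx (- k%:R), const_mx k%:R) => //= j; rewrite !mxE.
 by rewrite (@le_trans _ _ 0)//.
- exact: cube_cover.
- by move=> _ [[a b] /= ab <-]; rewrite E.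
- move=> k; rewrite lam_box ?ltry// => j; rewrite !mxE.
 by rewrite (@le_trans _ _ 0)//.
Qed.

Lemma lam_cube_fin k : (lam (cube k) < +oo)%E.
Proof.
rewrite lam_box ?ltry// => j; rewrite !mxE.
by rewrite (@le_trans _ _ 0)//.
Qed.

Lemma meas_shift (h : V) : mfun ((fun u : V => u + h) : BV -> BV).
Proof.
apply: (@meas_rVD R _ _ n) => //.
Qed.

(** The image measure under a translation gives boxes the same volume; [lam_unique] does the
    rest. *)
Lemma lam_shift (h : V) (A : set BV) : measurable A ->
 lam ((fun u : V => u + h) @^-1` A) = lam A.
Proof.
move=> mA; pose mh := meas_shift h.
pose nu : {measure set BV -> \bar R} :=
 @measure_function_pushforward__canonical__measure_function_Measure _ _ _ _ _ lam _ mh.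
rewrite -[LHS]/(nu A); apply: (lam_unique _ mA).
move=> a b ab; rewrite /= /pushforward.

rewrite (_ : _ @^-1` _ = box (a - h) (b - h)).
 rewrite !lam_box// => [|j]; last by rewrite !mxE lerD2r.
 by congr (_%:E); apply: eq_bigr => j _; rewrite !mxE; ring.
by apply/seteqP; split=> u Hu j; have := Hu j; rewrite !mxE; lra.
Qed.

Lemma integral_shift (h : V) (f : BV -> \bar R) :
 mfun f -> (forall u, 0 <= f u)%E ->
 (\int[lam]_u f ((u : V) + h)%R = \int[lam]_u f u)%E.
Proof.
move=> mf f0; have mh := meas_shift h.
have := @ge0_integral_pushforward _ _ _ _ _ _ mh lam setT f measurableT mf (fun y _ => f0 y).
rewrite /= => H; rewrite -[LHS]H.
by apply: eq_measure_integral => /= A mA _; exact: lam_shift.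
Qed.

Lemma meas_comp_shift (h : V) d' (T : measurableType d') (f : BV -> T) :
 mfun f ->
 mfun (fun u : BV => f ((u : V) + h)).
Proof. by move=> mf; apply: (measurableT_comp mf (meas_shift h)). Qed.

Lemma integ_shift (h : V) (f : BV -> R) : lam.-integrable [set: BV] (EFin \o f) ->
 lam.-integrable [set: BV] (fun u : BV => (f ((u : V) + h))%:E).
Proof.
move=> /integrableP[mf fi]; apply/integrableP; split.
 exact: (meas_comp_shift h mf).
rewrite (@integral_shift h (fun u => `|(f u)%:E|%E)) //.
by apply: measurableT_comp.
Qed.

Lemma Rintegral_shift (h : V) (f : BV -> R) : lam.-integrable [set: BV] (EFin \o f) ->
 \int[lam]_u f ((u : V) + h) = \int[lam]_u f u.
Proof.
move=> fi; congr fine; have /integrableP[mf _] := fi.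
have mh := meas_shift h.
have H := @integral_pushforward _ _ _ _ _ _ mh lam setT (EFin \o f) mf (integ_shift h fi) measurableT.
rewrite /= in H; rewrite -[LHS]H.
by apply: eq_measure_integral => /= A mA _; exact: lam_shift.
Qed.

Lemma lam_compact_bounded (A : set V) (r : R) : (forall u, A u -> `|u| <= r) ->
 exists k, A `<=` cube k.
Proof.
move=> Ar; exists (Num.bound r).+1 => u /Ar ur j; rewrite !mxE.
have r0 : 0 <= r := le_trans (normr_ge0 _) ur.
have b := archi_boundP r0.
have : `|u 0 j| < (Num.bound r).+1%:R.
 apply: le_lt_trans (rV_coord _ _) (le_lt_trans ur _). by apply: lt_trans b _; rewrite ltr_nat.
by rewrite ltr_norml => /andP[/ltW -> ->].
Qed.

End lebesgue.

(** * Real integrals, completeness of L2 and Riesz' theorem *)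

Section integral_tools.
Context d (T : measurableType d) (R : realType) (mu : {measure set T -> \bar R}).
Implicit Types f g h : T -> R.

Definition integ f := mu.-integrable [set: T] (EFin \o f).
(** Locked, so that unification never looks inside an integral. *)
Definition I : (T -> R) -> R := locked (fun f => \int[mu]_x f x).
Definition sqint f := mfun f /\ integ (fun x => f x ^+ 2).

Lemma IU f : I f = \int[mu]_x f x. Proof. by rewrite /I -lock. Qed.

Lemma integ_meas f : integ f -> mfun f.
Proof. by move=> /integrableP[/measurable_EFinP]. Qed.

Lemma eq_integ f g : f =1 g -> integ f -> integ g.
Proof. by move=> /funext ->. Qed.

Lemma integD f g : integ f -> integ g -> integ (fun x => f x + g x).
Proof. by move=> fi gi; exact: (integrableD measurableT fi gi). Qed.

Lemma integZ c f : integ f -> integ (fun x => c * f x).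
Proof. by move=> fi; exact: (integrableZl measurableT c fi). Qed.

Lemma integN f : integ f -> integ (fun x => - f x).
Proof. by move=> /(integZ (-1)); apply: eq_integrable => // x _; rewrite /= mulN1r. Qed.

Lemma integB f g : integ f -> integ g -> integ (fun x => f x - g x).
Proof. by move=> fi gi; apply: integD => //; exact: integN. Qed.

Lemma integ_sum (J : Type) (r : seq J) (F : J -> T -> R) :
 (forall j, integ (F j)) -> integ (fun x => \sum_(j <- r) F j x).
Proof.
move=> Fi; elim: r => [|j r IH].
 by apply: (@eq_integ (cst 0)) => [x|]; [rewrite big_nil|exact: integrable0].
by apply: (eq_integ _ (integD (Fi j) IH)) => x; rewrite big_cons.
Qed.

Lemma integ_le f g : mfun f -> (forall x, `|f x| <= g x) -> integ g -> integ f.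
Proof.
move=> mf fg; apply: le_integrable => //; first exact/measurable_EFinP.
by move=> x _ /=; rewrite lee_fin (le_trans (fg x))// ler_norm.
Qed.

Lemma integ_abs f : integ f -> integ (fun x => `|f x|).
Proof. exact: integrable_norm. Qed.

Lemma ID f g : integ f -> integ g -> I (fun x => f x + g x) = I f + I g.
Proof. by move=> fi gi; rewrite !IU RintegralD. Qed.

Lemma IZ c f : integ f -> I (fun x => c * f x) = c * I f.
Proof. by move=> fi; rewrite !IU RintegralZl. Qed.

Lemma IN f : integ f -> I (fun x => - f x) = - I f.
Proof.
by move=> fi; rewrite -mulN1r -IZ// !IU; apply: eq_Rintegral => x _; rewrite mulN1r.
Qed.

Lemma IB f g : integ f -> integ g -> I (fun x => f x - g x) = I f - I g.
Proof. by move=> fi gi; rewrite !IU RintegralB. Qed.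

Lemma I_sum (J : Type) (r : seq J) (F : J -> T -> R) : (forall j, integ (F j)) ->
 I (fun x => \sum_(j <- r) F j x) = \sum_(j <- r) I (F j).
Proof.
move=> Fi; elim: r => [|j r IH].
 rewrite big_nil (_ : (fun _ => _) = cst 0); last by apply/funext => x; rewrite big_nil.
 by rewrite !IU Rintegral_cst// mul0r.
rewrite big_cons -IH -ID//; last exact: integ_sum.
by rewrite !IU; apply: eq_Rintegral => x _; rewrite big_cons.
Qed.

Lemma I_le f g : integ f -> integ g -> (forall x, f x <= g x) -> I f <= I g.
Proof. by move=> fi gi fg; rewrite !IU; apply: le_Rintegral. Qed.

Lemma I_ge0 f : (forall x, 0 <= f x) -> 0 <= I f.
Proof. by move=> f0; rewrite !IU; apply: Rintegral_ge0. Qed.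

Lemma I2_ge0 f : 0 <= I (fun x => f x ^+ 2).
Proof. by apply: I_ge0 => x; exact: sqr_ge0. Qed.

Lemma I_eq f g : f =1 g -> I f = I g.
Proof. by move=> fg; rewrite !IU; apply: eq_Rintegral. Qed.

Lemma I_abs f : integ f -> `|I f| <= I (fun x => `|f x|).
Proof. by move=> fi; rewrite !IU; apply: le_normr_Rintegral. Qed.

Lemma I_EFin f : integ f -> (I f)%:E = (\int[mu]_x (f x)%:E)%E.
Proof. by move=> fi; rewrite !IU fineK//; exact: integrable_fin_num. Qed.

Lemma ge0_integP f : mfun f -> (forall x, 0 <= f x) ->
 (\int[mu]_x (f x)%:E < +oo)%E -> integ f.
Proof.
move=> mf f0 fi; apply/integrableP; split; first exact/measurable_EFinP.
by apply: le_lt_trans fi; apply: ge0_le_integral => //=;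
 [apply/measurable_EFinP/measurableT_comp|exact/measurable_EFinP|move=> x _; rewrite ger0_norm].
Qed.

Lemma sqintM f g : sqint f -> sqint g -> integ (fun x => f x * g x).
Proof.
move=> [mf fi] [mg gi]; apply: (integ_le _ _ (integD fi gi)).
 exact: measurable_funM.
move=> x; rewrite ler_norml; have := sqr_ge0 (f x - g x); have := sqr_ge0 (f x + g x).
have := sqr_ge0 (f x).
by rewrite sqrrD => *; lra.
Qed.

Lemma sqintD f g : sqint f -> sqint g -> sqint (fun x => f x + g x).
Proof.
move=> [mf fi] [mg gi]; have mfg : mfun (fun x : T => f x + g x).
 exact: measurable_funD.
split=> //; apply: (integ_le _ _ (integZ 2 (integD fi gi))).
 exact: measurable_funX.
move=> x; rewrite ger0_norm ?sqr_ge0//; have := sqr_ge0 (f x - g x).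
by rewrite sqrrD => *; lra.
Qed.

Lemma sqintZ c f : sqint f -> sqint (fun x => c * f x).
Proof.
move=> [mf fi]; split; first exact: measurable_funM.
by apply: (eq_integ _ (integZ (c ^+ 2) fi)) => x; rewrite exprMn.
Qed.

Lemma sqintN f : sqint f -> sqint (fun x => - f x).
Proof.
move=> [mf fi]; split; first exact: measurableT_comp.
by apply: (eq_integ _ fi) => x; rewrite sqrrN.
Qed.

Lemma sqintB f g : sqint f -> sqint g -> sqint (fun x => f x - g x).
Proof. by move=> fi gi; apply: sqintD => //; exact: sqintN. Qed.

Lemma I_sqD f g (t : R) : sqint f -> sqint g ->
 I (fun x => (f x + t * g x) ^+ 2) =
 I (fun x => f x ^+ 2) + 2 * t * I (fun x => f x * g x) + t ^+ 2 * I (fun x => g x ^+ 2).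
Proof.
move=> [mf fi] [mg gi]; have fg := sqintM (conj mf fi) (conj mg gi).
rewrite -(IZ _ fg) -(IZ _ gi) -ID//; last exact: integZ.
rewrite -ID; [|by apply: integD => //; exact: integZ|exact: integZ].
by apply: I_eq => x; ring.
Qed.

Lemma CS f g : sqint f -> sqint g ->
 I (fun x => f x * g x) ^+ 2 <= I (fun x => f x ^+ 2) * I (fun x => g x ^+ 2).
Proof.
move=> fi gi; set b := I (fun x => _ * _).
set a := I (fun x => f x ^+ 2); set c := I (fun x => g x ^+ 2).
have H t : 0 <= a + 2 * t * b + t ^+ 2 * c.
 by rewrite -I_sqD//; apply: I_ge0 => x; exact: sqr_ge0.
have c0 : 0 <= c by exact: I2_ge0.
have [cz|cn] := eqVneq c 0.
 (* If int g^2 = 0 but int f g is nonzero, the value of t chosen here would make int (f + t g)^2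
    equal to -1. *)
 have [->|bn] := eqVneq b 0; first by rewrite cz expr0n mulr0. have := H (- (a + 1) / (2 * b)); rewrite cz.
 have -> : 2 * (- (a + 1) / (2 * b)) * b = - (a + 1) by field. lra.
have {}c0 : 0 < c by rewrite lt_def cn.
have := H (- b / c).
have -> : a + 2 * (- b / c) * b + (- b / c) ^+ 2 * c = a - b ^+ 2 / c by field.
by rewrite subr_ge0 ler_pdivrMr.
Qed.

(** Fatou's lemma for a bound that holds only from some index on: the sequence is shifted by that
    index, which does not change the limit. *)
Lemma fatou_le (g_ : nat -> T -> R) (g : T -> R) (B : \bar R) :
 (forall n, mfun (g_ n)) -> mfun g ->
 (forall n x, 0 <= g_ n x) -> (forall x, 0 <= g x) ->
 {ae mu, forall x, g_ ^~ x @ \oo --> g x} ->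
 (exists N, forall n, (N <= n)%N -> (\int[mu]_x (g_ n x)%:E <= B)%E) ->
 (\int[mu]_x (g x)%:E <= B)%E.
Proof.
move=> mg_ mg g0_ g0 cvg [N HN].
have E : (\int[mu]_x (g x)%:E = \int[mu]_x limn_einf (fun n => (g_ (n + N)%N x)%:E))%E.
 apply: ae_eq_integral => //.
 - exact/measurable_EFinP.
 - apply: (@measurableT_comp _ _ _ _ _ _ (@oppe R) _ (fun x => limn_esup (fun n => - (g_ (n + N)%N x)%:E)%E)); first exact: oppe_measurable.
  apply: measurable_fun_limn_esup => n; apply: measurableT_comp => //. exact/measurable_EFinP.
 - apply: filterS cvg => x gx _; apply/esym; apply: (cvg_limn_einf_sup _).1.
  apply/fine_cvgP; split; first exact: nearW. by rewrite (cvg_shiftn N (g_ ^~ x)).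
have F := @fatou _ _ _ mu setT measurableT (fun n x => (g_ (n + N)%N x)%:E)
 (fun n => (measurable_EFinP _ _).2 (mg_ (n + N)%N)) (fun n x _ => g0_ (n + N)%N x).
rewrite E; apply: (le_trans F).
rewrite limn_einf_lim; apply: lime_le; first exact: is_cvg_einfs.
apply: nearW => n; apply: (le_trans _ (HN (n + N)%N (leq_addl _ _))).
by apply: ereal_inf_lbound; exists n => /=.
Qed.

Definition cauchy2 (u : nat -> T -> R) := forall e, 0 < e ->
 exists N, forall n m, (N <= n)%N -> (N <= m)%N -> I (fun x => (u n x - u m x) ^+ 2) <= e.

Section supported.
Variable D : set T.
Hypothesis iD : integ \1_D.

(** Relative to a set [D] of finite measure L2 functions are integrable, since |f| <= 1_D + f^2.
    With [D] everything this serves the compact manifold, with [D] a cube the functions of bounded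
    support on Euclidean space. *)
Lemma sqint_integ_on f : sqint f -> (forall x, ~ D x -> f x = 0) -> integ f.
Proof.
move=> [mf fi] fD; apply: (integ_le mf _ (integD iD fi)) => x.
rewrite indicE; case: (boolP (x \in D)) => xD; last first.
 by rewrite fD ?normr0// ; move: xD; rewrite notin_setE.
have := sqr_ge0 (`|f x| - 1); rewrite sqrrB real_normK ?num_real// => h.
by have := normr_ge0 (f x) => h0; rewrite /=; lra.
Qed.

Lemma I_abs_sq_on f : sqint f -> (forall x, ~ D x -> f x = 0) ->
 I (fun x => `|f x|) ^+ 2 <= I \1_D * I (fun x => f x ^+ 2).
Proof.
move=> [mf fi] fD; have sqD x : (\1_D x : R) ^+ 2 = \1_D x.
 by rewrite indicE; case: (x \in D); rewrite /= ?expr1n ?expr0n.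
have h1 : sqint \1_D by split; [exact: integ_meas iD|exact: eq_integ].
have h2 : sqint (fun x => `|f x|).
 split; first exact: measurableT_comp. by apply: (eq_integ _ fi) => x; rewrite real_normK ?num_real.
have := CS h1 h2.
have -> : I (fun x => \1_D x * `|f x|) = I (fun x => `|f x|).
 apply: I_eq => x; rewrite indicE; case: (boolP (x \in D)) => xD; first by rewrite mul1r.
 by rewrite fD ?normr0 ?mulr0//; move: xD; rewrite notin_setE.
have -> : I (fun x => \1_D x ^+ 2) = I \1_D by apply: I_eq => x.
suff -> : I (fun x => `|f x| ^+ 2) = I (fun x => f x ^+ 2) by [].
by apply: I_eq => x; rewrite real_normK ?num_real.
Qed.

(** Riesz-Fischer. Along a subsequence with squared distances at most 4^-k the increments are
    summable in L1, hence almost everywhere; Fatou's lemma then gives L2 convergence of the whole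
    sequence. The subsequence is part of the conclusion because limits in other norms are identified
    through it. *)
Lemma L2_complete_on (u : nat -> T -> R) : (forall n, sqint (u n)) ->
 (forall n x, ~ D x -> u n x = 0) -> cauchy2 u ->
 exists f, [/\ sqint f,
  (forall e, 0 < e -> exists N, forall n, (N <= n)%N -> I (fun x => (u n x - f x) ^+ 2) <= e) &
  exists s : nat -> nat, (forall k, (k <= s k)%N) /\ {ae mu, forall x, (fun k => u (s k) x) @ \oo --> f x}].
Proof.
move=> f2 uD fC; have e40 k : 0 < (4^-1 : R) ^+ k by rewrite exprn_gt0.
have [N HN] := choice (fun k => fC _ (e40 k)).
pose s := fix s k := if k is k'.+1 then maxn (N k) (s k').+1 else N 0%N.
have sN k : (N k <= s k)%N by case: k => //= k; rewrite leq_maxl.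
have sS k : (s k < s k.+1)%N by rewrite /= leq_maxr.
have sk k : (k <= s k)%N by elim: k => // k IH; apply: leq_ltn_trans (sS k).
have smono k m : (k <= m)%N -> (s k <= s m)%N.
 elim: m => [|m IH]; first by rewrite leqn0 => /eqP ->.
 rewrite leq_eqVlt => /orP[/eqP ->//|]; rewrite ltnS => /IH h. exact: leq_trans h (ltnW (sS m)).
pose dk k x := `|u (s k.+1) x - u (s k) x|.
have f2B n m : sqint (fun x => u n x - u m x) by exact: sqintB.
have I1D : 0 <= I \1_D by apply: I_ge0 => x.
have f2D k m x : ~ D x -> u k x - u m x = 0 by move=> nD; rewrite !uD// subrr.
have mdk k : mfun (dk k) by apply: measurableT_comp => //; case: (f2B (s k.+1) (s k)).
(* [I \1_D + 1] bounds the square root of the measure of [D]. *)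
have Idk k : (\int[mu]_x (dk k x)%:E <= ((I \1_D + 1) * (2^-1) ^+ k)%:E)%E.
 have ik : integ (dk k) by apply: integ_abs; exact: (sqint_integ_on (f2B _ _) (f2D _ _)).
 rewrite -I_EFin// lee_fin. have c0 : 0 <= I \1_D + 1 by rewrite addr_ge0//.
 rewrite -(@ler_pXn2r _ 2%N)// ?nnegrE ?mulr_ge0 ?I_ge0//; last by move=> x; exact: normr_ge0.
 apply: (le_trans (I_abs_sq_on (f2B _ _) (f2D _ _))); rewrite exprMn -exprM mulnC exprM.
 have -> : (2^-1 : R) ^+ 2 = 4^-1 by field. apply: ler_pM; [exact: I1D|by exact: I2_ge0| |].
  by rewrite sqrrD ; have := sqr_ge0 (I \1_D); lra.
 by apply: HN; [exact: leq_trans (sN k) (ltnW (sS k))|exact: sN].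
have Sfin : (\int[mu]_x (\sum_(0 <= k <oo) (dk k x)%:E) < +oo)%E.
 rewrite integral_nneseries//; last 2 first.
 - by move=> k; exact/measurable_EFinP.
 - by move=> k x _; rewrite lee_fin normr_ge0.
 apply: (@le_lt_trans _ _ (\sum_(0 <= k <oo) ((I \1_D + 1) * (2^-1) ^+ k)%:E)%E).
  apply: lee_nneseries => [k *|k *]; last exact: Idk. by apply: integral_ge0 => x _; rewrite lee_fin normr_ge0.
 apply: (@le_lt_trans _ _ ((I \1_D + 1) * 2)%:E); last exact: ltry.
 have c0 : 0 <= I \1_D + 1 by rewrite addr_ge0//. apply: lime_le.
  by apply: is_cvg_nneseries => k _ _; rewrite lee_fin mulr_ge0//.
 apply: nearW => n; rewrite sumEFin lee_fin -mulr_sumr ler_wpM2l//.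
 suff : \sum_(0 <= i < n) (2^-1 : R) ^+ i = 2 - 2 * (2^-1) ^+ n.
  have h : 0 <= (2^-1 : R) ^+ n by []. by move=> ->; lra.
 elim: n => [|n IH]; first by rewrite big_nil ; ring. by rewrite big_nat_recr//= IH exprS; field.
have ae1 : {ae mu, forall x, cvgn (fun k => u (s k) x)}.
 have Sint : mu.-integrable [set: T] (fun x => \sum_(0 <= k <oo) (dk k x)%:E)%E.
  have mS : mfun (fun x : T => \sum_(0 <= k <oo) (dk k x)%:E)%E.
   by apply: ge0_emeasurable_sum => [k x _ _|k _]; [rewrite lee_fin normr_ge0|exact/measurable_EFinP].
  apply/integrableP; split=> //; apply: le_lt_trans Sfin; apply: ge0_le_integral => //=.
  - exact: measurableT_comp.
  - move=> x _; rewrite gee0_abs//; apply: nneseries_ge0 => k _ _; exact: normr_ge0.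
 have := integrable_ae measurableT Sint; apply: filterS => x /(_ Logic.I) Sx. pose v k := u (s k.+1) x - u (s k) x.
 have cv : cvgn (series v).
  apply: normed_cvg; apply: nondecreasing_is_cvgn.
   by apply: nondecreasing_series => k _ _; exact: normr_ge0.
  exists (fine (\sum_(0 <= k <oo) (dk k x)%:E)) => _ [n _ <-]. rewrite -lee_fin fineK// -sumEFin.
  by apply: nneseries_lim_ge => k _; rewrite lee_fin normr_ge0.
 have -> : (fun k => u (s k) x) = (fun k => u (s 0%N) x + series v k).
  by apply/funext => k; rewrite /series /= telescope_sumr// addrC subrK.
 by apply: is_cvgD => //; exact: is_cvg_cst.
(* The upper limit is measurable whether or not the sequence converges; on the null set of
   divergence the value does not matter. *)
pose f x := fine (limn_esup (fun k => (u (s k) x)%:E)).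
have mf : mfun f.
 apply: (measurableT_comp (fine_measurable measurableT)).
 apply: measurable_fun_limn_esup => k; apply/measurable_EFinP; by case: (f2 (s k)).
have aef : {ae mu, forall x, (fun k => u (s k) x) @ \oo --> f x}.
 apply: filterS ae1 => x /cvg_ex[l fl]. suff -> : f x = l by [].
 have fl' : (fun k => (u (s k) x)%:E) @ \oo --> l%:E.
  by apply/fine_cvgP; split; first exact: nearW.
 by rewrite /f (cvg_limn_einf_sup fl').2.
have key e n : 0 < e -> (forall m, (n <= m)%N -> I (fun x => (u n x - u m x) ^+ 2) <= e) ->
  (\int[mu]_x ((u n x - f x) ^+ 2)%:E <= e%:E)%E.
 move=> e0 He; apply: (@fatou_le (fun k x => (u n x - u (s k) x) ^+ 2)).
 - by move=> k; apply: measurable_funX; case: (f2B n (s k)).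
 - by apply: measurable_funX; apply: measurable_funB => //; case: (f2 n).
 - by move=> k x; exact: sqr_ge0.
 - by move=> x; exact: sqr_ge0.
 - apply: filterS aef => x fx.
  have H : (fun k => u n x - u (s k) x) @ \oo --> u n x - f x by apply: cvgB => //; exact: cvg_cst.
  under eq_fun do rewrite expr2. by rewrite expr2; exact: cvgM.
 - exists n => k nk; have [_ i2] := f2B n (s k).
  rewrite -I_EFin// ; apply: He. exact: leq_trans nk (sk k).
have f2' : sqint f.
 have [N1 HN1] := fC 1 ltr01. have h := key 1 N1 ltr01 (fun m hm => HN1 N1 m (leqnn _) hm).
 have hs : sqint (fun x => u N1 x - f x).
  have mm : mfun (fun x : T => u N1 x - f x).
   by apply: measurable_funB => //; case: (f2 N1).
  split=> //; apply: ge0_integP; [exact: measurable_funX|by move=> x; exact: sqr_ge0|].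
  exact: le_lt_trans h (ltry _).
 have := sqintB (f2 N1) hs; congr sqint; apply/funext => x; ring.
exists f; split=> //.
 move=> e e0; have [N1 HN1] := fC e e0; exists N1 => n nN. have [_ i2] := sqintB (f2 n) f2'.
 rewrite -lee_fin I_EFin//; apply: key => // m nm. by apply: HN1 => //; exact: leq_trans nm.
by exists s.
Qed.

(* Minimise |Tp|^2 - 2 l(p) over the subspace E; the parallelogram law makes a
  minimising sequence Cauchy, and the Euler-Lagrange equation is the conclusion. *)
Lemma riesz_range_on (X : lmodType R) (E : X -> Prop) (A : X -> T -> R) (l : X -> R) (C : R) :
 E 0 -> (forall a p q, E p -> E q -> E (a *: p + q)) ->
 (forall a p q x, E p -> E q -> A (a *: p + q) x = a * A p x + A q x) ->
 (forall a p q, E p -> E q -> l (a *: p + q) = a * l p + l q) ->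
 (forall p, E p -> sqint (A p)) -> (forall p x, E p -> ~ D x -> A p x = 0) ->
 (forall p, E p -> l p ^+ 2 <= C * I (fun x => A p x ^+ 2)) ->
 exists z, exists2 p_ : nat -> X, [/\ forall n, E (p_ n), sqint z &
  forall e, 0 < e -> exists N, forall n, (N <= n)%N -> I (fun x => (A (p_ n) x - z x) ^+ 2) <= e] &
  forall p, E p -> l p = I (fun x => z x * A p x).
Proof.
move=> E0 Elin Alin llin A2 AD0 lb.
pose J p := I (fun x => A p x ^+ 2) - 2 * l p.
(* From l(p)^2 <= |C| a one gets 2 l(p) <= a + |C|, so [J] is bounded below. *)
have Jge p : E p -> - `|C| <= J p.
 move=> Ep; have := lb p Ep; have : 0 <= I (fun x => A p x ^+ 2) by exact: I2_ge0.
 rewrite /J; move: (I _) (l p) => a b a0 h.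
 have {}h : b ^+ 2 <= `|C| * a by apply: le_trans h _; rewrite ler_wpM2r// ler_norm.
 have c0 := normr_ge0 C; move: (`|C|) c0 h => c c0 h.
 have := sqr_ge0 (a - c) => h2; have [b0|b0] := leP b 0; first by nra. suff : 2 * b <= a + c by lra.
 rewrite -(@ler_pXn2r _ 2%N)// ?nnegrE ?addr_ge0 ?mulr_ge0// ?(ltW b0)//. by rewrite exprMn; lra.
pose S := [set J p | p in E].
have hS : has_inf S by split; [exists (J 0), 0|exists (- `|C|) => _ [p Ep <-]; exact: Jge].
pose m := inf S.
have mle p : E p -> m <= J p by move=> Ep; apply: inf_lbound; [case: hS|exists p].
have /choice[p_ Hp] : forall n : nat, exists p, E p /\ J p < m + n.+1%:R^-1.
 move=> n; have e0 : 0 < n.+1%:R^-1 :> R by rewrite invr_gt0.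
 by have [_ [p Ep <-] Jp] := inf_adherent e0 hS; exists p.
have AD a p q : E p -> E q -> A (a *: p + q) = (fun x => A q x + a * A p x).
 by move=> Ep Eq; apply/funext => x; rewrite Alin// addrC.
have JD a p q : E p -> E q ->
  J (a *: p + q) = J q + a * (2 * I (fun x => A q x * A p x) - 2 * l p) + a ^+ 2 * I (fun x => A p x ^+ 2).
 move=> Ep Eq; rewrite /J AD// llin// (I_sqD _ (A2 _ Eq) (A2 _ Ep)); ring.
(* The midpoint of [p] and [q] competes in the infimum [m]. *)
have par p q : E p -> E q -> I (fun x => (A p x - A q x) ^+ 2) <= 2 * (J p - m) + 2 * (J q - m).
 move=> Ep Eq; have Er : E (2^-1 *: p + 2^-1 *: q).
  have E2 : E (2^-1 *: q) by have := Elin 2^-1 _ _ Eq E0; rewrite addr0. exact: Elin.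
 have lq : l (2^-1 *: q) = 2^-1 * l q.
  have := llin 2^-1 q 0 Eq E0; have := llin (-1) 0 0 E0 E0. by rewrite scaler0 !addr0 => h; lra.
 have Aq x : A (2^-1 *: q) x = 2^-1 * A q x.
  have := Alin 2^-1 q 0 x Eq E0; have := Alin (-1) 0 0 x E0 E0. by rewrite scaler0 !addr0 => h; lra.
 have E2 : E (2^-1 *: q) by have := Elin 2^-1 _ _ Eq E0; rewrite addr0. have := mle _ Er; rewrite /J llin// lq.
 have -> : A (2^-1 *: p + 2^-1 *: q) = (fun x => 2^-1 * (A p x + 1 * A q x)).
  by apply/funext => x; rewrite Alin// Aq; ring.
 have -> : (fun x => (2^-1 * (A p x + 1 * A q x)) ^+ 2) = (fun x => 4^-1 * (A p x + 1 * A q x) ^+ 2).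
  by apply/funext => x; field.
 have [_ i1] := sqintD (A2 p Ep) (sqintZ 1 (A2 q Eq)). rewrite IZ// (I_sqD _ (A2 p Ep) (A2 q Eq)).
 have -> : I (fun x => (A p x - A q x) ^+ 2) = I (fun x => (A p x + (-1) * A q x) ^+ 2).
  by apply: I_eq => x; ring.
 rewrite (I_sqD _ (A2 p Ep) (A2 q Eq)). by move: (I _) (I _) (I _) (l p) (l q) => a b c d' e'; lra.
have pC : cauchy2 (fun n => A (p_ n)).
 move=> e e0; have e40 : 0 < e / 4 by rewrite divr_gt0. have [N HN] := invS_lt e40; exists N => n k Nn Nk.
 have [En Jn] := Hp n; have [Ek Jk] := Hp k. apply: le_trans (par _ _ En Ek) _.
 have hn i : (N <= i)%N -> i.+1%:R^-1 <= e / 4.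
  move=> Ni; apply: le_trans (ltW HN); rewrite lef_pV2 ?posrE//. by rewrite ler_nat.
 have := hn n Nn; have := hn k Nk. by move: (n.+1%:R^-1) (k.+1%:R^-1) Jn Jk => a b; lra.
have [z [z2 zc _]] := L2_complete_on (fun n => A2 _ (Hp n).1) (fun n x => AD0 _ x (Hp n).1) pC.
exists z, p_; first by split=> // n; case: (Hp n).
move=> p Ep; have zA := sqintM z2 (A2 p Ep).
set w := I (fun x => z x * A p x); pose b := I (fun x => A p x ^+ 2).
have b0 : 0 <= b by exact: I2_ge0.
(* Minimality tested with [p_ n + t p], up to an error [e]: [n] is so large that [J (p_ n)] is
   within e/2 of the infimum and the pairing of [A (p_ n)] with [A p] is close to [w]. *)
have key (t e : R) : 0 < e -> - e <= 2 * t * (w - l p) + t ^+ 2 * b.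
 move=> e0; have [N1 HN1] := invS_lt (divr_gt0 e0 (ltr0n R 2)). pose e1 := (e / 2) ^+ 2 / (4 * t ^+ 2 * b + 1).
 have d0 : 0 < 4 * t ^+ 2 * b + 1.
  by rewrite ltr_wpDl// mulr_ge0// mulr_ge0// sqr_ge0.
 have e10 : 0 < e1 by rewrite divr_gt0// exprn_gt0// divr_gt0. have [N2 HN2] := zc e1 e10; pose n := maxn N1 N2.
 have [En Jn] := Hp n. have := mle _ (Elin t _ _ Ep En); rewrite JD//. have dz := sqintB (A2 _ En) z2.
 have := CS dz (A2 p Ep); rewrite -/b.
 have -> : I (fun x => (A (p_ n) x - z x) * A p x) = I (fun x => A (p_ n) x * A p x) - w.
  rewrite -IB//; last exact: sqintM (A2 _ En) (A2 p Ep). by apply: I_eq => x; ring.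
 set v := I (fun x => A (p_ n) x * A p x) => cs hm. have hn : n.+1%:R^-1 < e / 2.
  apply: le_lt_trans HN1; rewrite lef_pV2 ?posrE// ler_nat ; exact: leq_maxl.
 have vw : 2 * t * (v - w) <= e / 2.
  have [h|h] := leP (2 * t * (v - w)) 0; first by rewrite (le_trans h)// ltW// divr_gt0.
  rewrite -(@ler_pXn2r _ 2%N)// ?nnegrE ?(ltW h)//; last by rewrite ltW// divr_gt0.
  have := HN2 n (leq_maxr _ _) => hz. have h3 : (v - w) ^+ 2 <= e1 * b by apply: le_trans cs _; rewrite ler_wpM2r.
  have -> : (2 * t * (v - w)) ^+ 2 = (4 * t ^+ 2) * (v - w) ^+ 2 by ring.
  apply: (@le_trans _ _ ((4 * t ^+ 2) * (e1 * b))); first by rewrite ler_wpM2l// mulr_ge0// sqr_ge0.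
  have -> : (4 * t ^+ 2) * (e1 * b) = e1 * (4 * t ^+ 2 * b) by ring.
  rewrite mulrAC ler_pdivrMr// ler_wpM2l ?sqr_ge0// lerDl//.
 by move: (n.+1%:R^-1) Jn hn => c Jn hn; lra.
apply/eqP; rewrite eq_sym -subr_eq0; apply/negPn/negP => wl0.
pose del := w - l p; have D2 : 0 < del ^+ 2 by rewrite exprn_even_gt0//=.
(* A nearly optimal [t]; [b + 1] in place of [b] avoids a division by zero. *)
have := key (- del / (b + 1)) (del ^+ 2 / (2 * (b + 1))).
have b1 : 0 < b + 1 by rewrite ltr_wpDl.
have -> : 0 < del ^+ 2 / (2 * (b + 1)) by rewrite divr_gt0// mulr_gt0.
have -> : 2 * (- del / (b + 1)) * del + (- del / (b + 1)) ^+ 2 * b =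
  - (del ^+ 2 / (b + 1)) * (1 + 1 / (b + 1)).
 by field; rewrite gt_eqF.
have -> : del ^+ 2 / (2 * (b + 1)) = 2^-1 * (del ^+ 2 / (b + 1)) by field; rewrite gt_eqF.
have : 0 < del ^+ 2 / (b + 1) by rewrite divr_gt0.
have : 0 < 1 / (b + 1) by rewrite divr_gt0.
move: (del ^+ 2 / (b + 1)) (1 / (b + 1)) => x y y0 x0 h; nra.
Qed.

End supported.

Hypothesis mufin : (mu [set: T] < +oo)%E.

Lemma integ_cst c : integ (fun=> c).
Proof.
apply: (@measurable_bounded_integrable _ _ _ mu (cst c)) => //.
by exists `|c|; split; [exact: num_real|move=> M cM x _; exact: ltW].
Qed.

Lemma integ_bounded f C : mfun f -> (forall x, `|f x| <= C) -> integ f.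
Proof. by move=> mf fC; apply: (integ_le mf fC); exact: integ_cst. Qed.

Lemma sqint_bounded f C : mfun f -> (forall x, `|f x| <= C) -> sqint f.
Proof.
move=> mf fC; split=> //; apply: (@integ_bounded _ (C ^+ 2)); first exact: measurable_funX.
by move=> x; rewrite normrX lerXn2r ?nnegrE// (le_trans (normr_ge0 (f x))).
Qed.

Lemma sqint_integ f : sqint f -> integ f.
Proof.
move=> [mf fi]; apply: (integ_le mf _ (integD (integ_cst 1) fi)) => x.
have := sqr_ge0 (`|f x| - 1); rewrite sqrrB real_normK ?num_real// => h.
have := normr_ge0 (f x); lra.
Qed.

Lemma I_abs_sq f : sqint f -> I (fun x => `|f x|) ^+ 2 <= I (fun=> 1) * I (fun x => f x ^+ 2).
Proof.
move=> [mf fi]; have h1 : sqint (fun=> 1).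
 by apply: (@sqint_bounded _ 1) => [|x]; [exact: measurable_cst|rewrite normr1].
have h2 : sqint (fun x => `|f x|).
 split; first exact: measurableT_comp. by apply: (eq_integ _ fi) => x; rewrite real_normK ?num_real.
have := CS h1 h2.
have -> : I (fun x => 1 * `|f x|) = I (fun x => `|f x|) by apply: I_eq => x; rewrite mul1r.
have -> : I (fun x => 1 ^+ 2) = I (fun=> 1 : R) by apply: I_eq => x; rewrite expr1n.
suff -> : I (fun x => `|f x| ^+ 2) = I (fun x => f x ^+ 2) by [].
by apply: I_eq => x; rewrite real_normK ?num_real.
Qed.

Let i1 : integ \1_[set: T].
Proof. by apply: (eq_integ _ (integ_cst 1)) => x; rewrite indicT. Qed.

Lemma L2_complete (u : nat -> T -> R) : (forall n, sqint (u n)) -> cauchy2 u ->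
 exists f, [/\ sqint f,
  (forall e, 0 < e -> exists N, forall n, (N <= n)%N -> I (fun x => (u n x - f x) ^+ 2) <= e) &
  exists s : nat -> nat, (forall k, (k <= s k)%N) /\ {ae mu, forall x, (fun k => u (s k) x) @ \oo --> f x}].
Proof. by move=> u2; apply: (L2_complete_on i1 u2) => n x []. Qed.

Lemma riesz_range (X : lmodType R) (E : X -> Prop) (A : X -> T -> R) (l : X -> R) (C : R) :
 E 0 -> (forall a p q, E p -> E q -> E (a *: p + q)) ->
 (forall a p q x, E p -> E q -> A (a *: p + q) x = a * A p x + A q x) ->
 (forall a p q, E p -> E q -> l (a *: p + q) = a * l p + l q) ->
 (forall p, E p -> sqint (A p)) ->
 (forall p, E p -> l p ^+ 2 <= C * I (fun x => A p x ^+ 2)) ->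
 exists z, exists2 p_ : nat -> X, [/\ forall n, E (p_ n), sqint z &
  forall e, 0 < e -> exists N, forall n, (N <= n)%N -> I (fun x => (A (p_ n) x - z x) ^+ 2) <= e] &
  forall p, E p -> l p = I (fun x => z x * A p x).
Proof. by move=> E0 h1 h2 h3 h4; apply: (riesz_range_on i1 E0 h1 h2 h3 h4) => p x _ []. Qed.

End integral_tools.

Local Notation ipr mu f g := (I mu (fun x => f x * g x)) (only parsing).
Local Notation I2 mu f := (I mu (fun x => f x ^+ 2)) (only parsing).

(** * Smooth cutoff functions *)

Section plateaus.
Context (R : realType) (n : nat).
Notation V := 'rV[R]_n.

(** The norm is the maximum norm, so a product over the coordinates is adapted to balls. The factor
    3/4 makes the argument of [sstep] equal to 1 at distance r/2 and to 0 at distance r. *)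
Definition box_bump (c : V) (r : R) (u : V) : R :=
 \prod_(j < n) sstep ((r ^+ 2 - (u 0 j - c 0 j) ^+ 2) / (3 / 4 * r ^+ 2)).

Lemma smc_opp (W : set V) f : smc W f -> smc W (fun u => - f u).
Proof. by move=> sf; apply: (smc_ext (smc_mul (smc_cst W (-1)) sf)) => u _; rewrite mulN1r. Qed.

Lemma smc_sub (W : set V) f g : smc W f -> smc W g -> smc W (fun u => f u - g u).
Proof. by move=> sf sg; apply: smc_add => //; exact: smc_opp. Qed.

Lemma smc_box_bump (W : set V) c r : smc W (box_bump c r).
Proof.
apply: smc_prod => j; apply: smc_sstep; apply: smc_mul; last exact: smc_cst.
have sj : smc W (fun u => u 0 j - c 0 j) by apply: smc_sub; [exact: smc_coord|exact: smc_cst].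
by apply: smc_sub; [exact: smc_cst|apply: (smc_ext (smc_mul sj sj)) => u _; rewrite expr2].
Qed.

Lemma box_bump_ge0 c r u : 0 <= box_bump c r u.
Proof. by apply: prodr_ge0 => j _; exact: sstep_ge0. Qed.

Lemma box_bump1 (c : V) (r : R) u : 0 < r -> `|u - c| <= r / 2 -> box_bump c r u = 1.
Proof.
move=> r0 uc; rewrite /box_bump big1// => j _; apply: sstep1.
rewrite ler_pdivlMr ?mulr_gt0//.
have : `|u 0 j - c 0 j| ^+ 2 <= (r / 2) ^+ 2.
 rewrite lerXn2r ?nnegrE// ?divr_ge0// ?(ltW r0)//.
 by have := rV_coord (u - c) j; rewrite !mxE => /le_trans; exact.
rewrite real_normK ?num_real// => h; lra.
Qed.

Lemma box_bump_neq0 (c : V) (r : R) u : 0 < r -> box_bump c r u != 0 -> `|u - c| <= r.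
Proof.
move=> r0 b0; apply: rV_normP => [|j]; first exact: ltW.
rewrite !mxE; apply/negPn/negP; rewrite -ltNge => h; move/negP: b0; apply.
apply/eqP; rewrite /box_bump (bigD1 j)//= sstep0 ?mul0r//.
rewrite pmulr_lle0 ?invr_gt0 ?mulr_gt0// subr_le0.
rewrite -[leRHS]real_normK ?num_real// lerXn2r ?nnegrE//// ltW//.
Qed.

Lemma closed_normB (c : V) (r : R) : closed [set u : V | `|u - c| <= r].
Proof.
have -> : [set u : V | `|u - c| <= r] = (fun u : V => `|u - c|) @^-1` [set x | x <= r] by [].
apply: preimage_closed; last exact: closed_le.
move=> u _; apply: (@continuous_comp _ _ _ (fun u : V => u - c) (fun u : V => `|u|)).
 by apply: (@cvgB _ _ _ (nbhs u)); [exact: cvg_id|exact: cst_continuous].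
exact: norm_continuous.
Qed.

Lemma compact_normB (c : V) (r : R) : compact [set u : V | `|u - c| <= r].
Proof.
apply: bounded_closed_compact; last exact: closed_normB.
exists (`|c| + r); split; first exact: num_real.
move=> x xc u /= uc; apply: le_trans (ltW xc).
by rewrite -[u](subrK c) (le_trans (ler_normD _ _))// addrC lerD2l.
Qed.

(** Finitely many half-balls cover [K], and [sstep] of the sum of their bumps is 1 wherever one bump
    is 1. The value 1 is taken on a neighbourhood [O] of [K], so that derivatives on [K] do not
    notice the cutoff. *)
Lemma plateau (K U : set V) : compact K -> open U -> K `<=` U ->
 exists k : V -> R, exists2 K' : set V, compact K' /\ K' `<=` U &
 [/\ smc setT k, forall u, 0 <= k u <= 1, (forall u, k u != 0 -> K' u) &
  exists2 O, open O & K `<=` O /\ forall u, O u -> k u = 1].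
Proof.
move=> cK oU KU.
have Hr u : exists r : R, 0 < r /\ (K u -> [set v : V | `|v - u| <= r] `<=` U).
 have [Ku|nKu] := pselect (K u); last by exists 1.
 have /nbhs_ballP[e /= e0 He] : nbhs u U by apply: open_nbhs_nbhs; split => //; exact: KU.
 exists (e / 2); rewrite divr_gt0//; split=> // _ v /= vu; apply: He.
 by rewrite -ball_normE/= distrC (le_lt_trans vu)// ltr_pdivrMr// ltr_pMr// ltr1n.
have {Hr} [r Hr] := choice Hr.
have r0 u := (Hr u).1; pose B u := ball u (r u / 2).
have rh u : 0 < r u / 2 by rewrite divr_gt0.
have [D' D'K KD'] : finite_subset_cover K B K.
 move: cK; rewrite compact_cover; apply.
  by move=> u _; exact: ball_open.
 by move=> u Ku; exists u => //; exact: ballxx.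
have H (s : seq V) : (forall u, u \in s -> K u) -> exists S : V -> R, exists2 K' : set V,
  compact K' /\ K' `<=` U & [/\ smc setT S, forall u, 0 <= S u, (forall u, S u != 0 -> K' u) &
  forall c u, c \in s -> B c u -> 1 <= S u].
 elim: s => [_|c s IH cs].
  exists (fun=> 0), set0; first by split => //; exact: compact0.
  by split=> //; [exact: smc_cst|move=> u; rewrite eqxx].
 have [|S [K' [cK' K'U] [sS S0 SK S1]]] := IH.
  by move=> u us; apply: cs; rewrite inE us orbT.
 exists (fun u => box_bump c (r c) u + S u), ([set u : V | `|u - c| <= r c] `|` K').
  split; first by apply: compactU => //; exact: compact_normB.
  by rewrite subUset; split=> //; apply: (Hr c).2; apply: cs; rewrite inE eqxx.
 split.
 - by apply: smc_add => //; exact: smc_box_bump.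
 - by move=> u; rewrite addr_ge0// box_bump_ge0.
 - move=> u; have [b0|b0] := eqVneq (box_bump c (r c) u) 0.
   by rewrite b0 add0r => /SK; right.
  by move=> _; left; exact: box_bump_neq0.
 - move=> c' u; rewrite inE => /orP[/eqP ->|c's] Bu.
   rewrite box_bump1 ?lerDl//; move: Bu; rewrite /B -ball_normE/= distrC. exact: ltW.
  by rewrite (le_trans (S1 _ _ c's Bu))// lerDr box_bump_ge0.
have [|S [K' HK' [sS S0 SK S1]]] := H (finmap.enum_fset D').
 by move=> u /D'K; rewrite inE.
exists (fun u => sstep (S u)), K' => //; split.
- exact: smc_sstep.
- by move=> u; rewrite sstep_ge0 sstep_le1.
- move=> u s0; apply: SK; apply: contra s0 => /eqP ->; apply/eqP.
 exact: sstep0.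
- exists (\bigcup_(c in [set c | c \in finmap.enum_fset D']) B c); first by apply: bigcup_open => c _; exact: ball_open.
 split=> // u [c cD Bu]; apply: sstep1; exact: S1 Bu.
Qed.

End plateaus.

(** * Charts, smooth functions and partitions of unity *)

Section manifold.
Context (R : realType) (d : nat) (M : riemannian_manifold R d).
Notation V := 'rV[R]_d.
Implicit Types (i j : chart_index M) (t : M).

Definition chim i : set V := chart i @` source i.

Lemma M_hausdorff : hausdorff_space M. Proof. by case: M. Qed.
Lemma M_second_countable : @second_countable M. Proof. by case: M. Qed.
Lemma chart_atP t : source (chart_at t) t. Proof. by move: t; case: M. Qed.
Lemma source_open i : open (source i). Proof. by move: i; case: M. Qed.
Lemma chim_open i : open (chim i). Proof. by rewrite /chim; move: i; case: M. Qed.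
Lemma chartK i t : source i t -> chart_inv i (chart i t) = t.
Proof. by move: i t; case: M. Qed.
Lemma chart_continuous i t : source i t -> {for t, continuous (chart i)}.
Proof. by move: i t; case: M. Qed.
Lemma inv_continuous i u : chim i u -> {for u, continuous (chart_inv i)}.
Proof. by rewrite /chim; move: i u; case: M. Qed.
Lemma transition_smooth i j (c : 'I_d) :
 smooth_on (chart i @` (source i `&` source j)) (fun u => chart j (chart_inv i u) 0 c).
Proof. by move: i j c; case: M. Qed.
Lemma metric_smooth i (a b : 'I_d) : smooth_on (chim i) (fun u => metric i u a b).
Proof. by rewrite /chim; move: i a b; case: M. Qed.
Lemma metric_sym i u : chim i u -> (metric i u)^T = metric i u.
Proof. by rewrite /chim; move: i u; case: M. Qed.
Lemma metric_pos i u (v : V) : chim i u -> v != 0 -> 0 < (v *m metric i u *m v^T) 0 0.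
Proof. by rewrite /chim; move: i u v; case: M. Qed.
Lemma metric_transition i j u (a b : 'I_d) : (chart i @` (source i `&` source j)) u ->
 metric i u a b = \sum_(c < d) \sum_(e < d)
   pd a (fun v => chart j (chart_inv i v) 0 c) u *
   pd b (fun v => chart j (chart_inv i v) 0 e) u *
   metric j (chart j (chart_inv i u)) c e.
Proof. by move: i j u a b; case: M. Qed.

Lemma chim_source i u : chim i u -> source i (chart_inv i u).
Proof. by move=> [t st <-]; rewrite chartK. Qed.

Lemma invK i u : chim i u -> chart i (chart_inv i u) = u.
Proof. by move=> [t st <-]; rewrite chartK. Qed.

Lemma chart_imageE i (O : set M) : chart i @` (O `&` source i) = chim i `&` chart_inv i @^-1` O.
Proof.
apply/seteqP; split=> [u [t [Ot st] <-]|u [cu Ou]].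
 by split; [exists t|rewrite /= chartK].
by exists (chart_inv i u); [split => //; exact: chim_source|rewrite invK].
Qed.

Lemma chart_open i (O : set M) : open O -> open (chart i @` (O `&` source i)).
Proof.
move=> oO; rewrite chart_imageE openE => u [cu Ou].
apply: filterI; first by apply: open_nbhs_nbhs; split => //; exact: chim_open.
by apply: (inv_continuous cu); apply: open_nbhs_nbhs.
Qed.

Lemma smooth_on_local (f : V -> R) (W : set V) :
 (forall u, W u -> exists2 O, O u & smooth_on O f) -> smooth_on W f.
Proof. by move=> H s u Wu; have [ Q Qu sQ] := H u Wu; exact: sQ. Qed.

(** One chart around each point is enough, because any other chart differs from it by a smooth
    transition map. *)
Lemma smooth_local (f : M -> R) :
 (forall t, exists j, exists2 O : set M, open O /\ O t &
   O `<=` source j /\ smooth_on (chart j @` O) (fun u => f (chart_inv j u))) -> smooth f.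
Proof.
move=> H i; apply: smooth_on_local => u cu.
have [j [ O [oO Ou] [Oj sO]]] := H (chart_inv i u).
pose W := chart i @` (O `&` source i); exists W.
 by rewrite /W chart_imageE.
have oW : open W by exact: chart_open.
have WW : W `<=` chart i @` (source i `&` source j).
 by move=> _ [t [Ot st] <-]; exists t => //; split=> //; exact: Oj.
have oOj : open (chart j @` O).
 have -> : O = O `&` source j by apply/seteqP; split=> [x Ox|x []]//; split=> //; exact: Oj. exact: chart_open.
have S : smc W (fun u => (fun u => f (chart_inv j u)) (chart j (chart_inv i u))).
 apply: (smc_comp oOj _ _ sO).
  by move=> v [t [Ot st] <-]; rewrite chartK//.
 by move=> c; apply: smc_base; apply: (smooth_onS WW); exact: transition_smooth.
apply: (smcP oW); apply: (smc_ext S) => v [t [Ot st] <-].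
by rewrite chartK// chartK//; exact: Oj.
Qed.

Lemma smooth_continuous (f : M -> R) : smooth f -> continuous f.
Proof.
move=> sf t; have st := chart_atP t; set i := chart_at t in st *.
have ct : chim i (chart i t) by exists t.
have [cf _] := smooth_on_C1 (sf i) ct.
have H : {for t, continuous ((fun u => f (chart_inv i u)) \o chart i)}.
 by apply: continuous_comp => //; exact: chart_continuous.
change (f x @[x --> t] --> f t); rewrite -[X in _ --> f X](chartK st); apply: cvg_trans H.
apply: (@near_eq_cvg _ _ (nbhs t)); near=> s; rewrite /= chartK//.
by near: s; apply: open_nbhs_nbhs; split=> //; exact: source_open.
Unshelve. all: by end_near. Qed.

Lemma smooth_smc (f : M -> R) i : smooth f -> smc (chim i) (fun u => f (chart_inv i u)).
Proof. by move=> sf; apply: smc_base; exact: sf. Qed.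

Lemma smooth_cst (c : R) : smooth (fun _ : M => c).
Proof. by move=> i; apply: (smcP (@chim_open i)); exact: smc_cst. Qed.

Lemma smoothD (f g : M -> R) : smooth f -> smooth g -> smooth (fun t => f t + g t).
Proof.
by move=> sf sg i; apply: (smcP (@chim_open i)); apply: smc_add; exact: smooth_smc.
Qed.

Lemma smoothM (f g : M -> R) : smooth f -> smooth g -> smooth (fun t => f t * g t).
Proof.
by move=> sf sg i; apply: (smcP (@chim_open i)); apply: smc_mul; exact: smooth_smc.
Qed.

Lemma smoothZ (c : R) (f : M -> R) : smooth f -> smooth (fun t => c * f t).
Proof. move=> sf; apply: (smoothM _ sf); exact: smooth_cst. Qed.

Lemma smoothV (f : M -> R) : smooth f -> (forall t, f t != 0) -> smooth (fun t => (f t)^-1).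
Proof.
move=> sf f0 i; apply: (smcP (@chim_open i)).
by apply: (@smc_inv _ _ _ (fun u => f (chart_inv i u))) => //; exact: smooth_smc.
Qed.

Lemma smooth_sstep (f : M -> R) : smooth f -> smooth (fun t => sstep (f t)).
Proof.
move=> sf i; apply: (smcP (@chim_open i)).
by apply: (@smc_sstep _ _ _ (fun u => f (chart_inv i u))); exact: smooth_smc.
Qed.

Lemma smooth_sum (J : Type) (r : seq J) (F : J -> M -> R) : (forall k, smooth (F k)) ->
 smooth (fun t => \sum_(k <- r) F k t).
Proof.
move=> sF i; apply: (smcP (@chim_open i)).
by apply: (@smc_sum _ _ _ _ _ (fun k u => F k (chart_inv i u))) => k; exact: smooth_smc.
Qed.

Definition push i (w : V -> R) (t : M) : R :=
 if `[< source i t >] then w (chart i t) else 0.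

Lemma pushE i w t : source i t -> push i w t = w (chart i t).
Proof. by move=> st; rewrite /push asboolT. Qed.

Lemma push_inv i w u : chim i u -> push i w (chart_inv i u) = w u.
Proof. by move=> cu; rewrite pushE ?invK//; exact: chim_source. Qed.

Lemma inv_compact i (K : set V) : compact K -> K `<=` chim i -> compact (chart_inv i @` K).
Proof.
move=> cK Ki; apply: continuous_compact => //; apply: continuous_in_subspaceT => u.
by rewrite inE => /Ki; exact: inv_continuous.
Qed.

(** Outside the chart domain the extension by zero vanishes near each point: the image of [K] is
    compact, hence closed, as the manifold is Hausdorff. *)
Lemma smooth_push i (w : V -> R) (K : set V) : compact K -> K `<=` chim i ->
 (forall u, w u != 0 -> K u) -> smooth_on (chim i) w -> smooth (push i w).
Proof.
move=> cK Ki wK sw; apply: smooth_local => t.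
have [st|nst] := pselect (source i t).
 exists i, (source i); first by split=> //; exact: source_open. split; first exact.
 apply: (smcP (@chim_open i)); apply: (smc_ext (smc_base sw)) => u cu. by rewrite push_inv.
pose O := ~` (chart_inv i @` K) `&` source (chart_at t).
have oO : open O.
 apply: openI; last exact: source_open. apply: closed_openC; apply: compact_closed; first exact: M_hausdorff.
 exact: inv_compact.
exists (chart_at t), O.
 split=> //; split; last exact: chart_atP.
 by move=> [u Ku ut]; apply: nst; rewrite -ut; apply: chim_source; exact: Ki.
split; first by move=> x [].
have oO' : open (chart (chart_at t) @` O).
 have -> : O = O `&` source (chart_at t) by rewrite -setIA setIid. exact: chart_open.
apply: (smcP oO'); apply: (smc_ext (smc_cst _ 0)) => _ [x [nx sx] <-].
rewrite chartK//; rewrite /push; case: asboolP => // six; apply/eqP; rewrite eq_sym.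
apply/negPn/negP => /wK Kx; apply: nx; exists (chart i x) => //; exact: chartK.
Qed.

Hypothesis cM : compact [set: M].

(** The plateaus of a finite subcover have a sum of at least 1, by which they can be divided. The
    supports [K l] are recorded in coordinates, where the Euclidean estimates are applied. *)
Lemma partition_of_unity (O : M -> set M) : (forall t, open (O t) /\ O t t) ->
 exists (N : nat) (ci : 'I_N -> M) (chi : 'I_N -> M -> R) (K : 'I_N -> set V),
 [/\ forall l, compact (K l) /\ K l `<=` chart (chart_at (ci l)) @` (O (ci l) `&` source (chart_at (ci l))),
   forall l, smooth (chi l), forall l t, 0 <= chi l t <= 1,
   forall t, \sum_l chi l t = 1 &
   forall l t, chi l t != 0 -> source (chart_at (ci l)) t /\ K l (chart (chart_at (ci l)) t)].
Proof.
move=> HO.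
have P t : exists kK : (V -> R) * set V * set V,
  [/\ compact kK.1.2 /\ kK.1.2 `<=` chart (chart_at t) @` (O t `&` source (chart_at t)),
  smc setT kK.1.1, (forall u, 0 <= kK.1.1 u <= 1), (forall u, kK.1.1 u != 0 -> kK.1.2 u) &
  open kK.2 /\ kK.2 (chart (chart_at t) t) /\ forall u, kK.2 u -> kK.1.1 u = 1].
 have st := chart_atP t; have [oO Ot] := HO t.
 have sub : [set chart (chart_at t) t] `<=` chart (chart_at t) @` (O t `&` source (chart_at t)).
  by move=> _ ->; exists t.
 have [k [K' [cK' K'U] [sk k01 kK [Q oQ [KQ Q1]]]]] :=
  plateau (@compact_set1 _ (chart (chart_at t) t)) (chart_open (i := chart_at t) oO) sub.
 by exists (k, K', Q); split=> //; split=> //; split=> //; exact: KQ.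
have {P}[kK HK] := choice P.
pose B t := source (chart_at t) `&` chart (chart_at t) @^-1` (kK t).2.
have oB t : open (B t).
 have [_ _ _ _ [oQ _]] := HK t. rewrite openE => s [ss Qs]; apply: filterI.
  by apply: open_nbhs_nbhs; split=> //; exact: source_open.
 by apply: (chart_continuous ss); exact: open_nbhs_nbhs.
have [D _ HD] : finite_subset_cover [set: M] B [set: M].
 move: cM; rewrite compact_cover; apply; first by move=> t _.
 by move=> t _; exists t => //; split; [exact: chart_atP|have [_ _ _ _ [_ []]] := HK t].
pose s : seq M := finmap.enum_fset D; pose N := size s; pose ci (l : 'I_N) := nth point s l.
pose ka l := push (chart_at (ci l)) (kK (ci l)).1.1.
have ska l : smooth (ka l).
 have [[cK KU] sk _ kKK _] := HK (ci l).
 apply: (smooth_push cK _ kKK); first by move=> u /KU[x [_ sx] <-]; exists x.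
 by apply: (smooth_onS _ (smcP (@openT _) sk)).
have ka01 l t : 0 <= ka l t <= 1.
 by rewrite /ka /push; case: asboolP => _; [have [_ _ ->] := HK (ci l)|rewrite lexx ler01].
pose S t := \sum_l ka l t.
have S1 t : 1 <= S t.
 have [c cD [sc Qc]] := HD t Logic.I. have ls : (index c s < N)%N by rewrite index_mem.
 have E : ci (Ordinal ls) = c by rewrite /ci nth_index. rewrite /S (bigD1 (Ordinal ls))//= (_ : ka _ t = 1).
  by rewrite lerDl sumr_ge0// => l _; have /andP[] := ka01 l t.
 by rewrite /ka E pushE//; have [_ _ _ _ [_ [_ ->]]] := HK c.
have S0 t : S t != 0 by rewrite gt_eqF// (lt_le_trans ltr01).
exists N, ci, (fun l t => ka l t / S t), (fun l => (kK (ci l)).1.2); split.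
- by move=> l; have [] := HK (ci l).
- by move=> l; apply: smoothM => //; apply: smoothV => //; exact: smooth_sum.
- move=> l t; have /andP[k0 k1] := ka01 l t.
 have Sp : 0 < S t by rewrite (lt_le_trans ltr01). apply/andP; split; first by rewrite divr_ge0// ltW.
 by rewrite ler_pdivrMr// mul1r (le_trans k1).
- by move=> t; rewrite -mulr_suml -/(S t) divff.
- move=> l t; rewrite mulf_eq0 negb_or => /andP[+ _]; rewrite /ka /push.
 case: asboolP => [st k0|_]; last by rewrite eqxx. by split=> //; have [_ _ _ kk _] := HK (ci l); exact: kk.
Qed.

End manifold.

Section sealed.
Context (R : realType) (d : nat) (M : riemannian_manifold R d).
Implicit Types (i : chart_index M) (f g : M -> R).

(* A copy of [smooth] which conversion does not unfold. *)
Variant sm f : Prop := Sm of smooth f.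

Lemma smE f : sm f -> smooth f. Proof. by case. Qed.
Lemma sm_continuous f : sm f -> continuous f. Proof. case; exact: smooth_continuous. Qed.
Lemma sm_smc f i : sm f -> smc (chim i) (fun u => f (chart_inv i u)).
Proof. case; exact: smooth_smc. Qed.
Lemma sm_cst c : sm (fun=> c). Proof. exact: (Sm (smooth_cst c)). Qed.
Lemma smD f g : sm f -> sm g -> sm (fun t => f t + g t).
Proof. case=> sf [sg]; exact: (Sm (smoothD sf sg)). Qed.
Lemma smM f g : sm f -> sm g -> sm (fun t => f t * g t).
Proof. case=> sf [sg]; exact: (Sm (smoothM sf sg)). Qed.
Lemma smZ c f : sm f -> sm (fun t => c * f t).
Proof. case=> sf; exact: (Sm (smoothZ c sf)). Qed.
Lemma sm_sstep f : sm f -> sm (fun t => sstep (f t)).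
Proof. case=> sf; exact: (Sm (smooth_sstep sf)). Qed.
Lemma sm_sum (J : Type) (r : seq J) (F : J -> M -> R) : (forall k, sm (F k)) ->
 sm (fun t => \sum_(k <- r) F k t).
Proof. move=> sF; exact: (Sm (smooth_sum r (fun k => smE (sF k)))). Qed.
Lemma sm_push i (w : 'rV[R]_d -> R) (K : set 'rV[R]_d) : compact K -> K `<=` chim i ->
 (forall u, w u != 0 -> K u) -> smooth_on (chim i) w -> sm (push i w).
Proof. move=> h1 h2 h3 h4; exact: (Sm (smooth_push h1 h2 h3 h4)). Qed.
Lemma sm_charts (F : M -> R) (H : chart_index M -> 'rV[R]_d -> R) :
 (forall i, smc (chim i) (H i)) -> (forall i t, source i t -> F t = H i (chart i t)) -> sm F.
Proof.
move=> sH FH; apply: Sm => i; apply: smcP; first exact: chim_open.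
apply: (smc_ext (sH i)) => u cu; rewrite (FH i) ?invK//; exact: chim_source.
Qed.

End sealed.

(** * Positive definite matrices *)

Section posdef.
Context (R : realType) (n : nat).

Definition posdef (G : 'M[R]_n) := forall v : 'rV[R]_n, v != 0 -> 0 < (v *m G *m v^T) 0 0.

Lemma dotv_gt0 (v : 'rV[R]_n) : v != 0 -> 0 < (v *m v^T) 0 0.
Proof.
move=> v0; rewrite mxE lt_def; apply/andP; split; last first.
 by apply: sumr_ge0 => j _; rewrite mxE sqr_ge0.
apply: contra v0 => /eqP E; apply/eqP/rowP => j; rewrite mxE.
have := E; rewrite (bigD1 j)//= => /eqP; rewrite paddr_eq0; last 2 first.
 - by rewrite mxE sqr_ge0.
 - by apply: sumr_ge0 => k _; rewrite mxE sqr_ge0.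
by rewrite mxE sqrf_eq0 => /andP[/eqP].
Qed.

Lemma posdef_det_neq0 G : posdef G -> \det G != 0.
Proof.
move=> pG; apply/negP => /det0P[v v0 vG].
by have := pG v v0; rewrite vG mul0mx mxE ltxx.
Qed.

(* The determinant does not vanish along the segment from the identity. *)
Lemma posdef_det_gt0 G : posdef G -> 0 < \det G.
Proof.
move=> pG.
pose p : {poly R} := \det (map_mx polyC 1%:M + 'X *: map_mx polyC (G - 1%:M)).
have pE s : p.[s] = \det (1%:M + s *: (G - 1%:M)).
 rewrite -horner_evalE -det_map_mx; congr (\det _); apply/matrixP => i j. by rewrite !mxE /= horner_evalE !hornerE.
have p0 : p.[0] = 1 by rewrite pE scale0r addr0 det1.
have p1 : p.[1] = \det G by rewrite pE scale1r addrCA subrr addr0.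
have ps s : 0 <= s <= 1 -> p.[s] != 0.
 move=> /andP[s0 s1]; rewrite pE; apply: posdef_det_neq0 => v v0.
 have -> : 1%:M + s *: (G - 1%:M) = (1 - s) *: 1%:M + s *: G.
  by rewrite scalerBl scalerBr scale1r addrA addrAC.
 have -> : (v *m ((1 - s) *: 1%:M + s *: G) *m v^T) 0 0 = (1 - s) * (v *m v^T) 0 0 + s * (v *m G *m v^T) 0 0.
  by rewrite mulmxDr mulmxDl -!scalemxAr -!scalemxAl mulmx1 [LHS]mxE; congr (_ + _); rewrite [LHS]mxE.
 have a0 := dotv_gt0 v0; have b0 := pG v v0. have [->|sn0] := eqVneq s 0; first by rewrite mul0r addr0 subr0 mul1r.
 by apply: ltr_wpDl; [rewrite mulr_ge0 ?subr_ge0// ltW|rewrite mulr_gt0// lt_def sn0].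
have := ps 1; rewrite lexx ler01 => /(_ isT); rewrite p1 => Gn0.
rewrite lt_def Gn0 /= leNgt; apply/negP => G0.
have [|x] := @Num.Theory.poly_ivt R (- p) 0 1 ler01.
 by rewrite !hornerN p0 p1 oppr_le0 oppr_ge0 ler01 ltW.
move=> x01; rewrite rootN => /eqP; apply/eqP; exact: ps.
Qed.

Lemma posdef_unit G : posdef G -> G \in unitmx.
Proof. by move=> pG; rewrite unitmxE unitfE posdef_det_neq0. Qed.

(** With w = v G^-1 the form v G^-1 v^T is w G w^T. *)
Lemma posdef_inv G : posdef G -> G^T = G -> posdef (invmx G).
Proof.
move=> pG sG v v0; have uG := posdef_unit pG.
have w0 : v *m invmx G != 0.
 by apply: contra v0 => /eqP E; rewrite -[v](mulmxKV uG) E mul0mx.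
have := pG _ w0; rewrite mulmxKV// trmx_mul trmx_inv sG mulmxA.
by [].
Qed.

End posdef.

(** * Riemannian integrals in charts *)

Section chart_integral.
Import HBNNSimple.
Context (R : realType) (d : nat) (M : riemannian_manifold R d).
Local Notation BM := (borel M).
Notation V := 'rV[R]_d.
Local Notation BV := (borel V).
Implicit Types (i j : chart_index M).

Definition rho i (u : V) : R := Num.sqrt (\det (metric i u)).

Lemma metric_posdef i u : chim i u -> posdef (metric i u).
Proof. by move=> cu v v0; exact: metric_pos. Qed.

Lemma smc_det m (W : set V) (A : V -> 'M[R]_m) : (forall a b, smc W (fun u => A u a b)) ->
 smc W (fun u => \det (A u)).
Proof.
move=> sA; apply: smc_sum => s.
by apply: smc_mul; [exact: smc_cst|apply: smc_prod => a; exact: sA].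
Qed.

Lemma rho_gt0 i u : chim i u -> 0 < rho i u.
Proof. by move=> cu; rewrite sqrtr_gt0; apply: posdef_det_gt0; exact: metric_posdef. Qed.

Lemma smc_metric i a b : smc (chim i) (fun u => metric i u a b).
Proof. by apply: smc_base; exact: metric_smooth. Qed.

Lemma smc_rho i : smc (chim i) (rho i).
Proof.
apply: smc_sqrt; first by apply: smc_det => a b; exact: smc_metric.
by move=> u cu; apply: posdef_det_gt0; exact: metric_posdef.
Qed.

(** Cramer's rule: the cofactors are polynomials in the entries, and the determinant does not
    vanish. *)
Lemma smc_invmetric i a b : smc (chim i) (fun u => invmx (metric i u) a b).
Proof.
have S : smc (chim i) (fun u => (\det (metric i u))^-1 * (\adj (metric i u)) a b).
 apply: smc_mul.
  apply: smc_inv; first by apply: smc_det => *; exact: smc_metric.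
  by move=> u cu; apply: posdef_det_neq0; exact: metric_posdef.
 have S : smc (chim i) (fun u => (-1) ^+ (b + a) * \det (row' b (col' a (metric i u)))).
  apply: smc_mul; first exact: smc_cst.
  by apply: smc_det => x y; apply: (smc_ext (smc_metric i (lift b x) (lift a y))) => u _; rewrite !mxE.
 by apply: (smc_ext S) => u _; rewrite mxE.
apply: (smc_ext S) => u cu; rewrite /invmx posdef_unit ?mxE//; exact: metric_posdef.
Qed.

Lemma smc_continuous_on (W : set V) f : open W -> smc W f -> forall u, W u -> {for u, continuous f}.
Proof. by move=> oW sf u Wu; have [] := smooth_on_C1 (smcP oW sf) Wu. Qed.

Lemma meas_smc (W : set V) f : open W -> smc W f ->
 measurable_fun (W : set BV) f.
Proof.
by move=> oW sf; apply: (@meas_continuous_on _ V) => // u; exact: smc_continuous_on.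
Qed.

Lemma meas_inv i : measurable_fun (chim i : set BV) (chart_inv i : BV -> BM).
Proof.
apply: (@measurability _ _ _ BM _ _ (@open M) erefl) => _ [U oU <-].
suff o : open (chim i `&` chart_inv i @^-1` U) by exact: borel_open.
by rewrite -chart_imageE; exact: chart_open.
Qed.

Lemma meas_chim i : measurable (chim i : set BV).
Proof. exact: (borel_open (@chim_open _ _ M i)). Qed.

Lemma meas_source i : measurable (source i : set BM).
Proof. exact: (borel_open (@source_open _ _ M i)). Qed.

Variables (mu : {measure set BM -> \bar R}) (lam : {measure set BV -> \bar R}).
Hypothesis Hl : is_lebesgue lam.
Hypothesis Hmu : density mu lam.

(** The Lebesgue density that represents f dmu in chart [i], set to 0 off the chart. *)
Definition pull i (f : M -> R) (u : V) : R :=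
 if `[< chim i u >] then f (chart_inv i u) * rho i u else 0.

Lemma meas_comp_inv i (f : BM -> R) : mfun f ->
 measurable_fun (chim i : set BV) (fun u : BV => f (chart_inv i u)).
Proof.
move=> mf; apply: (measurable_comp (F := [set: BM])) => //; exact: meas_inv.
Qed.

Lemma meas_pull i (f : BM -> R) : mfun f ->
 mfun (pull i f : BV -> R).
Proof.
move=> mf; have -> : pull i f = (fun u => f (chart_inv i u) * rho i u) \_ (chim i).
 apply/funext => u; rewrite /pull patchE; case: asboolP => cu; first by rewrite mem_set. by rewrite memNset.
apply/(measurable_restrictT _ (meas_chim i)).
apply: measurable_funM; first exact: meas_comp_inv.
by apply: meas_smc; [exact: chim_open|exact: smc_rho].
Qed.

Lemma pull_ge0 i (f : M -> R) u : (forall t, 0 <= f t) -> 0 <= pull i f u.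
Proof. by move=> f0; rewrite /pull; case: ifP => // _; rewrite mulr_ge0// sqrtr_ge0. Qed.

Lemma integral_pull_indic i (A : set BM) : measurable A ->
 (\int[mu]_(t in source i) (\1_A t)%:E = \int[lam]_u (pull i \1_A u)%:E)%E.
Proof.
move=> mA; rewrite integral_indic//; last exact: meas_source.
rewrite setIC (@Hmu i _ (measurableI _ _ (meas_source i) mA)); last by move=> t [].
rewrite setIC chart_imageE integral_mkcond; apply: eq_integral => u _; rewrite patchE /pull.
case: asboolP => cu; last by rewrite memNset// => -[].
rewrite indicE; case: ifPn => [|].
 by rewrite inE => -[_ Au]; rewrite mem_set// mul1r.
rewrite notin_setE => nA; rewrite memNset ?mul0r// => Au; exact: nA.
Qed.

Lemma integral_pull_nnsfun i (f : {nnsfun BM >-> R}) :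
 (\int[mu]_(t in source i) (f t)%:E = \int[lam]_u (pull i f u)%:E)%E.
Proof.
have mpi (A : set BM) : measurable A -> mfun (fun u : BV => (pull i \1_A u)%:E).
 by move=> mA; apply/measurable_EFinP; apply: meas_pull.
under eq_integral do rewrite fimfunE -fsumEFin//.
rewrite ge0_integral_fsum//; last 3 first.
- exact: meas_source.
- by move=> r; apply/measurable_EFinP; apply: measurable_funM.
- by move=> r t _; exact: nnfun_muleindic_ge0.
transitivity (\sum_(r \in range f) \int[lam]_u (r%:E * (pull i \1_(f @^-1` [set r]) u)%:E))%E; last first.
 rewrite -ge0_integral_fsum//.
 - apply: eq_integral => u _; rewrite /pull; case: asboolP => cu.
   rewrite [in RHS]fimfunE mulr_fsuml//. rewrite -fsumEFin//; apply: eq_fsbigr => r _; rewrite -EFinM mulrA//.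
  by rewrite fsbig1// => r _; rewrite mule0.
 - by move=> r; apply: measurable_funeM; exact: mpi.
 (* For negative [r] the level set of the nonnegative simple function is empty. *)
 - move=> r u _; have [r0|r0] := leP 0 r.
   by rewrite mule_ge0// lee_fin pull_ge0.
  by rewrite preimage_nnfun0// /pull indicE in_set0 mul0r; case: ifP => _; rewrite mule0.
apply: eq_fsbigr => r; rewrite inE => -[t _ <-].
under eq_integral do rewrite EFinM.
rewrite ge0_integralZl//; last first.
- by rewrite lee_fin.
- by apply/measurable_EFinP.
- exact: meas_source.
- rewrite integral_pull_indic// ge0_integralZl//; first exact: mpi.
 by move=> u _; rewrite lee_fin pull_ge0.
- by rewrite lee_fin.
Qed.

(** The usual extension of [density] from indicators to simple functions and then, by monotone
    convergence on both sides, to nonnegative functions. *)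
Lemma ge0_integral_pull i (f : BM -> R) : mfun f ->
 (forall t, 0 <= f t) -> (forall t, ~ source i t -> f t = 0) ->
 (\int[mu]_t (f t)%:E = \int[lam]_u (pull i f u)%:E)%E.
Proof.
move=> mf f0 fs.
have -> : (\int[mu]_t (f t)%:E = \int[mu]_(t in source i) (f t)%:E)%E.
 rewrite [RHS]integral_mkcond; apply: eq_integral => t _; rewrite patchE.
 by case: ifPn => //; rewrite notin_setE => /fs ->.
have mfE : mfun (EFin \o f) by exact/measurable_EFinP.
pose g := nnsfun_approx measurableT mfE.
have gf t : (g n t)%:E @[n --> \oo] --> (f t)%:E.
 by apply: (cvg_nnsfun_approx measurableT mfE) => // x _; rewrite lee_fin.
have gnd t : {homo (fun n => g n t) : n m / (n <= m)%N >-> n <= m}.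
 by move=> n m nm; exact/lefP/nd_nnsfun_approx.
have L : (\int[mu]_(t in source i) (g n t)%:E @[n --> \oo] --> \int[mu]_(t in source i) (f t)%:E)%E.
 rewrite (_ : \int[mu]_(t in source i) (f t)%:E = \int[mu]_(t in source i) limn (fun n => (g n t)%:E))%E.
  apply: cvg_monotone_convergence; first exact: meas_source.
  - by move=> n; apply: measurable_funTS; exact/measurable_EFinP.
  - by move=> n t _; rewrite lee_fin.
  - by move=> t _ n m nm; exact: gnd.
 by apply: eq_integral => t _; apply/esym/cvg_lim.
have pg u : (pull i (g n) u)%:E @[n --> \oo] --> (pull i f u)%:E.
 rewrite /pull; case: asboolP => cu; last exact: cvg_cst. under eq_fun do rewrite EFinM.
 rewrite EFinM; apply: cvgeM; [by []|exact: gf|exact: cvg_cst].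
have L' : (\int[lam]_u (pull i (g n) u)%:E @[n --> \oo] --> \int[lam]_u (pull i f u)%:E)%E.
 rewrite (_ : \int[lam]_u (pull i f u)%:E = \int[lam]_u limn (fun n => (pull i (g n) u)%:E))%E.
  apply: cvg_monotone_convergence => //.
  - by move=> n; apply/measurable_EFinP; exact: meas_pull.
  - by move=> n u _; rewrite lee_fin pull_ge0.
  - move=> u _ n m nm; rewrite lee_fin /pull; case: ifP => // _.
   by rewrite ler_wpM2r ?sqrtr_ge0//; exact: gnd.
 by apply: eq_integral => u _; apply/esym/cvg_lim.
move: L; under eq_fun do rewrite integral_pull_nnsfun.
by move=> L; apply: (cvg_unique _ L L').
Qed.

(** Split into the positive and negative parts (|f| + f)/2 and (|f| - f)/2, both dominated by
    |f|. *)
Lemma integ_pull i (f : BM -> R) : (forall t, ~ source i t -> f t = 0) ->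
 integ mu f -> integ lam (pull i f : BV -> R) /\ I mu f = I lam (pull i f : BV -> R).
Proof.
move=> fs fi; have mf := integ_meas fi.
have aux (g : BM -> R) : mfun g -> (forall t, 0 <= g t <= `|f t|) ->
  integ lam (pull i g : BV -> R) /\ I mu g = I lam (pull i g : BV -> R).
 move=> mg gf; have g0 t : 0 <= g t by have /andP[] := gf t. have gs t : ~ source i t -> g t = 0.
  by move=> /fs ft; apply/eqP; rewrite eq_le g0 andbT -(normr0 R) -ft; have /andP[] := gf t.
 have gi : integ mu g.
  by apply: (integ_le mg _ (integ_abs fi)) => t; rewrite ger0_norm//; have /andP[] := gf t.
 have E := ge0_integral_pull mg g0 gs. split; last by rewrite !IU /Rintegral E.
 apply: ge0_integP; [exact: meas_pull|by move=> u; exact: pull_ge0|]. by rewrite -E; exact: integrable_lty.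
pose fp t := (`|f t| + f t) / 2; pose fm t := (`|f t| - f t) / 2.
have [ip Ep] : integ lam (pull i fp : BV -> R) /\ I mu fp = I lam (pull i fp : BV -> R).
 apply: aux => [|t].
  by apply: measurable_funM => //; apply: measurable_funD => //; exact: measurableT_comp.
 by rewrite /fp; have := ler_norm (f t); have := ler_norm (- f t); rewrite normrN; lra.
have [im Em] : integ lam (pull i fm : BV -> R) /\ I mu fm = I lam (pull i fm : BV -> R).
 apply: aux => [|t].
  by apply: measurable_funM => //; apply: measurable_funB => //; exact: measurableT_comp.
 by rewrite /fm; have := ler_norm (f t); have := ler_norm (- f t); rewrite normrN; lra.
have fE t : f t = fp t - fm t by rewrite /fp /fm; field.
have pE u : pull i f u = pull i fp u - pull i fm u.
 by rewrite /pull; case: ifP => _; [rewrite fE; ring|rewrite subr0].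
have -> : (pull i f : BV -> R) = (fun u => pull i fp u - pull i fm u) by apply/funext.
split; first exact: integB.
rewrite IB// -Ep -Em -IB; [exact: I_eq| |].
 apply: (eq_integ (f := fun t => 2^-1 * (`|f t| + f t))); first by move=> t; rewrite mulrC.
 by apply: integZ; apply: integD => //; exact: integ_abs.
apply: (eq_integ (f := fun t => 2^-1 * (`|f t| - f t))); first by move=> t; rewrite mulrC.
by apply: integZ; apply: integB => //; exact: integ_abs.
Qed.

End chart_integral.

Section dct.
Context d (T : measurableType d) (R : realType) (mu : {measure set T -> \bar R}).

Lemma I_dct (f_ : nat -> T -> R) (f g : T -> R) : integ mu g ->
 (forall n, mfun (f_ n)) -> (forall n x, `|f_ n x| <= g x) ->
 (forall x, f_ ^~ x @ \oo --> f x) -> integ mu f /\ I mu (f_ n) @[n --> \oo] --> I mu f.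
Proof.
move=> ig mf fg ff.
have mF : mfun f by apply: (measurable_fun_cvg mf) => x _.
have Hff : {ae mu, forall x, [set: T] x -> (fun n => (f_ n x)%:E) @ \oo --> (f x)%:E}.
 by apply: aeW => x _; apply/fine_cvgP; split; [exact: nearW|exact: ff].
have Hfg : {ae mu, forall x n, [set: T] x -> (`|(f_ n x)%:E| <= (g x)%:E)%E}.
 by apply: aeW => x n _; exact: fg.
have mE (h : T -> R) : mfun h -> mfun (EFin \o h).
 by move=> mh; exact/measurable_EFinP.
have [i1 i2 i3] := dominated_convergence measurableT (fun n => mE _ (mf n)) (mE _ mF) Hff ig Hfg.
split=> //.
have fi n : integ mu (f_ n) by apply: (integ_le (mf n) _ ig).
have L : (I mu (f_ n))%:E @[n --> \oo] --> (I mu f)%:E.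
 by rewrite (I_EFin i1); under eq_fun do rewrite (I_EFin (fi _)).
by move/fine_cvgP: L => [].
Qed.

End dct.

(** * Difference quotients and integration by parts on Euclidean space *)

Section euclid.
Context (R : realType) (n : nat).
Notation V := 'rV[R]_n.
Local Notation BV := (borel V).
Implicit Types (w f g : V -> R) (K : set V).

Definition csm K w := smc setT w /\ forall u, ~ K u -> w u = 0.
Definition Dh (h : V) w (u : V) : R := \sum_a h 0 a * pd a w u.

Lemma smcT_on w : smc setT w -> smooth_on setT w.
Proof. by move=> sw; apply: smcP => //; exact: openT. Qed.

Lemma smc_pd a w : smc setT w -> smc setT (pd a w).
Proof. by move=> /smcT_on sw; apply: smc_base; exact: smooth_on_pd. Qed.

Lemma smc_Dh h w : smc setT w -> smc setT (Dh h w).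
Proof. by move=> sw; apply: smc_sum => a; apply: smc_mul; [exact: smc_cst|exact: smc_pd]. Qed.

Lemma smcT_diff w u : smc setT w -> differentiable w u.
Proof. by move=> /smcT_on sw; exact: (smooth_on_diff openT (Logic.I : setT u) sw). Qed.

Lemma smcT_continuous w : smc setT w -> continuous w.
Proof. by move=> sw u; have [] := smooth_on_C1 (smcT_on sw) (Logic.I : setT u). Qed.

Lemma Dh_line w (u h : V) (t : R) : smc setT w ->
 is_derive t 1 (fun s => w (u + s *: h)) (Dh h w (u + t *: h)).
Proof.
move=> sw; have dw := smcT_diff (u + t *: h) sw.
have := @is_derive_line R n w u h t (@diff_derivable _ _ _ _ _ h dw).
by rewrite deriveE// diff_pd.
Qed.

Lemma MVTh w (u h : V) (s : R) : smc setT w ->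
 exists2 xi, `|xi| <= `|s| & w (u + s *: h) - w u = Dh h w (u + xi *: h) * s.
Proof.
move=> sw.
have [xi x1] := @MVT0 R (fun s => w (u + s *: h)) (fun t => Dh h w (u + t *: h)) s (fun t _ => Dh_line u h t sw).
by rewrite scale0r addr0 => E; exists xi.
Qed.

Lemma pd_eq0 K a w u : closed K -> (forall v, ~ K v -> w v = 0) -> ~ K u -> pd a w u = 0.
Proof.
move=> cK w0 nK.
rewrite (@pd_eq R n (~` K) w (fun=> 0) u a (closed_openC cK) nK w0).
by rewrite /partial derive_cst.
Qed.

Lemma csm_pd K a w : closed K -> csm K w -> csm K (pd a w).
Proof. by move=> cK [sw w0]; split; [exact: smc_pd|move=> u; exact: pd_eq0]. Qed.

Lemma csmM K f w : smc setT f -> csm K w -> csm K (fun u => f u * w u).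
Proof. by move=> sf [sw w0]; split; [exact: smc_mul|move=> u /w0 ->; rewrite mulr0]. Qed.

Lemma csmD K f w : csm K f -> csm K w -> csm K (fun u => f u + w u).
Proof. by move=> [sf f0] [sw w0]; split; [exact: smc_add|move=> u nK; rewrite f0// w0// addr0]. Qed.

Lemma csmS K K' w : K `<=` K' -> csm K w -> csm K' w.
Proof. by move=> KK [sw w0]; split=> // u nK; apply: w0 => /KK. Qed.

Lemma csm_Dh K h w : closed K -> csm K w -> csm K (Dh h w).
Proof.
move=> cK sw; split; first by apply: smc_Dh; case: sw.
by move=> u nK; rewrite /Dh big1// => a _; rewrite (csm_pd a cK sw).2// mulr0.
Qed.

Lemma csm_bounded K w : compact K -> csm K w -> exists2 B, 0 <= B & forall u, `|w u| <= B.
Proof.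
move=> cK [sw w0].
have cwK : compact (w @` K).
 by apply: continuous_compact => //; apply: continuous_subspaceT; exact: smcT_continuous.
have [r [_ Hr]] := compact_bounded cwK.
exists (Num.max 0 (r + 1)); first by rewrite le_max lexx.
move=> u; have [Ku|/w0 ->] := pselect (K u); last by rewrite normr0 le_max lexx.
by rewrite le_max (Hr (r + 1)) ?orbT ?ltrDl//.
Qed.

Lemma compact_norm K : compact K -> exists2 r, 0 <= r & forall u, K u -> `|u| <= r.
Proof.
move=> cK; have [r [_ Hr]] := compact_bounded cK.
exists (Num.max 0 (r + 1)); first by rewrite le_max lexx.
by move=> u Ku; rewrite le_max (Hr (r + 1)) ?orbT ?ltrDl.
Qed.

Variable (lam : {measure set BV -> \bar R}).
Hypothesis Hl : is_lebesgue lam.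

Lemma cube_integ k (B : R) : integ lam (fun u => B * \1_(cube k : set BV) u).
Proof.
apply: integZ; apply: ge0_integP => //.
- by apply: measurable_indic; exact: meas_box.
- rewrite integral_indic//; last exact: meas_box.
 by rewrite setIT; exact: lam_cube_fin.
Qed.

Lemma bounded_support_integ K (B : R) (f : BV -> R) : compact K ->
 mfun f -> (forall u, `|f u| <= B) ->
 (forall u, ~ K u -> f u = 0) -> integ lam f.
Proof.
move=> cK mf fB f0; have [r _ Kr] := compact_norm cK.
have [k Kk] := lam_compact_bounded Kr.
apply: (integ_le mf _ (cube_integ k B)) => u; rewrite indicE.
case: (boolP (u \in cube k)) => uk; first by rewrite mulr1.
by rewrite f0 ?normr0 ?mulr0// => /Kk; move: uk; rewrite notin_setE.
Qed.

Lemma meas_smcT w : smc setT w -> mfun (w : BV -> R).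
Proof. by move=> sw; apply: meas_continuous; exact: smcT_continuous. Qed.

Lemma csm_integ K w : compact K -> csm K w -> integ lam (w : BV -> R).
Proof.
move=> cK sw; have [B _ wB] := csm_bounded cK sw.
by apply: (bounded_support_integ cK _ wB sw.2); apply: meas_smcT; case: sw.
Qed.

Lemma csm_sqint K w : compact K -> csm K w -> sqint lam (w : BV -> R).
Proof.
move=> cK sw; split; first by apply: meas_smcT; case: sw.
apply: (eq_integ (f := fun u : BV => w u * w u)); first by move=> u.
by apply: (csm_integ cK); apply: csmM => //; case: sw.
Qed.

Definition dq (h : V) (w : V -> R) (m : nat) (u : BV) : R :=
 m.+1%:R * (w ((u : V) + m.+1%:R^-1 *: h) - w u).

Lemma meas_dq h w m : smc setT w -> mfun (dq h w m).
Proof.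
move=> sw; apply: measurable_funM => //; apply: measurable_funB; last exact: meas_smcT.
by apply: meas_comp_shift; exact: meas_smcT.
Qed.

Lemma dq_cvg h w u : smc setT w -> dq h w m u @[m --> \oo] --> Dh h w u.
Proof.
move=> sw.
have E m : exists2 xi, `|xi| <= m.+1%:R^-1 & dq h w m u = Dh h w (u + xi *: h).
 have [xi x1 E] := MVTh u h m.+1%:R^-1 sw; exists xi.
  by rewrite (le_trans x1)// ger0_norm//.
 by rewrite /dq E mulrCA mulfV ?mulr1//.
pose xi m := projT1 (cid2 (E m)).
have xi1 m : `|xi m| <= m.+1%:R^-1 by rewrite /xi; case: cid2.
have -> : dq h w ^~ u = (fun m => Dh h w (u + xi m *: h)).
 by apply/funext => m; rewrite /xi; case: cid2.
have xi0 : xi m @[m --> \oo] --> (0 : R).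
 apply: (squeeze_cvgr (f := fun m => - m.+1%:R^-1) (h := fun m => m.+1%:R^-1)).
 - by apply: nearW => m; rewrite -ler_norml.
 - by rewrite -oppr0; apply: cvgN; exact: cvg_harmonic.
 - exact: cvg_harmonic.
have L : u + xi m *: h @[m --> \oo] --> u.
 rewrite -[X in _ --> X]addr0; apply: cvgD; first exact: cvg_cst. by rewrite -(scale0r h); apply: cvgZr_tmp.
exact: (cvg_comp _ _ L (smcT_continuous (smc_Dh h sw) (x := u))).
Qed.

(** Uniform in [m]: the mean value theorem bounds the quotient, and its support stays within
    distance |h| of [K]. *)
Lemma dq_dominated h w K : compact K -> csm K w ->
 exists2 B, 0 <= B & exists k, forall m u, `|dq h w m u| <= B * \1_(cube k : set BV) u.
Proof.
move=> cK sw; have kK := closed_rV cK.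
have [B B0 wB] := csm_bounded cK (csm_Dh h kK sw).
have [r r0 Kr] := compact_norm cK.
have [k Kk] := lam_compact_bounded (fun u (H : [set u : V | `|u| <= r + `|h|] u) => H).
exists B => //; exists k => m u; rewrite indicE; case: (boolP (u \in _)) => uk.
 rewrite /dq; have [xi x1 ->] := MVTh u h m.+1%:R^-1 sw.1. by rewrite mulrCA mulfV ?mulr1//.
have nu : r + `|h| < `|u|.
 by rewrite ltNge; apply/negP => ur; move: uk; rewrite notin_setE; apply; exact: Kk.
rewrite /dq (sw.2 u) ?sw.2 ?subr0 ?mulr0 ?normr0//.
 move=> /Kr; apply/negP; rewrite -ltNge. have : `|u| <= `|u + m.+1%:R^-1 *: h| + `|m.+1%:R^-1 *: h|.
  by rewrite -[X in `|X| <= _](addrK (m.+1%:R^-1 *: h)); exact: ler_normB.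
 have : `|m.+1%:R^-1 *: h| <= `|h|.
  rewrite normrZ ger0_norm// ler_piMl// invf_le1// ler1n//.
 by move=> a b; rewrite -(ltrD2r `|h|) (lt_le_trans nu)// (le_trans b)// lerD2l.
by move=> /Kr; apply/negP; rewrite -ltNge (le_lt_trans _ nu)// lerDl.
Qed.

(** Each difference quotient has integral 0 by translation invariance; dominated convergence passes
    to the derivative. *)
Lemma I_Dh h w K : compact K -> csm K w -> I lam (Dh h w : BV -> R) = 0.
Proof.
move=> cK sw; have [B B0 [k dB]] := dq_dominated h cK sw.
have [_ L] := I_dct (cube_integ k B) (fun m => meas_dq h m sw.1) dB (fun u => @dq_cvg h w u sw.1).
have wi := csm_integ cK sw.
have E m : I lam (dq h w m) = 0.
 rewrite IZ; last by apply: integB => //; exact: integ_shift.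
 by rewrite IB//; [rewrite !IU (Rintegral_shift Hl)// subrr mulr0|exact: integ_shift].
move: L; under eq_fun do rewrite E.
by move=> L; apply/esym; apply: (cvg_unique _ _ L) => //; exact: cvg_cst.
Qed.

Lemma Dh_delta a w u : Dh (ev a) w u = pd a w u.
Proof.
rewrite /Dh (bigD1 a)//= delta_coord eqxx mul1r big1 ?addr0// => b ba.
by rewrite delta_coord (negbTE ba) mul0r.
Qed.

Lemma I_pd a w K : compact K -> csm K w -> I lam (pd a w : BV -> R) = 0.
Proof.
move=> cK sw; rewrite -[RHS](I_Dh (ev a) cK sw); apply: I_eq => u.
by rewrite Dh_delta.
Qed.

Lemma pdM a f g u : smc setT f -> smc setT g ->
 pd a (fun v => f v * g v) u = pd a f u * g u + f u * pd a g u.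
Proof.
move=> sf sg; rewrite /partial deriveM; last 2 first.
- by have [_] := smooth_on_C1 (smcT_on sf) (Logic.I : setT u).
- by have [_] := smooth_on_C1 (smcT_on sg) (Logic.I : setT u).
by rewrite addrC; congr (_ + _); exact: mulrC.
Qed.

Lemma ibp a f g K : compact K -> smc setT f -> csm K g ->
 ipr lam f (pd a g) = - ipr lam (pd a f) g.
Proof.
move=> cK sf sg; have kK := closed_rV cK.
apply/eqP; rewrite -addr_eq0 addrC -ID.
- rewrite -[X in _ == X](I_pd a cK (csmM sf sg)); apply/eqP/I_eq => u.
 by rewrite pdM//; case: sg.
- by apply: (csm_integ cK); apply: csmM => //; exact: smc_pd.
- by apply: (csm_integ cK); apply: csmM => //; exact: csm_pd.
Qed.

Lemma sqr_sum_le (m : nat) (a : nat -> R) :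
 (\sum_(i < m) a i) ^+ 2 <= m%:R * \sum_(i < m) a i ^+ 2.
Proof.
elim: m => [|m IH]; first by rewrite !big_ord0 expr0n mulr0.
rewrite !big_ord_recr/=; set S := \sum_(i < m) a i in IH *; set Q := \sum_(i < m) _ in IH *.
have Q0 : 0 <= Q by apply: sumr_ge0 => i _; exact: sqr_ge0.
have [m0|m0] := eqVneq m 0%N.
 have -> : S = 0 by rewrite /S m0 big_ord0. by rewrite m0 add0r mul1r lerDr.
have mp : 0 < m%:R :> R by rewrite ltr0n lt0n.
have h : 2 * S * a m <= Q + m%:R * a m ^+ 2.
 rewrite -(ler_pM2l mp); have := sqr_ge0 (S - m%:R * a m); nra.
rewrite -natr1; nra.
Qed.

(* Subdividing h does not increase m^2 N(h/m), whose limit is the right-hand side. *)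
Lemma translation_estimate (A : set V) h w K : compact K -> csm K w ->
 measurable (A : set BV) ->
 (forall u (s : R), 0 <= s <= 1 -> A u -> A (u + h) -> A (u + s *: h)) ->
 I lam (fun u => \1_A (u : V) * \1_A ((u : V) + h) * (w ((u : V) + h) - w u) ^+ 2) <=
 I lam (fun u => \1_A (u : V) * Dh h w u ^+ 2).
Proof.
move=> cK sw mA cA; set F := fun u => \1_A u * \1_A (u + h) * (w (u + h) - w u) ^+ 2.
have [B B0 [k dB]] := dq_dominated h cK sw.
have m1A : mfun (\1_A : BV -> R) by [].
have mw := meas_smcT sw.1.
have mq m : mfun (fun u : BV => \1_A u * dq h w m u ^+ 2 : R).
 by apply: measurable_funM => //; apply: measurable_funX; apply: meas_dq; case: sw.
have dom m (u : BV) : `|\1_A u * dq h w m u ^+ 2| <= B ^+ 2 * \1_(cube k : set BV) u.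
 have d2 : dq h w m u ^+ 2 <= B ^+ 2 * \1_(cube k : set BV) u.
  rewrite -[leLHS]ger0_norm ?sqr_ge0// normrX.
  have := dB m u; rewrite indicE; case: (_ \in _); rewrite ?mulr1 ?mulr0.
   by move=> q; rewrite lerXn2r.
  by rewrite normr_le0 => /eqP ->; rewrite normr0 expr0n.
 rewrite indicE; case: (_ \in A); first by rewrite mul1r ger0_norm ?sqr_ge0.
 by rewrite mul0r normr0 (le_trans _ d2)// sqr_ge0.
have lim (u : BV) : \1_A u * dq h w m u ^+ 2 @[m --> \oo] --> \1_A u * Dh h w u ^+ 2.
 apply: cvgM; first exact: cvg_cst. exact: (cvg_comp _ _ (@dq_cvg h w u sw.1) (@exprn_continuous R 2 _)).
have [_ L] := I_dct (cube_integ k (B ^+ 2)) mq dom lim.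
apply: (cvgr_to_ge L); apply: nearW => m.
have mi : integ lam (fun u => \1_A u * dq h w m u ^+ 2 : R).
 exact: (integ_le (mq m) (dom m) (cube_integ k (B ^+ 2))).
pose e := m.+1%:R^-1 *: h.
pose G (u : BV) : R := \1_A u * (w (u + e) - w u) ^+ 2.
have GE u : G u = m.+1%:R^-2 * (\1_A u * dq h w m u ^+ 2).
 have m0 : m.+1%:R != 0 :> R by []. by rewrite /G /dq ; field.
have iG : integ lam G by apply: (eq_integ (fun u => esym (GE u))); exact: integZ.
have sh (i : nat) : integ lam (fun u => G (u + i%:R *: e)) by exact: integ_shift.
(* The increment along [h] telescopes into m+1 increments along [e], whose squares are summed by
   Cauchy-Schwarz; the segment hypothesis keeps the intermediate points in [A]. *)
have FE u : `|F u| <= m.+1%:R * \sum_(i < m.+1) G (u + i%:R *: e).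
 have -> : `|F u| = F u.
  by rewrite ger0_norm// mulr_ge0 ?sqr_ge0////.
 have G0 v : 0 <= G v by rewrite mulr_ge0 ?sqr_ge0. have RHS0 : 0 <= m.+1%:R * \sum_(i < m.+1) G (u + i%:R *: e).
  by rewrite mulr_ge0// sumr_ge0.
 rewrite /F !indicE; case: (boolP (_ \in A)) => [|_]; last by rewrite !mul0r.
 rewrite inE => Au; case: (boolP (_ \in A)) => [|_]; last by rewrite mulr0 mul0r.
 rewrite inE => Auh; rewrite !mul1r. pose a (i : nat) := w (u + i%:R *: e + e) - w (u + i%:R *: e).
 have -> : w ((u : V) + h) - w u = \sum_(i < m.+1) a i.
  rewrite (eq_bigr (fun i : 'I_m.+1 => w ((u : V) + i.+1%:R *: e) - w ((u : V) + i%:R *: e))); last first.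
   by move=> i _; rewrite /a -addrA -{2}(scale1r e) -scalerDl natr1.
  rewrite -(big_mkord xpredT (fun i => w ((u : V) + i.+1%:R *: e) - w ((u : V) + i%:R *: e))).
  rewrite telescope_sumr// scale0r addr0; congr (w _ - _). by rewrite scalerA mulfV ?scale1r//.
 apply: (le_trans (sqr_sum_le _ _)); rewrite ler_pM2l// ; apply: ler_sum => i _.
 rewrite /G indicE mem_set ?mul1r// scalerA; apply: cA => //.
 by rewrite divr_ge0//= ler_pdivrMr// mul1r ler_nat ltnW.
have mF : measurable_fun [set: BV] F.
 apply: measurable_funM; first by apply: measurable_funM => //; exact: meas_comp_shift.
 by apply: measurable_funX; apply: measurable_funB => //; exact: meas_comp_shift.
have iS : integ lam (fun u => m.+1%:R * \sum_(i < m.+1) G (u + i%:R *: e)).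
 by apply: integZ; apply: integ_sum.
have iF := integ_le mF FE iS.
apply: (le_trans (I_le iF iS (fun u => le_trans (ler_norm _) (FE u)))).
rewrite IZ; last exact: integ_sum.
rewrite I_sum// (eq_bigr (fun=> I lam G)); last by move=> i _; rewrite !IU; exact: Rintegral_shift.
have -> : I lam G = m.+1%:R^-2 * I lam (fun u => \1_A u * dq h w m u ^+ 2).
 by rewrite -IZ//; exact: I_eq.
rewrite sumr_const card_ord.
by apply: eq_le_; field.
Qed.

End euclid.

(** * Cutoffs, gradients and quadratic forms *)

Section cutoff.
Context (R : realType) (n : nat).
Notation V := 'rV[R]_n.
Local Notation BV := (borel V).

(** [g] is uncontrolled off [W], but there the product vanishes: [W] and the open complement of [K]
    cover the space, and the product is smooth on each. *)
Lemma cutoff_ex (W K : set V) (k g : V -> R) : open W -> compact K -> K `<=` W ->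
 csm K k -> smc W g -> csm K (fun u => k u * g u).
Proof.
move=> oW cK KW [sk k0] sg; split; last by move=> u /k0 ->; rewrite mul0r.
have oK : open (~` K) by apply: closed_openC; apply: compact_closed => //.
apply: smc_base; apply: smooth_on_local => u _; have [Ku|nKu] := pselect (K u).
 exists W; first exact: KW. apply: (smcP oW); apply: smc_mul => //.
 by apply: smc_base; apply: (smooth_onS _ (smcT_on sk)).
exists (~` K) => //; apply: (smcP oK).
by apply: (smc_ext (smc_cst _ 0)) => v /k0 ->; rewrite mul0r.
Qed.

Lemma smcW (W W' : set V) g : W `<=` W' -> open W' -> smc W' g -> smc W g.
Proof. by move=> WW o sg; apply: smc_base; apply: (smooth_onS WW); exact: smcP. Qed.

Lemma smc_pd_on (W : set V) a g : open W -> smc W g -> smc W (pd a g).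
Proof. by move=> o sg; apply: smc_base; apply: smooth_on_pd; exact: smcP. Qed.

Lemma smc_derivable (W : set V) f u a : open W -> W u -> smc W f -> derivable f u (ev a).
Proof. move=> oW Wu sf; have [_ H] := smooth_on_C1 (smcP oW sf) Wu; exact (H a). Qed.

Definition grad (f : V -> R) (u : V) : V := \row_a pd a f u.

Lemma gradD (W : set V) f g u : open W -> W u -> smc W f -> smc W g ->
 grad (fun v => f v + g v) u = grad f u + grad g u.
Proof.
move=> oW Wu sf sg; apply/rowP => a; rewrite !mxE /partial deriveD//.
- exact (smc_derivable oW Wu sf).
- exact (smc_derivable oW Wu sg).
Qed.

Lemma gradM (W : set V) f g u : open W -> W u -> smc W f -> smc W g ->
 grad (fun v => f v * g v) u = f u *: grad g u + g u *: grad f u.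
Proof.
move=> oW Wu sf sg; apply/rowP => a; rewrite !mxE /partial deriveM//.
- exact (smc_derivable oW Wu sf).
- exact (smc_derivable oW Wu sg).
Qed.

Lemma grad_cst (c : R) u : grad (fun=> c) u = 0.
Proof. by apply/rowP => a; rewrite !mxE /partial derive_cst. Qed.

Lemma grad_congr (W : set V) f g u : open W -> W u -> (forall v, W v -> f v = g v) ->
 grad f u = grad g u.
Proof. by move=> oW Wu fg; apply/rowP => a; rewrite !mxE; exact: (pd_eq _ oW Wu fg). Qed.

Lemma grad_comp (W : set V) (h : R -> R) f u : open W -> W u -> smc W f ->
 derivable h (f u) 1 -> grad (fun v => h (f v)) u = derive1 h (f u) *: grad f u.
Proof.
move=> oW Wu sf dh; apply/rowP => a; rewrite !mxE /partial.
have df : derivable f u (ev a) := smc_derivable oW Wu sf.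
by rewrite (derive_val (is_derive := dom_is_derive dh df)) mulrC.
Qed.

Definition qf (A : 'M[R]_n) (x y : V) : R := (x *m A *m y^T) 0 0.

Lemma qfDl A x y z : qf A (x + y) z = qf A x z + qf A y z.
Proof. by rewrite /qf !mulmxDl mxE. Qed.
Lemma qfZl A c x z : qf A (c *: x) z = c * qf A x z.
Proof. by rewrite /qf -!scalemxAl mxE. Qed.
Lemma qfDr A x y z : qf A z (x + y) = qf A z x + qf A z y.
Proof. by rewrite /qf linearD/= mulmxDr mxE. Qed.
Lemma qfZr A c x z : qf A z (c *: x) = c * qf A z x.
Proof. by rewrite /qf linearZ/= -scalemxAr mxE. Qed.
Lemma qf0l A z : qf A 0 z = 0.
Proof. by rewrite /qf !mul0mx mxE. Qed.
Lemma qfC A x y : A^T = A -> qf A x y = qf A y x.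
Proof.
move=> sA; transitivity ((x *m A *m y^T)^T 0 0); first by rewrite [RHS]mxE.
by rewrite !trmx_mul trmxK sA mulmxA.
Qed.
Lemma qf_sum A x y : qf A x y = \sum_a \sum_b x 0 a * A a b * y 0 b.
Proof.
rewrite /qf mxE exchange_big/=; apply: eq_bigr => b _; rewrite !mxE mulr_suml.
by [].
Qed.

Variable lam : {measure set BV -> \bar R}.
Hypothesis Hl : is_lebesgue lam.

(** A positive value would persist on a small box, which has positive volume. *)
Lemma I_csm_eq0 K (w : V -> R) : compact K -> csm K w -> (forall u, 0 <= w u) ->
 I lam (w : BV -> R) = 0 -> forall u, w u = 0.
Proof.
move=> cK sw w0 Iw u; apply/eqP/negPn/negP => wu.
have wp : 0 < w u by rewrite lt_def wu w0.
have : \forall v \near u, w u / 2 < w v.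
 have FN : Filter (nbhs u) by exact: nbhs_filter. have := smcT_continuous sw.1 (x := u).
 move=> /(@cvgr_gt _ _ _ FN _ _) /(_ (w u / 2)); apply. by rewrite ltr_pdivrMr// ltr_pMr// ltr1n.
move=> /nbhs_ballP[e /= e0 He].
pose a : V := u - const_mx (e / 2); pose b : V := u + const_mx (e / 2).
have e2 : 0 < e / 2 by rewrite divr_gt0.
have ab j : a 0 j <= b 0 j by rewrite !mxE lerD2l ge0_cp// ltW.
have wb v : box a b v -> w u / 2 <= w v.
 move=> bv; apply/ltW/He; rewrite -ball_normE/=; apply: (@le_lt_trans _ _ (e / 2)).
  apply: rV_normP => [|j]; first exact: ltW. have := bv j; rewrite !mxE ler_norml => /andP[h1 h2].
  by apply/andP; lra.
 by rewrite ltr_pdivrMr// ltr_pMr// ltr1n.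
have := csm_integ Hl cK sw => wi.
have mb := meas_box a b.
have lb := lam_box Hl ab.
have ib : integ lam (\1_(box a b : set BV) : BV -> R).
 apply: ge0_integP => //; rewrite integral_indic// setIT; first by rewrite lb ltry.
have : w u / 2 * I lam (\1_(box a b : set BV) : BV -> R) <= I lam (w : BV -> R).
 rewrite -IZ//; apply: I_le => //; first exact: integZ.
 move=> v; rewrite indicE; case: (boolP (_ \in _)) => [|_]; last by rewrite mulr0. by rewrite inE mulr1; exact: wb.
rewrite Iw leNgt => /negP; apply; apply: mulr_gt0; first by rewrite divr_gt0.
rewrite -lte_fin I_EFin// integral_indic// setIT lb.
by apply: prodr_gt0 => j _; rewrite !mxE; lra.
Qed.

End cutoff.

(** * Gradient and Laplacian in a chart *)

Section chart_calculus.
Context (R : realType) (d : nat) (M : riemannian_manifold R d).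
Notation V := 'rV[R]_d.
Implicit Types (i j : chart_index M) (f g h : M -> R) (K : set V).

Definition Lap i f : V -> R := laplacian_loc (@metric _ _ M i) (fun u => f (chart_inv i u)).
Definition gr i f : V -> V := grad (fun u => f (chart_inv i u)).
(** The inner product of the gradients, g^{ab} d_a f d_b g (carre du champ). *)
Definition Gam i f g (u : V) : R := qf (invmx (metric i u)) (gr i f u) (gr i g u).

Lemma invmetric_sym i u : chim i u -> (invmx (metric i u))^T = invmx (metric i u).
Proof. by move=> cu; rewrite trmx_inv metric_sym. Qed.

Lemma smc_gr i f a : sm f -> smc (chim i) (fun u => gr i f u 0 a).
Proof.
move=> sf; apply: (smc_ext (smc_pd_on a (@chim_open _ _ M i) (sm_smc i sf))) => u _.
by rewrite mxE.
Qed.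

Lemma smc_Gam i f g : sm f -> sm g -> smc (chim i) (Gam i f g).
Proof.
move=> sf sg; apply: (smc_ext (f := fun u => \sum_a \sum_b gr i f u 0 a * invmx (metric i u) a b * gr i g u 0 b)).
 apply: smc_sum => a; apply: smc_sum => b; apply: smc_mul; last exact: smc_gr.
 by apply: smc_mul; [exact: smc_gr|exact: smc_invmetric].
by move=> u _; rewrite /Gam qf_sum.
Qed.

Definition flux i f a b (u : V) : R := rho i u * invmx (metric i u) a b * pd b (fun v => f (chart_inv i v)) u.

Lemma smc_flux i f a b : sm f -> smc (chim i) (flux i f a b).
Proof.
move=> sf; apply: smc_mul; last by apply: smc_pd_on; [exact: chim_open|exact: sm_smc].
by apply: smc_mul; [exact: smc_rho|exact: smc_invmetric].
Qed.

Lemma LapE i f u : Lap i f u = - ((rho i u)^-1 * \sum_a \sum_b pd a (flux i f a b) u).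
Proof. by []. Qed.

Lemma smc_Lap i f : sm f -> smc (chim i) (Lap i f).
Proof.
move=> sf; apply: smc_opp; apply: smc_mul.
 by apply: smc_inv; [exact: smc_rho|move=> u cu; rewrite gt_eqF// rho_gt0].
apply: smc_sum => a; apply: smc_sum => b; apply: smc_pd_on; first exact: chim_open.
exact: smc_flux.
Qed.

(** With [J] the Jacobian of the transition map, the metric becomes J G J^T and gradients are
    multiplied by J^T, so [J] cancels in the contraction with the inverse metric. *)
Lemma Gam_chart i j f g u : sm f -> sm g -> (chart i @` (source i `&` source j)) u ->
 Gam i f g u = Gam j f g (chart j (chart_inv i u)).
Proof.
move=> sf sg Wu; set W := chart i @` _ in Wu.
have oW : open W by rewrite /W setIC; apply: chart_open; exact: source_open.
have Wci v : W v -> chim i v by move=> [t [si sj] <-]; exists t.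
have Wj v : W v -> source j (chart_inv i v) by move=> [t [si sj] <-]; rewrite chartK.
pose P v := chart j (chart_inv i v).
have WP v : W v -> chim j (P v) by move=> Wv; exists (chart_inv i v) => //; exact: Wj.
pose J : 'M[R]_d := \matrix_(a, c) pd a (fun v => P v 0 c) u.
have GE : metric i u = J *m metric j (P u) *m J^T.
 apply/matrixP => a b; rewrite (metric_transition _ _ Wu) !mxE exchange_big/=.
 apply: eq_bigr => e _; rewrite mxE mulr_suml; apply: eq_bigr => c _. by rewrite !mxE mulrAC.
have grE h : sm h -> gr i h u = gr j h (P u) *m J^T.
 move=> sh; apply/rowP => a; rewrite !mxE.
 have E v : W v -> h (chart_inv i v) = ((fun y => h (chart_inv j y)) \o P) v.
  by move=> Wv /=; rewrite chartK//; exact: Wj.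
 rewrite (pd_eq a oW Wu E). have dP c : derivable (fun v => P v 0 c) u (ev a).
  have [_ H] := smooth_on_C1 (@transition_smooth _ _ M i j c) Wu; exact (H a).
 have dh : differentiable (fun y => h (chart_inv j y)) (P u).
  exact: (smooth_on_diff (@chim_open _ _ M j) (WP _ Wu) (@smE _ _ _ _ sh j)).
 rewrite {1}/partial (derive_val (is_derive := chain_rule dP dh)). by apply: eq_bigr => c _; rewrite !mxE mulrC.
have uG : metric j (P u) \in unitmx by apply: posdef_unit; apply: metric_posdef; exact: WP.
have uA : metric i u \in unitmx by apply: posdef_unit; apply: metric_posdef; exact: Wci.
have uJ : J \in unitmx.
 by move: uA; rewrite GE !unitmx_mul => /andP[/andP[]].
have uJT : J^T \in unitmx by rewrite unitmx_tr.
have XE : J^T *m invmx (metric i u) *m J = invmx (metric j (P u)).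
 have EG : metric j (P u) = invmx J *m metric i u *m invmx J^T.
  by rewrite GE -!mulmxA mulmxV// mulmx1 mulKmx.
 have XG : J^T *m invmx (metric i u) *m J *m metric j (P u) = 1%:M.
  by rewrite EG !mulmxA mulmxK// mulmxKV// mulmxV.
 by rewrite -[LHS](mulmxK uG) XG mul1mx.
by rewrite /Gam (grE f sf) (grE g sg) /qf -XE trmx_mul trmxK !mulmxA.
Qed.

End chart_calculus.

(** * Fubini's theorem *)

Section fubini.
Context (R : realType) d1 (T1 : measurableType d1) (m1 : {sigma_finite_measure set T1 -> \bar R}).
Context d2 (T2 : measurableType d2) (m2 : {sigma_finite_measure set T2 -> \bar R}).

(** Domination by a product a(x) b(y) makes every section integrable, not just almost every one, so
    that iterated real integrals can be manipulated pointwise. *)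
Lemma I_fubini_sf (F : T1 -> T2 -> R) (a : T1 -> R) (b : T2 -> R) :
 measurable_fun [set: T1 * T2] (fun z => F z.1 z.2) -> (forall x y, `|F x y| <= a x * b y) ->
 integ m1 a -> integ m2 b ->
 [/\ forall x, integ m2 (F x), forall y, integ m1 (F ^~ y), integ m1 (fun x => I m2 (F x)),
   integ m2 (fun y => I m1 (F ^~ y)) &
   I m1 (fun x => I m2 (F x)) = I m2 (fun y => I m1 (F ^~ y))].
Proof.
move=> mF Fab ia ib.
have mx x : measurable_fun [set: T2] (F x) by exact: (measurableT_comp mF (pair1_measurable x)).
have my y : measurable_fun [set: T1] (F ^~ y) by exact: (measurableT_comp mF (pair2_measurable y)).
have ix x : integ m2 (F x) by apply: (integ_le (mx x) (Fab x)); exact: integZ.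
have iy y : integ m1 (F ^~ y).
 by apply: (integ_le (my y) (Fab ^~ y)); apply: (eq_integ _ (integZ (b y) ia)) => x; rewrite mulrC.
have mFE : measurable_fun [set: T1 * T2] (fun z => (F z.1 z.2)%:E) by exact/measurable_EFinP.
have iF : (m1 \x m2)%E.-integrable [set: T1 * T2] (fun z => (F z.1 z.2)%:E).
 apply: (iffRL (@integrable12ltyP _ _ _ _ _ m1 m2 _ mFE)). pose c := I m2 (fun y => `|b y|).
 apply: (@le_lt_trans _ _ (\int[m1]_x (`|a x| * c)%:E)%E).
  apply: ge0_le_integral => //.
  - by move=> x _; apply: integral_ge0.
  - have mA : measurable_fun [set: T1 * T2] (fun z => `|(F z.1 z.2)%:E|%E) by apply: measurableT_comp.
   have A0 z : (0 <= `|(F z.1 z.2)%:E|)%E by []. have H := measurable_fun_fubini_tonelli_F (m2 := m2) _ mA A0.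
   by [].
  - by apply/measurable_EFinP; apply: measurable_funM => //; apply: measurableT_comp => //; exact: integ_meas ia.
  - move=> x _ /=.
   rewrite (_ : (\int[m2]_y _)%E = (I m2 (fun y => `|F x y|))%:E); last by rewrite (I_EFin (integ_abs (ix x))).
   rewrite -IZ; last exact: integ_abs. apply: I_le; [exact: integ_abs|by apply: integZ; exact: integ_abs|].
   by move=> y; rewrite (le_trans (Fab x y))// -normrM ler_norm.
 have i : integ m1 (fun x => `|a x| * c).
  by apply: (eq_integ _ (integZ c (integ_abs ia))) => x; rewrite mulrC.
 by rewrite -(I_EFin i) ltry.
have E1 x : (\int[m2]_y (F x y)%:E)%E = (I m2 (F x))%:E by rewrite (I_EFin (ix x)).
have E2 y : (\int[m1]_x (F x y)%:E)%E = (I m1 (F ^~ y))%:E by rewrite (I_EFin (iy y)).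
have i1 : integ m1 (fun x => I m2 (F x)).
 rewrite /integ (_ : _ \o _ = fubini_F m2 (fun z => (F z.1 z.2)%:E)); last first.
  by apply/funext => x /=; rewrite /fubini_F /=.
 exact: integrable_fubini_F.
have i2 : integ m2 (fun y => I m1 (F ^~ y)).
 have m2F : measurable_fun [set: T2] (fun y => I m1 (F ^~ y)).
  apply/measurable_EFinP; rewrite (_ : _ \o _ = fubini_G m1 (fun z => (F z.1 z.2)%:E)); last first.
   by apply/funext => y /=; rewrite /fubini_G /=.
  exact: (measurable_fubini_G iF).
 apply: (integ_le m2F _ (integZ (I m1 (fun x => `|a x|)) (integ_abs ib))) => y.
 apply: (le_trans (I_abs (iy y))); rewrite mulrC -(IZ _ (integ_abs ia)).
 apply: (I_le (integ_abs (iy y)) (integZ _ (integ_abs ia))) => x.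
 by rewrite (le_trans (Fab x y))// mulrC -normrM ler_norm.
split=> //.
have := Fubini iF => /=.
under eq_integral do rewrite E1; under [in X in _ = X -> _]eq_integral do rewrite E2.
by rewrite -(I_EFin i1) -(I_EFin i2) => -[].
Qed.

End fubini.

Section sigma_finite_copy.
Context d (T : measurableType d) (R : realType) (m : {measure set T -> \bar R}).
Hypothesis sf : sigma_finite setT m.

(** A copy of [m] that carries the proof of sigma-finiteness as an argument, from which the
    structure required for product measures is inferred. *)
Definition sfm of sigma_finite setT m : set T -> \bar R := m.
HB.instance Definition _ := Measure.on (sfm sf).
HB.instance Definition _ := Measure_isSigmaFinite.Build _ _ _ (sfm sf) sf.

End sigma_finite_copy.

(** * Faber-Krahn and Poincare inequalities on Euclidean space *)

Section euclid_fubini.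
Context (R : realType) (n : nat).
Notation V := 'rV[R]_n.
Local Notation BV := (borel V).
Variable lam : {measure set BV -> \bar R}.
Hypothesis Hl : is_lebesgue lam.

Lemma I_fubini (F : BV -> BV -> R) (a b : BV -> R) :
 measurable_fun [set: BV * BV] (fun z => F z.1 z.2) -> (forall x y, `|F x y| <= a x * b y) ->
 integ lam a -> integ lam b ->
 [/\ forall x, integ lam (F x), forall y, integ lam (F ^~ y), integ lam (fun x => I lam (F x)),
   integ lam (fun y => I lam (F ^~ y)) &
   I lam (fun x => I lam (F x)) = I lam (fun y => I lam (F ^~ y))].
Proof.
have sf : sigma_finite setT lam.
 exists (fun k => cube k : set BV); first by rewrite cube_cover.
 by move=> k; split; [exact: meas_box|exact: lam_cube_fin].
move=> h1 h2 h3 h4.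
exact: (@I_fubini_sf _ _ _ (sfm sf) _ _ (sfm sf) F a b h1 h2 h3 h4).
Qed.

Lemma meas_addp : measurable_fun [set: BV * BV] ((fun z => (z.1 : V) + z.2) : _ -> BV).
Proof. by apply: meas_rVD. Qed.

Definition nab2 (w : V -> R) (u : V) : R := \sum_a pd a w u ^+ 2.

Lemma csm_nab2 K w : closed K -> csm K w -> csm K (nab2 w).
Proof.
move=> cK sw; split.
 apply: smc_sum => a; apply: (smc_ext (f := fun u => pd a w u * pd a w u)).
  by apply: smc_mul; apply: smc_pd; case: sw.
 by [].
move=> u nK; rewrite /nab2 big1// => a _; rewrite (csm_pd a cK sw).2//.
by rewrite expr0n.
Qed.

Lemma Dh_sq_le (w : V -> R) (h u : V) r : 0 <= r -> (forall j, `|h 0 j| <= r) ->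
 Dh h w u ^+ 2 <= n%:R * r ^+ 2 * nab2 w u.
Proof.
move=> r0 hr; pose f (m : nat) : R := if insub m is Some a then h 0 a * pd a w u else 0.
have E : Dh h w u = \sum_(i < n) f i by apply: eq_bigr => i _; rewrite /f valK.
have H := sqr_sum_le n f; rewrite E; apply: (le_trans H).
rewrite -mulrA; apply: ler_wpM2l => //; rewrite mulr_sumr.
apply: ler_sum => i _; rewrite /f valK exprMn ler_wpM2r ?sqr_ge0//.
by rewrite -[h 0 i ^+ 2]real_normK ?num_real// lerXn2r.
Qed.

Lemma box_fin (a b : V) : (forall j, a 0 j <= b 0 j) ->
 integ lam (\1_(box a b : set BV) : BV -> R) /\
 I lam (\1_(box a b : set BV) : BV -> R) = \prod_(j < n) (b 0 j - a 0 j).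
Proof.
move=> ab; have mb := meas_box a b.
have E : (\int[lam]_x (\1_(box a b : set BV) x)%:E = (\prod_(j < n) (b 0 j - a 0 j))%:E)%E.
 by rewrite integral_indic// setIT lam_box.
split; last by rewrite !IU /Rintegral E.
by apply: ge0_integP => //; rewrite E ltry.
Qed.

(* w^2 <= (w' - w)^2 + 2 |w w'| for the translate w', averaged over a cube. *)
Lemma faber_krahn_euclid K w r : compact K -> csm K w -> 0 < r ->
 r ^+ n * I2 lam w <=
 n%:R * r ^+ n.+2 * I lam (nab2 w : BV -> R) + 2 * I lam (fun u => `|w u|) ^+ 2.
Proof.
move=> cK sw r0; pose B : set V := box 0 (const_mx r).
have kK : closed K by exact: (closed_rV cK).
have ab j : (0 : V) 0 j <= (const_mx r : V) 0 j by rewrite !mxE ltW.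
have [iB EB] := box_fin ab; have mB := meas_box 0 (const_mx r : V).
have iw := csm_integ Hl cK sw; have iaw := integ_abs iw; have [mw iw2] := csm_sqint Hl cK sw.
have [C C0 wC] := csm_bounded cK sw.
have IBE : I lam (\1_(B : set BV) : BV -> R) = r ^+ n.
 rewrite EB; under eq_bigr do rewrite !mxE subr0. by rewrite big_const_ord iter_mulr_1.
have mprod : measurable_fun [set: BV * BV] (fun z => w ((z.2 : V) + z.1)).
 by apply: (measurableT_comp mw); apply: meas_rVD; [exact: measurable_snd|exact: measurable_fst].
pose F (h x : BV) : R := \1_B (h : V) * (`|w x| * `|w ((x : V) + h)|).
have mF : measurable_fun [set: BV * BV] (fun z => F z.1 z.2).
 apply: measurable_funM; first exact: (measurableT_comp (measurable_indic mB) measurable_fst).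
 apply: measurable_funM; last exact: measurableT_comp.
 by apply: measurableT_comp => //; exact: (measurableT_comp mw measurable_snd).
have Fle h x : `|F h x| <= \1_B (h : V) * (C * `|w x|).
 rewrite /F normrM (ger0_norm (_ : 0 <= \1_B (h : V) :> R)); last by rewrite indicE.
 rewrite ler_wpM2l ?indicE// normrM !normr_id mulrC. by rewrite ler_wpM2r.
have [F1 F2 F3 F4 FE] := I_fubini mF Fle iB (integZ C iaw).
(* After exchanging the integrals, the inner one over the cube is at most the full integral of |w|,
   whence the square of the L1 norm. *)
have half : I lam (fun h => I lam (F h)) <= I lam (fun u => `|w u|) ^+ 2.
 rewrite FE expr2 -(IZ _ iaw); apply: (I_le F4 (integZ _ iaw)) => x; rewrite mulrC.
 apply: (@le_trans _ _ (I lam (fun h => `|w x| * `|w ((h : V) + x)|))).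
  have i : integ lam (fun h => `|w ((h : V) + x)|) by exact: (integ_shift Hl (x : V) iaw).
  apply: (I_le (F2 x) (integZ _ i)).
  by move=> h; rewrite /F [(h : V) + x]addrC indicE; case: (_ \in _); rewrite ?mul1r// mul0r mulr_ge0.
 rewrite (IZ _ (integ_shift Hl (x : V) iaw)). by rewrite !IU (Rintegral_shift Hl (x : V) iaw).
have main (h : BV) : \1_B (h : V) * I2 lam w <=
  (n%:R * r ^+ 2 * I lam (nab2 w : BV -> R)) * \1_B (h : V) + 2 * I lam (F h).
 rewrite indicE; case: (boolP (_ \in _)) => [|_]; last first.
  by rewrite mul0r mulr0 add0r mulr_ge0// I_ge0// => x; rewrite /F indicE !mulr_ge0.
 rewrite inE => Bh; rewrite mul1r mulr1. have hr j : `|(h : V) 0 j| <= r.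
  by have := Bh j; rewrite !mxE => /andP[h0 h1]; rewrite ger0_norm// ltW.
 have te := @translation_estimate _ _ lam Hl setT (h : V) w K cK sw measurableT (fun _ _ _ _ _ => Logic.I).
 have iD : integ lam (fun u => Dh (h : V) w u ^+ 2).
  by have [] := csm_sqint Hl cK (csm_Dh (h : V) kK sw).
 have iN := csm_integ Hl cK (csm_nab2 kK sw). have iS : integ lam (fun u => (w ((u : V) + h) - w u) ^+ 2).
  have sS : sqint lam (fun u => w ((u : V) + h)).
   split; first exact: meas_comp_shift. exact: (integ_shift Hl (h : V) iw2).
  by have [] := sqintB sS (csm_sqint Hl cK sw).
 have te' : I lam (fun u => (w ((u : V) + h) - w u) ^+ 2) <= n%:R * r ^+ 2 * I lam (nab2 w : BV -> R).
  rewrite (_ : I lam _ = I lam (fun u => \1_setT (u : V) * \1_setT ((u : V) + h) * (w ((u : V) + h) - w u) ^+ 2)); last first.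
   by apply: I_eq => u; rewrite !indicT/= !mul1r.
  apply: (le_trans te); rewrite -(IZ _ iN); apply: I_le.
  - by apply: (eq_integ _ iD) => u; rewrite indicT mul1r.
  - exact: integZ.
  - by move=> u; rewrite indicT mul1r; exact: Dh_sq_le (ltW r0) hr.
 apply: (@le_trans _ _ (I lam (fun u => (w ((u : V) + h) - w u) ^+ 2) + 2 * I lam (F h))); last by rewrite lerD2r.
 rewrite -(IZ _ (F1 h)) -(ID iS (integZ 2 (F1 h))); apply: (I_le iw2 (integD iS (integZ 2 (F1 h)))).
 move=> u; rewrite /F indicE mem_set// mul1r -normrM.
 have := ler_norm (w u * w ((u : V) + h)); have := sqr_ge0 (w ((u : V) + h)).
 by move: (w u) (w _) => x y; rewrite sqrrB; nra.
have iC : integ lam (fun h => \1_B (h : V) * I2 lam w).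
 by apply: (eq_integ _ (integZ (I2 lam w) iB)) => h; rewrite mulrC.
have iR1 := integZ (n%:R * r ^+ 2 * I lam (nab2 w : BV -> R)) iB.
have := I_le iC (integD iR1 (integZ 2 F3)) main.
rewrite (ID iR1 (integZ 2 F3)) (IZ _ iB) (IZ _ F3).
rewrite (_ : I lam (fun h => \1_B (h : V) * _) = r ^+ n * I2 lam w); last first.
 by rewrite -IBE mulrC -(IZ _ iB); apply: I_eq => h; rewrite mulrC.
rewrite IBE => H; apply: (le_trans H).
rewrite [r ^+ n.+2]exprS [r ^+ n.+1]exprS; move: half; set X := I lam _; set Y := I lam _; set Z := I lam _.
by rewrite expr2; move: (r ^+ n) n%:R => p q; lra.
Qed.

(** [m] is the mean over the box [A]. By Cauchy-Schwarz the left-hand side is at most the double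
    integral of (w(y) - w(x))^2 over A x A; with y = x + h the integral in x is estimated by
    [translation_estimate] on the convex set [A], for [h] in the cube [Q] containing all
    differences, whose volume is (2r)^n. *)
Lemma poincare_box K w (a b : V) r : compact K -> csm K w ->
 (forall j, a 0 j < b 0 j /\ b 0 j - a 0 j <= r) -> 0 < r ->
 exists m, (\prod_(j < n) (b 0 j - a 0 j)) * I lam (fun u => \1_(box a b) (u : V) * (w u - m) ^+ 2) <=
  (2 * r) ^+ n * (n%:R * r ^+ 2) * I lam (fun u => \1_(box a b) (u : V) * nab2 w u).
Proof.
move=> cK sw abr r0; set A := box a b; set P := \prod_(j < n) _.
have kK : closed K by exact: (closed_rV cK).
have ab j : a 0 j <= b 0 j by apply: ltW; case: (abr j).
have [iA EA] := box_fin ab; have mA := meas_box a b; rewrite -/A -/P in iA EA mA.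
have P0 : 0 < P by apply: prodr_gt0 => j _; rewrite subr_gt0; case: (abr j).
have [C C0 wC] := csm_bounded cK sw; have mw := meas_smcT sw.1.
have m1 : mfun (\1_A : BV -> R) by exact: measurable_indic.
have A01 (u : V) : 0 <= \1_A u :> R by rewrite indicE.
have A2 (u : V) : \1_A u ^+ 2 = \1_A u :> R by rewrite indicE; case: (_ \in _); rewrite ?expr1n ?expr0n.
have iAB (f : BV -> R) B : mfun f -> (forall u, `|f u| <= B) -> integ lam (fun u => \1_A (u : V) * f u).
 move=> mf fB; apply: (integ_le _ _ (integZ B iA)); first exact: measurable_funM.
 by move=> u; rewrite normrM (ger0_norm (A01 _)) mulrC ler_wpM2r.
have iAw := iAB _ _ mw wC.
pose m := I lam (fun u => \1_A (u : V) * w u) / P; exists m.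
have wB (x u : V) : `|w u - w x| <= 2 * C.
 by rewrite (le_trans (ler_normB _ _))// mulr_natl mulr2n lerD.
have mdif (x : V) : mfun (fun u : BV => w u - w x) by apply: measurable_funB.
have mdif2 (x : V) : mfun (fun u : BV => (w u - w x) ^+ 2) by apply: measurable_funX.
have wB2 (x u : V) : `|(w u - w x) ^+ 2| <= (2 * C) ^+ 2.
 by rewrite normrX lerXn2r ?nnegrE// mulr_ge0.
pose J (x : V) := I lam (fun y => \1_A (y : V) * (w y - w x) ^+ 2).
(* Cauchy-Schwarz for w(u) - w(x) against the indicator of [A]; [P] is the volume of [A]. *)
have step1 x : P * (w x - m) ^+ 2 <= J x.
 have s1 : sqint lam (\1_A : BV -> R) by split=> //; apply: (eq_integ _ iA) => u; rewrite A2.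
 have s2 : sqint lam (fun u => \1_A (u : V) * (w u - w x)).
  split; first exact: measurable_funM. by apply: (eq_integ _ (iAB _ _ (mdif2 x) (wB2 x))) => u; rewrite exprMn A2.
 have := CS s1 s2. have -> : I lam (fun u => \1_A (u : V) * (\1_A (u : V) * (w u - w x))) = P * (m - w x).
  have i2 := integZ (w x) iA. transitivity (I lam (fun u => \1_A (u : V) * w u - w x * \1_A (u : V))).
   by apply: I_eq => u; rewrite mulrA -expr2 A2 mulrBr [w x * _]mulrC.
  by rewrite (IB iAw i2) (IZ _ iA) EA /m mulrBr [P * (_ / _)]mulrCA mulfV ?gt_eqF// mulr1 [w x * _]mulrC.
 have -> : I lam (fun u => \1_A (u : V) ^+ 2) = P by rewrite -EA; apply: I_eq => u; rewrite A2.
 have -> : I lam (fun u => (\1_A (u : V) * (w u - w x)) ^+ 2) = J x.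
  by apply: I_eq => u; rewrite exprMn A2.
 rewrite exprMn expr2 -mulrA ler_pM2l// -sqrrN opprB. by [].
pose Q : set V := box (const_mx (- r)) (const_mx r).
have Qab j : (const_mx (- r) : V) 0 j <= (const_mx r : V) 0 j by rewrite !mxE; lra.
have [iQ EQ] := box_fin Qab.
have {}EQ : I lam (\1_(Q : set BV) : BV -> R) = (2 * r) ^+ n.
 rewrite EQ; under eq_bigr do rewrite !mxE opprK -mulr2n -mulr_natl. by rewrite big_const_ord iter_mulr_1.
have AQ (x h : V) : A x -> A (x + h) -> forall j, - r <= h 0 j < r.
 move=> Ax Axh j; have := Ax j; have := Axh j; rewrite !mxE; have [_] := abr j; lra.
pose F (x h : BV) : R := \1_A (x : V) * \1_A ((x : V) + h) * (w ((x : V) + h) - w x) ^+ 2.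
have mF : measurable_fun [set: BV * BV] (fun z => F z.1 z.2).
 have mwa : measurable_fun [set: BV * BV] (fun z => w ((z.1 : V) + z.2)) by exact: (measurableT_comp mw meas_addp).
 apply: measurable_funM.
  apply: measurable_funM; first exact: (measurableT_comp m1 measurable_fst).
  exact: (measurableT_comp m1 meas_addp).
 by apply: measurable_funX; apply: measurable_funB => //; exact: (measurableT_comp mw measurable_fst).
have Fle x h : `|F x h| <= ((2 * C) ^+ 2 * \1_A (x : V)) * \1_(Q : set BV) h.
 rewrite /F; case: (pselect (A x /\ A ((x : V) + h))) => [[Ax Axh]|nA].
  have Qh : Q h by move=> j; rewrite !mxE; exact: AQ Ax Axh j.
  by rewrite !indicE !mem_set// !mulr1 mul1r; exact: (wB2 x ((x : V) + h)).
 rewrite (_ : \1_A (x : V) * \1_A ((x : V) + h) = 0) ?mul0r ?normr0.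
  by rewrite !mulr_ge0 ?sqr_ge0// indicE.
 rewrite !indicE; case: (boolP (_ \in _)) => [|_]; last by rewrite mul0r.
 rewrite inE => Ax; rewrite memNset ?mulr0// => Axh; exact: nA.
have [F1 F2 F3 F4 FE] := I_fubini mF Fle (integZ _ iA) iQ.
have JE (x : BV) : \1_A (x : V) * J x = I lam (F x).
 have i := iAB _ _ (mdif2 x) (wB2 x). have i' := integ_shift Hl (x : V) i.
 have -> : J x = I lam (fun h => \1_A ((h : V) + x) * (w ((h : V) + x) - w x) ^+ 2).
  by rewrite /J !IU (Rintegral_shift Hl (x : V) i).
 rewrite -(IZ _ i'). by apply: I_eq => h; rewrite /F mulrA [(h : V) + x]addrC.
have iN := csm_integ Hl cK (csm_nab2 kK sw).
have iAN : integ lam (fun u => \1_A (u : V) * nab2 w u).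
 have [B _ NB] := csm_bounded cK (csm_nab2 kK sw). by apply: (iAB _ B _ NB); exact: integ_meas iN.
have step2 (h : BV) : I lam (F ^~ h) <=
  (n%:R * r ^+ 2 * I lam (fun u => \1_A (u : V) * nab2 w u)) * \1_(Q : set BV) h.
 rewrite indicE; case: (boolP (h \in _)) => [|hQ]; last first.
  rewrite mulr0 (_ : I lam (F ^~ h) = I lam (fun u => 0 * \1_A (u : V))).
   by rewrite (IZ _ iA) mul0r.
  apply: I_eq => x; rewrite mul0r; apply/eqP; rewrite -normr_le0.
  have z : \1_(Q : set BV) h = 0 :> R by rewrite indicE (negbTE hQ).
  by apply: (le_trans (Fle x h)); rewrite z mulr0.
 rewrite inE => Qh; rewrite mulr1. have hr j : `|(h : V) 0 j| <= r.
  by have := Qh j; rewrite !mxE => h1; rewrite ler_norml; lra.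
 have cA u (s : R) : 0 <= s <= 1 -> A u -> A (u + (h : V)) -> A (u + s *: (h : V)).
  move=> s01 Au Auh j; have := Au j; have := Auh j; rewrite !mxE. have /andP[s0 s1] := s01.
  move: (u 0 j) ((h : V) 0 j) (a 0 j) (b 0 j) => x y p q. have [y0|/ltW y0] := leP 0 y.
   by have := mulr_ge0 s0 y0; have := ler_piMl y0 s1; lra.
  by have := mulr_ge0_le0 s0 y0; have := ler_niMl y0 s1; lra.
 apply: (le_trans (translation_estimate Hl cK sw mA cA)). rewrite -(IZ _ iAN); apply: I_le; [|exact: integZ|].
  have sD := csm_Dh (h : V) kK sw; have [B B0 DB] := csm_bounded cK sD.
  apply: (iAB _ (B ^+ 2)); first by apply: measurable_funX; exact: meas_smcT sD.1.
  by move=> u; rewrite normrX lerXn2r ?nnegrE.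
 by move=> u; rewrite [leRHS]mulrCA; apply: ler_wpM2l => //; exact: Dh_sq_le (ltW r0) hr.
have iL : integ lam (fun u => \1_A (u : V) * (w u - m) ^+ 2).
 apply: (iAB _ ((C + `|m|) ^+ 2)); first by apply: measurable_funX; apply: measurable_funB.
 by move=> u; rewrite normrX lerXn2r ?nnegrE ?addr_ge0// (le_trans (ler_normB _ _))// lerD2r.
rewrite -(IZ _ iL); apply: (@le_trans _ _ (I lam (fun x => I lam (F x)))).
 apply: (I_le (integZ _ iL) F3) => x; rewrite -JE mulrCA ler_wpM2l//; exact: step1.
rewrite FE -EQ -[_ * (n%:R * _) * _]mulrA [leRHS]mulrC -(IZ _ iQ).
by apply: (I_le F4 (integZ _ iQ)) => h; exact: step2.
Qed.

End euclid_fubini.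

(** * Lp norms, dyadic sums and elementary inequalities *)

Section lp.
Context d (T : measurableType d) (R : realType) (mu : {measure set T -> \bar R}).
Implicit Types f g : T -> R.

Definition pint p f := mfun f /\ integ mu (fun x => `|f x| `^ p).
Definition nrm p f : R := I mu (fun x => `|f x| `^ p) `^ p^-1.

Lemma nrm_ge0 p f : 0 <= nrm p f. Proof. exact: powR_ge0. Qed.

Lemma LnormE p f : integ mu (fun x => `|f x| `^ p) ->
 Lnorm mu p%:E (fun x => (f x)%:E) = (nrm p f)%:E.
Proof.
move=> fi; rewrite unlock -poweR_EFin; congr (_ `^ _)%E.
by rewrite (I_EFin fi).
Qed.

(** Young's inequality supplies the integrability of the product. *)
Lemma I_hoelder p q f g : 0 < p -> 0 < q -> p^-1 + q^-1 = 1 -> pint p f -> pint q g ->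
 integ mu (fun x => f x * g x) /\ I mu (fun x => `|f x * g x|) <= nrm p f * nrm q g.
Proof.
move=> p0 q0 pq [mf fi] [mg gi].
have ifg : integ mu (fun x => f x * g x).
 apply: (integ_le _ _ (integD (integZ p^-1 fi) (integZ q^-1 gi))); first exact: measurable_funM.
 move=> x; rewrite normrM; have := conjugate_powR (normr_ge0 (f x)) (normr_ge0 (g x)) p0 q0 pq.
 by rewrite [p^-1 * _]mulrC [q^-1 * _]mulrC.
split=> //; have := hoelder mu mf mg p0 q0 pq.
rewrite (LnormE fi) (LnormE gi).
have i1 : integ mu (fun x => `|f x * g x| `^ 1).
 by apply: (eq_integ _ (integ_abs ifg)) => x; rewrite powRr1.
rewrite (LnormE i1) /nrm invr1 powRr1; last by apply: I_ge0 => x.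
by rewrite (_ : I mu (fun x => _ `^ 1) = I mu (fun x => `|f x * g x|))//; apply: I_eq => x; rewrite powRr1.
Qed.

Lemma nrm_eq p f : 0 < p -> nrm p f `^ p = I mu (fun x => `|f x| `^ p).
Proof.
move=> p0; rewrite -powRrM mulVf ?gt_eqF// powRr1//.
by apply: I_ge0 => x.
Qed.

End lp.

Section dyadic.
Context (R : realType).

Lemma norm_powRrM (x c t : R) : 0 < c -> `|(`|x| `^ c)| `^ (t / c) = `|x| `^ t.
Proof. by move=> c0; rewrite (ger0_norm (powR_ge0 _ _)) -powRrM mulrC divfK// gt_eqF. Qed.

(** If x lies between 2a 2^k and 4a 2^k, the k-th term alone is at least x^t; smaller x are covered
    by the first term. *)
Lemma dyadic_layer (a t x : R) n : 0 < a -> 0 < t -> 0 <= x -> x <= 2 * (a * 2 ^+ n) ->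
 x `^ t <= (2 * a) `^ t + \sum_(k < n) (4 * (a * 2 ^+ k)) `^ t * (2 * (a * 2 ^+ k) < x)%R%:R.
Proof.
move=> a0 t0 x0; elim: n => [|n IH] xn.
 by rewrite big_ord0 addr0 ge0_ler_powR ?nnegrE// ?(ltW t0)// ?mulr_ge0 ?(ltW a0)//; move: xn; rewrite mulr1.
have S0 : 0 <= (2 * a) `^ t + \sum_(k < n) (4 * (a * 2 ^+ k)) `^ t * (2 * (a * 2 ^+ k) < x)%R%:R.
 by rewrite addr_ge0 ?powR_ge0// sumr_ge0// => k _; rewrite mulr_ge0// powR_ge0.
rewrite big_ord_recr/= addrA; have [h|h] := leP x (2 * (a * 2 ^+ n)).
 by rewrite mulr0 addr0; exact: IH.
rewrite mulr1 -[leLHS]add0r lerD// ge0_ler_powR ?nnegrE// ?(ltW t0)//.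
 by rewrite !mulr_ge0 ?(ltW a0).
by apply: (le_trans xn); rewrite exprS; lra.
Qed.

(** A geometric sum of ratio q = 2^c is dominated by its last term, up to the factor q/(q - 1). *)
Lemma dyadic_sum (a c x : R) n : 0 < a -> 0 < c -> 0 <= x ->
 \sum_(k < n) (a * 2 ^+ k) `^ c * (a * 2 ^+ k < x)%R%:R <= 2 `^ c / (2 `^ c - 1) * x `^ c.
Proof.
move=> a0 c0 x0; set q := 2 `^ c.
have q1 : 1 < q.
 have : (1 : R) `^ c < q by rewrite gt0_ltr_powR ?nnegrE// ltr1n. by rewrite powR1.
have qm : 0 < q - 1 by rewrite subr_gt0.
have Cq : 0 <= q / (q - 1) by rewrite divr_ge0 ?ltW// (lt_trans ltr01).
elim: n => [|n IH]; first by rewrite big_ord0 mulr_ge0// powR_ge0.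
rewrite big_ord_recr/=; have [h|h] := leP x (a * 2 ^+ n); first by rewrite mulr0 addr0.
rewrite mulr1.
have an0 k : 0 <= a * 2 ^+ k by rewrite mulr_ge0 ?(ltW a0).
apply: (@le_trans _ _ (q / (q - 1) * (a * 2 ^+ n) `^ c)); last first.
 by rewrite ler_wpM2l// ge0_ler_powR ?nnegrE// ltW.
have E k : (a * 2 ^+ k) `^ c = a `^ c * q ^+ k.
 by rewrite powRM ?(ltW a0)// -powR_mulrn// powRAC powR_mulrn//.
apply: (@le_trans _ _ (\sum_(k < n.+1) a `^ c * q ^+ k)).
 rewrite big_ord_recr/= E lerD2r; apply: ler_sum => k _.
 by rewrite E ler_piMr ?mulr_ge0 ?exprn_ge0 ?powR_ge0//; case: (_ < _).
rewrite -mulr_sumr E mulrCA ler_wpM2l ?powR_ge0//.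
have := subrX1 q n.+1 => Hq.
rewrite -(ler_pM2l qm).
have -> : (q - 1) * (q / (q - 1) * q ^+ n) = q ^+ n.+1 by rewrite exprS; field; rewrite gt_eqF.
lra.
Qed.

End dyadic.

Section arithmetic.
Context (R : realType).
Implicit Types B Q F N X y : R.

Lemma absorb_le1 B Q F N y : 0 <= B -> 0 <= Q -> 0 <= F -> 0 <= N -> y <= Q * N ->
 y <= (1 + 2 * B + Q) * (F + N).
Proof.
move=> B0 Q0 F0 N0 h; apply: (le_trans h); apply: ler_pM => //; lra.
Qed.

Lemma absorb_le2 B Q F N y : 0 <= B -> 0 <= Q -> 0 <= F -> 0 <= N -> y <= 2 * B * F ->
 y <= (1 + 2 * B + Q) * (F + N).
Proof.
move=> B0 Q0 F0 N0 h; apply: (le_trans h); apply: ler_pM => //; lra.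
Qed.

(** [A] is less than half of [X] and is absorbed; then [X] cancels. *)
Lemma absorb_div A B F X y : 0 < y -> 0 < X -> 2 * A < X -> X <= A + B * (X / y * F) -> y <= 2 * B * F.
Proof.
move=> y0 X0 h1 h2.
have h : X * (1 / 2) <= X * (B * F / y).
 have -> : X * (B * F / y) = B * (X / y * F) by ring. by move: (B * (X / y * F)) h2 => z h2; lra.
by move: h; rewrite ler_pM2l// ler_pdivlMr// ; lra.
Qed.

(** After taking the root, the exponent of [m] is (1 - p/2)/p, between 0 and 1, so this power is at
    most 1 + m. *)
Lemma interp_le (p x m : R) : 1 <= p -> p <= 2 -> 0 <= x -> 0 <= m ->
 (x `^ p * m `^ (1 - p / 2)) `^ p^-1 <= (1 + m) * x.
Proof.
move=> p1 p2 x0 m0; have p0 : 0 < p by exact: lt_le_trans p1.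
rewrite powRM ?powR_ge0// -!powRrM mulfV ?gt_eqF// powRr1// mulrC ler_wpM2r//.
have e0 : 0 <= (1 - p / 2) / p by apply: divr_ge0; [lra|exact: ltW].
have e1 : (1 - p / 2) / p <= 1 by rewrite ler_pdivrMr//; lra.
have [m1|m1] := leP 1 m.
 by rewrite (le_trans (ler1_powR m1 e1))// lerDr.
apply: (@le_trans _ _ 1); last by rewrite lerDl.
apply: (@le_trans _ _ (1 `^ ((1 - p / 2) / p))); last by rewrite powR1.
by rewrite ge0_ler_powR ?nnegrE// ltW.
Qed.

End arithmetic.

(** * Convolution with smooth kernels *)

Section euclidean_regularity.
Context (R : realType) (n : nat).
Local Notation V := 'rV[R]_n.
Local Notation BV := (borel V).
Variable lam : {measure set BV -> \bar R}.
Hypothesis Hl : is_lebesgue lam.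

Section convolution.
Implicit Types (K : set V) (eta psi : V -> R) (w : BV -> R).

Lemma compact_norm0 (r : R) : compact [set u : V | `|u| <= r].
Proof.
rewrite (_ : [set u : V | _] = [set u : V | `|u - 0| <= r]); first exact: compact_normB.
by apply/seteqP; split=> u /=; rewrite subr0.
Qed.

Lemma meas_subp : measurable_fun [set: BV * BV] ((fun z => (z.1 : V) - z.2) : _ -> BV).
Proof.
have -> : (fun z : BV * BV => (z.1 : V) - z.2) = (fun z => (z.1 : V) + (-1) *: (z.2 : V)).
 by apply/funext => z; rewrite scaleN1r.
apply: (@meas_rVD R _ _ n); first exact: measurable_fst.
apply: (@meas_rVZ R _ _ n (fun=> -1)); [exact: measurable_cst|exact: measurable_snd].
Qed.

Lemma meas_subl (x : V) : mfun ((fun y : V => x - y) : BV -> BV).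
Proof.
have -> : (fun y : V => x - y) = (fun y => x + (-1) *: y) by apply/funext => z; rewrite scaleN1r.
apply: (@meas_rVD R _ _ n); first exact: measurable_cst.
by apply: (@meas_rVZ R _ _ n (fun=> -1)).
Qed.

Definition convol eta w (x : V) : R := I lam (fun y => eta (x - y) * w y).

Lemma conv_integ K eta w x : compact K -> csm K eta -> integ lam w ->
 integ lam (fun y => eta (x - y) * w y).
Proof.
move=> cK se iw; have [B B0 eB] := csm_bounded cK se.
have me : mfun (eta : BV -> R) by apply: meas_smcT; exact: se.1.
apply: (integ_le _ _ (integZ B (integ_abs iw))).
 apply: measurable_funM; last exact: integ_meas iw. exact: (measurableT_comp me (meas_subl x)).
by move=> y; rewrite normrM ler_wpM2r.
Qed.

Lemma csm_lipschitz K eta : compact K -> csm K eta ->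
 exists2 L, 0 <= L & forall (x y : V), `|eta x - eta y| <= L * `|x - y|.
Proof.
move=> cK se; have cK' := closed_rV cK.
have /choice[B HB] : forall a, exists B, 0 <= B /\ forall u, `|pd a eta u| <= B.
 by move=> a; have [B] := csm_bounded cK (csm_pd a cK' se); exists B.
exists (\sum_a B a); first by apply: sumr_ge0 => a _; case: (HB a).
move=> x y; have [xi _] := MVTh y (x - y) 1 se.1.
rewrite scale1r [y + _]addrC subrK mulr1 => ->.
apply: (le_trans (ler_norm_sum _ _ _)); rewrite mulr_suml; apply: ler_sum => a _.
rewrite normrM mulrC; apply: ler_pM => //; first by case: (HB a).
by rewrite -[_ - _]/(x - y); exact: rV_coord.
Qed.

Lemma csm_taylor K eta a : compact K -> csm K eta ->
 exists2 L, 0 <= L & forall (x : V) (t : R),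
  `|eta (x + t *: ev a) - eta x - t * pd a eta x| <= L * t ^+ 2.
Proof.
move=> cK se; have cK' := closed_rV cK.
have [L L0 HL] := csm_lipschitz cK (csm_pd a cK' se).
exists L => // x t; have [xi xit ->] := MVTh x (ev a) t se.1.
rewrite Dh_delta [t * _]mulrC -mulrBl normrM.
apply: (@le_trans _ _ (L * `|t| * `|t|)); last first.
 by rewrite -mulrA -expr2 real_normK ?num_real//.
rewrite ler_wpM2r//; apply: (le_trans (HL _ _)); rewrite ler_wpM2l//.
rewrite addrC addKr normrZ; apply: (le_trans _ xit); rewrite ler_piMr//.
by apply: rV_normP => // j; rewrite delta_coord; case: (_ == _); rewrite /= ?normr1 ?normr0.
Qed.

Lemma conv_Lipschitz K eta w : compact K -> csm K eta -> integ lam w ->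
 exists2 L, 0 <= L & forall (x y : V), `|convol eta w x - convol eta w y| <= L * `|x - y|.
Proof.
move=> cK se iw; have [L L0 HL] := csm_lipschitz cK se.
have N0 : 0 <= I lam (fun y => `|w y|) by apply: I_ge0.
exists (L * I lam (fun y => `|w y|)); first exact: mulr_ge0.
move=> x y; rewrite -(IB (conv_integ x cK se iw) (conv_integ y cK se iw)).
have iB := integB (conv_integ x cK se iw) (conv_integ y cK se iw).
apply: (le_trans (I_abs iB)).
have -> : L * I lam (fun y => `|w y|) * `|x - y| = I lam (fun z => (L * `|x - y|) * `|w z|).
 by rewrite (IZ _ (integ_abs iw)); ring.
apply: (I_le (integ_abs iB) (integZ _ (integ_abs iw))) => z.
rewrite -mulrBl normrM ler_wpM2r//; apply: (le_trans (HL _ _)).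
by rewrite opprB addrA subrK.
Qed.

(** The Taylor remainder of [eta] is quadratic uniformly in the point, which justifies
    differentiation under the integral for a merely integrable [w]. *)
Lemma conv_is_derive K eta w x a : compact K -> csm K eta -> integ lam w ->
 is_derive x (ev a) (convol eta w) (convol (pd a eta) w x).
Proof.
move=> cK se iw; have cK' := closed_rV cK.
have [L L0 HL] := csm_taylor a cK se; have ie := conv_integ x cK se iw.
have ip := conv_integ x cK (csm_pd a cK' se) iw.
pose N := I lam (fun y => `|w y|); have N0 : 0 <= N by apply: I_ge0.
have key (t : R) : `|convol eta w (t *: ev a + x) - convol eta w x - t * convol (pd a eta) w x| <= L * N * t ^+ 2.
 have it := conv_integ (t *: ev a + x) cK se iw.
 rewrite /convol -(IZ _ ip) -(IB it ie) -(IB (integB it ie) (integZ _ ip)).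
 have iB := integB (integB it ie) (integZ t ip). apply: (le_trans (I_abs iB)).
 have -> : L * N * t ^+ 2 = I lam (fun z => (L * t ^+ 2) * `|w z|).
  by rewrite (IZ _ (integ_abs iw)) /N; ring.
 apply: (I_le (integ_abs iB) (integZ _ (integ_abs iw))) => z. rewrite mulrA -!mulrBl normrM ler_wpM2r//.
 by have := HL (x - z) t; rewrite [x - z + _]addrC addrA.
have cv : (fun t : R => t^-1 *: (convol eta w (t *: ev a + x) - convol eta w x)) @ 0^' --> convol (pd a eta) w x.
 apply/cvgrPdist_le => /= e e0; near=> t. have tn : t != 0 by near: t; exact: nbhs_dnbhs_neq.
 have tt : 0 < `|t| by rewrite normr_gt0.
 rewrite -[X in `|_ - X|]/(t^-1 * (convol eta w (t *: ev a + x) - convol eta w x)).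
 rewrite distrC -(ler_pM2l tt) -normrM mulrBr mulrA mulfV// mul1r.
 apply: (le_trans (key t)); rewrite -[t ^+ 2]real_normK ?num_real// expr2 mulrA mulrC ler_wpM2l//.
 have : `|t| < e / (L * N + 1).
  near: t; apply: dnbhs0_lt; by rewrite divr_gt0// ltr_wpDl// mulr_ge0.
 rewrite ltr_pdivlMr ?ltr_wpDl ?mulr_ge0// mulrDr mulr1 => h.
 by rewrite mulrC; apply: ltW; apply: le_lt_trans h; rewrite lerDl.
by apply: DeriveDef; [apply/cvg_ex; exists (convol (pd a eta) w x)|exact: cvg_lim cv].
Unshelve. all: by end_near. Qed.

Lemma pd_conv K eta w a : compact K -> csm K eta -> integ lam w ->
 pd a (convol eta w) = convol (pd a eta) w.
Proof.
move=> cK se iw; apply/funext => x.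
by have [_] := conv_is_derive x a cK se iw.
Qed.

(** The convolutions of [w] with smooth functions vanishing off [K] form a class closed under
    differentiation. *)
Lemma smc_conv K eta w : compact K -> csm K eta -> integ lam w -> smc setT (convol eta w).
Proof.
move=> cK se iw; have cK' := closed_rV cK; apply: smc_base.
apply: (@smooth_on_coind R n setT (fun f => exists2 e, csm K e & f = convol e w)) => //; last by exists eta.
 exact: openT.
move=> _ [e se' ->]; split=> [u _|a]; last first.
 exists (convol (pd a e) w); first by exists (pd a e) => //; exact: csm_pd.
 by move=> u _; rewrite (pd_conv a cK se' iw).
split; last by move=> a; case: (conv_is_derive u a cK se' iw).
have [L L0 HL] := conv_Lipschitz cK se' iw.
apply/(@cvgrPdist_le _ _ _ (nbhs u)) => eps e0; have L1 : 0 < L + 1 by rewrite ltr_wpDl.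
apply/nbhs_ballP; exists (eps / (L + 1)); first by rewrite /= divr_gt0.
move=> v; rewrite -ball_normE /= => /ltW h; apply: (le_trans (HL _ _)).
apply: (@le_trans _ _ ((L + 1) * `|u - v|)); first by rewrite ler_wpM2r// lerDl.
by move: h; rewrite ler_pdivlMr// mulrC.
Qed.

Lemma csm_conv (r s : R) eta w : csm [set u : V | `|u| <= r] eta -> integ lam w ->
 (forall u : V, ~ `|u| <= s -> w u = 0) -> csm [set u : V | `|u| <= r + s] (convol eta w).
Proof.
move=> se iw w0; have cK : compact [set u : V | `|u| <= r].
 exact: compact_norm0.
split; first exact: (smc_conv cK se iw).
move=> u /= nu; rewrite /convol (_ : I lam _ = I lam (fun=> 0)); last first.
 apply: I_eq => y; have [ys|ys] := boolP (`|y : V| <= s); last first.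
  by rewrite w0 ?mulr0//; exact/negP.
 rewrite se.2 ?mul0r// => /= h; apply: nu; rewrite -[u](subrK y).
 by apply: (le_trans (ler_normD _ _)); rewrite lerD.
have iz : integ lam (fun=> 0) by apply: (eq_integ _ (integZ 0 iw)) => x; rewrite mul0r.
by rewrite -[RHS](mul0r (I lam (fun=> 0))) -(IZ 0 iz); rewrite mul0r.
Qed.

Lemma conv_adjoint (K K' : set V) eta w psi : compact K -> csm K eta -> compact K' -> csm K' psi ->
 integ lam w -> (forall u, eta (- u) = eta u) ->
 ipr lam (convol eta w) psi = ipr lam w (convol eta psi).
Proof.
move=> cK se cK' sp iw ev; have [B B0 eB] := csm_bounded cK se.
have ip := csm_integ Hl cK' sp.
have me : mfun (eta : BV -> R) by apply: meas_smcT; exact: se.1.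
have mw := integ_meas iw; have mp := integ_meas ip.
have mF : measurable_fun [set: BV * BV] (fun z => eta ((z.1 : V) - z.2) * w z.2 * psi z.1).
 apply: measurable_funM; last exact: measurableT_comp. apply: measurable_funM; last exact: measurableT_comp.
 exact: (measurableT_comp me meas_subp).
have F0 (x y : BV) : `|eta (x - y) * w y * psi x| <= (B * `|psi x|) * `|w y|.
 by rewrite !normrM mulrAC ler_wpM2r// ler_wpM2r.
have [h1 h2 _ _] := I_fubini Hl (F := fun x y => eta (x - y) * w y * psi x) mF F0 (integZ B (integ_abs ip)) (integ_abs iw).
move=> E; transitivity (I lam (fun x => I lam (fun y => eta (x - y) * w y * psi x))).
 apply: I_eq => x; rewrite mulrC -(IZ _ (conv_integ x cK se iw)); apply: I_eq => y; ring.
rewrite E; apply: I_eq => y; rewrite -(IZ _ (conv_integ y cK se ip)); apply: I_eq => x.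
by rewrite -ev opprB; ring.
Qed.

(** Schur's test for a kernel of size [B] and range [r]: Cauchy-Schwarz on each section, then
    Fubini. The balls of radius [r] have measure at most (4r)^n. *)
Lemma schur (k : V -> V -> R) (B r : R) w : 0 <= B -> 0 < r ->
 measurable_fun [set: BV * BV] (fun z : BV * BV => k z.1 z.2) ->
 (forall x y, `|k x y| <= B) -> (forall x y, r < `|x - y| -> k x y = 0) ->
 sqint lam w -> (exists s, forall u : V, ~ `|u| <= s -> w u = 0) ->
 sqint lam (fun x => ipr lam (k x) w) ->
 I lam (fun x => ipr lam (k x) w ^+ 2) <=
 (B * (4 * r) ^+ n) ^+ 2 * I2 lam w.
Proof.
move=> B0 r0 mk kB k0 w2 [s w0] sq.
pose N (x y : V) : R := (`|x - y| <= r)%R%:R.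
(* The ball |x - y| <= r is closed and boxes are half-open; doubling the side makes the inclusion
   hold. *)
pose bx x : set V := box (x - const_mx (2 * r)) (x + const_mx (2 * r)).
have Nb x y : N x y <= \1_(bx x) y.
 rewrite /N indicE; case: (boolP (`|x - y| <= r)) => //= h. rewrite mem_set//= => j.
 have := le_trans (rV_coord (x - y) j) h; rewrite !mxE ler_norml => /andP[]; lra.
have NC x y : N x y = N y x by rewrite /N distrC.
have N0 x y : 0 <= N x y by [].
have N1 x y : N x y <= 1 by rewrite /N; case: (`|x - y| <= r)%R.
have NN x y : N x y ^+ 2 = N x y by rewrite /N; case: (`|x - y| <= r)%R; rewrite /= ?expr1n ?expr0n.
have mN : measurable_fun [set: BV * BV] (fun z : BV * BV => N z.1 z.2).
 have -> : (fun z : BV * BV => N z.1 z.2) = \1_([set u : BV | `|u : V| <= r]) \o (fun z => (z.1 : V) - z.2).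
  by apply/funext => z /=; congr (nat_of_bool _)%:R; apply/idP/idP; rewrite inE.
 apply: measurableT_comp meas_subp; apply: measurable_indic.
 apply: borel_closed; apply: compact_closed (@compact_norm0 r); exact: norm_hausdorff.
have mNx x : mfun (N x : BV -> R).
 have := measurableT_comp mN (pair1_measurable (x : BV)); exact.
have bI x : integ lam (\1_(bx x : set BV) : BV -> R) /\ I lam (\1_(bx x : set BV) : BV -> R) = (4 * r) ^+ n.
 have [|h1 h2] := box_fin Hl (a := x - const_mx (2 * r)) (b := x + const_mx (2 * r)).
  by move=> j; rewrite !mxE; lra.
 split=> //; rewrite h2 (eq_bigr (fun=> 4 * r)) ?prodr_const ?card_ord// => j _. by rewrite !mxE; ring.
have iN x : integ lam (N x : BV -> R).
 by apply: (integ_le (mNx x) _ (bI x).1) => y; rewrite ger0_norm.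
have IN x : I lam (N x : BV -> R) <= (4 * r) ^+ n.
 by rewrite -(bI x).2; apply: (I_le (iN x) (bI x).1) => y.
have r4 : 0 <= (4 * r) ^+ n by rewrite exprn_ge0// mulr_ge0// ltW.
have sN x : sqint lam (N x : BV -> R).
 by split; [exact: mNx|apply: (eq_integ _ (iN x)) => y; rewrite NN].
have [mw iw2] := w2.
have iNw x : integ lam (fun y => N x y * w y ^+ 2).
 apply: (integ_le _ _ iw2); first by apply: measurable_funM => //; exact: measurable_funX.
 by move=> y; rewrite (ger0_norm (mulr_ge0 (N0 _ _) (sqr_ge0 _))) ler_piMl ?sqr_ge0.
have sNw x : sqint lam (fun y => N x y * w y).
 split; first exact: measurable_funM. by apply: (eq_integ _ (iNw x)) => y; rewrite exprMn NN.
have pt x : ipr lam (k x) w ^+ 2 <= B ^+ 2 * (4 * r) ^+ n * I lam (fun y => N x y * w y ^+ 2).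
 have skx : sqint lam (fun y => k x y).
  have mkx : mfun (k x : BV -> R).
   have := measurableT_comp mk (pair1_measurable (x : BV)); exact.
  split=> //; apply: (integ_le _ _ (integZ (B ^+ 2) (iN x))); first exact: measurable_funX.
  move=> y; rewrite ger0_norm ?sqr_ge0//; have [h|h] := leP `|x - y| r.
   by rewrite /N h mulr1 -real_normK ?num_real// lerXn2r.
  by rewrite k0// expr0n/= mulr_ge0// sqr_ge0.
 have -> : ipr lam (k x) w = I lam (fun y => k x y * (N x y * w y)).
  apply: I_eq => y; have [h|h] := leP `|x - y| r; first by rewrite /N h mul1r. by rewrite k0// !mul0r.
 apply: (le_trans (CS skx (sNw x))).
 have -> : I lam (fun y => (N x y * w y) ^+ 2) = I lam (fun y => N x y * w y ^+ 2).
  by apply: I_eq => y; rewrite exprMn NN.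
 rewrite ler_wpM2r//; first by apply: I_ge0 => y; rewrite mulr_ge0// sqr_ge0.
 apply: (@le_trans _ _ (B ^+ 2 * I lam (N x : BV -> R))); last by rewrite ler_wpM2l// sqr_ge0.
 rewrite -(IZ _ (iN x)); apply: (I_le skx.2 (integZ _ (iN x))) => y.
 have [h|h] := leP `|x - y| r; last by rewrite k0// expr0n/= mulr_ge0// sqr_ge0.
 by rewrite /N h mulr1 -real_normK ?num_real// lerXn2r.
pose bs : V := const_mx (`|s| + 2 * r).
have [|ib _] := box_fin Hl (a := - bs) (b := bs).
 by move=> j; rewrite !mxE; have := normr_ge0 s; lra.
have bd (x y : V) : `|N x y * w y ^+ 2| <= \1_(box (- bs) bs) x * w y ^+ 2.
 rewrite (ger0_norm (mulr_ge0 (N0 _ _) (sqr_ge0 _))); have [ys|ys] := boolP (`|y : V| <= s); last first.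
  by rewrite w0 ?expr0n/= ?mulr0//; exact/negP.
 rewrite ler_wpM2r ?sqr_ge0// /N indicE; case: (boolP (`|x - y| <= r)) => //= h. rewrite mem_set//= => j.
 have h1 := le_trans (rV_coord (x - y) j) h; have h2 := le_trans (rV_coord y j) ys.
 move: h1 h2; rewrite !mxE !ler_norml => /andP[h1 h2] /andP[h3 h4]. by have := ler_norm s; lra.
have mG : measurable_fun [set: BV * BV] (fun z : BV * BV => N z.1 z.2 * w z.2 ^+ 2).
 apply: measurable_funM => //; apply: measurable_funX; exact: measurableT_comp.
have [_ _ i3 i4 E] := I_fubini Hl (F := fun x y => N x y * w y ^+ 2) mG bd ib iw2.
apply: (@le_trans _ _ (B ^+ 2 * (4 * r) ^+ n * I lam (fun x => I lam (fun y => N x y * w y ^+ 2)))).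
 by rewrite -(IZ _ i3); apply: (I_le sq.2 (integZ _ i3)) => x.
rewrite E [(B * _) ^+ 2]exprMn mulrA -[leRHS]mulrA ler_wpM2l ?mulr_ge0//.
rewrite -(IZ _ iw2); apply: (I_le i4 (integZ _ iw2)) => y.
have -> : I lam (fun x => N x y * w y ^+ 2) = w y ^+ 2 * I lam (N y : BV -> R).
 by rewrite -(IZ _ (iN y)); apply: I_eq => x; rewrite NC mulrC.
by rewrite mulrC ler_wpM2r// sqr_ge0.
Qed.

End convolution.

(** * Mollifiers and weak derivatives *)

Section mollifiers.
Implicit Types (K : set V) (eta psi theta : V -> R) (w h : BV -> R).

Definition molr (k : nat) : R := k.+1%:R^-1.

Lemma molr_gt0 k : 0 < molr k. Proof. by rewrite invr_gt0. Qed.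

Lemma pd_indep a (f : V -> R) u : (forall (t : R) v, f (v + t *: ev a) = f v) ->
 pd a f u = 0.
Proof.
move=> h; rewrite /partial derive_line0 (_ : (fun t : R => _) = fun=> f u); first exact: derive_cst.
by apply/funext => t; rewrite addrC.
Qed.

Lemma pd_add a (f g : V -> R) u : smc setT f -> smc setT g ->
 pd a (fun v => f v + g v) u = pd a f u + pd a g u.
Proof.
move=> sf sg; rewrite /partial deriveD; first exact: erefl.
 by apply: (smc_derivable (W := setT)) sf; [exact: openT|].
by apply: (smc_derivable (W := setT)) sg; [exact: openT|].
Qed.

Lemma pd_sum (J : Type) (r : seq J) (f : J -> V -> R) a u : (forall j, smc setT (f j)) ->
 pd a (fun v => \sum_(j <- r) f j v) u = \sum_(j <- r) pd a (f j) u.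
Proof.
move=> sf; elim: r => [|j r IH].
 rewrite big_nil; apply: pd_indep => t v; by rewrite !big_nil.
rewrite big_cons -IH -(pd_add _ _ (sf j) (smc_sum _ sf)).
by congr partial; apply/funext => v; rewrite big_cons.
Qed.

Lemma pd_C a b (f : V -> R) : smc setT f -> pd a (pd b f) = pd b (pd a f).
Proof. by move=> sf; apply/funext => u; exact: (pdC a b openT Logic.I (smcT_on sf)). Qed.

(** The bump of radius [r] is the unit bump rescaled, so its derivatives are of order 1/r. *)
Lemma pd_box_bump : exists2 C, 0 <= C & forall (r : R) a u, 0 < r ->
 r * `|pd a (box_bump (0 : V) r) u| <= C.
Proof.
have s1 := smc_box_bump (setT : set V) 0 1; have K1 := @compact_norm0 1.
have c1 : csm [set u : V | `|u| <= 1] (box_bump 0 1).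
 by split=> // u nu; apply/eqP/negPn/negP => /(box_bump_neq0 ltr01); rewrite subr0 => h.
have /choice[B HB] : forall a, exists B, 0 <= B /\ forall u, `|pd a (box_bump (0 : V) 1) u| <= B.
 move=> a; have [B B0 h] := csm_bounded K1 (csm_pd a (closed_rV K1) c1). by exists B.
exists (\sum_a B a) => [|r a u r0]; first by apply: sumr_ge0 => a _; case: (HB a).
have -> : pd a (box_bump 0 r) u = r^-1 * pd a (box_bump 0 1) (r^-1 *: u).
 rewrite {1}/partial derive_line0. have -> : (fun t : R => box_bump 0 r (t *: ev a + u)) =
   fun t : R => box_bump 0 1 (r^-1 *: u + t *: (r^-1 *: ev a)).
  apply/funext => t; apply: eq_bigr => j _; congr sstep; rewrite !mxE; field. by rewrite gt_eqF.
 have [_ ->] := Dh_line (r^-1 *: u) (r^-1 *: ev a) 0 s1.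
 transitivity (r^-1 * Dh (ev a) (box_bump 0 1) (r^-1 *: u)); last by rewrite Dh_delta.
 by rewrite scale0r addr0 mulr_sumr; apply: eq_bigr => j _; rewrite mxE mulrA.
rewrite normrM ger0_norm ?invr_ge0 ?(ltW r0)// mulrA mulfV ?gt_eqF// mul1r.
apply: (le_trans ((HB a).2 _)); rewrite (bigD1 a)//= lerDl.
by apply: sumr_ge0 => j _; case: (HB j).
Qed.

(** The bumps are normalised by their mass, which is at least r^n for r = [molr k]. The last two
    bounds say that [eta k] is at most C/(4r)^n and its derivatives at most C/(r (4r)^n), the sizes
    for which [schur] gives constants independent of [k]. *)
Lemma mollifiers : exists (eta : nat -> V -> R) (C : R), 0 <= C /\ forall k,
 [/\ csm [set u : V | `|u| <= molr k] (eta k), (forall u, 0 <= eta k u) /\ (forall u, eta k (- u) = eta k u),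
   I lam (eta k : BV -> R) = 1, forall u, eta k u * (4 * molr k) ^+ n <= C &
   forall a u, molr k * `|pd a (eta k) u| * (4 * molr k) ^+ n <= C].
Proof.
have [C C0 HC] := pd_box_bump.
pose b k := box_bump (0 : V) (molr k); pose m k := I lam (b k : BV -> R).
have cb k : csm [set u : V | `|u| <= molr k] (b k).
 split; first exact: smc_box_bump.
 move=> u nu; apply/eqP/negPn/negP => /(box_bump_neq0 (molr_gt0 k)); rewrite subr0 => h; exact: nu.
have ib k := csm_integ Hl (@compact_norm0 (molr k)) (cb k).
have rn k : 0 < molr k ^+ n by rewrite exprn_gt0// molr_gt0.
have mr k : molr k ^+ n <= m k.
 have r0 := molr_gt0 k; pose c : V := const_mx (molr k / 2).
 have [|h1 h2] := box_fin Hl (a := - c) (b := c); first by move=> j; rewrite !mxE; lra.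
 have <- : I lam (\1_(box (- c) c : set BV) : BV -> R) = molr k ^+ n.
  rewrite h2 (eq_bigr (fun=> molr k)) ?prodr_const ?card_ord// => j _; by rewrite !mxE; field.
 apply: (I_le h1 (ib k)) => u; rewrite indicE. case: (boolP (u \in _)) => [|_]; last exact: box_bump_ge0.
 rewrite inE /= => hu; rewrite /b box_bump1//=; apply: rV_normP; first by rewrite divr_ge0// ltW.
 move=> j; have := hu j; rewrite !mxE ler_norml => /andP[]; lra.
have m0 k : 0 < m k by exact: lt_le_trans (mr k).
have cr k : (m k)^-1 * molr k ^+ n <= 1 by rewrite mulrC ler_pdivrMr// mul1r.
exists (fun k u => (m k)^-1 * b k u), (4 ^+ n * (1 + C)); split.
 by rewrite mulr_ge0// addr_ge0.
move=> k; have i0 : 0 <= (m k)^-1 by rewrite invr_ge0 ltW.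
have c1 : smc setT (b k) := (cb k).1.
split; [|split| | |].
- split; first by apply: smc_mul; [exact: smc_cst|].
 by move=> u nu; rewrite (cb k).2// mulr0.
- by move=> u; rewrite mulr_ge0// box_bump_ge0.
- move=> u; congr (_ * _); apply: eq_bigr => j _; by rewrite !mxE !subr0 sqrrN.
- by rewrite (IZ _ (ib k)) mulVf// gt_eqF.
- move=> u; rewrite exprMn mulrCA ler_wpM2l//.
 have bu : b k u <= 1.
  by apply: prodr_ile1 => j _; rewrite sstep_ge0 sstep_le1.
 apply: (@le_trans _ _ 1); last by rewrite lerDl.
 apply: (le_trans _ (cr k)); rewrite mulrAC ler_piMr// mulr_ge0// ltW//.
- move=> a u; rewrite (@pdM R n a (fun=> (m k)^-1) (b k) u) //; last exact: smc_cst.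
 rewrite (@pd_indep a (fun=> (m k)^-1))// mul0r add0r normrM (ger0_norm i0) exprMn mulrCA. rewrite ler_wpM2l//.
 have := HC (molr k) a u (molr_gt0 k); move: (`|_|) => z h.
 have -> : molr k * ((m k)^-1 * z) * molr k ^+ n = ((m k)^-1 * molr k ^+ n) * (molr k * z) by ring.
 have h0 : 0 <= (m k)^-1 * molr k ^+ n by rewrite mulr_ge0// ltW.
 apply: (@le_trans _ _ ((m k)^-1 * molr k ^+ n * C)); first by rewrite ler_wpM2l.
 by apply: (@le_trans _ _ (1 * C)); [rewrite ler_wpM2r|rewrite mul1r lerDr].
Qed.

(** Multiplying a test function by [kap] gives it compact support; as [kap] is 1 with vanishing
    derivatives on the ball, pairings with functions living there do not change. *)
Lemma cutball (s : R) : exists (kap : V -> R) (K : set V), [/\ compact K, csm K kap,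
 forall u, 0 <= kap u <= 1 & forall u : V, `|u| <= s -> kap u = 1 /\ forall a, pd a kap u = 0].
Proof.
have [k [K' [cK _] [sk k01 k0 [ O oO [KO k1]]]]] := plateau (@compact_norm0 s) openT (@subsetT _ _).
exists k, K'; split=> //.
 by split=> // u nu; apply/eqP/negPn/negP => /k0.
move=> u us; have Ou := KO u us; split; first exact: k1.
move=> a; rewrite (@pd_eq R n O k (fun=> 1) u a oO Ou k1).
exact: pd_indep.
Qed.

(** L2 functions vanishing outside some ball; their products with arbitrary smooth functions are
    integrable. *)
Definition L2c w := sqint lam w /\ exists s : R, forall u : V, ~ `|u| <= s -> w u = 0.

Lemma L2c_integ w : L2c w -> integ lam w.
Proof.
move=> [w2 [s ws]].
have [k Hk] : exists k, [set u : V | `|u| <= s] `<=` cube k.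
 by apply: (@lam_compact_bounded R n _ s).
apply: (sqint_integ_on (D := cube k : set BV) _ w2).
 by apply: (eq_integ _ (cube_integ Hl k 1)) => u; rewrite mul1r.
by move=> u nu; apply: ws => h; apply: nu; exact: Hk.
Qed.

Lemma csm_L2c K f : compact K -> csm K f -> L2c f.
Proof.
move=> cK sf; split; first exact: (csm_sqint Hl cK sf).
have [r _ Kr] := compact_norm cK; exists r => u nu; apply: sf.2 => /Kr; exact: nu.
Qed.

Lemma L2cM w theta : L2c w -> smc setT theta -> L2c (fun u => w u * theta u).
Proof.
move=> [[mw iw] [s ws]] st; have [kap [K [cK sk k01 k1]]] := cutball s.
have [B B0 HB] := csm_bounded cK (csmM st sk).
have mt := meas_smcT st.
split; last by exists s => u nu; rewrite ws// mul0r.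
split; first exact: measurable_funM.
apply: (integ_le _ _ (integZ (B ^+ 2) iw)).
 by apply: measurable_funX; exact: measurable_funM.
move=> u; rewrite ger0_norm ?sqr_ge0// exprMn mulrC.
have [us|us] := boolP (`|u : V| <= s); last by rewrite ws ?expr0n ?mulr0//; exact/negP.
rewrite ler_wpM2r ?sqr_ge0//; have := HB u; rewrite (k1 _ us).1 mulr1 => h.
by rewrite -[leLHS]real_normK ?num_real// lerXn2r.
Qed.

Lemma L2cD w h (c : R) : L2c w -> L2c h -> L2c (fun u => c * w u + h u).
Proof.
move=> [w2 [s ws]] [h2 [t ht]]; split; first exact: (sqintD (sqintZ c w2) h2).
exists (Num.max s t) => u nu.
by rewrite ws ?ht ?mulr0 ?addr0// => hu; apply: nu; rewrite le_max hu ?orbT.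
Qed.

Lemma L2c_sum (w : 'I_n -> BV -> R) : (forall a, L2c (w a)) -> L2c (fun u => \sum_a w a u).
Proof.
move=> hw; elim: (index_enum _) => [|a r IH].
 have -> : (fun u => \sum_(a <- [::]) w a u) = (fun u => 0) by apply/funext => u; rewrite big_nil.
 apply: (@csm_L2c set0); first exact: compact0. by split; [exact: smc_cst|].
have := L2cD 1 (hw a) IH.
by congr L2c; apply/funext => u; rewrite big_cons mul1r.
Qed.

Lemma L2c_integM w theta : L2c w -> smc setT theta -> integ lam (fun u => w u * theta u).
Proof. by move=> hw st; exact: L2c_integ (L2cM hw st). Qed.

(** Test functions may have unbounded support, because [w] and [h] are taken in [L2c]. *)
Definition weak a w h := forall psi, smc setT psi ->
 ipr lam w (pd a psi) = - ipr lam h psi.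

Lemma smc_refl (x : V) eta : smc setT eta -> smc setT (fun y => eta (x - y)).
Proof.
move=> se; apply: (@smc_comp R n setT n setT (fun y => x - y) eta openT) => // j; last exact: (smcP openT).
have -> : (fun u : V => (x - u) 0 j) = fun u => x 0 j + (-1) * u 0 j.
 by apply/funext => u; rewrite !mxE mulN1r.
by apply: smc_add; [exact: smc_cst|apply: smc_mul; [exact: smc_cst|exact: smc_coord]].
Qed.

Lemma pd_refl (x : V) eta a y : smc setT eta ->
 pd a (fun y => eta (x - y)) y = - pd a eta (x - y).
Proof.
move=> se; rewrite /partial derive_line0.
have -> : (fun t : R => eta (x - (t *: ev a + y))) = fun t : R => eta ((x - y) + t *: - ev a).
 by apply/funext => t; rewrite scalerN opprD addrA addrAC.
have [_ ->] := Dh_line (x - y) (- ev a) 0 se.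
transitivity (- Dh (ev a) eta (x - y)); last by rewrite Dh_delta.
by rewrite scale0r addr0 -sumrN; apply: eq_bigr => j _; rewrite mxE mulNr.
Qed.

(** The weak equation is tested with the reflected kernel y -> eta(x - y). *)
Lemma pd_conv_weak K eta w h a : compact K -> csm K eta -> L2c w -> L2c h -> weak a w h ->
 pd a (convol eta w) = convol eta h.
Proof.
move=> cK se hw hh W; rewrite (pd_conv a cK se (L2c_integ hw)); apply/funext => x.
have := W _ (smc_refl x se.1).
have -> : (fun u => w u * pd a (fun y : V => eta (x - y)) u) = fun u => - (pd a eta (x - u) * w u).
 by apply/funext => u; rewrite pd_refl ?mulrN 1?mulrC//; exact: se.1.
have cK' := closed_rV cK.
rewrite IN; last exact: (conv_integ x cK (csm_pd a cK' se) (L2c_integ hw)).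
by move=> /oppr_inj E; apply: (etrans E); apply: I_eq => u; rewrite mulrC.
Qed.

End mollifiers.

(** * Mollified functions and Friedrichs' commutator *)

Section mollified.
Variables (eta : nat -> V -> R) (C : R).
Hypothesis C0 : 0 <= C.
Hypothesis Heta : forall k,
 [/\ csm [set u : V | `|u| <= molr k] (eta k), (forall u, 0 <= eta k u) /\ (forall u, eta k (- u) = eta k u),
   I lam (eta k : BV -> R) = 1, forall u, eta k u * (4 * molr k) ^+ n <= C &
   forall a u, molr k * `|pd a (eta k) u| * (4 * molr k) ^+ n <= C].
Local Notation conv k := (convol (eta k)).
Let cB k := @compact_norm0 (molr k).
Let clB k : closed [set u : V | `|u| <= molr k]. Proof. by apply: closed_rV. Qed.
Let ceta k : csm [set u : V | `|u| <= molr k] (eta k). Proof. by case: (Heta k). Qed.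
Let seta k : smc setT (eta k) := (ceta k).1.

Section elliptic.
Implicit Types (K : set V) (psi theta : V -> R) (w h : BV -> R).

Lemma molr_le1 k : molr k <= 1.
Proof. by rewrite invf_le1// ler1n. Qed.

Lemma csm_convk k w : L2c w -> exists2 K, compact K & csm K (conv k w).
Proof.
move=> hw; have [_ [s ws]] := hw.
exists [set u : V | `|u| <= molr k + s]; first exact: compact_norm0.
exact: (csm_conv (ceta k) (L2c_integ hw) ws).
Qed.

Lemma conv_L2 k w : L2c w -> I2 lam (conv k w) <= C ^+ 2 * I2 lam w.
Proof.
move=> hw; have [_ ev i1 e1 _] := Heta k; have [w2 ws] := hw.
have r0 : 0 < (4 * molr k) ^+ n by rewrite exprn_gt0// mulr_gt0// molr_gt0.
have [K cK sK] := csm_convk k hw.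
have me := meas_smcT (seta k).
have := @schur (fun x y => eta k (x - y)) (C / (4 * molr k) ^+ n) (molr k) w _ (molr_gt0 k) _ _ _ w2 ws (csm_sqint Hl cK sK).
rewrite divfK ?gt_eqF//; apply.
- by rewrite divr_ge0// ltW.
- exact: (measurableT_comp me (@meas_subp)).
- by move=> x y; rewrite ger0_norm ?ler_pdivlMr// ev.1.
- move=> x y h; apply: (ceta k).2 => /= h'; by move: h; rewrite ltNge h'.
Qed.

(** The commutator has the kernel (A(x) - A(y)) d_b eta(x - y). Within the range r of the mollifier
    the Lipschitz factor L r compensates the size 1/r of the derivative, so the bound does not
    depend on [k]. *)
Lemma friedrichs k (A : V -> R) L b w : smc setT A -> 0 <= L -> (forall x y, `|A x - A y| <= L * `|x - y|) -> L2c w ->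
 exists2 K, compact K & csm K (fun x => A x * pd b (conv k w) x - pd b (conv k (fun y => w y * A y)) x) /\
 I lam (fun x => (A x * pd b (conv k w) x - pd b (conv k (fun y => w y * A y)) x) ^+ 2) <=
 (L * C) ^+ 2 * I2 lam w.
Proof.
move=> sA L0 AL hw; have hA := L2cM hw sA; have [w2 ws] := hw.
have [K1 cK1 s1] := csm_convk k hw; have [K2 cK2 s2] := csm_convk k hA.
pose K := K1 `|` K2; have cK : compact K by exact: compactU.
have s1' : csm K (fun x => A x * pd b (conv k w) x).
 apply: csmM => //; apply: csm_pd; first exact: compact_closed cK. apply: (csmS _ s1); exact: subsetUl.
have s2' : csm K (pd b (conv k (fun y => w y * A y))).
 apply: csm_pd; first exact: compact_closed cK. apply: (csmS _ s2); exact: subsetUr.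
have s3 : csm K (fun x => A x * pd b (conv k w) x - pd b (conv k (fun y => w y * A y)) x).
 have -> : (fun x => A x * pd b (conv k w) x - pd b (conv k (fun y => w y * A y)) x) =
   (fun x => A x * pd b (conv k w) x + (fun=> -1) x * pd b (conv k (fun y => w y * A y)) x).
  by apply/funext => x; rewrite mulN1r.
 apply: csmD => //; apply: csmM => //; exact: smc_cst.
exists K => //; split=> //.
have iw := L2c_integ hw; have iA := L2c_integ hA.
have cp := csm_pd b (@clB k) (ceta k).
pose kk x y := (A x - A y) * pd b (eta k) (x - y).
have E : (fun x => A x * pd b (conv k w) x - pd b (conv k (fun y => w y * A y)) x) = fun x => ipr lam (kk x) w.
 apply/funext => x; rewrite (pd_conv b (@cB k) (ceta k) iw) (pd_conv b (@cB k) (ceta k) iA).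
 have i1 := conv_integ x (@cB k) cp iw; have i2 := conv_integ x (@cB k) cp iA.
 rewrite -(IZ _ i1) -(IB (integZ _ i1) i2); apply: I_eq => y; rewrite /kk; ring.
have [_ _ _ _ e2] := Heta k.
have r0 : 0 < (4 * molr k) ^+ n by rewrite exprn_gt0// mulr_gt0// molr_gt0.
have kk0 x y : molr k < `|x - y| -> pd b (eta k) (x - y) = 0.
 by move=> h; apply: cp.2 => /= h'; move: h; rewrite ltNge h'.
have sq : sqint lam (fun x => ipr lam (kk x) w).
 by rewrite -E; exact: (csm_sqint Hl cK s3).
have mp := meas_smcT (smc_pd b (seta k)); have mA := meas_smcT sA.
have mk : measurable_fun [set: BV * BV] (fun z : BV * BV => kk z.1 z.2).
 apply: measurable_funM; last exact: (measurableT_comp mp (@meas_subp)).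
 apply: measurable_funB; [exact: measurableT_comp|exact: measurableT_comp].
have := @schur kk (L * C / (4 * molr k) ^+ n) (molr k) w _ (molr_gt0 k) mk _ _ w2 ws sq.
rewrite divfK ?gt_eqF// => h.
rewrite (_ : (fun x => _ ^+ 2) = fun x => ipr lam (kk x) w ^+ 2); last first.
 by apply/funext => x; congr (_ ^+ 2); exact: (congr1 (fun f => f x) E).
apply: h.
- by rewrite divr_ge0 ?mulr_ge0// ltW.
- move=> x y; rewrite ler_pdivlMr// normrM; have [h|h] := leP `|x - y| (molr k); last first.
  by rewrite kk0// normr0 mulr0 mul0r mulr_ge0.
 apply: (@le_trans _ _ (L * (molr k * `|pd b (eta k) (x - y)| * (4 * molr k) ^+ n))); last by rewrite ler_wpM2l.
 rewrite !mulrA ler_wpM2r ?(ltW r0)// ler_wpM2r//; apply: (le_trans (AL _ _)); by rewrite ler_wpM2l.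
- by move=> x y h; rewrite /kk kk0// mulr0.
Qed.

(** By the symmetry of [eta] the convolution is moved to the test function, on which it converges
    uniformly, with error at most L times [molr k]. *)
Lemma conv_cvg w psi : L2c w -> smc setT psi ->
 ipr lam (conv k w) psi @[k --> \oo] --> ipr lam w psi.
Proof.
move=> hw sp; have [w2 [s ws]] := hw; have iw := L2c_integ hw.
(* The mollified functions vanish outside the ball of radius s + 1, since all [molr k] are at most
   1. *)
have [kap [K [cK sk _ k1]]] := cutball (s + 1).
pose phi x := psi x * kap x; have sphi : csm K phi by exact: csmM.
have [L L0 HL] := csm_lipschitz cK sphi.
have E1 k : ipr lam (conv k w) psi = ipr lam w (conv k phi).
 have [_ ev _ _ _] := Heta k. rewrite -(conv_adjoint (@cB k) (ceta k) cK sphi iw ev.2); apply: I_eq => x.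
 have [xs|xs] := boolP (`|x : V| <= s + 1); first by rewrite /phi (k1 _ xs).1 mulr1.
 rewrite (csm_conv (ceta k) iw ws).2 ?mul0r//= => h; move/negP: xs; apply.
 by apply: (le_trans h); rewrite addrC lerD2l molr_le1.
have E2 : ipr lam w psi = ipr lam w phi.
 apply: I_eq => x; have [xs|xs] := boolP (`|x : V| <= s); last by rewrite ws ?mul0r//; exact/negP.
 have xs1 : `|x : V| <= s + 1 by apply: (le_trans xs); rewrite lerDl. by rewrite /phi (k1 _ xs1).1 mulr1.
have ip := csm_integ Hl cK sphi.
have cl k x : `|conv k phi x - phi x| <= L * molr k.
 have [_ [e0 ev] i1 _ _] := Heta k. have ie : integ lam (fun y => eta k (x - y)).
  have h := integ_shift Hl (- x) (csm_integ Hl (@cB k) (ceta k)).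
  by apply: (eq_integ _ h) => y; rewrite -ev opprB.
 have I1 : I lam (fun y => eta k (x - y)) = 1.
  rewrite -i1 !IU -(Rintegral_shift Hl (- x) (csm_integ Hl (@cB k) (ceta k))).
  by congr Rintegral; apply/funext => y; rewrite -ev opprB.
 have ic := conv_integ x (@cB k) (ceta k) ip.
 have iz : integ lam (fun y => phi x * eta k (x - y)) by exact: integZ.
 have -> : convol (eta k) phi x - phi x = I lam (fun y => eta k (x - y) * phi y - phi x * eta k (x - y)).
  by rewrite (IB ic iz) (IZ _ ie) I1 mulr1.
 apply: (le_trans (I_abs (integB ic iz))).
 have -> : L * molr k = I lam (fun y => L * molr k * eta k (x - y)) by rewrite (IZ _ ie) I1 mulr1.
 apply: (I_le (integ_abs (integB ic iz)) (integZ _ ie)) => y.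
 rewrite [phi x * _]mulrC -mulrBr normrM (ger0_norm (e0 _)) mulrC. have [h|h] := leP `|x - y| (molr k).
  rewrite ler_wpM2r//; apply: (le_trans (HL _ _)); by rewrite ler_wpM2l// distrC.
 by rewrite (ceta k).2 ?mulr0//= => h'; move: h; rewrite ltNge h'.
rewrite E2; apply/cvgrPdist_le => /= e e0.
pose N := I lam (fun x => `|w x|); have N0 : 0 <= N by apply: I_ge0.
have [m Hm] := invS_lt (e := e / (L * N + 1)) (divr_gt0 e0 (ltr_wpDl (mulr_ge0 L0 N0) ltr01)).
exists m => // k /= mk; rewrite E1.
have i1 := L2c_integM hw sphi.1.
have i2 : integ lam (fun x => w x * conv k phi x).
 by apply: (L2c_integM hw); exact: smc_conv.
rewrite -(IB i1 i2); apply: (le_trans (I_abs (integB i1 i2))).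
apply: (@le_trans _ _ (I lam (fun x => (L * molr k) * `|w x|))).
 apply: (I_le (integ_abs (integB i1 i2)) (integZ _ (integ_abs iw))) => x.
 rewrite -mulrBr normrM mulrC ler_wpM2r// distrC; exact: cl.
rewrite (IZ _ (integ_abs iw)) mulrAC.
have km : molr k <= e / (L * N + 1).
 by apply: (le_trans _ (ltW Hm)); rewrite lef_pV2 ?posrE// ler_nat.
apply: (@le_trans _ _ ((L * N + 1) * molr k)).
 by rewrite ler_wpM2r ?lerDl// ltW// molr_gt0.
by rewrite mulrC -ler_pdivlMr// ltr_wpDl// mulr_ge0.
Qed.

(** A weak derivative by duality: the bound on the mollifications passes to the limit and makes psi
    -> - int w d_a psi bounded in L2, so that Riesz' theorem gives a representative. *)
Lemma weak_of_bounded w a B : L2c w ->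
 (forall k, I2 lam (pd a (conv k w)) <= B) ->
 exists2 h, L2c h & weak a w h.
Proof.
move=> hw HB; have [w2 [s ws]] := hw.
have [kap [K [cK sk k01 k1]]] := cutball s.
have [r _ Kr] := compact_norm cK; have [m Km] := lam_compact_bounded Kr.
pose l (psi : V -> R^o) : R := - ipr lam w (pd a psi).
have kE psi u : smc setT psi -> w u * pd a (fun v => kap v * psi v) u = w u * pd a psi u.
 move=> sp; have [us|us] := boolP (`|u : V| <= s); last by rewrite ws ?mul0r//; exact/negP.
 by rewrite (pdM a u sk.1 sp) (k1 _ us).1 (k1 _ us).2 mul0r add0r mul1r.
have sN psi : smc setT psi -> csm K (fun v => kap v * psi v).
 by move=> sp; split; [apply: smc_mul => //; exact: sk.1|move=> u nu; rewrite sk.2// mul0r].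
have lb psi : smc setT psi -> l psi ^+ 2 <= B * I lam (fun u => (kap u * psi u) ^+ 2).
 move=> sp; have sK := sN _ sp; pose X := B * I lam (fun u => (kap u * psi u) ^+ 2).
 have cv : (- ipr lam (conv k w) (pd a (fun v => kap v * psi v))) ^+ 2 @[k --> \oo] --> l psi ^+ 2.
  have h : - ipr lam (conv k w) (pd a (fun v => kap v * psi v)) @[k --> \oo] --> l psi.
   apply: cvgN; rewrite (_ : I lam _ = ipr lam w (pd a (fun v => kap v * psi v))).
    by apply: conv_cvg => //; exact: smc_pd sK.1.
   by apply: I_eq => x; rewrite kE.
  exact: cvgM.
 rewrite -(cvg_lim (@Rhausdorff R) cv); apply: limr_le; first by apply/cvg_ex; exists (l psi ^+ 2).
 apply: nearW => k /=; have [K1 cK1 s1] := csm_convk k hw. have ccl : closed K1 by apply: compact_closed cK1.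
 rewrite (ibp Hl a cK s1.1 sK) opprK.
 apply: (le_trans (CS (csm_sqint Hl cK1 (csm_pd a ccl s1)) (csm_sqint Hl cK sK))).
 by rewrite ler_wpM2r//; apply: I_ge0 => x; exact: sqr_ge0.
have iD : integ lam (\1_(cube m : set BV) : BV -> R).
 by apply: (eq_integ _ (cube_integ Hl m 1)) => u; rewrite mul1r.
have pl (c : R) p q u : smc setT p -> smc setT q -> pd a (c *: p + q : V -> R^o) u = c * pd a p u + pd a q u.
 move=> sp sq; apply: (etrans (pd_add a u (smc_mul (smc_cst _ c) sp) sq)).
 by rewrite (pdM a u (smc_cst _ c) sp) (@pd_indep a (fun=> c)) ?mul0r ?add0r.
have [z [p_ [_ z2 _] Hz]] := @riesz_range_on _ _ _ lam (cube m) iD (V -> R^o)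
 (fun psi : V -> R => smc setT psi) (fun psi u => kap u * psi u) l B
 (smc_cst _ 0)
 (fun c p q sp sq => smc_add (smc_mul (smc_cst _ c) sp) sq)
 (fun c p q u sp sq => ltac:(rewrite /= !fctE /GRing.scale /=; ring))
 (fun c p q sp sq => ltac:(idtac; rewrite /l (_ : I lam _ = I lam (fun u => c * (w u * pd a p u) + w u * pd a q u));
   [rewrite (ID (integZ c (L2c_integM hw (smc_pd a sp))) (L2c_integM hw (smc_pd a sq))) (IZ c (L2c_integM hw (smc_pd a sp))); ring
   |apply: I_eq => u; rewrite pl//; ring]))
 (fun p sp => csm_sqint Hl cK (sN p sp))
 (fun p u sp nu => ltac:(by rewrite /= (sk.2 u (fun ku => nu (Km u ku))) mul0r))
 lb.
exists (fun u => z u * kap u).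
 split; last first.
  by exists r => u nu; rewrite sk.2 ?mulr0// => /Kr.
 have [mz iz] := z2; have mk := meas_smcT sk.1. split; first exact: measurable_funM.
 apply: (integ_le _ _ iz); first by apply: measurable_funX; exact: measurable_funM.
 move=> u; rewrite ger0_norm ?sqr_ge0// exprMn ler_piMr ?sqr_ge0//.
 by have /andP[h0 h1] := k01 u; rewrite expr_le1.
move=> psi sp; have := Hz psi sp; rewrite /l => /eqP; rewrite eqr_oppLR => /eqP E.
by apply: (etrans E); congr (- _); apply: I_eq => u; rewrite mulrA.
Qed.

End elliptic.

(** * Regularity for elliptic equations in divergence form *)

Section elliptic_regularity.
Implicit Types (K : set V) (psi theta : V -> R) (w h : BV -> R).

Lemma sum_arith (d q x y : R) (N e : 'I_n -> R) :
 \sum_a \sum_(b < n) (d * N a + q * x) + (\sum_b (d * N b + q * e b) + y) =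
 d * n.+1%:R * \sum_a N a + (\sum_(a < n) \sum_(b < n) q * x + \sum_b q * e b + y).
Proof.
under eq_bigr do rewrite big_split/=.
rewrite !big_split/= -[\sum_(i < n) d * N i]mulr_sumr.
have -> : \sum_(a < n) \sum_(b < n) d * N a = n%:R * (d * \sum_a N a).
 by rewrite mulr_sumr mulr_sumr; apply: eq_bigr => a _; rewrite sumr_const card_ord mulr_natl.
rewrite -natr1; ring.
Qed.

Lemma half_absorb (e x y : R) : 0 < e -> e * x <= e / 2 * x + y -> x <= y / (e / 2).
Proof. by move=> e0 h; rewrite ler_pdivlMr// ; lra. Qed.

Lemma mul_sum2 (x y : R) (f : 'I_n -> 'I_n -> R) :
 x * (y + \sum_a \sum_b f a b) = x * y + \sum_a \sum_b x * f a b.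
Proof. by rewrite mulrDr mulr_sumr; congr (_ + _); apply: eq_bigr => a _; rewrite mulr_sumr. Qed.

Lemma I_young (delta : R) (f g : BV -> R) : 0 < delta -> sqint lam f -> sqint lam g ->
 ipr lam f g <= delta * I2 lam f + delta^-1 * I2 lam g.
Proof.
move=> d0 f2 g2; have [_ i1] := f2; have [_ i2] := g2.
rewrite -(IZ _ i1) -(IZ _ i2) -(ID (integZ _ i1) (integZ _ i2)).
apply: (I_le (sqintM f2 g2) (integD (integZ _ i1) (integZ _ i2))) => u.
have h : 0 <= delta^-1 * (delta * f u - g u) ^+ 2 by rewrite mulr_ge0 ?sqr_ge0// invr_ge0 ltW.
have E : delta^-1 * (delta * f u - g u) ^+ 2 = delta * f u ^+ 2 + delta^-1 * g u ^+ 2 - 2 * (f u * g u).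
 by field; rewrite gt_eqF.
have h1 : 0 <= delta * f u ^+ 2 by rewrite mulr_ge0 ?sqr_ge0// ltW.
have h2 : 0 <= delta^-1 * g u ^+ 2 by rewrite mulr_ge0 ?sqr_ge0// invr_ge0 ltW.
move: h h1 h2; lra.
Qed.

Variables (A : 'I_n -> 'I_n -> V -> R) (c L : R).
Hypothesis sA : forall a b, smc setT (A a b).
Hypothesis L0 : 0 <= L.
Hypothesis AL : forall a b x y, `|A a b x - A a b y| <= L * `|x - y|.
Hypothesis c0 : 0 < c.
Hypothesis ell : forall u (x : 'I_n -> R), c * \sum_a x a ^+ 2 <= \sum_a \sum_b x a * (A a b u * x b).

Definition divop psi (u : V) : R := \sum_a \sum_b pd a (fun v => A a b v * pd b psi v) u.

Let sAp a b psi : smc setT psi -> smc setT (fun v => A a b v * pd b psi v).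
Proof. by move=> sp; apply: smc_mul; [exact: sA|exact: smc_pd]. Qed.

Lemma smc_divop psi : smc setT psi -> smc setT (divop psi).
Proof. by move=> sp; apply: smc_sum => a; apply: smc_sum => b; apply: smc_pd; exact: sAp. Qed.

(** The weak form of sum_ab d_b (A_ab d_a w) = F0 - sum_b d_b F_b, with all derivatives on the test
    function. Since [F] enters under a divergence, [w] gains one derivative over [F]. *)
Definition weak_eq w (F : 'I_n -> BV -> R) (F0 : BV -> R) := forall psi, smc setT psi ->
 ipr lam w (divop psi) =
 \sum_b ipr lam (F b) (pd b psi) + ipr lam F0 psi.

Lemma I_sum2 (f : 'I_n -> 'I_n -> BV -> R) : (forall a b, integ lam (f a b)) ->
 I lam (fun u => \sum_a \sum_b f a b u) = \sum_a \sum_b I lam (f a b).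
Proof.
move=> hf; rewrite I_sum; last by move=> a; apply: integ_sum.
by apply: eq_bigr => a _; rewrite I_sum.
Qed.

Section base.
Variables (w : BV -> R) (F : 'I_n -> BV -> R) (F0 : BV -> R).
Hypothesis hw : L2c w.
Hypothesis hF : forall b, L2c (F b).
Hypothesis hF0 : L2c F0.
Hypothesis E : weak_eq w F F0.

Let f b : BV -> R := fun u => (-1) * F b u + \sum_a w u * pd a (A a b) u.
Let hf b : L2c (f b).
Proof.
by apply: L2cD => //; apply: (L2c_sum) => a; apply: L2cM => //; exact: smc_pd.
Qed.

(** The weak equation tested with y -> eta_k(x - y): an equation for the mollified function with the
    coefficients left inside the convolution. [f] collects the data and the derivatives of the
    coefficients. *)
Lemma div_identity k x : \sum_a \sum_b pd a (pd b (conv k (fun y => w y * A a b y))) x =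
 \sum_b pd b (conv k (f b)) x + conv k F0 x.
Proof.
have se := (ceta k).1; have spsi := smc_refl x se.
have cp b := csm_pd b (@clB k) (ceta k).
have ip (e : V -> R) (g : BV -> R) : csm [set u : V | `|u| <= molr k] e -> L2c g ->
  integ lam (fun y => e (x - y) * g y).
 by move=> ce hg; exact: (conv_integ x (@cB k) ce (L2c_integ hg)).
have hA a b : L2c (fun y => w y * A a b y) by exact: L2cM.
have hpA a b : L2c (fun y => w y * pd a (A a b) y) by apply: L2cM => //; exact: smc_pd.
have E1 a b : pd a (pd b (conv k (fun y => w y * A a b y))) x =
  I lam (fun y => pd a (pd b (eta k)) (x - y) * (w y * A a b y)).
 rewrite (pd_conv b (@cB k) (ceta k) (L2c_integ (hA a b))).
 by rewrite (pd_conv a (@cB k) (cp b) (L2c_integ (hA a b))).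
have E2 b : pd b (conv k (f b)) x =
  - I lam (fun y => pd b (eta k) (x - y) * F b y) +
  \sum_a I lam (fun y => pd b (eta k) (x - y) * (w y * pd a (A a b) y)).
 rewrite (pd_conv b (@cB k) (ceta k) (L2c_integ (hf b))).
 rewrite -(IN (ip _ _ (cp b) (hF b))) -I_sum; last by move=> a; exact: ip.
 rewrite -ID; [|exact: (integN (ip _ _ (cp b) (hF b)))|by apply: integ_sum => a; exact: ip].
 by apply: I_eq => y; rewrite mulrDr mulr_sumr mulN1r mulrN.
have E3 a b y : pd a (fun v => A a b v * pd b (fun y => eta k (x - y)) v) y =
  pd a (pd b (eta k)) (x - y) * A a b y - pd b (eta k) (x - y) * pd a (A a b) y.
 have -> : (fun v => A a b v * pd b (fun y => eta k (x - y)) v) = fun v => A a b v * (fun v => (-1) * pd b (eta k) (x - v)) v.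
  by apply/funext => v; rewrite pd_refl// mulN1r.
 have sp := smc_pd b se; have sr := smc_refl x sp.
 rewrite (pdM a y (sA a b) (smc_mul (smc_cst _ _) sr)) (pdM a y (smc_cst _ (-1)) sr) pd_refl//.
 rewrite (@pd_indep a (fun=> -1))//; ring.
have := E spsi.
have -> : ipr lam w (divop (fun y => eta k (x - y))) =
  \sum_a \sum_b (I lam (fun y => pd a (pd b (eta k)) (x - y) * (w y * A a b y)) -
   I lam (fun y => pd b (eta k) (x - y) * (w y * pd a (A a b) y))).
 have ii a b : integ lam (fun y => pd a (pd b (eta k)) (x - y) * (w y * A a b y) - pd b (eta k) (x - y) * (w y * pd a (A a b) y)).
  by apply: integB; [exact: (ip _ _ (csm_pd a (@clB k) (cp b)) (hA a b))|exact: ip].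
 transitivity (\sum_a \sum_b I lam (fun y => pd a (pd b (eta k)) (x - y) * (w y * A a b y) - pd b (eta k) (x - y) * (w y * pd a (A a b) y))).
  rewrite -(I_sum2 ii); apply: I_eq => y; rewrite mulr_sumr; apply: eq_bigr => a _.
  rewrite mulr_sumr; apply: eq_bigr => b _; rewrite E3; ring.
 apply: eq_bigr => a _; apply: eq_bigr => b _.
 by rewrite IB//; [exact: (ip _ _ (csm_pd a (@clB k) (cp b)) (hA a b))|exact: ip].
under eq_bigr do rewrite sumrB.
rewrite sumrB => /eqP; rewrite subr_eq => /eqP h.
under eq_bigr do under eq_bigr do rewrite E1.
rewrite h; under [in RHS]eq_bigr do rewrite E2.
rewrite big_split/= [in RHS]exchange_big/= -!addrA; congr (_ + _).
 apply: eq_bigr => b _; rewrite -(IN (ip _ _ (cp b) (hF b))); apply: I_eq => y. by rewrite pd_refl// mulrN mulrC.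
by rewrite addrC; congr (_ + _); apply: I_eq => y; rewrite mulrC.
Qed.

(** Ellipticity bounds the gradient of the mollification W by the pairings of d_a W with A_ab d_b W.
    Up to the Friedrichs commutator [D], the latter is d_b of the mollified w A_ab, to which
    [div_identity] applies after an integration by parts. Young's inequality absorbs the
    gradient. *)
Lemma energy_bound : exists B, forall k a, I2 lam (pd a (conv k w)) <= B.
Proof.
pose NN (g : BV -> R) := I2 lam g.
have NN0 g : 0 <= NN g by exact: I2_ge0.
(* The gradient occurs n times with the commutators and once with [f], each time with weight [d];
   together they use half of the ellipticity constant. *)
pose d := c / 2 / n.+1%:R.
have d0 : 0 < d by rewrite !divr_gt0.
pose T := \sum_(a < n) \sum_(b < n) d^-1 * ((L * C) ^+ 2 * NN w) + \sum_b d^-1 * (C ^+ 2 * NN (f b)) +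
 (C ^+ 2 * NN w + C ^+ 2 * NN F0).
exists (T / (c / 2)) => k a0.
have [K cK sW] := csm_convk k hw; set W := conv k w in sW *.
have cl : closed K by apply: (closed_rV).
have sp a := csm_pd a cl sW.
have qp a := csm_sqint Hl cK (sp a); have qW := csm_sqint Hl cK sW.
pose S := \sum_a NN (pd a W).
have /choice[Kf cKf] : forall b, exists Kb : set V, compact Kb /\ csm Kb (conv k (f b)).
 by move=> b; have [K' h1 h2] := csm_convk k (hf b); exists K'.
have qE b := csm_sqint Hl (cKf b).1 (cKf b).2.
have [K0 cK0 s0] := csm_convk k hF0; have q0 := csm_sqint Hl cK0 s0.
pose H a b := pd b (conv k (fun y => w y * A a b y)).
have hA a b : L2c (fun y => w y * A a b y) by exact: L2cM.
have sH a b : smc setT (H a b).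
 by apply: smc_pd; exact: (smc_conv (@cB k) (ceta k) (L2c_integ (hA a b))).
pose D a b x := A a b x * pd b W x - H a b x.
have FD a b : sqint lam (D a b : BV -> R) /\ NN (D a b) <= (L * C) ^+ 2 * NN w.
 have [K' cK' [s' h']] := friedrichs k b (sA a b) L0 (AL a b) hw. by split=> //; exact: (csm_sqint Hl cK' s').
have iH a b : integ lam (fun x => pd a W x * H a b x).
 apply: (csm_integ Hl cK).
 by split; [apply: smc_mul; [exact: (sp a).1|exact: sH]|move=> u nu; rewrite (sp a).2// mul0r].
have iD a b : integ lam (fun x => pd a W x * D a b x) by exact: (sqintM (qp a) (FD a b).1).
have ell_int : c * S <= \sum_a \sum_b ipr lam (pd a W) (D a b) + \sum_a \sum_b ipr lam (pd a W) (H a b).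
 rewrite -(I_sum2 iD) -(I_sum2 iH).
 have is1 : integ lam (fun u => \sum_a \sum_b pd a W u * D a b u) by apply: integ_sum => a; apply: integ_sum.
 have is2 : integ lam (fun u => \sum_a \sum_b pd a W u * H a b u) by apply: integ_sum => a; apply: integ_sum.
 have isq : integ lam (fun u => \sum_a pd a W u ^+ 2) by apply: integ_sum => a; exact: (qp a).2.
 rewrite -(ID is1 is2) /S -I_sum; last by move=> a; exact: (qp a).2.
 rewrite -(IZ _ isq); apply: (I_le (integZ _ isq) (integD is1 is2)) => x.
 apply: (le_trans (ell x (fun a => pd a W x))). rewrite -big_split/=; apply: eq_le_; apply: eq_bigr => a _.
 rewrite -big_split/=; apply: eq_bigr => b _; by rewrite mulrBr subrK.
have iWE b : integ lam (fun x => pd b (conv k (f b)) x * W x).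
 by apply: (csm_integ Hl cK); apply: csmM => //; apply: smc_pd; exact: (cKf b).2.1.
have iW0 : integ lam (fun x => conv k F0 x * W x).
 by apply: (csm_integ Hl cK); apply: csmM => //; exact: s0.1.
have HE : \sum_a \sum_b ipr lam (pd a W) (H a b) = \sum_b ipr lam (pd b W) (conv k (f b)) - ipr lam (conv k F0) W.
 have i3 a b : integ lam (fun x => pd a (H a b) x * W x).
  by apply: (csm_integ Hl cK); apply: csmM => //; apply: smc_pd.
 transitivity (- I lam (fun x => \sum_a \sum_b pd a (H a b) x * W x)).
  rewrite (I_sum2 i3) -sumrN; apply: eq_bigr => a _; rewrite -sumrN; apply: eq_bigr => b _.
  by rewrite -(ibp Hl a cK (sH a b) sW); apply: I_eq => x; rewrite mulrC.
 rewrite (_ : I lam (fun x => \sum_a \sum_b _) = I lam (fun x => \sum_b pd b (conv k (f b)) x * W x + conv k F0 x * W x)); last first.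
  apply: I_eq => x; rewrite -mulr_suml -mulrDl -div_identity mulr_suml; apply: eq_bigr => a _.
  by rewrite mulr_suml.
 rewrite ID//; last by apply: integ_sum. rewrite I_sum// opprD -sumrN; congr (_ - _); apply: eq_bigr => b _.
 rewrite -(ibp Hl b cK (cKf b).2.1 sW); by apply: I_eq => x; rewrite mulrC.
have main : c * S <= d * n.+1%:R * S + T.
 apply: (le_trans ell_int); rewrite HE.
 apply: (@le_trans _ _ (\sum_a \sum_(b < n) (d * NN (pd a W) + d^-1 * ((L * C) ^+ 2 * NN w)) +
   (\sum_b (d * NN (pd b W) + d^-1 * (C ^+ 2 * NN (f b))) + (C ^+ 2 * NN w + C ^+ 2 * NN F0)))).
  apply: lerD.
   apply: ler_sum => a _; apply: ler_sum => b _.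
   apply: (le_trans (I_young d0 (qp a) (FD a b).1)); rewrite lerD2l ler_wpM2l ?invr_ge0 ?(ltW d0)//.
   exact: (FD a b).2.
  apply: lerD.
   apply: ler_sum => b _; apply: (le_trans (I_young d0 (qp b) (qE b))).
   rewrite lerD2l ler_wpM2l ?invr_ge0 ?(ltW d0)//; exact: conv_L2.
  have iW0' := integN iW0. apply: (@le_trans _ _ (I lam (fun x => - (conv k F0 x) * W x))).
   rewrite -(IN iW0); apply: (I_le iW0') => [|x]; last by rewrite mulNr.
   by apply: (eq_integ _ iW0') => x; rewrite mulNr.
  apply: (le_trans (I_young ltr01 (sqintN q0) qW)); rewrite invr1 !mul1r addrC; apply: lerD.
   exact: conv_L2.
  rewrite (_ : I lam _ = NN (conv k F0)); first exact: conv_L2. by apply: I_eq => x; rewrite sqrrN.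
 apply: eq_le_; exact: sum_arith.
have dE : d * n.+1%:R = c / 2 by rewrite divfK.
have h : S <= T / (c / 2).
 by move: main; rewrite dE; exact: half_absorb.
apply: (le_trans _ h); rewrite /S (bigD1 a0)//= lerDl; apply: sumr_ge0 => a _; exact: NN0.
Qed.

End base.

(** The Sobolev space of order [s], restricted to functions of bounded support. *)
Fixpoint Hs (s : nat) (w : BV -> R) : Prop :=
 L2c w /\ if s is s'.+1 then forall a, exists2 h, Hs s' h & weak a w h else True.

Lemma Hs_L2c s w : Hs s w -> L2c w. Proof. by case: s => [|s] []. Qed.

Lemma HsW s w : Hs s.+1 w -> Hs s w.
Proof.
elim: s w => [|s IH] w [hw hd]; split=> // a; have [h hh Wh] := hd a.
by exists h => //; exact: IH.
Qed.

Lemma HsD s e w w' : Hs s w -> Hs s w' -> Hs s (fun u => e * w u + w' u).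
Proof.
elim: s w w' => [|s IH] w w' [hw hd] [hw' hd']; split=> //; try exact: L2cD.
move=> a; have [h hh Wh] := hd a; have [h' hh' Wh'] := hd' a.
exists (fun u => e * h u + h' u); first exact: IH.
move=> psi sp; have sa := smc_pd a sp.
have i1 := L2c_integM hw sa; have i2 := L2c_integM hw' sa.
have i3 := L2c_integM (Hs_L2c hh) sp; have i4 := L2c_integM (Hs_L2c hh') sp.
transitivity (e * ipr lam w (pd a psi) + ipr lam w' (pd a psi)).
 by rewrite -(IZ _ i1) -(ID (integZ _ i1) i2); apply: I_eq => u; ring.
rewrite (Wh _ sp) (Wh' _ sp) mulrN -opprD -(IZ _ i3) -(ID (integZ _ i3) i4); congr (- _).
apply: I_eq => u; ring.
Qed.

Lemma Hs_csm s K w : compact K -> csm K w -> Hs s w.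
Proof.
move=> cK; elim: s w => [|s IH] w sw; split=> //; try exact: (csm_L2c cK sw).
have cl : closed K by apply: (closed_rV).
move=> a; exists (pd a w); first by apply: IH; exact: csm_pd.
move=> psi sp; have := ibp Hl a cK sp sw => h.
have i1 : ipr lam (pd a psi) w = - ipr lam psi (pd a w).
 by rewrite h opprK.
rewrite (_ : ipr lam w (pd a psi) = ipr lam (pd a psi) w).
 by rewrite i1; congr (- _); apply: I_eq => u; rewrite mulrC.
by apply: I_eq => u; rewrite mulrC.
Qed.

Lemma Hs0 s : Hs s (fun=> 0).
Proof. by apply: (Hs_csm s (@compact0 V)); split=> //; exact: smc_cst. Qed.

Lemma Hs_sum s (w : 'I_n -> BV -> R) : (forall a, Hs s (w a)) -> Hs s (fun u => \sum_a w a u).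
Proof.
move=> hw; elim: (index_enum _) => [|a r IH].
 by have := Hs0 s; congr Hs; apply/funext => u; rewrite big_nil.
by have := HsD 1 (hw a) IH; congr Hs; apply/funext => u; rewrite big_cons mul1r.
Qed.

Lemma HsM s w theta : Hs s w -> smc setT theta -> Hs s (fun u => w u * theta u).
Proof.
elim: s w theta => [|s IH] w theta [hw hd] st; split=> //; try exact: L2cM.
move=> a; have [h hh Wh] := hd a; have sta := smc_pd a st.
exists (fun u => 1 * (h u * theta u) + w u * pd a theta u).
 by apply: HsD; [exact: IH|apply: IH => //; exact: HsW].
move=> psi sp; have := Wh _ (smc_mul st sp).
have hL := Hs_L2c hh.
have i1 := L2c_integM (L2cM hw st) (smc_pd a sp).
have i2 := L2c_integM (L2cM hw sta) sp.
have i3 := L2c_integM (L2cM hL st) sp.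
have -> : ipr lam w (pd a (fun u0 => theta u0 * psi u0)) =
  I lam (fun u => w u * theta u * pd a psi u) + I lam (fun u => w u * pd a theta u * psi u).
 by rewrite -(ID i1 i2); apply: I_eq => u; rewrite pdM//; ring.
have -> : I lam (fun u => (1 * (h u * theta u) + w u * pd a theta u) * psi u) =
  I lam (fun u => h u * theta u * psi u) + I lam (fun u => w u * pd a theta u * psi u).
 by rewrite -(ID i3 i2); apply: I_eq => u; ring.
have -> : I lam (fun u => h u * (theta u * psi u)) = I lam (fun u => h u * theta u * psi u).
 by apply: I_eq => u; ring.
lra.
Qed.

Lemma divop_pd e psi u : smc setT psi -> pd e (divop psi) u =
 divop (pd e psi) u + \sum_a \sum_b pd a (fun v => pd e (A a b) v * pd b psi v) u.
Proof.
move=> sp; rewrite pd_sum; last first.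
 by move=> a; apply: smc_sum => b; apply: smc_pd; exact: sAp.
rewrite -big_split/=; apply: eq_bigr => a _; rewrite pd_sum; last by move=> b; apply: smc_pd; exact: sAp.
rewrite -big_split/=; apply: eq_bigr => b _.
have sb := smc_pd b sp.
rewrite pd_C ; last exact: sAp.
rewrite -pd_add; last 2 first.
- by apply: smc_mul => //; exact: smc_pd (smc_pd _ _).
- by apply: smc_mul => //; exact: smc_pd.
congr partial; apply/funext => v; apply: (etrans (pdM e v (sA a b) sb)).
by rewrite addrC (pd_C e b sp).
Qed.

(** The weak derivative in direction [e] solves an equation of the same kind, to which the induction
    hypothesis applies; the start is [energy_bound] with [weak_of_bounded]. *)
Lemma elliptic_regularity s w F F0 : Hs s w -> (forall b, Hs s (F b)) -> Hs s F0 -> weak_eq w F F0 -> Hs s.+1 w.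
Proof.
elim: s w F F0 => [|s IH] w F F0 hw hF hF0 E.
 have [hw0 _] := hw; split=> // a. have [B HB] := energy_bound hw0 (fun b => Hs_L2c (hF b)) (Hs_L2c hF0) E.
 by have [h hh Wh] := weak_of_bounded hw0 (fun k => HB k a); exists h.
have [hw0 hd] := hw; split=> // e.
have /choice[h /all_and2[hh Wh]] : forall a, exists ha : BV -> R, Hs s ha /\ weak a w ha.
 by move=> a; have [h ? ?] := hd a; exists h.
have /choice[G /all_and2[hG WG]] : forall b, exists Gb : BV -> R, Hs s Gb /\ weak e (F b) Gb.
 by move=> b; have [_ /(_ e)[g ? ?]] := hF b; exists g.
have hF0' := HsW hF0.
exists (h e) => //.
pose Q b (u : BV) : R := \sum_a h a u * pd e (A a b) u.
have hQ b : Hs s (Q b) by apply: Hs_sum => a; apply: HsM => //; exact: smc_pd.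
(* Data of the differentiated equation: the derivative of [F], the derivative of the coefficients
   applied to the gradient of [w], and [F0], which enters under a divergence and is thus not
   differentiated. *)
pose F' b (u : BV) : R := 1 * G b u + ((- (b == e)%:R) * F0 u + Q b u).
have hF' b : Hs s (F' b) by apply: HsD => //; exact: HsD.
apply: (IH (h e) F' (fun=> 0)) => //; first exact: Hs0.
move=> psi sp; have L2 (g : BV -> R) : Hs s g -> L2c g := @Hs_L2c s g.
have := Wh e _ (smc_divop sp) => /eqP; rewrite -eqr_oppLR => /eqP <-.
have se := smc_pd e sp.
have i1 : integ lam (fun u => w u * divop (pd e psi) u) by exact: (L2c_integM hw0 (smc_divop se)).
have sab a b : smc setT (fun v => pd e (A a b) v * pd b psi v).
 by apply: smc_mul; apply: smc_pd.
have i2 a b : integ lam (fun u => w u * pd a (fun v => pd e (A a b) v * pd b psi v) u).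
 by apply: (L2c_integM hw0); apply: smc_pd.
have -> : ipr lam w (pd e (divop psi)) = ipr lam w (divop (pd e psi)) +
  \sum_a \sum_b ipr lam w (pd a (fun v => pd e (A a b) v * pd b psi v)).
 rewrite -(I_sum2 i2) -ID//; last by apply: integ_sum => a; apply: integ_sum.
 apply: I_eq => u; exact: (etrans (congr1 (fun z => w u * z) (divop_pd e u sp)) (mul_sum2 _ _ _)).
rewrite (E _ se).
have -> : \sum_b ipr lam (F b) (pd b (pd e psi)) = - \sum_b ipr lam (G b) (pd b psi).
 rewrite -sumrN; apply: eq_bigr => b _; rewrite (pd_C b e sp); exact: (WG b _ (smc_pd b sp)).
have -> : \sum_a \sum_b ipr lam w (pd a (fun v => pd e (A a b) v * pd b psi v)) =
  - \sum_b ipr lam (Q b) (pd b psi).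
 rewrite exchange_big/= -sumrN; apply: eq_bigr => b _.
 have i3 a : integ lam (fun u => h a u * (pd e (A a b) u * pd b psi u)).
  exact: (L2c_integM (L2 _ (hh a)) (sab a b)).
 transitivity (- \sum_a I lam (fun u => h a u * (pd e (A a b) u * pd b psi u))).
  by rewrite -sumrN; apply: eq_bigr => a _; exact: (Wh a _ (sab a b)).
 rewrite -I_sum//; congr (- _); apply: I_eq => u; rewrite /Q mulr_suml; apply: eq_bigr => a _; ring.
have -> : I lam (fun u => 0 * psi u) = 0.
 rewrite -[RHS](mul0r (ipr lam F0 psi)) -(IZ _ (L2c_integM (L2 _ hF0') sp)). by apply: I_eq => u; rewrite !mul0r.
have -> : \sum_b ipr lam (F' b) (pd b psi) =
  \sum_b ipr lam (G b) (pd b psi) - ipr lam F0 (pd e psi) + \sum_b ipr lam (Q b) (pd b psi).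
 have -> : ipr lam F0 (pd e psi) = \sum_b (b == e)%:R * ipr lam F0 (pd b psi).
  by rewrite (bigD1 e)//= eqxx mul1r big1 ?addr0// => b /negbTE ->; rewrite mul0r.
 rewrite -sumrN -!big_split/=; apply: eq_bigr => b _; have sb := smc_pd b sp.
 have j1 := L2c_integM (L2 _ (hG b)) sb; have j2 := L2c_integM (L2 _ hF0') sb.
 have j3 := L2c_integM (L2 _ (hQ b)) sb.
 rewrite -mulNr -(IZ _ j2) -(ID j1 (integZ _ j2)) -(ID (integD j1 (integZ _ j2)) j3).
 apply: I_eq => u; rewrite /F'; ring.
ring.
Qed.

End elliptic_regularity.

(** * Sup bounds for mollifications by a discrete Sobolev inequality *)

Section sup_bound.
Implicit Types (K : set V) (g : V -> R) (js : seq 'I_n).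

(** These boxes interpolate between the unit cube at [x], for [js] empty, and the cube of side [e],
    for [js] all indices: a pointwise bound is reached by shrinking one direction at a time. *)
Definition side js (e : R) : V := \row_j (if j \in js then e else 1).
Definition sbox x js e : set V := box x (x + side js e).

Lemma sbox_fin x js e : 0 <= e -> uniq js -> integ lam (\1_(sbox x js e : set BV) : BV -> R) /\
 I lam (\1_(sbox x js e : set BV) : BV -> R) = e ^+ size js.
Proof.
move=> e0 ujs; have [|h1 h2] := box_fin Hl (a := x) (b := x + side js e).
 by move=> j; rewrite !mxE lerDl; case: ifP.
split=> //; rewrite h2.
transitivity (\prod_(j < n) (if j \in js then e else 1)).
 by apply: eq_bigr => j _; rewrite !mxE addrAC subrr add0r.
rewrite -big_mkcond/= prodr_const; congr (_ ^+ _); exact/card_uniqP.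
Qed.

(** The mean of g^2 over [sbox x js e] when [js] has no repetitions. *)
Definition mass x js e g := (e ^+ size js)^-1 * I lam (fun u => \1_(sbox x js e) u * g u ^+ 2).

Lemma integ_indic_csm (A : set BV) K g : measurable A -> compact K -> csm K g ->
 integ lam (fun u => \1_A u * g u ^+ 2).
Proof.
move=> mA cK sg; have [mg ig] := csm_sqint Hl cK sg.
apply: (integ_le _ _ ig); first by apply: measurable_funM; [exact: measurable_indic|exact: measurable_funX].
move=> u; rewrite indicE; case: (u \in A); rewrite /= ?mul1r ?mul0r ?normr0 ?sqr_ge0//.
by rewrite ger0_norm ?sqr_ge0.
Qed.

(** The translates occupy consecutive intervals in direction [j], so a point lies in at most one of
    them. *)
Lemma slices_disjoint x js j N (v : V) : j \notin js ->
 \sum_(l < N.+1) \1_(sbox x (j :: js) N.+1%:R^-1) (v - (l%:R / N.+1%:R) *: ev j) <=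
 \1_(sbox x js N.+1%:R^-1) v :> R.
Proof.
move=> jjs; pose e : R := N.+1%:R^-1; have e0 : 0 < e by rewrite invr_gt0.
have Ne : N.+1%:R * e = 1 :> R by rewrite mulfV.
pose inl (l : 'I_N.+1) := sbox x (j :: js) e (v - (l%:R / N.+1%:R) *: ev j).
have jl l : inl l -> x 0 j + l%:R * e <= v 0 j < x 0 j + l%:R * e + e.
 move=> /(_ j); rewrite !mxE !eqxx inE eqxx /= => /andP[h1 h2]. by apply/andP; rewrite -/e in h1 h2 *; lra.
have inA l : inl l -> sbox x js e v.
 move=> hl i; have := hl i; rewrite !mxE inE /=; have [->|ij] := eqVneq i j; last first.
  by rewrite mulr0 subr0 /=.
 rewrite (negbTE jjs) => _; have /andP[h1 h2] := jl _ hl. have hl1 : l%:R * e + e <= 1.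
  rewrite -[leRHS]Ne -[X in _ + X]mul1r -mulrDl natr1 ler_pM2r// ler_nat; exact: ltn_ord.
 by apply/andP; split; [apply: le_trans h1; rewrite lerDl mulr_ge0// ltW|lra].
have uq l l' : inl l -> inl l' -> (l <= l')%N.
 move=> h h'; have /andP[h1 _] := jl _ h; have /andP[_ h2] := jl _ h'.
 rewrite -ltnS -(ltr_nat R) -(ltr_pM2r e0) ; lra.
have [[l hl]|none] := pselect (exists l, inl l); last first.
 rewrite big1; first by rewrite indicE. by move=> l _; rewrite indicE memNset// => h; apply: none; exists l.
rewrite (bigD1 l)//= big1 ?addr0; last first.
 move=> l' ll'; rewrite indicE memNset// => h; move/negP: ll'; apply; apply/eqP/val_inj/eqP.
 by rewrite eqn_leq (uq _ _ h hl) (uq _ _ hl h).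
apply: (@le_trans _ _ 1); first by rewrite indicE; case: (_ \in _).
by rewrite indicE mem_set//; exact: inA hl.
Qed.

Lemma I_slices x js j N K g : j \notin js -> compact K -> csm K g ->
 \sum_(l < N.+1) I lam (fun u => \1_(sbox x (j :: js) N.+1%:R^-1) u * g ((u : V) + (l%:R / N.+1%:R) *: ev j) ^+ 2) <=
 I lam (fun u => \1_(sbox x js N.+1%:R^-1) u * g u ^+ 2).
Proof.
move=> jjs cK sg; set e : R := N.+1%:R^-1; pose h (l : 'I_N.+1) : V := (l%:R / N.+1%:R) *: ev j.
have mB js' : measurable (sbox x js' e : set BV) by exact: meas_box.
have iA := integ_indic_csm (mB js) cK sg.
have il l : integ lam (fun u => \1_(sbox x (j :: js) e) (u - h l) * g u ^+ 2).
 have [mg ig] := csm_sqint Hl cK sg. apply: (integ_le _ _ ig).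
  apply: measurable_funM; last exact: measurable_funX. exact: meas_comp_shift.
 move=> u; rewrite indicE; case: (_ \in _); rewrite /= ?mul1r ?mul0r ?normr0 ?sqr_ge0//.
 by rewrite ger0_norm ?sqr_ge0.
have E l : I lam (fun u => \1_(sbox x (j :: js) e) u * g (u + h l) ^+ 2) =
  I lam (fun u => \1_(sbox x (j :: js) e) (u - h l) * g u ^+ 2).
 rewrite !IU -(Rintegral_shift Hl (h l) (il l)); congr Rintegral. by apply/funext => u; rewrite addrK.
under eq_bigr do rewrite E.
rewrite -I_sum//; apply: (I_le _ iA); first by apply: integ_sum.
by move=> u; rewrite -mulr_suml ler_wpM2r ?sqr_ge0//; exact: slices_disjoint.
Qed.

Lemma telescope_bound g j (Ct : R) N (e : R) (u : V) (l : nat) : e = N.+1%:R^-1 -> (l <= N.+1)%N ->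
 (forall (y : V) (t : R), `|g (y + t *: ev j) - g y - t * pd j g y| <= Ct * t ^+ 2) ->
 (g (u + (l%:R / N.+1%:R) *: ev j) - g u) ^+ 2 <=
 2 * e * \sum_(i < N.+1) pd j g (u + (i%:R / N.+1%:R) *: ev j) ^+ 2 + 2 * Ct ^+ 2 * e ^+ 2.
Proof.
move=> Ee lN HT.
have Ne : N.+1%:R * e = 1 :> R by rewrite Ee mulfV.
pose p (i : nat) : V := u + (i%:R / N.+1%:R) *: ev j.
have pS i : p i.+1 = p i + e *: ev j.
 by rewrite /p -addrA -scalerDl -Ee -natr1 mulrDl mul1r.
have step i : (g (p i.+1) - g (p i)) ^+ 2 <= 2 * e ^+ 2 * pd j g (p i) ^+ 2 + 2 * Ct ^+ 2 * e ^+ 4.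
 have := HT (p i) e; rewrite -pS; move: (g (p i.+1) - g (p i)) (pd j g (p i)) => a b h.
 have {}h : (a - e * b) ^+ 2 <= (Ct * e ^+ 2) ^+ 2.
  rewrite -[leLHS]real_normK ?num_real// lerXn2r// ; exact: le_trans h.
 have := sqr_ge0 (e * b - (a - e * b)); move: h. have -> : (Ct * e ^+ 2) ^+ 2 = Ct ^+ 2 * e ^+ 4 by ring.
 have -> : 2 * e ^+ 2 * b ^+ 2 = 2 * (e * b) ^+ 2 by ring. rewrite -[2 * Ct ^+ 2 * e ^+ 4]mulrA; nra.
have tel : g (p l) - g u = \sum_(i < l) (g (p i.+1) - g (p i)).
 rewrite -(big_mkord xpredT (fun i => g (p i.+1) - g (p i))) telescope_sumr//.
 by rewrite {3}/p mul0r scale0r addr0.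
rewrite tel; apply: (le_trans (@sqr_sum_le R l (fun i => g (p i.+1) - g (p i)))).
have h0 (i : nat) : 0 <= 2 * e ^+ 2 * pd j g (p i) ^+ 2 + 2 * Ct ^+ 2 * e ^+ 4.
 by apply: (le_trans _ (step i)); exact: sqr_ge0.
apply: (@le_trans _ _ (N.+1%:R * \sum_(i < N.+1) (2 * e ^+ 2 * pd j g (p i) ^+ 2 + 2 * Ct ^+ 2 * e ^+ 4))).
 apply: ler_pM => //; first by apply: sumr_ge0 => i _; exact: sqr_ge0.
  by rewrite ler_nat.
 rewrite -(big_mkord xpredT (fun i => (g (p i.+1) - g (p i)) ^+ 2)).
 rewrite -(big_mkord xpredT (fun i => 2 * e ^+ 2 * pd j g (p i) ^+ 2 + 2 * Ct ^+ 2 * e ^+ 4)).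
 rewrite [leRHS](big_cat_nat (leq0n l) lN)/=.
 apply: (@le_trans _ _ (\sum_(0 <= i < l) (2 * e ^+ 2 * pd j g (p i) ^+ 2 + 2 * Ct ^+ 2 * e ^+ 4))).
  by apply: ler_sum => i _.
 by rewrite lerDl; apply: sumr_ge0 => i _.
rewrite big_split/= -mulr_sumr sumr_const card_ord.
move: (\sum_(i < N.+1) _) => S; apply: eq_le_.
transitivity ((N.+1%:R * e) * (2 * e * S) + (N.+1%:R * e) ^+ 2 * (2 * Ct ^+ 2 * e ^+ 2)); first by ring.
by rewrite Ne expr1n !mul1r.
Qed.

(** The thin box is compared with its N+1 translates in direction [j], which are disjoint and lie in
    the box not yet shrunk in that direction. The differences telescope into derivatives with a
    Taylor error of order e^2: a discrete form of g(0)^2 <= 2 int g^2 + 4 int g'^2 that avoids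
    integrating over lines. *)
Lemma mass_step K g j : compact K -> csm K g -> exists2 B, 0 <= B & forall x js N, uniq (j :: js) ->
 let e := N.+1%:R^-1 in
 mass x (j :: js) e g <= 2 * mass x js e g + 4 * mass x js e (pd j g) + B * e ^+ 2.
Proof.
move=> cK sg; have cl : closed K by apply: (closed_rV).
have [Ct Ct0 HT] := csm_taylor j cK sg; have sp := csm_pd j cl sg.
exists (4 * Ct ^+ 2); first by rewrite mulr_ge0 ?sqr_ge0.
move=> x js N /= /andP[jjs ujs]; set e : R := N.+1%:R^-1; have e0 : 0 < e by rewrite invr_gt0.
have Ne : N.+1%:R * e = 1 :> R by rewrite mulfV.
pose h (l : nat) : V := (l%:R / N.+1%:R) *: ev j.
have mB js' : measurable (sbox x js' e : set BV) by exact: meas_box.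
have [ibx Ibx] := sbox_fin x (ltW e0) (js := j :: js) (introT andP (conj jjs ujs)).
have ish (f : V -> R) l : csm K f -> integ lam (fun u => \1_(sbox x (j :: js) e) u * f (u + h l) ^+ 2).
 move=> sf; have [mf if_] := csm_sqint Hl cK sf. have := integ_shift Hl (h l) if_ => i1. apply: (integ_le _ _ i1).
  apply: measurable_funM; first exact: measurable_indic. apply: measurable_funX; exact: meas_comp_shift.
 move=> u; rewrite indicE; case: (u \in _); rewrite /= ?mul1r ?mul0r ?normr0 ?sqr_ge0//.
 by rewrite ger0_norm ?sqr_ge0.
have i0 := integ_indic_csm (mB (j :: js)) cK sg.
have is1 := integ_sum (index_enum 'I_N.+1) (fun l : 'I_N.+1 => ish g l sg).
have is2 := integ_sum (index_enum 'I_N.+1) (fun l : 'I_N.+1 => ish _ l sp).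
have key : N.+1%:R * I lam (fun u => \1_(sbox x (j :: js) e) u * g u ^+ 2) <=
  2 * I lam (fun u => \1_(sbox x js e) u * g u ^+ 2) +
  4 * I lam (fun u => \1_(sbox x js e) u * pd j g u ^+ 2) + 4 * N.+1%:R * Ct ^+ 2 * e ^+ 2 * e ^+ (size js).+1.
 apply: (@le_trans _ _ (2 * \sum_(l < N.+1) I lam (fun u => \1_(sbox x (j :: js) e) u * g (u + h l) ^+ 2) +
   4 * \sum_(l < N.+1) I lam (fun u => \1_(sbox x (j :: js) e) u * pd j g (u + h l) ^+ 2) +
   4 * N.+1%:R * Ct ^+ 2 * e ^+ 2 * I lam (\1_(sbox x (j :: js) e : set BV) : BV -> R))).
  rewrite -(I_sum _ (fun l : 'I_N.+1 => ish g l sg)) -(I_sum _ (fun l : 'I_N.+1 => ish _ l sp)).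
  rewrite -(IZ _ i0) -(IZ _ is1) -(IZ _ is2) -(IZ _ ibx) -(ID (integZ _ is1) (integZ _ is2)).
  rewrite -(ID (integD (integZ _ is1) (integZ _ is2)) (integZ _ ibx)).
  apply: (I_le (integZ _ i0) (integD (integD (integZ _ is1) (integZ _ is2)) (integZ _ ibx))) => u.
  rewrite indicE; case: (u \in _); last first.
   by rewrite /= mul0r !big1 ?mulr0// => i _; rewrite mul0r.
  rewrite /= mul1r mulr1; under eq_bigr do rewrite mul1r; under [X in _ + 4 * X + _]eq_bigr do rewrite mul1r.
  set S1 := \sum_(i < _) _; set S2 := \sum_(i < _) _.
  have -> : N.+1%:R * g u ^+ 2 = \sum_(l < N.+1) g u ^+ 2 by rewrite sumr_const card_ord mulr_natl.
  apply: (@le_trans _ _ (\sum_(l < N.+1) (2 * g (u + h l) ^+ 2 + (4 * e * S2 + 4 * Ct ^+ 2 * e ^+ 2)))).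
   apply: ler_sum => l _; have := telescope_bound u (erefl e) (ltnW (ltn_ord l)) HT.
   have -> : 4 * e * S2 = 2 * (2 * e * S2) by ring.
   have -> : 4 * Ct ^+ 2 * e ^+ 2 = 4 * (Ct ^+ 2 * e ^+ 2) by ring.
   have -> : 2 * Ct ^+ 2 * e ^+ 2 = 2 * (Ct ^+ 2 * e ^+ 2) by ring.
   move: (2 * e * S2) (Ct ^+ 2 * e ^+ 2) (g u) (g (u + h l)) => y z a b. by have := sqr_ge0 (2 * b - a); nra.
  rewrite big_split/= -mulr_sumr sumr_const card_ord -[_ *+ N.+1]mulr_natl le_eqVlt; apply/orP; left.
  have -> : N.+1%:R * (4 * e * S2 + 4 * Ct ^+ 2 * e ^+ 2) = 4 * (N.+1%:R * e) * S2 + 4 * N.+1%:R * Ct ^+ 2 * e ^+ 2 by ring.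
  by rewrite Ne mulr1 addrA.
 rewrite Ibx; apply: lerD; last exact: lexx.
 by apply: lerD; rewrite ler_wpM2l//; [exact: (I_slices x N jjs cK sg)|exact: (I_slices x N jjs cK sp)].
rewrite /mass /=.
have ek : 0 < e ^+ size js by rewrite exprn_gt0.
rewrite mulrC ler_pdivrMr ?exprn_gt0//.
have -> : I lam (fun u => \1_(sbox x (j :: js) e) u * g u ^+ 2) = e * (N.+1%:R * I lam (fun u => \1_(sbox x (j :: js) e) u * g u ^+ 2)).
 by rewrite mulrA [e * _]mulrC Ne mul1r.
apply: (@le_trans _ _ _ _ _ (ler_wpM2l (ltW e0) key)).
move: (I lam _) (I lam _) => X Y; rewrite [e ^+ (size js).+1]exprS; move: (e ^+ size js) ek => q q0.
apply: eq_le_.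
have -> : e * (2 * Y + 4 * X + 4 * N.+1%:R * Ct ^+ 2 * e ^+ 2 * (e * q)) =
 e * (2 * Y + 4 * X) + (N.+1%:R * e) * (4 * Ct ^+ 2 * e ^+ 2 * (e * q)) by ring.
by rewrite Ne; field; rewrite !gt_eqF.
Qed.

(** For [js] without repetitions: the sum of the squared L2 norms of the mixed derivatives in which
    each direction of [js] occurs at most once. *)
Fixpoint mixed js g : R := if js is j :: js' then mixed js' g + mixed js' (pd j g)
 else I2 lam g.

Lemma mixed_ge0 js g : 0 <= mixed js g.
Proof.
elim: js g => [|j js IH] g /=; last by rewrite addr_ge0.
by exact: I2_ge0.
Qed.

Lemma mass_mixed K js : compact K -> uniq js -> forall g, csm K g -> exists2 B, 0 <= B & forall x N,
 mass x js N.+1%:R^-1 g <= 4 ^+ size js * mixed js g + B * N.+1%:R^-1 ^+ 2.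
Proof.
move=> cK; have cl : closed K by apply: (closed_rV).
elim: js => [|j js IH] ujs g sg.
 exists 0 => // x N; rewrite /mass /= invr1 !mul1r mul0r addr0.
 have mB : measurable (sbox x [::] N.+1%:R^-1 : set BV) by exact: meas_box.
 apply: (I_le (integ_indic_csm mB cK sg) (csm_sqint Hl cK sg).2) => u.
 by rewrite indicE; case: (u \in _); rewrite /= ?mul1r ?mul0r ?sqr_ge0.
have ujs' : uniq js by case/andP: ujs.
have [B1 B10 H1] := IH ujs' _ sg; have [B2 B20 H2] := IH ujs' _ (csm_pd j cl sg).
have [B3 B30 H3] := mass_step j cK sg.
exists (2 * B1 + 4 * B2 + B3); first by rewrite !addr_ge0// mulr_ge0.
move=> x N; apply: (le_trans (H3 x js N ujs)); have h1 := H1 x N; have h2 := H2 x N.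
have m0 := mixed_ge0 js g; have q0 := exprn_ge0 (size js) (ler0n R 4); have qm := mulr_ge0 q0 m0.
move: h1 h2 qm; rewrite /= [4 ^+ (size js).+1]exprS.
move: (mixed js g) (mixed js (pd j g)) (4 ^+ size js) (N.+1%:R^-1 ^+ 2) => m m' q s.
have -> : 4 * q * (m + m') + (2 * B1 + 4 * B2 + B3) * s =
 4 * (q * m) + 4 * (q * m') + 2 * (B1 * s) + 4 * (B2 * s) + B3 * s by ring.
move: (q * m) (q * m') (B1 * s) (B2 * s) (B3 * s) => *; lra.
Qed.

(** As the side e of the cube tends to 0, the mean of g^2 tends to g(x)^2, while the error term of
    [mass_mixed] is of order e^2. *)
Lemma sup_mixed K g x : compact K -> csm K g -> g x ^+ 2 <= 2 * 4 ^+ n * mixed (enum 'I_n) g.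
Proof.
move=> cK sg; have [B B0 HB] := mass_mixed cK (enum_uniq 'I_n) sg.
have [L L0 HL] := csm_lipschitz cK sg.
have small N : g x ^+ 2 <= 2 * 4 ^+ n * mixed (enum 'I_n) g + (2 * B + 2 * L ^+ 2) * N.+1%:R^-1.
 set e : R := N.+1%:R^-1; have e0 : 0 < e by rewrite invr_gt0. have e1 : e <= 1 by rewrite invf_le1// ler1n.
 have mB : measurable (sbox x (enum 'I_n) e : set BV) by exact: meas_box.
 have [ibx Ibx] := sbox_fin x (ltW e0) (enum_uniq 'I_n). have i0 := integ_indic_csm mB cK sg. have h := HB x N.
 have hm : g x ^+ 2 <= 2 * mass x (enum 'I_n) e g + 2 * L ^+ 2 * e ^+ 2.
  have ek : 0 < e ^+ size (enum 'I_n) by rewrite exprn_gt0. rewrite -(ler_pM2r ek) mulrDl.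
  rewrite [2 * (_^-1 * _)]mulrA -[2 * _^-1 * _ * _]mulrA [I lam _ * _]mulrC mulrA divfK ?gt_eqF//.
  rewrite -Ibx -(IZ _ ibx) -(IZ _ ibx) -(IZ _ i0) -(ID (integZ _ i0) (integZ _ ibx)).
  apply: (I_le (integZ _ ibx) (integD (integZ _ i0) (integZ _ ibx))) => u.
  rewrite indicE; case: (boolP (u \in _)) => [|_]; last by rewrite !mulr0 mul0r. rewrite inE /= => hu.
  have ux : `|x - u| <= e.
   apply: rV_normP; first exact: ltW. move=> j; have := hu j; rewrite !mxE mem_enum inE => /andP[h1 h2].
   by rewrite ler_norml; lra.
  have := le_trans (HL x u) (ler_wpM2l L0 ux) => hh. have {}hh : (g x - g u) ^+ 2 <= L ^+ 2 * e ^+ 2.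
   by rewrite -exprMn -[leLHS]real_normK ?num_real// lerXn2r ?nnegrE ?mulr_ge0// ltW.
  rewrite -[2 * L ^+ 2 * _]mulrA; move: hh; move: (L ^+ 2 * e ^+ 2) (g x) (g u) => z a b.
  have := sqr_ge0 (a - 2 * b); nra.
 have es : e ^+ 2 <= e by rewrite ler_piMl// ltW.
 rewrite size_enum_ord in h; move: h hm; move: (mixed _ _) (4 ^+ n) => mm q h hm.
 apply: (le_trans hm); rewrite -[2 * q * mm]mulrA. have h2 : B * e ^+ 2 <= B * e by rewrite ler_wpM2l.
 have h3 : L ^+ 2 * e ^+ 2 <= L ^+ 2 * e by rewrite ler_wpM2l ?sqr_ge0.
 have -> : (2 * B + 2 * L ^+ 2) * e = 2 * (B * e) + 2 * (L ^+ 2 * e) by ring.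
 have -> : 2 * L ^+ 2 * e ^+ 2 = 2 * (L ^+ 2 * e ^+ 2) by ring.
 move: (B * e) (B * e ^+ 2) (L ^+ 2 * e) (L ^+ 2 * e ^+ 2) (q * mm) h h2 h3 => a b c d f; lra.
apply/ler_addgt0Pr => eps eps0.
pose D := 2 * B + 2 * L ^+ 2 + 1; have D0 : 0 < D.
 by rewrite ltr_wpDl// addr_ge0// mulr_ge0// sqr_ge0.
have [N HN] := invS_lt (divr_gt0 eps0 D0).
apply: (le_trans (small N)); rewrite lerD2l.
apply: (@le_trans _ _ (D * N.+1%:R^-1)); first by rewrite ler_wpM2r// lerDl.
by rewrite mulrC -ler_pdivlMr// ltW.
Qed.

Lemma conv_mixed js w : Hs (size js) w -> exists B, forall k, mixed js (conv k w) <= B.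
Proof.
elim: js w => [|j js IH] w hw.
 by exists (C ^+ 2 * I2 lam w) => k; exact: (conv_L2 k (Hs_L2c hw)).
have [B1 H1] := IH _ (HsW hw); have [hw0 /(_ j)[h hh Wh]] := hw.
have [B2 H2] := IH _ hh; exists (B1 + B2) => k /=; apply: lerD; first exact: H1.
have [ck _ _ _ _] := Heta k.
by rewrite (pd_conv_weak (@compact_norm0 (molr k)) ck hw0 (Hs_L2c hh) Wh).
Qed.

(** A derivative of a mollification is the mollification of a weak derivative, whose [mixed] norm
    over all directions is bounded uniformly in [k]; this costs n further weak derivatives. *)
Lemma conv_bounded s w : Hs (n + size s) w ->
 exists B, forall k u, `|foldr (@partial R n) (conv k w) s u| <= B.
Proof.
elim/last_ind: s w => [|s a IH] w.
 rewrite addn0 => hw; have hw' : Hs (size (enum 'I_n)) w by rewrite size_enum_ord.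
 have [B HB] := conv_mixed hw'; exists (2 * 4 ^+ n * B + 1) => k u /=. have [K cK sK] := csm_convk k (Hs_L2c hw).
 have := sup_mixed u cK sK => h. have {}h : convol (eta k) w u ^+ 2 <= 2 * 4 ^+ n * B.
  by apply: (le_trans h); rewrite ler_wpM2l.
 move: h; rewrite -[_ ^+ 2]real_normK ?num_real//; move: (`|_|) (normr_ge0 (convol (eta k) w u)) (2 * 4 ^+ n * B) => z z0 y h.
 by have := sqr_ge0 (z - 1); nra.
rewrite size_rcons addnS => -[hw0 /(_ a)[h hh Wh]].
have [B HB] := IH _ hh; exists B => k u; rewrite foldr_rcons.
have [ck _ _ _ _] := Heta k.
rewrite (pd_conv_weak (@compact_norm0 (molr k)) ck hw0 (Hs_L2c hh) Wh); exact: HB.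
Qed.

(** Sequences bounded in the topology of smooth convergence: each derivative has a bound uniform in
    the index. *)
Definition bfam (W : nat -> V -> R) := (forall k, smc setT (W k)) /\
 forall s, exists B, forall k u, `|foldr (@partial R n) (W k) s u| <= B.

Lemma bfam_pd a W : bfam W -> bfam (fun k => pd a (W k)).
Proof.
move=> [sW bW]; split=> [k|s]; first exact: smc_pd.
by have [B HB] := bW (rcons s a); exists B => k u; have := HB k u; rewrite foldr_rcons.
Qed.

Lemma foldr_pd_add s f g u : smc setT f -> smc setT g ->
 foldr (@partial R n) (fun v => f v + g v) s u = foldr (@partial R n) f s u + foldr (@partial R n) g s u.
Proof.
elim/last_ind: s f g => [|s a IH] f g sf sg //.
rewrite !foldr_rcons -(IH _ _ (smc_pd a sf) (smc_pd a sg)).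
rewrite (_ : pd a (fun v => f v + g v) = fun v => pd a f v + pd a g v)//.
by apply/funext => v; exact: pd_add.
Qed.

Lemma bfamD W W' : bfam W -> bfam W' -> bfam (fun k u => W k u + W' k u).
Proof.
move=> [sW bW] [sW' bW']; split=> [k|s]; first exact: smc_add.
have [B HB] := bW s; have [B' HB'] := bW' s; exists (B + B') => k u.
rewrite (foldr_pd_add s u (sW k) (sW' k)).
by apply: (le_trans (ler_normD _ _)); apply: lerD.
Qed.

Lemma bfamM K theta W : compact K -> csm K theta -> bfam W -> bfam (fun k u => theta u * W k u).
Proof.
move=> cK st bW; split=> [k|s].
 by apply: smc_mul; [exact: st.1|exact: bW.1].
have cl : closed K by apply: (closed_rV).
elim/last_ind: s theta W st bW => [|s a IH] theta W st bW.
 have [T _ HT] := csm_bounded cK st; have [B HB] := bW.2 [::].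
 exists (T * B) => k u /=; rewrite normrM; apply: ler_pM => //; exact: HB.
have sta := csm_pd a cl st; have bWa := bfam_pd a bW.
have [B1 H1] := IH _ _ sta bW; have [B2 H2] := IH _ _ st bWa.
exists (B1 + B2) => k u; rewrite foldr_rcons.
have s1 : smc setT (fun v => pd a theta v * W k v) by apply: smc_mul; [exact: sta.1|exact: bW.1].
have s2 : smc setT (fun v => theta v * pd a (W k) v) by apply: smc_mul; [exact: st.1|exact: bWa.1].
have -> : pd a (fun v => theta v * W k v) = fun v => pd a theta v * W k v + theta v * pd a (W k) v.
 by apply/funext => v; exact: (pdM a v st.1 (bW.1 k)).
rewrite (foldr_pd_add s u s1 s2).
by apply: (le_trans (ler_normD _ _)); apply: lerD.
Qed.

Lemma bfam0 : bfam (fun _ _ => 0).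
Proof.
split=> [k|s]; first exact: smc_cst.
exists 0 => k u; elim/last_ind: s => [|s a IH]; first by rewrite /= normr0.
rewrite foldr_rcons (_ : pd a (fun=> 0) = fun=> 0)//.
by apply/funext => v; exact: pd_indep.
Qed.

Lemma bfam_sum (W : 'I_n -> nat -> V -> R) : (forall a, bfam (W a)) -> bfam (fun k u => \sum_a W a k u).
Proof.
move=> hW; elim: (index_enum _) => [|a r IH].
 by have := bfam0; congr bfam; apply/funext => k; apply/funext => u; rewrite big_nil.
by have := bfamD (hW a) IH; congr bfam; apply/funext => k; apply/funext => u; rewrite big_cons.
Qed.

Lemma bfam_conv w : (forall s, Hs s w) -> bfam (fun k => conv k w).
Proof.
move=> hw; split=> [k|s]; last by apply: conv_bounded.
have [K cK [sK _]] := csm_convk k (Hs_L2c (hw 0%N)); exact: sK.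
Qed.

End sup_bound.

End mollified.

End euclidean_regularity.

(** * Powers and convergence in Lp and L2 *)

Section power_tools.
Context d (T : measurableType d) (R : realType) (mu : {measure set T -> \bar R}).
Implicit Types f g : T -> R.

Lemma powR_cvg (a : R) (u : nat -> R) (l : R) : 0 < a -> (forall n, 0 <= u n) -> 0 <= l ->
 u n @[n --> \oo] --> l -> u n `^ a @[n --> \oo] --> l `^ a.
Proof.
(* The power is differentiable at positive points; the limit 0 is treated directly. *)
move=> a0 u0 l0 ul; have [lz|ln] := eqVneq l 0; last first.
 have lp : 0 < l by rewrite lt_def ln. have dl := @ex_derive _ _ _ _ _ _ _ (is_derive1_powR a lp).
 have cl : {for l, continuous (fun x : R => x `^ a)}.
  by apply: differentiable_continuous; apply/derivable1_diffP.
 exact: (cvg_comp _ _ ul cl).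
rewrite lz powR0 ?gt_eqF//; rewrite lz in ul.
apply/cvgrPdist_le => /= e e0; have ea : 0 < e `^ a^-1 by exact: powR_gt0.
have /cvgrPdist_lt/(_ _ ea) := ul; apply: filterS => n /=.
rewrite !sub0r !normrN (ger0_norm (u0 n)) (ger0_norm (powR_ge0 _ _)) => h.
rewrite -[leRHS](powRr1 (ltW e0)) -(mulVf (lt0r_neq0 a0)) powRrM.
by rewrite ge0_ler_powR ?nnegrE// ltW.
Qed.

Lemma seq_lim_unique (u : nat -> R) (l m : R) : u n @[n --> \oo] --> l -> u n @[n --> \oo] --> m -> l = m.
Proof. by move=> /(cvg_lim (@Rhausdorff R)) <- /(cvg_lim (@Rhausdorff R)). Qed.

Lemma powD_le (a x y : R) : 0 < a -> 0 <= x -> 0 <= y -> (x + y) `^ a <= 2 `^ a * (x `^ a + y `^ a).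
Proof.
move=> a0 x0 y0; have key (z w : R) : 0 <= z -> 0 <= w -> z <= w -> (z + w) `^ a <= 2 `^ a * (z `^ a + w `^ a).
 move=> z0 w0 zw; apply: (@le_trans _ _ ((2 * w) `^ a)).
  by rewrite ge0_ler_powR ?nnegrE// ; lra.
 by rewrite powRM// ler_wpM2l// lerDr powR_ge0.
have [h|/ltW h] := leP x y; first exact: key.
by rewrite addrC [x `^ a + _]addrC; exact: key.
Qed.

Lemma meas_pow a f : mfun f -> mfun (fun x : T => `|f x| `^ a).
Proof. by move=> mf; apply: (measurableT_comp (measurable_powR _)); apply: measurableT_comp. Qed.

Lemma pintD a f g : 0 < a -> pint mu a f -> pint mu a g -> pint mu a (fun x => f x + g x).
Proof.
move=> a0 [mf f_] [mg g_]; have mfg : mfun (fun x : T => f x + g x) by exact: measurable_funD.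
split=> //; apply: (integ_le _ _ (integZ (2 `^ a) (integD f_ g_))); first exact: meas_pow.
move=> x; rewrite (ger0_norm (powR_ge0 _ _)); apply: (le_trans _ (powD_le a0 (normr_ge0 _) (normr_ge0 _))).
by rewrite ge0_ler_powR ?nnegrE ?(ltW a0)// ler_normD.
Qed.

Lemma pintN a f : pint mu a f -> pint mu a (fun x => - f x).
Proof.
move=> [mf f_]; split; first exact: measurableT_comp.
by apply: (eq_integ _ f_) => x; rewrite normrN.
Qed.

Lemma pint_le a f g : 0 < a -> mfun f -> (forall x, `|f x| <= `|g x|) -> pint mu a g -> pint mu a f.
Proof.
move=> a0 mf fg [mg g_]; split=> //; apply: (integ_le _ _ g_); first exact: meas_pow.
by move=> x; rewrite (ger0_norm (powR_ge0 _ _)) ge0_ler_powR// ltW.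
Qed.

Lemma integ_ae f g : mfun f -> integ mu g -> {ae mu, forall x, f x = g x} ->
 integ mu f /\ I mu f = I mu g.
Proof.
move=> mf ig fg; have mg := integ_meas ig.
have ne : ae_eq mu [set: T] (EFin \o f) (EFin \o g).
 by apply: filterS fg => x h _ /=; rewrite h.
split.
 apply/integrableP; split; first exact/measurable_EFinP. have /integrableP[_ h] := ig; apply: le_lt_trans h.
 apply: eq_le_. apply: ae_eq_integral => //; try (apply: measurableT_comp => //; exact/measurable_EFinP).
 by apply: filterS fg => x h _ /=; rewrite h.
rewrite !IU; congr fine; apply: ae_eq_integral => //; exact/measurable_EFinP.
Qed.

Lemma nrm_le a f (e : R) : 0 < a -> 0 <= e -> I mu (fun x => `|f x| `^ a) <= e `^ a -> nrm mu a f <= e.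
Proof.
move=> a0 e0 h; rewrite -[leRHS](powRr1 e0) -(mulfV (lt0r_neq0 a0)) powRrM.
by rewrite ge0_ler_powR ?nnegrE ?invr_ge0 ?powR_ge0 ?(ltW a0)//; apply: I_ge0 => x.
Qed.

Definition l2cvg (u : nat -> T -> R) z := forall e, 0 < e -> exists N, forall n, (N <= n)%N ->
 I mu (fun x => (u n x - z x) ^+ 2) <= e.

Lemma l2_pair u z h : (forall n, sqint mu (u n)) -> sqint mu z -> sqint mu h -> l2cvg u z ->
 ipr mu (u n) h @[n --> \oo] --> ipr mu z h.
Proof.
move=> u2 z2 h2 uz; apply/cvgrPdist_le => /= e e0.
pose H := I2 mu h; have H0 : 0 <= H by exact: I2_ge0.
have H1 : 0 < H + 1 by rewrite ltr_wpDl.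
have [N HN] := uz (e ^+ 2 / (H + 1)) (divr_gt0 (exprn_gt0 _ e0) H1).
exists N => // n /= /HN; rewrite ler_pdivlMr// => hn.
have d2 := sqintB (u2 n) z2; have := CS d2 h2.
have -> : I mu (fun x => (u n x - z x) * h x) = ipr mu (u n) h - ipr mu z h.
 by rewrite -(IB (sqintM (u2 n) h2) (sqintM z2 h2)); apply: I_eq => x; rewrite mulrBl.
move=> cs; rewrite distrC -(@ler_pXn2r _ 2%N)// ?nnegrE// ?(ltW e0)//.
rewrite real_normK ?num_real//; apply: (le_trans cs); apply: (le_trans _ hn).
by rewrite ler_wpM2l ?lerDl//; apply: I_ge0 => x; exact: sqr_ge0.
Qed.

Lemma l2_triangle (u : nat -> T -> R) z n m (e : R) : (forall n, sqint mu (u n)) -> sqint mu z ->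
 I mu (fun x => (u n x - z x) ^+ 2) <= e -> I mu (fun x => (u m x - z x) ^+ 2) <= e ->
 I mu (fun x => (u n x - u m x) ^+ 2) <= 4 * e.
Proof.
move=> u2 z2 h1 h2; have [_ i1] := sqintB (u2 n) z2; have [_ i2] := sqintB (u2 m) z2.
have [_ i3] := sqintB (u2 n) (u2 m).
apply: (@le_trans _ _ (2 * I mu (fun x => (u n x - z x) ^+ 2) + 2 * I mu (fun x => (u m x - z x) ^+ 2))); last by lra.
rewrite -(IZ _ i1) -(IZ _ i2) -(ID (integZ _ i1) (integZ _ i2)).
apply: (I_le i3 (integD (integZ _ i1) (integZ _ i2))) => x.
by have := sqr_ge0 ((u n x - z x) + (u m x - z x)); nra.
Qed.

End power_tools.

(** * Constants that centre a nonlinear mean *)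

Section centering.
Context d (T : measurableType d) (R : realType) (mu : {measure set T -> \bar R}).
Variables (psi : R -> R).
Hypothesis psic : forall (u : nat -> R) l, u n @[n --> \oo] --> l -> psi (u n) @[n --> \oo] --> psi l.
Hypothesis psi_le : forall s t, s <= t -> psi s <= psi t.
Hypothesis psiN : forall s, psi (- s) = - psi s.
Hypothesis psi1 : 0 < psi 1.
Hypothesis mufin : (mu [set: T] < +oo)%E.
Hypothesis mu0 : 0 < I mu (fun=> 1 : R).

(** At each point psi(f - n) is eventually at most - psi 1. Truncating from below at - psi 1
    provides a dominating function for the limit. *)
Lemma centering_lt0 (f : T -> R) :
 (forall c, integ mu (fun x => psi (f x - c))) -> exists c, I mu (fun x => psi (f x - c)) < 0.
Proof.
move=> ipsi; have ip : integ mu (fun x => psi (f x)) by apply: (eq_integ _ (ipsi 0)) => x; rewrite subr0.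
pose g (n : nat) x := Num.max (psi (f x - n%:R)) (- psi 1).
have mg n : mfun (g n).
 by apply: measurable_maxr; [exact: integ_meas|exact: measurable_cst].
have ig := integD (integ_abs ip) (integ_cst mufin (psi 1)).
have gb n x : `|g n x| <= `|psi (f x)| + psi 1.
 have h : psi (f x - n%:R) <= psi (f x) by apply: psi_le; rewrite gerBl.
 have h1 := ler_norm (psi (f x)); have h2 := normr_ge0 (psi (f x)).
 rewrite ler_norml; apply/andP; split; first by rewrite le_max; lra.
 have p1 := ltW psi1; rewrite ge_max; apply/andP; split.
  by apply: (le_trans (le_trans h h1)); rewrite lerDl.
 by apply: (@le_trans _ _ 0); rewrite ?oppr_le0// addr_ge0.
have gc x : g ^~ x @ \oo --> - psi 1.
 apply: cvg_near_cst; have := archi_boundP (normr_ge0 (f x + 1)); set N := Num.bound _ => hN; exists N => // n /= Nn.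
 apply/max_idPr; rewrite -psiN; apply: psi_le. have h1 : N%:R <= n%:R :> R by rewrite ler_nat.
 have := le_lt_trans (ler_norm _) (lt_le_trans hN h1); lra.
have [_ cv] := I_dct ig mg gb gc.
have neg : I mu (fun=> - psi 1) < 0.
 rewrite (_ : I mu (fun=> - psi 1) = - psi 1 * I mu (fun=> 1 : R)); first by rewrite mulNr oppr_lt0 mulr_gt0.
 by rewrite -(IZ _ (integ_cst mufin 1)); rewrite mulr1.
have /cvgrPdist_lt/(_ (- I mu (fun=> - psi 1))) := cv; rewrite oppr_gt0 => /(_ neg) [N _ /(_ N (leqnn N))] /= h.
exists N%:R; apply: (@le_lt_trans _ _ (I mu (g N))).
 apply: (I_le (ipsi _) (integ_le (mg N) _ ig)) => x; last by rewrite le_max lexx. by [].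
move: h; rewrite ltr_norml => /andP[h _]; lra.
Qed.

(** An intermediate value argument for the decreasing function [G]; continuity is used only along
    the sequences sup S + 1/(n+1) and sup S - 1/(n+1). *)
Lemma centering (f : T -> R) :
 (forall c, integ mu (fun x => psi (f x - c))) -> exists c, I mu (fun x => psi (f x - c)) = 0.
Proof.
move=> ipsi; pose G c := I mu (fun x => psi (f x - c)).
have Gle a b : a <= b -> G b <= G a.
 by move=> ab; apply: (I_le (ipsi _) (ipsi _)) => x; apply: psi_le; lra.
have [c1 h1] := centering_lt0 ipsi.
have eN c x : psi (- f x - c) = - psi (f x - (- c)) by rewrite -psiN; congr psi; ring.
have [|c2 h2] := @centering_lt0 (fun x => - f x).
 by move=> c; apply: (eq_integ _ (integN (ipsi (- c)))) => x.
have {}h2 : 0 < G (- c2).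
 rewrite -oppr_lt0 -(IN (ipsi _)); move: h2.
 by rewrite (_ : I mu _ = I mu (fun x => - psi (f x - - c2))) //; apply: I_eq => x.
pose S := [set c | 0 <= G c].
have hS : has_sup S.
 split; first by exists (- c2); exact: ltW.
 exists c1 => c; rewrite /S /= leNgt => h; rewrite leNgt; apply/negP => cc.
 by move: h; rewrite (le_lt_trans (Gle _ _ (ltW cc))).
have Gcv (e : R) : `|e| <= 1 -> (G (sup S + e / n.+1%:R) @[n --> \oo] --> G (sup S))%R.
 move=> e1; pose g (n : nat) x := psi (f x - (sup S + e / n.+1%:R)).
 have ig := integD (integ_abs (ipsi (sup S + 1))) (integ_abs (ipsi (sup S - 1))).
 apply: (I_dct (f_ := g) (f := fun x => psi (f x - sup S)) ig _ _ _).2.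
 - by move=> n; exact: integ_meas (ipsi _).
 - move=> n x; have en : `|e / n.+1%:R| <= 1.
   by rewrite normrM normfV (ger0_norm (ler0n _ _)) ler_pdivrMr// mul1r (le_trans e1)// ler1n.
  move: en; rewrite ler_norml => /andP[en1 en2].
  have l1 : psi (f x - (sup S + 1)) <= g n x by apply: psi_le; rewrite lerB// lerD2l.
  have l2 : g n x <= psi (f x - (sup S - 1)) by apply: psi_le; rewrite lerB// lerD2l.
  move: l1 l2; move: (psi (f x - (sup S + 1))) (psi (f x - (sup S - 1))) (g n x) => a b w aw wb.
  have := ler_norm b; have := ler_norm (- a); rewrite normrN.
  have := normr_ge0 a; have := normr_ge0 b => *; rewrite ler_norml; lra.
 move=> x; apply: psic; apply: cvgB; first exact: cvg_cst.
 rewrite -[X in _ --> X]addr0; apply: cvgD; first exact: cvg_cst.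
 rewrite -[X in _ --> X](mulr0 e); apply: cvgM; first exact: cvg_cst. exact: cvg_harmonic.
have npos (n : nat) : 0 < n.+1%:R^-1 :> R by [].
exists (sup S); apply/eqP; rewrite eq_le; apply/andP; split.
 have /Gcv cv : `|1| <= 1 :> R by rewrite normr1.
 rewrite -/(G _) -(cvg_lim (@Rhausdorff R) cv); apply: limr_le; first by apply/cvg_ex; exists (G (sup S)).
 apply: nearW => n; rewrite leNgt; apply/negP => h.
 have := @sup_upper_bound _ _ hS _ (ltW h : S _); rewrite gerDl mul1r leNgt npos//.
have /Gcv cv : `|(-1) : R| <= 1 by rewrite normrN normr1.
rewrite -/(G _) -(cvg_lim (@Rhausdorff R) cv); apply: limr_ge; first by apply/cvg_ex; exists (G (sup S)).
apply: nearW => n; have [c Sc hc] := sup_adherent (npos n) hS.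
by apply: (le_trans (Sc : 0 <= G c)); apply: Gle; rewrite mulN1r; exact: ltW.
Qed.

End centering.

(** * Duality maps of Lp: signed powers and a regularised sign *)

Section test_functions.
Context (R : realType).
Implicit Types (s t a : R).

(** The signed power sgn(s) |s|^a; for a = p - 1 it is the duality map of Lp. *)
Definition spow a s : R := Num.max s 0 `^ a - Num.max (- s) 0 `^ a.

Lemma spow_cvg a (u : nat -> R) l : 0 < a -> u n @[n --> \oo] --> l -> spow a (u n) @[n --> \oo] --> spow a l.
Proof.
move=> a0 ul; have pc (v : nat -> R) m : v n @[n --> \oo] --> m ->
  Num.max (v n) 0 `^ a @[n --> \oo] --> Num.max m 0 `^ a.
 move=> vm; apply: powR_cvg => //; [by move=> n; rewrite le_max lexx orbT|by rewrite le_max lexx orbT|].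
 have E (r : R) : Num.max r 0 = (r + `|r|) / 2 by rewrite maxr_absE addr0 subr0.
 rewrite E; under eq_cvg do rewrite E. by apply: cvgMl; apply: cvgD => //; exact: cvg_norm.
by apply: cvgB; apply: pc => //; exact: cvgN.
Qed.

Lemma spow_le a s t : 0 <= a -> s <= t -> spow a s <= spow a t.
Proof.
move=> a0 st; have st' : - t <= - s by rewrite lerN2.
have m0 (r : R) : Num.max r 0 \is Num.nneg by rewrite nnegrE le_max lexx orbT.
by apply: lerB; apply: ge0_ler_powR => //; rewrite ge_max !le_max lexx ?st ?st' orbT.
Qed.

Lemma spowN a s : spow a (- s) = - spow a s.
Proof. by rewrite /spow opprB opprK. Qed.

Lemma spow_ge0 a s : a != 0 -> 0 <= s -> spow a s = s `^ a.
Proof. by move=> a0 s0; rewrite /spow max_l// max_r ?oppr_le0// powR0// subr0. Qed.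

Lemma norm_spow a s : a != 0 -> `|spow a s| = `|s| `^ a.
Proof.
move=> a0; wlog s0 : s / 0 <= s => [H|].
 have [/H//|/ltW h] := leP 0 s. by rewrite -[s]opprK spowN normrN H ?normrN// oppr_ge0.
by rewrite spow_ge0// (ger0_norm s0) ger0_norm ?powR_ge0.
Qed.

Lemma mul_spow a s : 1 < a -> s * spow (a - 1) s = `|s| `^ a.
Proof.
move=> a1; have a0 : a - 1 != 0 by rewrite gt_eqF// subr_gt0.
wlog s0 : s / 0 <= s => [H|].
 have [/H//|/ltW h] := leP 0 s. by rewrite -[s]opprK spowN mulrNN normrN H// oppr_ge0.
by rewrite spow_ge0// (ger0_norm s0) mulr_powRB1// (lt_trans _ a1).
Qed.

Lemma meas_spow a : measurable_fun [set: R] (spow a).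
Proof.
apply: measurable_funB; apply: (measurableT_comp (measurable_powR _)); exact: measurable_maxr.
Qed.

(** A continuous substitute for the sign, bounded by 1, whose product with [s] is still at least |s|
    - e. *)
Definition ssgn (e s : R) : R := s / (`|s| + e).

Section ssgn.
Variable e : R.
Hypothesis e0 : 0 < e.
Let p s : 0 < `|s| + e. Proof. by rewrite ltr_wpDl. Qed.

Lemma ssgn_cvg (u : nat -> R) l : u n @[n --> \oo] --> l -> ssgn e (u n) @[n --> \oo] --> ssgn e l.
Proof.
move=> ul; apply: cvgM => //; apply: cvgV; first by rewrite gt_eqF.
apply: cvgD; last exact: cvg_cst.
exact: cvg_norm.
Qed.

Lemma ssgn_le s t : s <= t -> ssgn e s <= ssgn e t.
Proof.
move=> st; rewrite ler_pdivrMr// mulrAC ler_pdivlMr//.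
have := e0; have [s0|/ltW s0] := leP 0 s; have [t0|/ltW t0] := leP 0 t;
 rewrite ?(ger0_norm s0) ?(ler0_norm s0) ?(ger0_norm t0) ?(ler0_norm t0); nra.
Qed.

Lemma ssgnN s : ssgn e (- s) = - ssgn e s.
Proof. by rewrite /ssgn normrN mulNr. Qed.

Lemma norm_ssgn s : `|ssgn e s| <= 1.
Proof. by rewrite normrM normfV (gtr0_norm (p s)) ler_pdivrMr// mul1r lerDl ltW. Qed.

Lemma mul_ssgn s : `|s| - e <= s * ssgn e s.
Proof.
rewrite mulrA ler_pdivlMr// -expr2 -[s ^+ 2]real_normK ?num_real//.
by have := sqr_ge0 e; nra.
Qed.

Lemma meas_ssgn : measurable_fun [set: R] (ssgn e).
Proof.
apply: continuous_measurable_fun => s; apply: cvgM; first exact: cvg_id.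
apply: cvgV; first by rewrite gt_eqF.
apply: cvgD; last exact: cvg_cst.
exact: norm_continuous.
Qed.

End ssgn.
End test_functions.

(** * Integration on the manifold and Green's formula *)

Section analysis.
Context (R : realType) (d : nat) (M : riemannian_manifold R d).
Local Notation V := 'rV[R]_d.
Local Notation BM := (borel M).
Local Notation BV := (borel V).
Hypothesis cM : compact [set: M].
Variables (mu : {measure set BM -> \bar R}) (lam : {measure set BV -> \bar R}).
Hypothesis Hl : is_lebesgue lam.
Hypothesis Hmu : density mu lam.
Hypothesis kM : connected [set: M].

Section manifold_integral.
Implicit Types (i j : chart_index M) (f g h : M -> R) (K : set V).

(** The coordinate form of [f], extended by zero; it is undone by [push] for functions with support
    in the chart. *)
Definition locf i f (u : V) : R := if `[< chim i u >] then f (chart_inv i u) else 0.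
Definition csupp i K f := [/\ compact K, K `<=` chim i, sm f &
 forall t, f t != 0 -> source i t /\ K (chart i t)].

Lemma csupp_locf i K f : csupp i K f -> csm K (locf i f).
Proof.
move=> [cK Ki sf fK].
have l0 u : ~ K u -> locf i f u = 0.
 rewrite /locf; case: asboolP => // cu nK; apply/eqP/negPn/negP => /fK[_]. by rewrite invK.
split=> //; apply: smc_base; apply: smooth_on_local => u _; have [Ku|nKu] := pselect (K u).
 exists (chim i); first exact: Ki. apply: smcP; first exact: chim_open.
 by apply: (smc_ext (sm_smc i sf)) => v cv; rewrite /locf asboolT.
have oK : open (~` K) by apply: closed_openC; apply: compact_closed => //.
exists (~` K) => //; apply: (smcP oK).
by apply: (smc_ext (smc_cst _ 0)) => v /l0 ->.
Qed.

Lemma csupp_push i K (w : V -> R) : compact K -> K `<=` chim i -> csm K w -> csupp i K (push i w).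
Proof.
move=> cK Ki [sw w0]; have wK u : w u != 0 -> K u.
 by move=> wu; apply: contrapT => /w0 /eqP; rewrite (negbTE wu).
split=> //.
 apply: (sm_push cK Ki wK); apply: (smooth_onS _ (smcT_on sw)); exact: subsetT.
by move=> t; rewrite /push; case: asboolP => [si /wK|]; [split|rewrite eqxx].
Qed.

Lemma csuppM i K f g : sm g -> csupp i K f -> csupp i K (fun t => g t * f t).
Proof.
move=> sg [cK Ki sf fK]; split; [exact: cK|exact: Ki|exact: smM|].
by move=> t; rewrite mulf_eq0 negb_or => /andP[_ /fK].
Qed.

Lemma meas_smooth f : sm f -> mfun (f : BM -> R).
Proof. by move=> sf; apply: meas_continuous; exact: sm_continuous. Qed.

Lemma csm_rho i K w : compact K -> K `<=` chim i -> csm K w -> csm K (fun u => w u * rho i u).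
Proof. by move=> cK Ki sw; apply: (cutoff_ex (@chim_open _ _ M i) cK Ki sw); exact: smc_rho. Qed.

Lemma pull_push i K (w : V -> R) u : K `<=` chim i -> csm K w ->
 pull i (push i w) u = w u * rho i u.
Proof.
move=> Ki [_ w0]; rewrite /pull; case: asboolP => cu; first by rewrite push_inv.
by rewrite w0 ?mul0r// => /Ki.
Qed.

Lemma I_push i K (w : V -> R) : compact K -> K `<=` chim i -> csm K w ->
 integ mu (push i w : BM -> R) /\
 I mu (push i w : BM -> R) = ipr lam w (rho i).
Proof.
move=> cK Ki sw; have [_ _ sp pK] := csupp_push cK Ki sw.
have p0 t : ~ source i t -> push i w t = 0 by move=> nt; rewrite /push asboolF.
have mp := meas_smooth sp.
have wri := csm_integ Hl cK (csm_rho cK Ki sw).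
have ip : integ mu (push i w : BM -> R).
 have : integ mu (fun t => `|push i w t|).
  apply: ge0_integP => //; first exact: measurableT_comp.
  have -> := ge0_integral_pull Hmu (i := i) (f := fun t => `|push i w t|).
  - rewrite (eq_integral (fun u : BV => (`|w u * rho i u|)%:E)).
    exact: (integrable_lty _ (integ_abs wri)).
   move=> u _; rewrite -(pull_push _ Ki sw) /pull; case: ifP => _; last by rewrite normr0.
   by rewrite normrM [`|rho i u|]ger0_norm// sqrtr_ge0.
  - exact: measurableT_comp.
  - by [].
  - by move=> t /p0 ->; rewrite normr0.
 by apply: integ_le.
split=> //; have [_ ->] := integ_pull Hmu p0 ip.
by apply: I_eq => u; exact: (pull_push u Ki sw).
Qed.

Lemma push_locf i K f t : csupp i K f -> push i (locf i f) t = f t.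
Proof.
move=> [cK Ki sf fK]; rewrite /push; case: asboolP => st.
 by rewrite /locf asboolT ?chartK//; exists t.
by apply/esym/eqP/negPn/negP => /fK[].
Qed.

Lemma I_csupp i K f : csupp i K f -> integ mu (f : BM -> R) /\
 I mu (f : BM -> R) = ipr lam (locf i f) (rho i).
Proof.
move=> sf; have [cK Ki _ _] := sf.
have [h1 h2] := I_push cK Ki (csupp_locf sf).
have E t : push i (locf i f) t = f t by exact: (push_locf t sf).
split; first by apply: (eq_integ _ h1) => t.
by rewrite -h2; apply: I_eq => t.
Qed.

(* Green's formula in a chart: both sides are integrals of compactly supported
  functions, and differ by the integral of a divergence. *)
Lemma chart_green i K f g : csupp i K f -> sm g ->
 I lam (fun u => locf i f u * Lap i g u * rho i u) =
 I lam (fun u => qf (invmx (metric i u)) (grad (locf i f) u) (gr i g u) * rho i u).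
Proof.
move=> csf sg; have [cK Ki sf fK] := csf; have [sw w0] := csupp_locf csf.
have kK := closed_rV cK.
have [k [K' [cK' K'i] [sk k01 kK' [ O oO [KO kO]]]]] := plateau cK (@chim_open _ _ M i) Ki.
have csk : csm K' k.
 by split=> // u nK; apply/eqP/negPn/negP => /kK'.
(* The cutoff [k] is 1 near [K], so the flux becomes smooth on the whole space without changing on
   the support of [locf i f]. *)
pose B a b u := k u * flux i g a b u.
have sB a b : csm K' (B a b).
 exact: (cutoff_ex (@chim_open _ _ M i) cK' K'i csk (smc_flux i a b sg)).
have w0d a u : ~ K u -> pd a (locf i f) u = 0 by exact: pd_eq0.
have BE a b u : K u -> B a b u = flux i g a b u.
 by move=> Ku; rewrite /B kO ?mul1r//; exact: KO.
have dBE a b u : K u -> pd a (B a b) u = pd a (flux i g a b) u.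
 move=> Ku; apply: (pd_eq a oO (KO _ Ku)) => v Ov. by rewrite /B kO ?mul1r.
have L u : locf i f u * Lap i g u * rho i u = - \sum_a \sum_b locf i f u * pd a (B a b) u.
 have [Ku|nK] := pselect (K u); last first.
  by rewrite w0// !mul0r big1 ?oppr0// => a _; rewrite big1// => b _; rewrite mul0r.
 have r0 : rho i u != 0 by rewrite gt_eqF// rho_gt0//; exact: Ki. rewrite LapE.
 have -> : \sum_a \sum_b locf i f u * pd a (B a b) u = locf i f u * \sum_a \sum_b pd a (flux i g a b) u.
  rewrite mulr_sumr; apply: eq_bigr => a _; rewrite mulr_sumr; apply: eq_bigr => b _. by rewrite dBE.
 by move: (\sum_a _) (locf i f u) (rho i u) r0 => x y z z0; field.
have G u : qf (invmx (metric i u)) (grad (locf i f) u) (gr i g u) * rho i u =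
  \sum_a \sum_b pd a (locf i f) u * B a b u.
 rewrite qf_sum mulr_suml; apply: eq_bigr => a _; rewrite mulr_suml; apply: eq_bigr => b _.
 rewrite !mxE; have [Ku|nK] := pselect (K u); last by rewrite w0d// !mul0r. by rewrite BE// /flux; ring.
transitivity (I lam (fun u => - \sum_a \sum_b locf i f u * pd a (B a b) u)).
 by apply: I_eq => u.
transitivity (I lam (fun u => \sum_a \sum_b pd a (locf i f) u * B a b u)); last first.
 by apply: I_eq => u.
have i1 a b : integ lam (fun u => locf i f u * pd a (B a b) u).
 by apply: (csm_integ Hl cK'); apply: csmM => //; apply: csm_pd => //; exact: compact_closed.
have i2 a b : integ lam (fun u => pd a (locf i f) u * B a b u).
 by apply: (csm_integ Hl cK'); apply: csmM => //; exact: smc_pd.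
rewrite IN; last by apply: integ_sum => a; exact: integ_sum.
rewrite !I_sum; try (by move=> a; exact: integ_sum).
rewrite -sumrN; apply: eq_bigr => a _; rewrite !I_sum// -sumrN; apply: eq_bigr => b _.
by rewrite (ibp Hl a cK' sw (sB a b)) opprK.
Qed.

Lemma locf_gr i K f u : csupp i K f -> chim i u -> grad (locf i f) u = gr i f u.
Proof.
move=> _ cu; apply: (grad_congr (@chim_open _ _ M i) cu) => v cv.
by rewrite /locf asboolT.
Qed.

Lemma chart_green_push i K f g : csupp i K f -> sm g ->
 let F := push i (fun u => locf i f u * Lap i g u) in let G := push i (Gam i f g) in
 [/\ integ mu (F : BM -> R), integ mu (G : BM -> R) &
   I mu (F : BM -> R) = I mu (G : BM -> R)].
Proof.
move=> csf sg F G; have [cK Ki sf fK] := csf; have sw := csupp_locf csf.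
have kK := closed_rV cK.
have [iF EF] := I_push cK Ki (cutoff_ex (@chim_open _ _ M i) cK Ki sw (smc_Lap i sg)).
pose Q u := qf (invmx (metric i u)) (grad (locf i f) u) (gr i g u).
have sQ : csm K Q.
 have E u : Q u = \sum_a pd a (locf i f) u * \sum_b (invmx (metric i u) a b * gr i g u 0 b).
  rewrite /Q qf_sum; apply: eq_bigr => a _; rewrite mulr_sumr. by apply: eq_bigr => b _; rewrite mxE mulrA.
 have S a : csm K (fun u => pd a (locf i f) u * \sum_b (invmx (metric i u) a b * gr i g u 0 b)).
  apply: (cutoff_ex (@chim_open _ _ M i) cK Ki); first exact: csm_pd.
  by apply: smc_sum => b; apply: smc_mul; [exact: smc_invmetric|exact: smc_gr].
 split; last by move=> u nK; rewrite E big1// => a _; rewrite (S a).2.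
 by apply: (smc_ext (smc_sum _ (fun a => (S a).1))) => u _.
have [iG EG] := I_push cK Ki sQ.
have GE t : push i Q t = G t.
 rewrite /G /push; case: asboolP => // st; rewrite /Q (locf_gr csf)//; by exists t.
split; [exact: iF|by apply: (eq_integ _ iG) => t; exact: GE|].
rewrite EF (_ : I mu (G : BM -> R) = I mu (push i Q : BM -> R)); last by apply: I_eq => t; rewrite GE.
by rewrite EG; exact: (chart_green csf sg).
Qed.

(* Pairing with a bump concentrated where the two values differ; the right-hand
  side of Green's formula does not depend on the chart. *)
Lemma Lap_chart_le i j f t : sm f -> source i t -> source j t ->
 Lap i f (chart i t) <= Lap j f (chart j t).
Proof.
move=> sf si sj; rewrite leNgt; apply/negP => lt.
pose H v := Lap i f v - Lap j f (chart j (chart_inv i v)).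
pose W := chart i @` (source j `&` source i).
have oW : open W by apply: chart_open; exact: source_open.
have Wci v : W v -> chim i v by move=> [s [_ s1] <-]; exists s.
have Wj v : W v -> source j (chart_inv i v) by move=> [s [s1 s2] <-]; rewrite chartK.
have WP v : W v -> chim j (chart j (chart_inv i v)) by move=> Wv; exists (chart_inv i v) => //; exact: Wj.
have sH : smc W H.
 apply: smc_sub; first by apply: (smcW Wci (@chim_open _ _ M i)); exact: smc_Lap.
 apply: (smc_comp (@chim_open _ _ M j)) => //.
  by move=> c; apply: smc_base; rewrite /W setIC; exact: transition_smooth.
 by apply: smcP; [exact: chim_open|exact: smc_Lap].
have Wu : W (chart i t) by exists t.
set u := chart i t in Wu lt.
have Hu : 0 < H u by rewrite /H chartK// subr_gt0.
pose U := W `&` [set v | 0 < H v].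
have oU : open U.
 rewrite openE => v [Wv Hv]; apply: filterI; first by apply: open_nbhs_nbhs. have cH := smc_continuous_on oW sH Wv.
 have FN : Filter (nbhs v) by exact: nbhs_filter. exact: (@cvgr_gt _ _ _ FN _ _ cH 0 Hv).
have [k [K [cK KU] [sk k01 kK [ O oO [uO kO]]]]] :=
 plateau (@compact_set1 _ u) oU (fun v (e : [set u] v) => eq_ind_r U (conj Wu Hu) e).
have KW : K `<=` W by move=> v /KU[].
have Ki : K `<=` chim i by move=> v /KW /Wci.
have csk : csm K k by split=> // v nK; apply/eqP/negPn/negP => /kK.
have cp := csupp_push cK Ki csk; have [_ _ sp pK] := cp.
pose Kj := (fun v => chart j (chart_inv i v)) @` K.
have cpj : csupp j Kj (push i k).
 split=> //.
 - apply: continuous_compact => //; apply: continuous_in_subspaceT => v; rewrite inE => Kv.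
  have c1 := inv_continuous (Ki _ Kv); have c2 := @chart_continuous _ _ M j _ (Wj _ (KW _ Kv)).
  exact: continuous_comp.
 - by move=> _ [v Kv <-]; apply: WP; exact: KW.
 - move=> s /pK[ss Ks]; have := Wj _ (KW _ Ks); rewrite chartK// => sjs; split=> //.
  by exists (chart i s) => //; rewrite chartK.
have [iF1 iG1 E1] := chart_green_push cp sf.
have [iF2 iG2 E2] := chart_green_push cpj sf.
(* On the overlap of the charts this is [Gam_chart]; elsewhere both sides vanish, as the bump is
   supported in the overlap. *)
have GE s : push i (Gam i (push i k) f) s = push j (Gam j (push i k) f) s.
 have g0 l Kl : csupp l Kl (push i k) -> ~ Kl (chart l s) -> source l s -> Gam l (push i k) f (chart l s) = 0.
  move=> cl nK sl; have [cKl Kli _ kl] := cl. have cs : chim l (chart l s) by exists s.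
  rewrite /Gam -(locf_gr cl cs) /qf (_ : grad _ _ = 0) ?mul0mx ?mxE//.
  apply/rowP => a; rewrite !mxE; have [sw w0] := csupp_locf cl. have cKl' := closed_rV cKl.
  exact: (pd_eq0 a cKl' w0).
 rewrite {1 3}/push; case: asboolP => si'; case: asboolP => sj'.
 - by rewrite -{2}(chartK si'); apply: (Gam_chart sp sf); exists s.
 - by rewrite (g0 i K cp)// => /KW/Wj; rewrite chartK.
 - rewrite (g0 j Kj cpj)// => -[v Kv] /(congr1 (chart_inv j)).
  by rewrite !chartK//; [move=> e; apply: si'; rewrite -e; apply: chim_source; exact: Ki|exact: (Wj _ (KW _ Kv))].
 - by [].
have E s : push i (fun u => k u * H u) s = push i (fun u => locf i (push i k) u * Lap i f u) s
  - push j (fun u => locf j (push i k) u * Lap j f u) s.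
 have kE l : source l s -> locf l (push i k) (chart l s) = push i k s.
  by move=> sl; rewrite /locf asboolT ?chartK//; exists s.
 rewrite {1 2 4}/push; case: asboolP => si'; case: asboolP => sj'.
 - by rewrite !kE// pushE// /H chartK// mulrBr.
 - rewrite kE// pushE// (csk.2 (chart i s)) ?mul0r ?subr0// => /KW/Wj.
  by rewrite chartK.
 - by rewrite kE// /push asboolF// mul0r subr0.
 - by rewrite subr0.
have ckH := cutoff_ex oW cK KW csk sH.
have ckHr := csm_rho cK Ki ckH.
have [ikH IkH] := I_push cK Ki ckH.
have I0 : I mu (push i (fun u => k u * H u) : BM -> R) = 0.
 transitivity (I mu (fun s => push i (fun u => locf i (push i k) u * Lap i f u) s
  - push j (fun u => locf j (push i k) u * Lap j f u) s)); first by apply: I_eq => s.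
 apply: (etrans (IB iF1 iF2)); apply/eqP; rewrite subr_eq0; apply/eqP.
 apply: (etrans E1); apply: (etrans _ (esym E2)). by apply: I_eq => s.
move: I0; rewrite IkH => I0.
have nn v : 0 <= k v * H v * rho i v.
 rewrite mulr_ge0 ?sqrtr_ge0//; have [Kv|nK] := pselect (K v).
  have [_ Hv] := KU _ Kv; have /andP[kv _] := k01 v. exact: (mulr_ge0 kv (ltW Hv)).
 by rewrite csk.2 ?mul0r.
have /eqP := I_csm_eq0 Hl cK ckHr nn I0 u.
rewrite kO; last exact: uO.
by rewrite mul1r mulf_eq0 !gt_eqF//; apply: rho_gt0; exact: Wci.
Qed.

Lemma Lap_chart i j f t : sm f -> source i t -> source j t ->
 Lap i f (chart i t) = Lap j f (chart j t).
Proof. move=> sf si sj; apply: le_anti; apply/andP; split; exact: Lap_chart_le. Qed.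

End manifold_integral.

(** * The Laplacian and the carre du champ as global operators *)

Section gamma.
Implicit Types (i j : chart_index M) (f g h : M -> R) (K : set V) (t : M).

(** [Lapl] and [Gamma] are locked, so that the choice of a chart stays hidden from conversion. *)
Definition Lapl : (M -> R) -> M -> R := locked (@laplacian R d M).
Definition Gamma : (M -> R) -> (M -> R) -> M -> R :=
 locked (fun f g t => Gam (chart_at t) f g (chart (chart_at t) t)).

Lemma LaplE : Lapl = @laplacian R d M. Proof. by rewrite /Lapl -lock. Qed.

Lemma GammaU f g t : Gamma f g t = Gam (chart_at t) f g (chart (chart_at t) t).
Proof. by rewrite /Gamma -lock. Qed.

Lemma chartP i t : source i t -> chim i (chart i t). Proof. by exists t. Qed.

Lemma GammaE i f g t : sm f -> sm g -> source i t -> Gamma f g t = Gam i f g (chart i t).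
Proof.
move=> sf sg si; rewrite GammaU (@Gam_chart _ _ _ (chart_at t) i f g) ?chartK//; try exact: chart_atP.
by exists t => //; split=> //; exact: chart_atP.
Qed.

Lemma sm_Gamma f g : sm f -> sm g -> sm (Gamma f g).
Proof.
move=> sf sg; apply: (sm_charts (H := fun i => Gam i f g)) => [i|i t si]; first exact: smc_Gam.
exact: GammaE.
Qed.

Let oc t := @chim_open _ _ M (chart_at t).
Let ct t := chartP (@chart_atP _ _ M t).

Lemma GammaC f g t : Gamma f g t = Gamma g f t.
Proof. by rewrite !GammaU; apply: qfC; apply: invmetric_sym. Qed.

Lemma GammaDl f g h t : sm f -> sm g -> Gamma (fun s => f s + g s) h t = Gamma f h t + Gamma g h t.
Proof.
move=> sf sg; rewrite !GammaU /Gam /gr (gradD (@oc t) (@ct t) (sm_smc _ sf) (sm_smc _ sg)).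
exact: qfDl.
Qed.

Lemma GammaMl f g h t : sm f -> sm g ->
 Gamma (fun s => f s * g s) h t = f t * Gamma g h t + g t * Gamma f h t.
Proof.
move=> sf sg; rewrite !GammaU /Gam /gr (gradM (@oc t) (@ct t) (sm_smc _ sf) (sm_smc _ sg)).
by rewrite qfDl !qfZl chartK//; exact: chart_atP.
Qed.

Lemma Gamma_cstl c h t : Gamma (fun=> c) h t = 0.
Proof. by rewrite !GammaU /Gam /gr grad_cst qf0l. Qed.

Lemma GammaZl c f h t : sm f -> Gamma (fun s => c * f s) h t = c * Gamma f h t.
Proof.
move=> sf; rewrite (GammaMl h t (@sm_cst _ _ M c) sf) Gamma_cstl.
by rewrite mulr0 addr0.
Qed.

Lemma GammaZZ a b f h t : sm f -> sm h ->
 Gamma (fun s => a * f s) (fun s => b * h s) t = a * (b * Gamma f h t).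
Proof. by move=> sf sh; rewrite (GammaZl _ _ t sf) GammaC (GammaZl _ _ t sh) GammaC. Qed.

Lemma Gamma_sum (J : Type) (r : seq J) (F : J -> M -> R) h t : (forall l, sm (F l)) ->
 Gamma (fun s => \sum_(l <- r) F l s) h t = \sum_(l <- r) Gamma (F l) h t.
Proof.
move=> sF; elim: r => [|l r IH].
 rewrite big_nil -[RHS](Gamma_cstl 0 h t); congr (Gamma _ h t). by apply/funext => s; rewrite big_nil.
rewrite big_cons -IH -(GammaDl h t (sF l) (sm_sum r sF)); congr (Gamma _ h t).
by apply/funext => s; rewrite big_cons.
Qed.

Lemma Gamma_ge0 f t : 0 <= Gamma f f t.
Proof.
rewrite !GammaU /Gam; set G := metric _ _; set v := gr _ _ _.
have pG : posdef G by apply: metric_posdef.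
have [->|v0] := eqVneq v 0; first by rewrite qf0l.
by apply/ltW; apply: (posdef_inv pG) => //; apply: metric_sym.
Qed.

Lemma Gamma_comp (tau tau' : R -> R) f h t : sm f -> (forall x : R, is_derive x 1 tau (tau' x)) ->
 Gamma (fun s => tau (f s)) h t = tau' (f t) * Gamma f h t.
Proof.
move=> sf dt; rewrite !GammaU /Gam /gr.
have dt' : derivable tau (f (chart_inv (chart_at t) (chart (chart_at t) t))) 1.
 by [].
rewrite (grad_comp (@oc t) (@ct t) (sm_smc _ sf) dt') qfZl derive1E.
rewrite (derive_val (is_derive := dt _)) chartK//; exact: chart_atP.
Qed.

Lemma GammaB_ge0 f g t : sm f -> sm g -> 2 * Gamma f g t <= Gamma f f t + Gamma g g t.
Proof.
move=> sf sg; have sN : sm (fun s => -1 * g s) by exact: smZ.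
have := Gamma_ge0 (fun s => f s + -1 * g s) t.
rewrite (GammaDl _ t sf sN) (GammaZl _ _ t sg) GammaC (GammaDl _ t sf sN) (GammaZl _ _ t sg).
rewrite [Gamma g (fun s => _ + _) t]GammaC (GammaDl _ t sf sN) (GammaZl _ _ t sg) (GammaC g f).
by move: (Gamma f f t) (Gamma f g t) (Gamma g g t) => x y z; lra.
Qed.

Lemma GammaM_le f g t : sm f -> sm g ->
 Gamma (fun s => f s * g s) (fun s => f s * g s) t <=
 2 * (f t ^+ 2 * Gamma g g t + g t ^+ 2 * Gamma f f t).
Proof.
move=> sf sg; rewrite (GammaMl _ t sf sg) GammaC (GammaMl _ t sf sg).
rewrite [Gamma f (fun s => _ * _) t]GammaC (GammaMl _ t sf sg).
have := GammaB_ge0 t (smZ (f t) sg) (smZ (g t) sf).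
rewrite (GammaZZ _ _ t sg sf) (GammaZZ _ _ t sg sg) (GammaZZ _ _ t sf sf) (GammaC g f).
by move: (Gamma f f t) (Gamma f g t) (Gamma g g t) (f t) (g t) => x y z a b; nra.
Qed.

Lemma laplacianE i f t : sm f -> source i t -> Lapl f t = Lap i f (chart i t).
Proof. by move=> sf si; rewrite LaplE; apply: (Lap_chart) => //; exact: chart_atP. Qed.

Lemma sm_Lapl f : sm f -> sm (Lapl f).
Proof.
move=> sf; apply: (sm_charts (H := fun i => Lap i f)) => [i|i t si]; first exact: smc_Lap.
exact: laplacianE.
Qed.

Lemma sm_iter m f : sm f -> sm (iter m Lapl f).
Proof. move=> sf; elim: m => [|m IH]; [exact: sf|exact: sm_Lapl]. Qed.

Lemma partition : exists (N : nat) (ii : 'I_N -> chart_index M) (chi : 'I_N -> M -> R) (K : 'I_N -> set V),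
 [/\ forall l, csupp (ii l) (K l) (chi l), forall l t, 0 <= chi l t <= 1 &
   forall t, \sum_l chi l t = 1].
Proof.
have [|N [ci [chi [K [K1 K2 K3 K4 K5]]]]] := @partition_of_unity _ _ M cM (fun=> setT).
 by move=> t; split=> //; exact: openT.
exists N, (fun l => chart_at (ci l)), chi, K; split; [|exact: K3|exact: K4] => l.
have [cK KW] := K1 l; split; [exact: cK| |exact: Sm|exact: K5].
by move=> u /KW[t [_ st] <-]; exists t.
Qed.

(** The constant 1 is a finite sum of integrable functions with compact support in charts. *)
Lemma mu_fin : (mu [set: M] < +oo)%E.
Proof.
have [N [ii [chi [K [cs _ s1]]]]] := partition.
have : integ mu (fun t => \sum_l chi l t).
 by apply: integ_sum => l; have [] := I_csupp (cs l).
move=> H; have : integ mu (fun _ => 1) by apply: (eq_integ _ H) => t.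
move=> /integrableP[_].
by under eq_integral do rewrite /= normr1; rewrite integral_cst// mul1e.
Qed.

Lemma sm_bounded f : sm f -> exists2 B, 0 <= B & forall t, `|f t| <= B.
Proof.
move=> sf; have cf : compact (f @` setT).
 by apply: continuous_compact => //; apply: continuous_subspaceT; exact: sm_continuous.
have [r [_ Hr]] := compact_bounded cf.
exists (Num.max 0 (r + 1)); first by rewrite le_max lexx.
by move=> t; rewrite le_max (Hr (r + 1)) ?orbT ?ltrDl//.
Qed.

Lemma integ_sm f : sm f -> integ mu (f : BM -> R).
Proof.
move=> sf; have [B _ fB] := sm_bounded sf.
by apply: (integ_bounded mu_fin _ fB); exact: meas_smooth.
Qed.

Lemma sqint_sm f : sm f -> sqint mu (f : BM -> R).
Proof.
move=> sf; have [B _ fB] := sm_bounded sf.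
by apply: (sqint_bounded mu_fin _ fB); exact: meas_smooth.
Qed.

Lemma Gamma_csupp0 i K f g t : csupp i K f -> ~ source i t -> Gamma f g t = 0.
Proof.
move=> cf si; have [_ _ _ fK] := cf.
pose S := chart_inv i @` K; have [cK Ki _ _] := cf.
have cS : closed S by apply: (compact_closed (@M_hausdorff _ _ M)); exact: inv_compact.
have nS : ~ S t by move=> [u Ku ut]; apply: si; rewrite -ut; apply: chim_source; exact: Ki.
pose j := chart_at t; pose W := chart j @` (~` S `&` source j).
have oW : open W by apply: chart_open; exact: closed_openC.
have Wt : W (chart j t) by exists t => //; split=> //; exact: chart_atP.
rewrite !GammaU /Gam /gr (@grad_congr _ _ W _ (fun=> 0) _ oW Wt) ?grad_cst ?qf0l//.
move=> _ [s [nSs sj] <-]; rewrite chartK//; apply/eqP/negPn/negP => /fK[ss Ks]; apply: nSs.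
by exists (chart i s) => //; rewrite chartK.
Qed.

Lemma green_csupp i K f g : csupp i K f -> sm g ->
 ipr mu f (Lapl g) = I mu (Gamma f g : BM -> R).
Proof.
move=> cf sg; have [iF iG E] := chart_green_push cf sg.
have [_ _ sf fK] := cf.
have f0 t : ~ source i t -> f t = 0 by move=> ns; apply/eqP/negPn/negP => /fK[].
transitivity (I mu (push i (fun u => locf i f u * Lap i g u) : BM -> R)).
 apply: I_eq => t; rewrite /push; case: asboolP => si; last by rewrite f0 ?mul0r.
 by rewrite (laplacianE sg si) /locf asboolT ?chartK//; exists t.
rewrite E; apply: I_eq => t; rewrite /push; case: asboolP => si; first by rewrite (GammaE sf sg si).
by rewrite (Gamma_csupp0 g cf si).
Qed.

(** The formula in charts is summed over a partition of unity, using that [Gamma] is additive in its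
    first argument. *)
Lemma green f g : sm f -> sm g ->
 ipr mu f (Lapl g) = I mu (Gamma f g : BM -> R).
Proof.
move=> sf sg; have [N [ii [chi [K [cs _ s1]]]]] := partition.
have schi l : sm (chi l) by case: (cs l).
have cf l := csuppM sf (cs l); have sfl l : sm (fun t => f t * chi l t) by apply: smM.
have fE t : f t = \sum_l f t * chi l t by rewrite -mulr_sumr s1 mulr1.
transitivity (\sum_l I mu (fun t => f t * chi l t * Lapl g t)).
 rewrite -I_sum; first by apply: I_eq => t; rewrite -mulr_suml -fE.
 by move=> l; apply: integ_sm; apply: smM => //; exact: sm_Lapl.
rewrite (eq_bigr (fun l => I mu (Gamma (fun t => f t * chi l t) g : BM -> R))); last first.
 by move=> l _; exact: green_csupp.
rewrite -I_sum; last by move=> l; apply: integ_sm; exact: sm_Gamma.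
apply: I_eq => t; rewrite -Gamma_sum//; congr (Gamma _ g t).
by apply/funext => s.
Qed.

Lemma laplacian_sym f g : sm f -> sm g ->
 ipr mu f (Lapl g) = ipr mu (Lapl f) g.
Proof.
move=> sf sg; rewrite (green sf sg); transitivity (I mu (Gamma g f : BM -> R)).
 by apply: I_eq => t; exact: GammaC.
by rewrite -(green sg sf); apply: I_eq => t; rewrite mulrC.
Qed.

Lemma iter_laplacian_sym m f g : sm f -> sm g ->
 ipr mu f (iter m Lapl g) = ipr mu (iter m Lapl f) g.
Proof.
move=> sf sg; elim: m f sf => [|m IH] f sf; first exact: I_eq.
rewrite [LHS](laplacian_sym sf (sm_iter m sg)) (IH _ (sm_Lapl sf)).
by apply: I_eq => t; rewrite -iterSr.
Qed.

Lemma I_laplacian f : sm f -> I mu (Lapl f : BM -> R) = 0.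
Proof.
move=> sf; transitivity (I mu (fun t => 1 * Lapl f t)).
 by apply: I_eq => t; rewrite mul1r.
rewrite (green (@sm_cst _ _ M 1) sf) -[RHS](mul0r (I mu (fun=> 0 : R))) -IZ.
 by apply: I_eq => t; rewrite Gamma_cstl mul0r.
by apply: (integ_cst mu_fin).
Qed.

(** Multiplied by a function of the partition and read in a chart, f^2 is smooth, nonnegative and of
    integral 0, and the volume density is positive. *)
Lemma smooth_sq_eq0 f : sm f -> I2 mu f = 0 -> forall t, f t = 0.
Proof.
move=> sf If t; have [N [ii [chi [K [cs c01 s1]]]]] := partition.
have sff : sm (fun t => f t * f t) by exact: smM.
have z l : chi l t * f t ^+ 2 = 0.
 have [_ _ sc cK'] := cs l. have cl := csuppM sff (cs l). have [h1 h2] := I_csupp cl; have [cK Ki _ _] := cl.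
 have I0 : I mu (fun t => f t * f t * chi l t) = 0.
  apply/eqP; rewrite eq_le; apply/andP; split; last first.
   by apply: I_ge0 => s; rewrite mulr_ge0 ?(andP (c01 l s)).1// sqr_ge0.
  rewrite -If; apply: I_le => //; first by apply: (eq_integ _ (integ_sm sff)) => s.
  by move=> s; rewrite ler_piMr ?sqr_ge0// (andP (c01 l s)).2.
 have [->|c0] := eqVneq (chi l t) 0; first by rewrite mul0r. have [st Kt] := cK' t c0; rewrite h2 in I0.
 have nn v : 0 <= locf (ii l) (fun t => f t * f t * chi l t) v * rho (ii l) v.
  rewrite mulr_ge0 ?sqrtr_ge0// /locf; case: ifP => // _. by rewrite mulr_ge0 ?(andP (c01 l _)).1// sqr_ge0.
 have := I_csm_eq0 Hl cK (csm_rho cK Ki (csupp_locf cl)) nn I0 (chart (ii l) t).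
 move=> /eqP; rewrite mulf_eq0 (gt_eqF (rho_gt0 (chartP st))) orbF /locf asboolT; last by exists t.
 by rewrite chartK// mulrC => /eqP.
have : \sum_l chi l t * f t ^+ 2 = 0 by rewrite big1.
by rewrite -mulr_suml s1 mul1r => /eqP; rewrite sqrf_eq0 => /eqP.
Qed.

(* The Laplacian is determined by its weak form. *)
Lemma laplacian_lin a f g t : sm f -> sm g ->
 Lapl (fun s => a * f s + g s) t = a * Lapl f t + Lapl g t.
Proof.
move=> sf sg; have sh : sm (fun s => a * f s + g s) by apply: smD => //; exact: smZ.
pose e s := Lapl (fun s => a * f s + g s) s - (a * Lapl f s + Lapl g s).
have sE : sm (fun s => -1 * (a * Lapl f s + Lapl g s)).
 by apply: smZ; apply: smD; [apply: smZ|]; exact: sm_Lapl.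
have se : sm e.
 have := smD (sm_Lapl sh) sE; congr sm; apply/funext => s. by rewrite mulN1r.
suff /smooth_sq_eq0 : I2 mu e = 0.
 by move=> /(_ se t) /eqP; rewrite subr_eq0 => /eqP.
have im h : sm h -> integ mu (fun s => e s * Lapl h s).
 by move=> sh'; apply: integ_sm; apply: smM => //; exact: sm_Lapl.
transitivity (I mu (fun s => e s * Lapl (fun s => a * f s + g s) s
 - (a * (e s * Lapl f s) + e s * Lapl g s))). by apply: I_eq => s; rewrite expr2 {2}/e; ring.
rewrite IB; [|exact: im|by apply: integD; [apply: integZ|]; exact: im].
rewrite ID; [|by apply: integZ; exact: im|exact: im].
rewrite (IZ _ (im _ sf)); have -> := green se sh; have -> := green se sf; have -> := green se sg.
have iG h : sm h -> integ mu (Gamma e h : BM -> R).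
 by move=> sh'; apply: integ_sm; exact: sm_Gamma.
rewrite -(IZ _ (iG _ sf)) -ID; [|by apply: integZ; exact: iG|exact: iG].
apply/eqP; rewrite subr_eq0; apply/eqP; apply: I_eq => s.
by rewrite GammaC (GammaDl _ s (smZ a sf) sg) (GammaZl _ _ s sf) !(GammaC e).
Qed.

End gamma.

Let mufin := mu_fin.

(** * Density of smooth functions and the fundamental lemma *)

Section fundamental_lemma.
Implicit Types (f g : M -> R) (t : M) (O : set M).

Lemma bump_exists O t : open O -> O t -> exists b : M -> R,
 [/\ sm b, forall s, 0 <= b s <= 1, forall s, ~ O s -> b s = 0 & \forall s \near t, b s = 1].
Proof.
move=> oO Ot; set i := chart_at t; have st : source i t := chart_atP t.
pose W := chart i @` (O `&` source i).
have oW : open W by exact: chart_open.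
have Wt : [set chart i t] `<=` W by move=> _ ->; exists t.
have [k [K [cK KW] [sk k01 kK [ O' oO' [tO' kO']]]]] := plateau (@compact_set1 _ (chart i t)) oW Wt.
have Wci : W `<=` chim i by move=> _ [s [_ ss] <-]; exists s.
have Ki : K `<=` chim i by move=> u /KW /Wci.
have csk : csm K k by split=> // u nK; apply/eqP/negPn/negP => /kK.
have [_ _ sp pK] := csupp_push cK Ki csk.
exists (push i k); split=> //.
- by move=> s; rewrite /push; case: asboolP => _; rewrite ?lexx ?ler01.
- move=> s nO; apply/eqP/negPn/negP => /pK[ss /KW[s' [Os' ss'] /(congr1 (chart_inv i))]].
 by rewrite !chartK// => e; apply: nO; rewrite -e.
- have n1 : nbhs t (source i) by apply: open_nbhs_nbhs; split=> //; exact: source_open.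
 have n2 : nbhs t (chart i @^-1` O').
  have c := @chart_continuous _ _ M i t st. apply: (c O'); apply: open_nbhs_nbhs; split=> //; exact: tO'.
 by apply: filterS2 n1 n2 => s ss sO; rewrite pushE// kO'.
Qed.

(* A countable sum of bumps exhausts an open set. *)
Lemma smooth_indicator O : open O -> exists phi : nat -> M -> R,
 [/\ forall n, sm (phi n), forall n t, 0 <= phi n t <= 1 &
   forall t, phi ^~ t @ \oo --> (\1_O t : R)].
Proof.
move=> oO; have [B /countable_injP[c cI] [_ bB]] := @M_second_countable _ _ M.
pose good (b : M -> R) := [/\ sm b, forall s, 0 <= b s <= 1 & forall s, ~ O s -> b s = 0].
(* The countable base is coded by [c]; [b n] is a bump equal to 1 on the basis set of code [n], or 0
   if there is no such bump. *)
have H n : exists b, good b /\ forall U : set M, B U -> c U = n ->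
  (exists2 b', good b' & forall s, U s -> b' s = 1) -> forall s, U s -> b s = 1.
 have [[U [BU [cU [b' gb' b'1]]]]|nU] :=
  pselect (exists U, B U /\ c U = n /\ exists2 b', good b' & forall s, U s -> b' s = 1).
  exists b'; split=> // U' BU' cU' _; suff -> : U' = U by []. by apply: cI; rewrite ?inE// cU'.
 exists (fun=> 0); split; first by split=> //; [exact: sm_cst|move=> s; rewrite lexx ler01].
 by move=> U BU cU b's; exfalso; apply: nU; exists U.
have [b Hb] := choice H; have gb n := (Hb n).1; have bP n := (Hb n).2.
pose S n t := \sum_(l < n) b l t.
have sS n : sm (S n) by apply: sm_sum => l; case: (gb l).
exists (fun n t => sstep (n%:R * S n t)); split.
- by move=> n; apply: sm_sstep; exact: smZ.
- by move=> n t; rewrite sstep_ge0 sstep_le1.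
move=> t; rewrite indicE; case: (boolP (t \in O)) => [|]; last first.
 rewrite notin_setE => nO; have -> : (fun n => sstep (n%:R * S n t)) = (fun=> 0 : R).
  apply/funext => n; apply: sstep0; rewrite /S big1// => l _. by case: (gb l) => _ _; apply.
 exact: cvg_cst.
rewrite inE => Ot; have [b' [sb' b01 b0 b1]] := bump_exists oO Ot.
have [U [BU Ut] Ub] := bB t _ b1.
have bt : b (c U) t = 1 by apply: (bP _ U) => //; exists b'.
apply: cvg_near_cst; exists (c U).+1 => // n /= nU.
apply: sstep1; have S1 : 1 <= S n t.
 rewrite /S (bigD1 (Ordinal nU))//= bt lerDl sumr_ge0// => l _. by case: (gb l) => _ /(_ t) /andP[].
have n1 : 1 <= n%:R :> R by rewrite ler1n (leq_trans _ nU).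
by rewrite -[leLHS]mulr1 ler_pM.
Qed.

Lemma integ_mulb (u f : BM -> R) B : integ mu u -> mfun f ->
 (forall t, `|f t| <= B) -> integ mu (fun t => u t * f t).
Proof.
move=> iu mf fB; apply: (integ_le _ _ (integZ B (integ_abs iu))).
 by apply: measurable_funM => //; exact: integ_meas iu.
by move=> t; rewrite normrM mulrC ler_wpM2r.
Qed.

Lemma integ_mul_sm u f : integ mu (u : BM -> R) -> sm f -> integ mu (fun t => u t * f t).
Proof.
move=> iu sf; have [B _ fB] := sm_bounded sf.
by apply: (integ_mulb iu _ fB); exact: meas_smooth.
Qed.

Lemma indic_norm_le1 (A : set M) t : `|\1_A t : R| <= 1.
Proof. by rewrite indicE; case: (_ \in _); rewrite ?normr1 ?normr0. Qed.

(** Open sets are stable under intersection and generate the Borel sets, and their indicators are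
    pointwise limits of smooth functions; Dynkin's lemma extends the identity to all Borel sets. *)
Lemma I_indic_eq0 (u : BM -> R) : integ mu u -> (forall f, sm f -> ipr mu u f = 0) ->
 forall A : set BM, measurable A -> I mu (fun t => u t * \1_A t) = 0.
Proof.
move=> iu u0.
have mu_ := integ_meas iu.
have ii (A : set BM) : measurable A -> integ mu (fun t => u t * \1_A t).
 by move=> mA; apply: (integ_mulb iu (measurable_indic mA) (indic_norm_le1 A)).
apply: (@dynkin_induction _ BM (@open M)) => //.
- by move=> A B; exact: openI.
- rewrite -(u0 _ (sm_cst M 1)).
 by rewrite indicT.
- move=> O oO; have [phi [sp p01 pO]] := smooth_indicator oO.
 have dom n t : `|u t * phi n t| <= `|u t|.
  by rewrite normrM ler_piMr// ger0_norm; have /andP[] := p01 n t.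
 have mp n : mfun (fun t : BM => u t * phi n t).
  by apply: measurable_funM => //; exact: meas_smooth.
 have cv t : u t * phi n t @[n --> \oo] --> u t * \1_O t.
  by apply: cvgM; [exact: cvg_cst|exact: pO].
 have [_] := I_dct (integ_abs iu) mp dom cv. under eq_fun do rewrite (u0 _ (sp _)).
 by move=> L; apply: (cvg_unique _ L) => //; exact: cvg_cst.
- move=> S mS IS; transitivity (I mu (fun t => u t * 1 - u t * \1_S t)).
  apply: I_eq => t; rewrite !indicE in_setC; case: (t \in S) => /=; ring.
 by rewrite IB//; [rewrite IS (u0 _ (sm_cst M 1)) subrr|exact: (integ_mul_sm iu (sm_cst M 1))|exact: ii].
- move=> F mF tF IF.
 have dsum n t : \sum_(k < n) (\1_(F k) t : R) = \1_(\bigcup_(k in [set k | (k < n)%N]) F k) t.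
  rewrite [RHS]indicE; case: (boolP (t \in _)) => [|].
   rewrite inE => -[k /= kn Fk]; rewrite (bigD1 (Ordinal kn))//= indicE mem_set//.
   rewrite big1 ?addr0// => l lk; rewrite indicE memNset// => Fl; move/eqP: lk; apply.
   by apply/val_inj; apply: (tF l k) => //; exists t.
  rewrite notin_setE => nF; rewrite big1// => k _; rewrite indicE memNset// => Fk; apply: nF. by exists k => //=.
 have dom n t : `|u t * \sum_(k < n) \1_(F k) t| <= `|u t|.
  by rewrite dsum normrM ler_piMr// indic_norm_le1.
 have mp n : mfun (fun t : BM => u t * \sum_(k < n) \1_(F k) t).
  apply: measurable_funM => //; apply: measurable_sum => k; exact: measurable_indic.
 have cv t : u t * \sum_(k < n) \1_(F k) t @[n --> \oo] --> u t * \1_(\bigcup_k F k) t.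
  apply: cvgM; first exact: cvg_cst. under eq_fun do rewrite dsum.
  rewrite (@indicE _ R (\bigcup_k F k)); case: (boolP (t \in _)) => [|].
   rewrite inE => -[k _ Fk]; apply: cvg_near_cst; exists k.+1 => // n /= kn.
   by rewrite indicE mem_set//; exists k.
  rewrite notin_setE => nF; apply: cvg_near_cst; apply: nearW => n.
  by rewrite indicE memNset// => -[k _ Fk]; apply: nF; exists k.
 have [_] := I_dct (integ_abs iu) mp dom cv. under eq_fun => n.
  have -> : I mu (fun t => u t * \sum_(k < n) \1_(F k) t) = 0.
   transitivity (I mu (fun t => \sum_(k < n) u t * \1_(F k) t)).
    by apply: I_eq => t; rewrite mulr_sumr.
   by rewrite I_sum; [rewrite big1|move=> k; exact: ii].
  over.
 by move=> L; apply: (cvg_unique _ L) => //; exact: cvg_cst.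
Qed.

(** Integrating over the set where u >= 0 and over its complement gives int |u| = 0. *)
Lemma fundamental_lemma (u : BM -> R) : integ mu u ->
 (forall f, sm f -> ipr mu u f = 0) -> {ae mu, forall t, u t = 0}.
Proof.
move=> iu u0; have mu_ := integ_meas iu.
have mA : measurable [set t : BM | 0 <= u t].
 have -> : [set t : BM | 0 <= u t] = [set: BM] `&` u @^-1` `[0, +oo[%classic.
  by apply/seteqP; split=> t /=; rewrite in_itv/= andbT; [split|case].
 by apply: mu_.
have Z := I_indic_eq0 iu u0.
have E : I mu (fun t => `|u t|) = 0.
 transitivity (I mu (fun t => u t * \1_[set t | (0 <= u t)] t - u t * \1_(~` [set t | (0 <= u t)]) t)).
  apply: I_eq => t; rewrite !indicE in_setC; case: (boolP (t \in _)) => /=.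
   by rewrite inE/= => ut; rewrite ger0_norm// mulr1 mulr0 subr0.
  rewrite notin_setE/= => /negP; rewrite -ltNge => ut. by rewrite ltr0_norm// mulr0 mulr1 sub0r.
 rewrite IB; [|exact: (integ_mulb iu (measurable_indic mA) (indic_norm_le1 _))|].
  by rewrite !Z// ?subrr//; exact: measurableC.
 exact: (integ_mulb iu (measurable_indic (measurableC mA)) (indic_norm_le1 _)).
have : (\int[mu]_t `|(u t)%:E| = 0)%E.
 by have := I_EFin (integ_abs iu); rewrite E => <-.
move=> /(ae_eq_integral_abs mu measurableT) H.
have /H : mfun (fun t : BM => (u t)%:E) by exact/measurable_EFinP.
by apply: filterS => t /(_ Logic.I) /= [].
Qed.

Lemma I1_gt0 : 0 < I mu (fun=> 1 : R).
Proof.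
rewrite lt_def I_ge0 ?andbT; last by move=> t.
apply/eqP => E; have := smooth_sq_eq0 (sm_cst M 1).
rewrite (_ : I mu _ = 0); last by rewrite -E; rewrite expr1n.
by move=> /(_ erefl point) /eqP; rewrite oner_eq0.
Qed.

(** Riesz' theorem for the pairing with [u] on smooth functions produces [z] as an L2 limit of
    smooth functions; [u - z] is orthogonal to all of them, hence 0 almost everywhere. *)
Lemma L2_dense (u : BM -> R) : sqint mu u -> forall e, 0 < e ->
 exists2 f, sm f & I mu (fun t => (f t - u t) ^+ 2) <= e.
Proof.
move=> su e e0.
have lin (a : R) (p q : M -> R) : sm p -> sm q -> ipr mu u (a *: p + q) = a * ipr mu u p + ipr mu u q.
 move=> sp sq; have i f (sf : sm f) := sqintM su (sqint_sm sf).
 rewrite -(IZ _ (i _ sp)) -(ID (integZ _ (i _ sp)) (i _ sq)); apply: I_eq => t.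
 by rewrite !fctE /= /GRing.scale/=; ring.
have [z [p_ [pE sz zl]] zE] := @riesz_range _ BM R mu mufin (M -> R)
 (fun f => sm f) (fun f t => f t) (fun f => ipr mu u f) (I2 mu u)
 (sm_cst M 0) (fun a p q sp sq => smD (smZ a sp) sq) (fun a p q x _ _ => erefl)
 lin (fun p sp => sqint_sm sp) (fun p sp => CS su (sqint_sm sp)).
have iu := sqint_integ mufin su; have iz := sqint_integ mufin sz.
have ae0 : {ae mu, forall t, u t - z t = 0}.
 apply: fundamental_lemma; first exact: integB. move=> f sf; transitivity (I mu (fun t => u t * f t - z t * f t)).
  by apply: I_eq => t; rewrite mulrBl.
 have sqf := sqint_sm sf. by rewrite IB ?(zE f sf) ?subrr//; exact: sqintM.
have [N HN] := zl e e0; exists (p_ N); first exact: pE.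
apply: (le_trans _ (HN N (leqnn N))).
apply: eq_le_.
rewrite !IU ; congr fine; apply: ae_eq_integral => //.
- have := sqintB (sqint_sm (pE N)) su => -[m _].
 by apply/measurable_EFinP; apply: measurable_funX.
- have := sqintB (sqint_sm (pE N)) sz => -[m _].
 by apply/measurable_EFinP; apply: measurable_funX.
- apply: (@filterS _ _ (ae_filter_ringOfSetsType mu) _ _ _ ae0) => t /eqP.
 by rewrite subr_eq0 => /eqP -> _.
Qed.

(** [u] is set to 0 where |u| > N, which costs little in L1, and the bounded remainder is
    approximated in L2. *)
Lemma L1_dense (u : BM -> R) : integ mu u -> forall e, 0 < e ->
 exists2 f, sm f & I mu (fun t => `|u t - f t|) <= e.
Proof.
move=> iu e e0; have mu_ := integ_meas iu.
pose A n := [set t : BM | `|u t| <= n%:R].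
have mA n : measurable (A n).
 have -> : A n = [set: BM] `&` (fun t => `|u t|) @^-1` `]-oo, n%:R]%classic.
  by apply/seteqP; split=> t /=; rewrite in_itv/=; [split|case].
 have mn : mfun (fun t : BM => `|u t|) by exact: measurableT_comp. exact: mn.
pose v n t := u t * \1_(A n) t.
have mv n : measurable_fun [set: BM] (v n) by apply: measurable_funM => //; exact: measurable_indic.
have dom n t : Num.norm (`|u t - v n t|) <= `|u t|.
 rewrite normr_id /v indicE; case: (_ \in _); first by rewrite mulr1 subrr normr0. by rewrite mulr0 subr0.
have cv t : `|u t - v n t| @[n --> \oo] --> (0 : R).
 apply: cvg_near_cst; near=> n. rewrite /v indicE mem_set ?mulr1 ?subrr ?normr0//.
 by near: n; exact: nbhs_infty_ger.
have md n : mfun (fun t : BM => `|u t - v n t|).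
 by apply: measurableT_comp => //; exact: measurable_funB.
have [_] := I_dct (integ_abs iu) md dom cv.
have -> : I mu (fun=> 0 : R) = 0 by rewrite -[RHS](mul0r (I mu (fun=> 1 : R))) -IZ; [apply: I_eq => t; rewrite mul0r|exact: integ_cst].
move=> /(@cvgr_lt R _ _ _ _ _) /(_ (e / 2)); rewrite divr_gt0// => /(_ isT) [N _ /(_ N (leqnn N))/= HN].
have sv : sqint mu (v N).
 apply: (sqint_bounded mufin (mv N) (C := N%:R)) => t; rewrite /v indicE.
 by case: (boolP (_ \in _)); rewrite ?mulr1 ?mulr0 ?normr0// inE.
pose m := I mu (fun=> 1 : R); have m0 : 0 < m := I1_gt0.
have em : 0 < (e / 2) ^+ 2 / m by rewrite divr_gt0// exprn_gt0// divr_gt0.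
have [f sf Hf] := L2_dense sv em.
exists f => //; have sqf := sqint_sm sf.
have ifv : integ mu (fun t => `|f t - v N t|) by apply: integ_abs; exact: (sqint_integ mufin (sqintB sqf sv)).
have iuv : integ mu (fun t => `|u t - v N t|) by apply: integ_abs; apply: integB => //; exact: (sqint_integ mufin sv).
have F : I mu (fun t => `|f t - v N t|) <= e / 2.
 rewrite -(@ler_pXn2r _ 2)// ?nnegrE ?I_ge0// ?divr_ge0// ?(ltW e0)//.
 apply: (le_trans (I_abs_sq mufin (sqintB sqf sv))). by rewrite mulrC -ler_pdivlMr.
apply: (@le_trans _ _ (I mu (fun t => `|u t - v N t| + `|f t - v N t|))).
 apply: I_le => [||t].
 - by apply: integ_abs; apply: integB => //; exact: (sqint_integ mufin sqf).
 - exact: integD.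
 - by rewrite [`|f t - _|]distrC; exact: ler_distD.
rewrite ID//; move: (ltW HN) F; lra.
Unshelve. all: by end_near. Qed.

(** Smooth functions are dense in L1, and the uniform bound on [g] controls the approximation error,
    so weak convergence extends from smooth to integrable [u]. *)
Lemma weak_bounded (g : nat -> M -> R) (B : R) (u : BM -> R) :
 (forall n, mfun (g n : BM -> R)) -> (forall n t, `|g n t| <= B) ->
 (forall f, sm f -> ipr mu (g n) f @[n --> \oo] --> (0 : R)) ->
 integ mu u -> ipr mu u (g n) @[n --> \oo] --> (0 : R).
Proof.
move=> mg gB g0 iu; apply/cvgrPdist_le => e e0.
have B0 : 0 <= B by apply: (le_trans _ (gB 0%N point)).
have eB : 0 < e / 2 / (B + 1) by rewrite !divr_gt0// ltr_wpDl.
have [f sf Hf] := L1_dense iu eB.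
have /cvgrPdist_le /(_ (e / 2)) := g0 f sf; rewrite divr_gt0// => /(_ isT) Hn.
apply: filterS Hn => n; rewrite !sub0r !normrN => Hn.
have isf := integ_sm sf.
have iuf : integ mu (fun t => u t - f t) by exact: integB.
have i1 := integ_mulb iuf (mg n) (gB n).
have i2 : integ mu (fun t => g n t * f t).
 by apply: (eq_integ _ (integ_mulb isf (mg n) (gB n))) => t; rewrite mulrC.
have -> : ipr mu u (g n) = I mu (fun t => (u t - f t) * g n t) + ipr mu (g n) f.
 by rewrite -ID//; apply: I_eq => t; ring.
rewrite (le_trans (ler_normD _ _))// (splitr e) lerD//.
apply: (le_trans (I_abs i1)).
apply: (@le_trans _ _ (I mu (fun t => B * `|u t - f t|))).
 apply: I_le; [exact: integ_abs|by apply: integZ; exact: integ_abs|]. by move=> t; rewrite normrM mulrC ler_wpM2r.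
rewrite IZ; last exact: integ_abs.
apply: (@le_trans _ _ ((B + 1) * (e / 2 / (B + 1)))).
 by apply: ler_pM => //; [apply: I_ge0|rewrite lerDl].
by rewrite mulrC divfK// gt_eqF// ltr_wpDl.
Qed.

Lemma const_of_orthogonal (u : BM -> R) : integ mu u ->
 (forall f, sm f -> I mu (f : BM -> R) = 0 -> ipr mu u f = 0) ->
 exists c, {ae mu, forall t : BM, u t = c}.
Proof.
move=> iu u0; pose m := I mu (fun=> 1 : R); have m0 : 0 < m := I1_gt0.
exists (I mu u / m).
have H : {ae mu, forall t : BM, u t - I mu u / m = 0}.
 apply: fundamental_lemma; first by apply: integB => //; exact: integ_cst. move=> f sf; have isf := integ_sm sf.
 pose a := I mu (f : BM -> R) / m. have i1 : integ mu (fun=> 1 : R) by exact: integ_cst.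
 have sg : sm (fun t => f t + - a * 1) by apply: smD => //; exact: sm_cst.
 have g0 : I mu (fun t => f t + - a * 1) = 0.
  rewrite ID//; last exact: integZ. by rewrite IZ// mulNr divfK ?subrr// gt_eqF.
 have := u0 _ sg g0; have iuf := integ_mul_sm iu sf.
 have -> : I mu (fun t => u t * (f t + - a * 1)) = ipr mu u f + - a * I mu u.
  by rewrite -IZ// -ID//; [apply: I_eq => t; ring|exact: integZ].
 have -> : I mu (fun t => (u t - I mu u / m) * f t) = ipr mu u f + - (I mu u / m) * I mu (f : BM -> R).
  by rewrite -IZ// -ID//; [apply: I_eq => t; ring|exact: integZ].
 by rewrite /a => <-; ring.
by apply: filterS H => t /eqP; rewrite subr_eq0 => /eqP.
Qed.

End fundamental_lemma.

(** * The Faber-Krahn inequality on the manifold *)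

Section comparison.
Implicit Types (i : chart_index M) (f g v : M -> R) (t : M).

Lemma sqr_sum_ord m (a : 'I_m -> R) : (\sum_i a i) ^+ 2 <= m%:R * \sum_i a i ^+ 2.
Proof.
pose f (k : nat) : R := if insub k is Some i then a i else 0.
have E1 : \sum_i a i = \sum_(i < m) f i by apply: eq_bigr => i _; rewrite /f valK.
have E2 : \sum_i a i ^+ 2 = \sum_(i < m) f i ^+ 2 by apply: eq_bigr => i _; rewrite /f valK.
by rewrite E1 E2; exact: sqr_sum_le.
Qed.

Lemma qf_CS n (A : 'M[R]_n) x y : posdef A -> A^T = A -> qf A x y ^+ 2 <= qf A x x * qf A y y.
Proof.
move=> pA sA; have [->|y0] := eqVneq y 0.
 by rewrite ![qf A _ 0](qfC _ _ sA) !qf0l expr0n mulr0.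
have yy : 0 < qf A y y := pA y y0.
pose t := - qf A x y / qf A y y.
have h : 0 <= qf A (x + t *: y) (x + t *: y).
 have [->|z0] := eqVneq (x + t *: y) 0; first by rewrite qf0l. exact: ltW (pA _ z0).
move: h; rewrite qfDl !qfDr !qfZl !qfZr (qfC y x sA) => h.
have {}h : 0 <= qf A y y * (qf A x x + t * qf A x y + (t * qf A x y + t * (t * qf A y y))).
 by rewrite mulr_ge0 ?(ltW yy).
have tE : t * qf A y y = - qf A x y by rewrite divfK ?gt_eqF.
move: h; have -> : qf A y y * (qf A x x + t * qf A x y + (t * qf A x y + t * (t * qf A y y))) =
 qf A x x * qf A y y + (t * qf A y y) * (2 * qf A x y + t * qf A y y) by ring.
by rewrite tE ; lra.
Qed.

(** Cauchy-Schwarz for G^-1 with the vector e_a G, whose pairing with [x] is the coordinate x_a and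
    whose square is G_aa. *)
Lemma norm2_le_qf n (G : 'M[R]_n) (x : 'rV[R]_n) : posdef G -> G^T = G ->
 \sum_a x 0 a ^+ 2 <= \tr G * qf (invmx G) x x.
Proof.
move=> pG sG; have uG := posdef_unit pG; have pA := posdef_inv pG sG.
have sA : (invmx G)^T = invmx G by rewrite trmx_inv sG.
rewrite mulr_suml; apply: ler_sum => a _.
have := qf_CS (ev a *m G) x pA sA.
have -> : qf (invmx G) (ev a *m G) x = x 0 a.
 rewrite /qf mulmxK// mxE (bigD1 a)//= delta_coord eqxx mul1r big1 ?addr0 ?mxE// => b ba.
 by rewrite delta_coord (negbTE ba) mul0r.
have -> // : qf (invmx G) (ev a *m G) (ev a *m G) = G a a.
rewrite /qf mulmxK// trmx_mul sG mxE (bigD1 a)//= delta_coord eqxx mul1r big1 => [|b ba].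
 rewrite mxE (bigD1 a)//= mxE delta_coord eqxx mulr1 big1 ?addr0// => b ba.
 by rewrite mxE delta_coord (negbTE ba) mulr0.
by rewrite delta_coord (negbTE ba) mul0r.
Qed.

Lemma smc_bounded_on (W K : set V) (f : V -> R) : open W -> compact K -> K `<=` W -> smc W f ->
 exists2 B, 0 < B & forall u, K u -> `|f u| <= B.
Proof.
move=> oW cK KW sf; have cfK : compact (f @` K).
 apply: continuous_compact => //; apply: continuous_in_subspaceT => u; rewrite inE => Ku.
 exact: (smc_continuous_on oW sf (KW _ Ku)).
have [r [_ Hr]] := compact_bounded cfK.
exists (Num.max 1 (r + 1)); first by rewrite lt_max ltr01.
by move=> u Ku; rewrite le_max (Hr (r + 1)) ?orbT ?ltrDl//.
Qed.

Lemma metric_bounds i (K : set V) : compact K -> K `<=` chim i ->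
 exists2 B, 0 < B & forall u, K u -> [/\ rho i u <= B, 1 <= B * rho i u &
  forall x : V, \sum_a x 0 a ^+ 2 <= B * (qf (invmx (metric i u)) x x * rho i u)].
Proof.
move=> cK Ki; have oc := @chim_open _ _ M i.
have [B1 B10 h1] := smc_bounded_on oc cK Ki (@smc_rho _ _ M i).
have srV : smc (chim i) (fun u => (rho i u)^-1).
 by apply: smc_inv; [exact: smc_rho|move=> u cu; rewrite gt_eqF// rho_gt0].
have [B2 B20 h2] := smc_bounded_on oc cK Ki srV.
have str : smc (chim i) (fun u => \tr (metric i u)) by apply: smc_sum => a; exact: smc_metric.
have [B3 B30 h3] := smc_bounded_on oc cK Ki str.
exists (B1 + B2 + B3 * B2); first by rewrite !addr_gt0// mulr_gt0.
move=> u Ku; have cu := Ki _ Ku; have r0 := rho_gt0 cu.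
have r2 : 1 <= B2 * rho i u.
 by have := h2 _ Ku; rewrite gtr0_norm ?invr_gt0// -ler_pdivrMr// mul1r.
have B32 : 0 < B3 * B2 by exact: mulr_gt0.
split.
- by rewrite (le_trans (ler_norm _))// (le_trans (h1 _ Ku))// -addrA lerDl addr_ge0// ltW.
- by rewrite (le_trans r2)// ler_pM2r//; lra.
- move=> x; have pG := metric_posdef cu; have sG := metric_sym cu.
 have q0 : 0 <= qf (invmx (metric i u)) x x.
  have [->|x0] := eqVneq x 0; first by rewrite qf0l. exact: ltW (posdef_inv pG sG x0).
 apply: (le_trans (norm2_le_qf x pG sG)).
 apply: (@le_trans _ _ (B3 * (qf (invmx (metric i u)) x x * (B2 * rho i u)))).
  apply: (@le_trans _ _ (B3 * qf (invmx (metric i u)) x x)).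
   by rewrite ler_wpM2r// (le_trans (ler_norm _))// h3.
  by rewrite ler_wpM2l ?(ltW B30)// ler_peMr.
 have -> : B3 * (qf (invmx (metric i u)) x x * (B2 * rho i u)) =
  (B3 * B2) * (qf (invmx (metric i u)) x x * rho i u) by ring.
 by apply: ler_wpM2r; [rewrite mulr_ge0 ?(ltW r0)|lra].
Qed.

Definition energy v := I mu (Gamma v v : BM -> R).

(** Each comparison has the direction that carries a Euclidean inequality over to the manifold: int
    f^2 from above, the Euclidean energy and L1 norm by the Riemannian ones. *)
Lemma chart_comparison i (K : set V) : compact K -> K `<=` chim i ->
 exists2 B, 0 < B & forall f, csupp i K f ->
 [/\ I2 mu f <= B * I2 lam (locf i f),
   I lam (nab2 (locf i f) : BV -> R) <= B * energy f &
   I lam (fun u => `|locf i f u|) <= B * I mu (fun t => `|f t|)].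
Proof.
move=> cK Ki; have [B B0 HB] := metric_bounds cK Ki.
exists B => // f cf; have [_ _ sf fK] := cf; have sw := csupp_locf cf.
have kK := closed_rV cK.
have f0 t : ~ source i t -> f t = 0 by move=> ns; apply/eqP/negPn/negP => /fK[].
have wE u : chim i u -> locf i f u = f (chart_inv i u) by move=> cu; rewrite /locf asboolT.
have nK u : ~ K u -> locf i f u = 0 := sw.2 u.
have [mw iw2] := csm_sqint Hl cK sw; have iw := csm_integ Hl cK sw.
have [_ if2] := sqint_sm sf; have iF := integ_sm sf.
have iG := integ_sm (sm_Gamma sf sf).
split.
- have f20 t : ~ source i t -> f t ^+ 2 = 0 by move=> ns; rewrite f0// expr0n.
 have [i1 ->] := integ_pull Hmu (i := i) f20 if2.
 rewrite -(IZ _ iw2); apply: (I_le i1 (integZ _ iw2)) => u; rewrite /pull.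
 case: asboolP => cu; last by rewrite mulr_ge0 ?sqr_ge0// ltW.
 rewrite -wE// mulrC; have [Ku|nKu] := pselect (K u); last by rewrite nK// expr0n !mulr0.
 by rewrite ler_wpM2r ?sqr_ge0//; case: (HB _ Ku).
- have [i1 E1] := integ_pull Hmu (i := i) (fun t ns => Gamma_csupp0 f cf ns) iG.
 have iN := csm_integ Hl cK (csm_nab2 kK sw). rewrite /energy E1 -(IZ _ i1); apply: (I_le iN (integZ _ i1)) => u.
 have [Ku|nKu] := pselect (K u); last first.
  rewrite (csm_nab2 kK sw).2// mulr_ge0 ?(ltW B0)// pull_ge0// => t; exact: Gamma_ge0.
 have cu := Ki _ Ku; rewrite /pull asboolT// (GammaE sf sf (chim_source cu)) invK//.
 rewrite /Gam -(locf_gr cf cu); have [_ _ /(_ (grad (locf i f) u))] := HB _ Ku.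
 by congr (_ <= _); apply: eq_bigr => a _; rewrite mxE.
- have fa0 t : ~ source i t -> `|f t| = 0 by move=> ns; rewrite f0// normr0.
 have [i1 E1] := integ_pull Hmu (i := i) fa0 (integ_abs iF).
 rewrite E1 -(IZ _ i1); apply: (I_le (integ_abs iw) (integZ _ i1)) => u.
 have [Ku|nKu] := pselect (K u); last first.
  by rewrite nK// normr0 mulr_ge0 ?(ltW B0)// pull_ge0.
 have cu := Ki _ Ku; rewrite /pull asboolT// -wE// mulrCA ler_peMr//. by case: (HB _ Ku).
Qed.

Lemma energy_ge0 v : 0 <= energy v.
Proof. by apply: I_ge0 => t; exact: Gamma_ge0. Qed.

(** The Euclidean inequality for the pieces of [v] under a partition of unity; the term int v^2 next
    to the energy stems from the derivatives of the cutoffs. *)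
Lemma faber_krahn : exists2 C, 0 < C & forall v r, sm v -> 0 < r -> r <= 1 ->
 r ^+ d * I2 mu v <=
 C * (r ^+ d.+2 * (energy v + I2 mu v) + I mu (fun t => `|v t|) ^+ 2).
Proof.
have [N [ii [chi [K [cs c01 s1]]]]] := @partition.
have H l : exists C, 0 < C /\ forall v r, sm v -> 0 < r -> r ^+ d * I mu (fun t => (v t * chi l t) ^+ 2) <=
 C * (r ^+ d.+2 * (energy v + I2 mu v) + I mu (fun t => `|v t|) ^+ 2). have [cK Ki sc _] := cs l.
 have [B B0 HB] := chart_comparison cK Ki. have [B' B'0 HB'] := sm_bounded (sm_Gamma sc sc).
 exists (B * (2 * B ^+ 2 + d%:R * B * (2 * (1 + B')))); split.
  by rewrite mulr_gt0// ltr_wpDr ?mulr_gt0// !mulr_ge0 ?addr_ge0// ltW.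
 move=> v r sv r0; set E := energy v; set S := I2 mu v; set L := I mu (fun t => `|v t|).
 have cf := csuppM sv (cs l); have [h1 h2 h3] := HB _ cf.
 have sw := csupp_locf cf; have fk := faber_krahn_euclid Hl cK sw r0.
 have [_ iv2] := sqint_sm sv; have iv := integ_sm sv. have iG := integ_sm (sm_Gamma sv sv). have [_ _ scv _] := cf.
 have E0 : 0 <= E by exact: energy_ge0. have S0 : 0 <= S by exact: I2_ge0.
 have e1 : energy (fun t => v t * chi l t) <= 2 * (1 + B') * (E + S).
  have i2 := integD (integZ B' iv2) iG. have : energy (fun t => v t * chi l t) <= 2 * (B' * S + E).
   rewrite -(IZ B' iv2) -(ID (integZ B' iv2) iG) -(IZ 2 i2).
   apply: (I_le (integ_sm (sm_Gamma scv scv)) (integZ 2 i2)) => t.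
   apply: (le_trans (GammaM_le t sv sc)); rewrite ler_wpM2l// lerD//.
    by rewrite mulrC ler_wpM2r ?sqr_ge0// (le_trans (ler_norm _)).
   rewrite ler_piMl ?Gamma_ge0// -[leRHS](expr1n _ 2) lerXn2r ?nnegrE//.
    by have /andP[] := c01 l t.
   by have /andP[] := c01 l t.
  by move=> h; nra.
 have l1 : I lam (fun u => `|locf (ii l) (fun t => v t * chi l t) u|) <= B * L.
  apply: (le_trans h3); rewrite ler_wpM2l ?(ltW B0)//; apply: I_le => [||t].
  - by apply: integ_abs; exact: (integ_sm scv).
  - exact: integ_abs.
  - rewrite normrM ler_piMr// ger0_norm; by have /andP[] := c01 l t.
 move: h1 h2 fk e1 l1; set W2 := I lam (fun u => _ ^+ 2); set NW := I lam (nab2 _).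
 set LW := I lam (fun u => `|_|); set EE := energy _ => h1 h2 fk e1 l1. have LW0 : 0 <= LW by apply: I_ge0 => u.
 have L2 : LW ^+ 2 <= B ^+ 2 * L ^+ 2 by rewrite -exprMn lerXn2r// nnegrE// (le_trans LW0).
 have rd : 0 <= r ^+ d by rewrite exprn_ge0// ltW. have rd2 : 0 <= r ^+ d.+2 by rewrite exprn_ge0// ltW.
 apply: (@le_trans _ _ (B * (r ^+ d * W2))).
  by rewrite mulrCA ler_wpM2l.
 rewrite -mulrA ler_wpM2l ?(ltW B0)//; apply: (le_trans fk).
 have h4 : NW <= B * (2 * (1 + B') * (E + S)) by rewrite (le_trans h2)// ler_wpM2l ?(ltW B0).
 apply: (@le_trans _ _ (d%:R * r ^+ d.+2 * (B * (2 * (1 + B') * (E + S))) + 2 * (B ^+ 2 * L ^+ 2))).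
  by rewrite lerD// ler_wpM2l// mulr_ge0.
 have a0 : 0 <= r ^+ d.+2 * (E + S) by rewrite mulr_ge0// addr_ge0. have b0 : 0 <= L ^+ 2 by exact: sqr_ge0.
 have p0 : 0 <= d%:R * B * (2 * (1 + B')) by rewrite !mulr_ge0 ?addr_ge0// ltW.
 have q0 : 0 <= 2 * B ^+ 2 by rewrite mulr_ge0 ?sqr_ge0.
 have -> : d%:R * r ^+ d.+2 * (B * (2 * (1 + B') * (E + S))) + 2 * (B ^+ 2 * L ^+ 2) =
  d%:R * B * (2 * (1 + B')) * (r ^+ d.+2 * (E + S)) + 2 * B ^+ 2 * L ^+ 2 by ring.
 by move=> *; nra.
have [C HC] := choice H.
exists (1 + N%:R * \sum_l C l).
 by rewrite ltr_wpDr// mulr_ge0// sumr_ge0// => l _; apply: ltW; case: (HC l).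
move=> v r sv r0 r1; set Z := r ^+ d.+2 * _ + _.
have Z0 : 0 <= Z.
 by rewrite addr_ge0 ?sqr_ge0// mulr_ge0 ?exprn_ge0 ?(ltW r0)// addr_ge0 ?energy_ge0// I_ge0// => t; exact: sqr_ge0.
have rd : 0 <= r ^+ d by rewrite exprn_ge0// ltW.
have i2 l : integ mu (fun t => (v t * chi l t) ^+ 2).
 by have [_ _ sc _] := csuppM sv (cs l); have [] := sqint_sm sc.
have iS : integ mu (fun t => \sum_l (v t * chi l t) ^+ 2) by exact: integ_sum.
have le1 : I2 mu v <= N%:R * \sum_l I mu (fun t => (v t * chi l t) ^+ 2).
 rewrite -(I_sum _ i2) -(IZ _ iS); have [_ iv2] := sqint_sm sv. apply: (I_le iv2 (integZ _ iS)) => t.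
 by apply: (le_trans _ (sqr_sum_ord (fun l => v t * chi l t))); rewrite -mulr_sumr s1 mulr1.
apply: (@le_trans _ _ (r ^+ d * (N%:R * \sum_l I mu (fun t => (v t * chi l t) ^+ 2)))).
 by rewrite ler_wpM2l.
apply: (@le_trans _ _ ((N%:R * \sum_l C l) * Z)); last by rewrite ler_wpM2r// lerDr.
rewrite mulrCA -mulrA ler_wpM2l// mulr_sumr mulr_suml; apply: ler_sum => l _.
by apply: (HC l).2.
Qed.

End comparison.

(** * The Poincare inequality *)

Section poincare.
Implicit Types (i : chart_index M) (f g v : M -> R) (t : M).

(** The energy on the right is that of the whole manifold, which lets the property pass to subsets
    and to overlapping unions. *)
Definition poinc (A : set M) := measurable (A : set BM) /\ exists2 C, 0 <= C &
 forall v, sm v -> exists m, I mu (fun t => \1_A t * (v t - m) ^+ 2) <= C * energy v.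

Lemma integ_indic_sm (A : set M) f : measurable (A : set BM) -> sm f ->
 integ mu (fun t => \1_A t * f t).
Proof.
move=> mA sf.
apply: (eq_integ _ (integ_mulb (integ_sm sf) (measurable_indic mA) (@indic_norm_le1 A))) => t.
by rewrite mulrC.
Qed.

Lemma sm_shift2 v m : sm v -> sm (fun t => (v t - m) ^+ 2).
Proof.
move=> sv; have s1 : sm (fun t => v t + (- m) * 1) by apply: smD => //; exact: sm_cst.
have := smM s1 s1; congr sm; apply/funext => t; ring.
Qed.

Lemma poincS (A B : set M) : measurable (A : set BM) -> A `<=` B -> poinc B -> poinc A.
Proof.
move=> mA AB [mB [C C0 H]]; split=> //; exists C => // v sv; have [m Hm] := H v sv; exists m.
apply: (le_trans _ Hm); have s2 := sm_shift2 m sv.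
apply: (I_le (integ_indic_sm mA s2) (integ_indic_sm mB s2)) => t.
rewrite ler_wpM2r ?sqr_ge0// !indicE; case: (boolP (t \in A)) => // /set_mem /AB Bt.
by rewrite mem_set.
Qed.

(** On the overlap, which has positive measure [q], both constants are close to [v], so (a - c)^2 q
    is bounded by the energy. *)
Lemma poincU (A B : set M) t : open A -> open B -> A t -> B t -> poinc A -> poinc B -> poinc (A `|` B).
Proof.
move=> oA oB At Bt [mA [CA CA0 HA]] [mB [CB CB0 HB]].
have [b [sb b01 b0 b1]] := bump_exists (openI oA oB) (conj At Bt).
have mAB := measurableI _ _ mA mB.
pose q := I mu (\1_(A `&` B) : BM -> R).
have iq (D : set M) : measurable (D : set BM) -> integ mu (\1_D : BM -> R).
 by move=> mD; apply: (eq_integ _ (integ_indic_sm mD (sm_cst M 1))) => s; rewrite mulr1.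
have q0 : 0 < q.
 have sbb : sm (fun t => b t * b t) by exact: smM. apply: (@lt_le_trans _ _ (I2 mu b)).
  rewrite lt_def I_ge0 ?andbT; last by move=> s; exact: sqr_ge0. apply/eqP => /(smooth_sq_eq0 sb)/(_ t) bt0.
  by have := nbhs_singleton b1; rewrite bt0 => /eqP; rewrite eq_sym oner_eq0.
 apply: I_le; [by apply: (eq_integ _ (integ_sm sbb)) => s; rewrite expr2|exact: iq|].
 move=> s; rewrite indicE; case: (boolP (s \in _)) => [_|]; last first.
  by rewrite notin_setE => /b0 ->; rewrite expr0n.
 have /andP[x y] := b01 s; by rewrite -[leRHS](expr1n _ 2) lerXn2r ?nnegrE.
split; first exact: measurableU.
pose mB1 := I mu (\1_B : BM -> R).
have mB0 : 0 <= mB1 by apply: I_ge0 => s.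
exists (CA + 2 * CB + 2 * (2 * (CA + CB) / q) * mB1).
 by rewrite !addr_ge0 ?mulr_ge0 ?invr_ge0 ?addr_ge0 ?(ltW q0).
move=> v sv; have [a Ha] := HA v sv; have [c Hc] := HB v sv; exists a.
have sa := sm_shift2 a sv; have sc := sm_shift2 c sv.
have iAa := integ_indic_sm mA sa; have iBc := integ_indic_sm mB sc.
have ac : (a - c) ^+ 2 * q <= 2 * (CA + CB) * energy v.
 apply: (@le_trans _ _ (2 * (I mu (fun s => \1_A s * (v s - a) ^+ 2) + I mu (fun s => \1_B s * (v s - c) ^+ 2)))).
  have i2 := integD iAa iBc; rewrite -(ID iAa iBc) -(IZ 2 i2) -(IZ _ (iq _ mAB)).
  apply: (I_le (integZ _ (iq _ mAB)) (integZ _ i2)) => s.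
  have h1 := sqr_ge0 (v s - a); have h2 := sqr_ge0 (v s - c).
  have h3 : (a - c) ^+ 2 <= 2 * ((v s - a) ^+ 2 + (v s - c) ^+ 2).
   by have := sqr_ge0 ((v s - a) + (v s - c)); nra.
  move: h1 h2 h3; rewrite !indicE in_setI. case: (s \in A); case: (s \in B) => /=; lra.
 by rewrite -mulrA ler_wpM2l// mulrDl lerD.
have iAB := integ_indic_sm (measurableU _ _ mA mB) sa.
have ib := iq _ mB.
apply: (@le_trans _ _ (I mu (fun s => \1_A s * (v s - a) ^+ 2) +
  (2 * I mu (fun s => \1_B s * (v s - c) ^+ 2) + (2 * (a - c) ^+ 2) * mB1))).
 rewrite -(IZ 2 iBc) -(IZ _ ib) -(ID (integZ 2 iBc) (integZ _ ib)).
 have i3 := integD (integZ 2 iBc) (integZ (2 * (a - c) ^+ 2) ib).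
 rewrite -(ID iAa i3); apply: (I_le iAB (integD iAa i3)) => s.
 have h1 := sqr_ge0 (v s - a); have h2 := sqr_ge0 (v s - c); have h4 := sqr_ge0 (a - c).
 have h3 : (v s - a) ^+ 2 <= 2 * ((v s - c) ^+ 2 + (a - c) ^+ 2).
  by have := sqr_ge0 ((v s - c) - (c - a)); nra.
 move: h1 h2 h3 h4; rewrite !indicE in_setU. case: (s \in A); case: (s \in B) => /=; lra.
have ac' : (a - c) ^+ 2 <= 2 * (CA + CB) / q * energy v.
 by rewrite mulrAC ler_pdivlMr.
have h2 : 2 * (a - c) ^+ 2 * mB1 <= 2 * (2 * (CA + CB) / q) * mB1 * energy v.
 have -> : 2 * (2 * (CA + CB) / q) * mB1 * energy v = 2 * (2 * (CA + CB) / q * energy v) * mB1 by ring.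
 by rewrite ler_wpM2r// ler_wpM2l.
by move: Ha Hc h2; nra.
Qed.

(* In a chart this is the Poincare inequality on a cube. *)
Lemma poinc_local t : exists A : set M, [/\ open A, A t & poinc A].
Proof.
set i := chart_at t; have st : source i t := chart_atP t; set u0 := chart i t.
have oc := @chim_open _ _ M i.
have /nbhs_ballP[e /= e0 He] : nbhs u0 (chim i) by apply: open_nbhs_nbhs; split=> //; exists t.
pose r := e / 2; have r0 : 0 < r by rewrite divr_gt0.
pose K0 := [set u : V | `|u - u0| <= r].
have cK0 : compact K0 by exact: compact_normB.
have K0i : K0 `<=` chim i.
 move=> u /= ur; apply: He; rewrite -ball_normE/= distrC (le_lt_trans ur)// ltr_pdivrMr// ltr_pMr// ltr1n//.
have [k [K [cK Ki] [sk k01 kK [ O oO [KO kO]]]]] := plateau cK0 oc K0i.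
have csk : csm K k by split=> // u nK; apply/eqP/negPn/negP => /kK.
pose A := [set s | source i s /\ `|chart i s - u0| < r].
have oA : open A.
 rewrite openE => s [ss sr]; apply: filterI; first by apply: open_nbhs_nbhs; split=> //; exact: source_open.
 have c := @chart_continuous _ _ M i s ss. have n1 : nbhs (chart i s) [set u | `|u - u0| < r].
  have o1 : open [set u : V | `|u - u0| < r].
   have -> : [set u : V | `|u - u0| < r] = ball u0 r.
    by apply/seteqP; split=> u; rewrite -ball_normE/= distrC.
   exact: ball_open.
  by apply: open_nbhs_nbhs.
 exact: (c _ n1).
exists A; split=> //; first by split=> //; rewrite subrr normr0.
have mA := borel_open oA; split=> //.
have [B B0 HB] := metric_bounds cK0 K0i.
pose a : V := u0 - const_mx r; pose b : V := u0 + const_mx r.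
have abr j : a 0 j < b 0 j /\ b 0 j - a 0 j <= 2 * r by rewrite !mxE; lra.
have r20 : 0 < 2 * r by lra.
pose P := \prod_(j < d) (b 0 j - a 0 j).
have P0 : 0 < P by apply: prodr_gt0 => j _; rewrite subr_gt0; case: (abr j).
pose C1 := (2 * (2 * r)) ^+ d * (d%:R * (2 * r) ^+ 2).
have C10 : 0 <= C1.
 rewrite /C1; apply: mulr_ge0; first by apply: exprn_ge0; lra. by apply: mulr_ge0 => //; exact: sqr_ge0.
exists (B * (C1 / P * B)).
 by rewrite mulr_ge0 ?(ltW B0)// mulr_ge0 ?(ltW B0)// divr_ge0// ltW.
move=> v sv; pose w u := k u * v (chart_inv i u).
have sw : csm K w by apply: (cutoff_ex oc cK Ki csk); exact: sm_smc.
have kKc := closed_rV cK.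
have [m Hm] := poincare_box Hl cK sw abr r20; exists m.
have boxK u : box a b u -> K0 u.
 move=> bu; apply: rV_normP => [|j]; first exact: ltW. by have := bu j; rewrite !mxE ler_norml => /andP[x y]; lra.
have wE u : K0 u -> w u = v (chart_inv i u) by move=> K0u; rewrite /w kO ?mul1r//; exact: KO.
have gE u : K0 u -> nab2 w u = \sum_a gr i v u 0 a ^+ 2.
 move=> K0u; apply: eq_bigr => c _; rewrite mxE; congr (_ ^+ 2). apply: (pd_eq c oO (KO _ K0u)) => y Oy.
 by rewrite /w kO ?mul1r.
pose f t := \1_A t * (v t - m) ^+ 2.
have f0 s : ~ source i s -> f s = 0.
 by move=> ns; rewrite /f indicE memNset ?mul0r// => -[].
have iF : integ mu (f : BM -> R) by apply: integ_indic_sm => //; exact: sm_shift2.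
have [i1 E1] := integ_pull Hmu (i := i) f0 iF.
rewrite E1.
have mbx := meas_box a b.
have iG := integ_sm (sm_Gamma sv sv).
pose g t := \1_(source i) t * Gamma v v t.
have ig : integ mu (g : BM -> R) by apply: integ_indic_sm; [exact: meas_source|exact: sm_Gamma].
have g0 s : ~ source i s -> g s = 0 by move=> ns; rewrite /g indicE memNset ?mul0r.
have [i2 E2] := integ_pull Hmu (i := i) g0 ig.
have gle : I mu (g : BM -> R) <= energy v.
 apply: (I_le ig iG) => s; rewrite /g indicE; case: (_ \in _); rewrite ?mul1r// mul0r; exact: Gamma_ge0.
have ab j : a 0 j <= b 0 j by apply: ltW; case: (abr j).
have [iBox _] := box_fin Hl ab.
have [Cw Cw0 wC] := csm_bounded cK sw.
have [Cn Cn0 nC] := csm_bounded cK (csm_nab2 kKc sw).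
have iW : integ lam (fun u => \1_(box a b) u * (w u - m) ^+ 2).
 apply: (integ_le _ _ (integZ ((Cw + `|m|) ^+ 2) iBox)).
  apply: measurable_funM; first exact: measurable_indic.
  apply: measurable_funX; apply: measurable_funB => //; exact: meas_smcT sw.1.
 move=> u; rewrite normrM mulrC (ger0_norm (_ : 0 <= \1_(box a b) u :> R))// ler_wpM2r//.
 by rewrite normrX lerXn2r ?nnegrE ?addr_ge0// (le_trans (ler_normB _ _))// lerD2r.
have iN : integ lam (fun u => \1_(box a b) u * nab2 w u).
 apply: (integ_le _ _ (integZ Cn iBox)).
  apply: measurable_funM; first exact: measurable_indic. exact: meas_smcT (csm_nab2 kKc sw).1.
 by move=> u; rewrite normrM mulrC (ger0_norm (_ : 0 <= \1_(box a b) u :> R))// ler_wpM2r.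
apply: (@le_trans _ _ (B * I lam (fun u => \1_(box a b) u * (w u - m) ^+ 2))).
 rewrite -(IZ _ iW); apply: (I_le i1 (integZ _ iW)) => u. have RH0 : 0 <= B * (\1_(box a b) u * (w u - m) ^+ 2).
  by rewrite mulr_ge0 ?(ltW B0)// mulr_ge0 ?sqr_ge0//.
 rewrite /pull; case: asboolP => cu //; rewrite /f indicE. case: (boolP (_ \in A)) => [|_]; last by rewrite !mul0r.
 rewrite inE => -[_]; rewrite invK// => ur; have K0u : K0 u by exact: ltW. have bu : box a b u.
  move=> j; have := le_lt_trans (rV_coord (u - u0) j) ur; rewrite !mxE ltr_norml => /andP[x y].
  by apply/andP; lra.
 rewrite indicE mem_set// !mul1r wE// mulrC ler_wpM2r ?sqr_ge0//. by case: (HB _ K0u).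
rewrite -mulrA ler_wpM2l ?(ltW B0)//.
have Hm' : I lam (fun u => \1_(box a b) u * (w u - m) ^+ 2) <= C1 / P * I lam (fun u => \1_(box a b) u * nab2 w u).
 by rewrite mulrAC ler_pdivlMr// mulrC.
apply: (le_trans Hm'); rewrite -[leRHS]mulrA; apply: ler_wpM2l; first by rewrite divr_ge0// ltW.
apply: (@le_trans _ _ (B * I mu (g : BM -> R))); last by rewrite ler_wpM2l// ltW.
rewrite E2 -(IZ _ i2); apply: (I_le iN (integZ _ i2)) => u.
have pg0 : 0 <= B * pull i g u.
 by rewrite mulr_ge0 ?(ltW B0)// pull_ge0// => s; rewrite mulr_ge0 ?Gamma_ge0//.
rewrite indicE; case: (boolP (_ \in _)) => [|_]; last by rewrite mul0r.
rewrite inE => /boxK K0u; rewrite gE//; have cu := K0i _ K0u.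
rewrite /pull asboolT// /g indicE mem_set ?mul1r; last exact: chim_source.
rewrite (GammaE sv sv (chim_source cu)) invK//.
by have [_ _] := HB _ K0u.
Qed.

(** The points that share with a base point an open set satisfying [poinc] form an open and closed
    set, which is everything by connectedness; compactness leaves a finite union of such sets. *)
Lemma poinc_all : poinc setT.
Proof.
pose t0 : M := point.
pose S := [set t | exists A : set M, [/\ open A, A t, A t0 & poinc A]].
have oS : open S.
 rewrite openE => t [A [oA At A0 pA]]; apply: (@filterS _ _ _ A); last exact: open_nbhs_nbhs.
 by move=> s As; exists A.
have cS : closed S.
 rewrite -[S]setCK; apply: open_closedC; rewrite openE => t nS. have [B [oB Bt pB]] := poinc_local t.
 apply: (@filterS _ _ _ B); last exact: open_nbhs_nbhs.
 move=> s Bs [A [oA As A0 pA]]; apply: nS; exists (A `|` B); split; [exact: openU|by right|by left|].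
 exact: (poincU oA oB As Bs).
have ST : S = setT.
 apply: kM.
 - by have [B [oB Bt pB]] := poinc_local t0; exists t0; exists B.
 - by exists S => //; rewrite setTI.
 - by exists S => //; rewrite setTI.
have H t : exists A : set M, [/\ open A, A t, A t0 & poinc A] by have : S t by rewrite ST.
have [A HA] := choice H.
have [D _ TD] : finite_subset_cover setT A setT.
 move: cM; rewrite compact_cover; apply; first by move=> t _; case: (HA t).
 by move=> t _; exists t => //; case: (HA t).
have L (s : seq M) t : exists B : set M, [/\ open B, B t0, poinc B & forall u, u \in s -> A u `<=` B].
 elim: s => [|u s [B [oB B0 pB sB]]].
  by exists (A t); case: (HA t) => ? ? ? ?.
 have [oA _ A0 pA] := HA u. exists (A u `|` B); split; [exact: openU|by left|exact: (poincU oA oB A0 B0)|].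
 by move=> y; rewrite inE => /orP[/eqP ->|/sB h]; [left|right; exact: h].
have [B [oB B0 pB sB]] := L (finmap.enum_fset D) t0.
apply: poincS pB => //; first by move=> t _; have [u Du Aut] := TD t Logic.I; apply: (sB u) Aut.
Qed.

Lemma poincare : exists2 C, 0 < C & forall v, sm v -> I mu (v : BM -> R) = 0 ->
 I2 mu v <= C * energy v.
Proof.
have [_ [C C0 H]] := poinc_all; exists (C + 1); first by rewrite ltr_wpDl.
move=> v sv v0; have [m Hm] := H v sv.
have E0 : 0 <= energy v by exact: energy_ge0.
apply: (@le_trans _ _ (C * energy v)); last by rewrite ler_wpM2r// lerDl.
apply: (le_trans _ Hm).
have [_ iv2] := sqint_sm sv; have iv := integ_sm sv.
have i1 := integ_cst mufin 1.
rewrite (_ : I mu (fun t => \1_setT t * _) = I2 mu v + (- (2 * m) * I mu (v : BM -> R) + m ^+ 2 * I mu (fun=> 1 : R))).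
 by rewrite v0 mulr0 add0r lerDl mulr_ge0 ?sqr_ge0// I_ge0.
rewrite -(IZ _ iv) -(IZ _ i1) -(ID (integZ _ iv) (integZ _ i1)) -(ID iv2 (integD (integZ _ iv) (integZ _ i1))).
by apply: I_eq => t; rewrite indicE in_setT /=; ring.
Qed.

(** With S = int v^2, X = int v Delta v and Y = int (Delta v)^2, the Poincare inequality gives S <=
    C X and Cauchy-Schwarz X^2 <= S Y, so S <= C^2 Y. *)
Lemma poincare_laplacian : exists2 C, 0 < C & forall v, sm v -> I mu (v : BM -> R) = 0 ->
 I2 mu v <= C * I2 mu (Lapl v).
Proof.
have [C C0 H] := poincare; exists (C ^+ 2); first by rewrite exprn_gt0.
move=> v sv v0; have := H v sv v0; rewrite /energy -(green sv sv).
have := CS (sqint_sm sv) (sqint_sm (sm_Lapl sv)).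
set S := I2 mu v; set X := I mu _; set Y := I mu _ => cs SX.
have S0 : 0 <= S by exact: I2_ge0.
have Y0 : 0 <= Y by exact: I2_ge0.
have [->|Sn] := eqVneq S 0; first by rewrite mulr_ge0// sqr_ge0.
have Sp : 0 < S by rewrite lt_def Sn.
rewrite -(ler_pM2l Sp); apply: (@le_trans _ _ ((C * X) ^+ 2)).
 by rewrite -expr2 lerXn2r// nnegrE// (le_trans S0).
by rewrite exprMn [leRHS]mulrCA; apply: ler_wpM2l => //; exact: sqr_ge0.
Qed.

Lemma poincare_iter k : exists2 C, 0 < C & forall v, sm v -> I mu (v : BM -> R) = 0 ->
 I2 mu v <= C * I2 mu (iter k (@Lapl) v).
Proof.
have [C C0 H] := poincare_laplacian.
elim: k => [|k [C' C'0 IH]]; first by exists 1 => // v _ _; rewrite mul1r.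
exists (C * C'); first exact: mulr_gt0.
move=> v sv v0; apply: (le_trans (H v sv v0)); rewrite -mulrA ler_pM2l//.
have sl := sm_Lapl sv.
have := IH _ sl (I_laplacian sv).
by under [X in _ <= _ * I mu X]eq_fun do rewrite -iterSr.
Qed.

End poincare.

(** * The Sobolev embedding by truncation at level sets *)

Section chain.
Implicit Types (i : chart_index M) (f g v phi : M -> R).
Let isq f (sf : sm f) := sqint_sm sf.
Let isi f (sf : sm f) := integ_sm sf.

(** An odd smooth truncation: 0 for |x| <= 1 and of modulus 1 for |x| >= 2, with nonnegative and
    bounded derivative. *)
Definition ramp (x : R) : R := sstep (x - 1) - sstep (- x - 1).
Definition ramp' (x : R) : R := sstep' (x - 1) + sstep' (- x - 1).

Lemma ramp_is_derive (x : R) : is_derive x 1 ramp (ramp' x).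
Proof.
have d1 : is_derive x 1 (fun y : R => y - 1) (1 - 0) by apply: is_deriveB.
have d2 : is_derive x 1 (fun y : R => - y - 1) (- 1 - 0) by apply: is_deriveB.
have h1 := @is_derive1_comp R (@sstep R) (fun y : R => y - 1) x _ _ (sstep_is_derive _) d1.
have h2 := @is_derive1_comp R (@sstep R) (fun y : R => - y - 1) x _ _ (sstep_is_derive _) d2.
have E : sstep' (x - 1) * (1 - 0) - sstep' (- x - 1) * (-1 - 0) = ramp' x.
 by rewrite /ramp'; ring.
rewrite -E; exact: is_deriveB.
Qed.

Lemma ramp_small x : `|x| <= 1 -> ramp x = 0.
Proof. by rewrite ler_norml => /andP[h1 h2]; rewrite /ramp !sstep0// ; lra. Qed.

Lemma ramp_le1 x : `|ramp x| <= 1.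
Proof.
rewrite /ramp ler_norml; have := sstep_ge0 (x - 1); have := sstep_le1 (x - 1).
by have := sstep_ge0 (- x - 1); have := sstep_le1 (- x - 1); lra.
Qed.

Lemma ramp_big x : 2 <= `|x| -> `|ramp x| = 1.
Proof.
rewrite /ramp; have [x0|x0] := leP 0 x.
 by rewrite ger0_norm// => h; rewrite sstep1 ?sstep0 ?subr0 ?normr1//; lra.
rewrite ltr0_norm// => h; rewrite sstep0 ?sstep1 ?sub0r ?normrN ?normr1//; lra.
Qed.

Lemma sm_ramp f : sm f -> sm (fun t => ramp (f t)).
Proof.
move=> sf.
have s1 : sm (fun t => f t + (-1) * 1) by apply: smD => //; exact: sm_cst.
have s2 : sm (fun t => -1 * f t + (-1) * 1) by apply: smD; [exact: smZ|apply: smZ; exact: sm_cst].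
have := smD (sm_sstep s1) (smZ (-1) (sm_sstep s2)); congr sm; apply/funext => t.
by rewrite !mulN1r.
Qed.

Definition lev (a : R) phi : set BM := [set t | a < `|phi t|].

Lemma meas_lev a phi : sm phi -> measurable (lev a phi).
Proof.
move=> sp; have mp : mfun (fun t : BM => `|phi t|).
 by apply: measurableT_comp => //; exact: meas_smooth.
have -> : lev a phi = [set: BM] `&` (fun t => `|phi t|) @^-1` `]a, +oo[%classic.
 by apply/seteqP; split=> t /=; rewrite in_itv/= andbT; [split|case].
exact: mp.
Qed.

Lemma lev_indic a phi t : \1_(lev a phi) t = (a < `|phi t|)%R%:R :> R.
Proof. by rewrite indicE; congr (nat_of_bool _)%:R; apply/idP/idP; rewrite inE. Qed.

Definition mlev a phi := I mu (\1_(lev a phi) : BM -> R).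
Definition flev a phi := I mu (fun t => \1_(lev a phi) t * `|Lapl phi t|).

Let ilev a phi : sm phi -> integ mu (\1_(lev a phi) : BM -> R).
Proof.
move=> sp; apply: (eq_integ _ (integ_indic_sm (meas_lev a sp) (sm_cst M 1))) => t.
by rewrite mulr1.
Qed.

Let iflev a phi : sm phi -> integ mu (fun t => \1_(lev a phi) t * `|Lapl phi t|).
Proof.
move=> sp; have il := isi (sm_Lapl sp).
apply: (integ_le _ _ (integ_abs il)).
 apply: measurable_funM; first exact: measurable_indic (meas_lev a sp).
 by apply: measurableT_comp => //; exact: integ_meas il.
by move=> t; rewrite normrM normr_id indicE; case: (_ \in _); rewrite ?normr1 ?mul1r// normr0 mul0r.
Qed.

(** Bounding one of the two factors [ramp'] by a constant leaves Gamma(ramp(phi/a), phi), whose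
    integral is int ramp(phi/a) Delta phi by Green's formula; [ramp] vanishes where |phi| <= a. *)
Lemma truncation_energy : exists2 B, 0 < B & forall a phi, 0 < a -> sm phi ->
 energy (fun t => a * ramp (a^-1 * phi t)) <= B * (a * flev a phi).
Proof.
have [B B0 HB] := @sstep'_bounded R.
exists (2 * B); first by rewrite mulr_gt0.
move=> a phi a0 sp; have spa : sm (fun t => a^-1 * phi t) by exact: smZ.
have sr := sm_ramp spa; have sv := smZ a sr.
have r0 x : 0 <= ramp' x by rewrite addr_ge0 ?sstep'_ge0.
have rB x : ramp' x <= 2 * B by rewrite mulr_natl lerD.
have G t : Gamma (fun t => a * ramp (a^-1 * phi t)) (fun t => a * ramp (a^-1 * phi t)) t =
  ramp' (a^-1 * phi t) ^+ 2 * Gamma phi phi t.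
 rewrite (GammaZZ _ _ t sr sr) (Gamma_comp _ t spa ramp_is_derive) GammaC (Gamma_comp _ t spa ramp_is_derive).
 by rewrite (GammaZZ _ _ t sp sp); field; rewrite gt_eqF.
have G2 t : Gamma (fun t => ramp (a^-1 * phi t)) phi t = ramp' (a^-1 * phi t) * (a^-1 * Gamma phi phi t).
 by rewrite (Gamma_comp _ t spa ramp_is_derive) (GammaZl _ _ t sp).
have gr : I mu (Gamma (fun t => ramp (a^-1 * phi t)) phi : BM -> R) <= flev a phi.
 rewrite -(green sr sp). apply: (I_le (isi (smM sr (sm_Lapl sp))) (iflev a sp)) => t.
 rewrite (le_trans (ler_norm _))// normrM indicE.
 case: (boolP (t \in _)) => [_|]; first by rewrite ler_wpM2r// ramp_le1.
 rewrite notin_setE/= => /negP; rewrite -leNgt => h.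
 by rewrite ramp_small ?normr0// normrM ger0_norm ?invr_ge0 ?(ltW a0)// mulrC ler_pdivrMr// mul1r.
have sG := sm_Gamma sr sp.
apply: (@le_trans _ _ (2 * B * (a * I mu (Gamma (fun t => ramp (a^-1 * phi t)) phi : BM -> R)))).
 have i1 := isi sG; rewrite -(IZ a i1) -(IZ _ (integZ a i1)).
 apply: (I_le (isi (sm_Gamma sv sv)) (integZ _ (integZ a i1))) => t.
 rewrite G G2; have -> : a * (ramp' (a^-1 * phi t) * (a^-1 * Gamma phi phi t)) = ramp' (a^-1 * phi t) * Gamma phi phi t.
  by field; rewrite gt_eqF.
 by rewrite expr2 -mulrA ler_wpM2r ?mulr_ge0 ?Gamma_ge0.
by rewrite ler_wpM2l ?mulr_ge0 ?(ltW B0)// ler_wpM2l// ltW.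
Qed.

Lemma mlev_ge0 a phi : 0 <= mlev a phi.
Proof. by apply: I_ge0 => t. Qed.

(** Faber-Krahn for v = a ramp(phi/a), which lives on {|phi| > a}, so that (int |v|)^2 <= m int v^2.
    At the radius with r^D = 4 C0 m both error terms are absorbed and int v^2 <= 2 C0 r^2 E(v);
    moreover |v| = a on {|phi| > 2a}. The condition D >= d enters through r^D <= r^d, as r <= 1. *)
Lemma level_decay (D : R) : d%:R <= D -> 0 < D -> exists C m0 : R, [/\ 0 < C, 0 < m0 &
 forall a phi, 0 < a -> sm phi -> mlev a phi <= m0 ->
  a * mlev (2 * a) phi <= C * (mlev a phi `^ (2 / D) * flev a phi)].
Proof.
move=> dD D0; have [C0 C00 FK] := faber_krahn.
have [B B0 HB] := truncation_energy.
have C4 : 0 < 4 * C0 by rewrite mulr_gt0.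
(* [r <= r0] ensures both r <= 1 and C0 r^2 <= 1/4; this determines the threshold for the
   measure. *)
pose r0 := Num.min 1 ((4 * C0)^-1); have r00 : 0 < r0 by rewrite lt_min ltr01 invr_gt0.
have r01 : r0 <= 1 by rewrite ge_min lexx.
have r02 : r0 <= (4 * C0)^-1 by rewrite ge_min lexx orbT.
exists (2 * C0 * B * (4 * C0) `^ (2 / D)), (r0 `^ D / (4 * C0)); split.
- by rewrite !mulr_gt0// powR_gt0.
- by rewrite divr_gt0// powR_gt0.
move=> a phi a0 sp mm; set m := mlev a phi in mm *; set m' := mlev _ phi; set F := flev a phi.
have m0 : 0 <= m by exact: mlev_ge0.
have sub (t : BM) : \1_(lev (2 * a) phi) t <= \1_(lev a phi) t :> R.
 rewrite !indicE; case: (boolP (t \in lev (2 * a) phi)) => // /set_mem h.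
 rewrite mem_set//= ; move: h; rewrite /lev/=; apply: lt_trans; lra.
have mm' : m' <= m by apply: (I_le (ilev _ sp) (ilev _ sp)) => t; exact: sub.
have [mz|mn] := eqVneq m 0.
 have D2 : 2 / D != 0 by rewrite mulf_neq0 ?invr_eq0 ?gt_eqF.
 have -> : m' = 0 by apply: le_anti; rewrite mlev_ge0 andbT -mz. by rewrite mz powR0// mul0r !mulr0.
have mp : 0 < m by rewrite lt_def mn.
pose r := (4 * C0 * m) `^ D^-1.
have Cm : 0 < 4 * C0 * m by rewrite mulr_gt0.
have rp : 0 < r by rewrite powR_gt0.
have rr0 : r <= r0.
 have -> : r0 = (r0 `^ D) `^ D^-1 by rewrite -powRrM mulfV ?gt_eqF// powRr1// ltW.
 rewrite ge0_ler_powR ?nnegrE ?invr_ge0 ?powR_ge0 ?(ltW D0) ?(ltW Cm)//. by rewrite mulrC -ler_pdivlMr.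
have r1 : r <= 1 by exact: le_trans rr0 r01.
have rD : r `^ D = 4 * C0 * m by rewrite /r -powRrM mulVf ?gt_eqF// powRr1// ltW.
have rd : 4 * C0 * m <= r ^+ d by rewrite -rD -powR_mulrn ?(ltW rp)// ger_powR// rp.
have r2 : r ^+ 2 = (4 * C0) `^ (2 / D) * m `^ (2 / D).
 by rewrite -(powRM _ (ltW C4) m0) -(powR_mulrn 2 (ltW rp)) /r -powRrM [_ * 2]mulrC.
have Cr2 : C0 * r ^+ 2 <= 1 / 4.
 have : C0 * r <= C0 * (4 * C0)^-1 by rewrite ler_pM2l// (le_trans rr0).
 have -> : C0 * (4 * C0)^-1 = 1 / 4 by field; rewrite gt_eqF.
 by apply: le_trans; rewrite expr2 mulrA ler_piMr// mulr_ge0 ?(ltW C00)// ltW.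
have spa : sm (fun t => a^-1 * phi t) by exact: smZ.
pose v t := a * ramp (a^-1 * phi t); have sv : sm v by apply: smZ; exact: sm_ramp.
have fk := FK v r sv rp r1; have en := HB a phi a0 sp; rewrite -/F in en.
rewrite -/v in en.
set S := I2 mu v in fk; set L := I mu (fun t => `|v t|) in fk; set E := energy v in fk en.
have E0 : 0 <= E by exact: energy_ge0.
have S0 : 0 <= S by exact: I2_ge0.
have vz (t : BM) : \1_(lev a phi) t * `|v t| = `|v t|.
 rewrite indicE; case: (boolP (t \in _)) => [_|]; first by rewrite mul1r.
 rewrite notin_setE /lev/= => /negP; rewrite -leNgt => h.
 rewrite /v ramp_small ?mulr0 ?normr0 ?mulr0// normrM ger0_norm ?invr_ge0 ?(ltW a0)//.
 by rewrite mulrC ler_pdivrMr// mul1r.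
have LS : L ^+ 2 <= m * S.
 have ind2 (t : BM) : \1_(lev a phi) t ^+ 2 = \1_(lev a phi) t :> R.
  by rewrite indicE; case: (_ \in _); rewrite ?expr1n ?expr0n.
 have s1 : sqint mu (\1_(lev a phi) : BM -> R).
  split; first exact: measurable_indic (meas_lev a sp). by apply: (eq_integ _ (ilev a sp)) => t; rewrite ind2.
 have [mv iv2] := isq sv. have s2 : sqint mu (fun t => `|v t|).
  split; first by apply: measurableT_comp. by apply: (eq_integ _ iv2) => t; rewrite real_normK// num_real.
 have := CS s1 s2.
 rewrite (_ : I mu (fun t => \1_(lev a phi) t * `|v t|) = L); last by apply: I_eq => t; exact: vz.
 rewrite (_ : I mu (fun t => \1_(lev a phi) t ^+ 2) = m); last by apply: I_eq => t; exact: ind2.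
 rewrite (_ : I mu (fun t => `|v t| ^+ 2) = S)//; apply: I_eq => t. by rewrite real_normK// num_real.
have rdp : 0 < r ^+ d by rewrite exprn_gt0.
have SE : S <= 2 * C0 * r ^+ 2 * E.
 have h1 : C0 * L ^+ 2 <= r ^+ d / 4 * S.
  apply: (@le_trans _ _ (C0 * (m * S))); first by rewrite ler_wpM2l// ltW. by rewrite mulrA ler_wpM2r//; lra.
 have h2 : C0 * (r ^+ d.+2 * (E + S)) <= r ^+ d * (C0 * r ^+ 2 * E + 1 / 4 * S).
  rewrite -[d.+2]addn2 exprD; have -> : C0 * (r ^+ d * r ^+ 2 * (E + S)) = r ^+ d * (C0 * r ^+ 2 * E + C0 * r ^+ 2 * S) by ring.
  by rewrite ler_pM2l// lerD2l ler_wpM2r.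
 have h3 : r ^+ d * S <= r ^+ d * (C0 * r ^+ 2 * E + S / 2).
  apply: (le_trans fk); rewrite mulrDr (le_trans (lerD h2 h1))//. by apply: eq_le_; field.
 by move: h3; rewrite ler_pM2l//; lra.
have aS : a ^+ 2 * m' <= S.
 have [_ iv2] := isq sv. rewrite /m' /mlev -(IZ _ (ilev _ sp)); apply: (I_le (integZ _ (ilev _ sp)) iv2) => t.
 rewrite indicE; case: (boolP (t \in _)) => [|_]; last by rewrite mulr0 sqr_ge0.
 rewrite inE /lev/= => h; rewrite mulr1 /v exprMn ler_peMr ?sqr_ge0//.
 rewrite -[X in _ <= X]real_normK ?num_real// ramp_big ?expr1n//.
 by rewrite normrM ger0_norm ?invr_ge0 ?(ltW a0)// mulrC ler_pdivlMr// ltW.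
have fin : a ^+ 2 * m' <= a * (2 * C0 * B * (4 * C0) `^ (2 / D) * (m `^ (2 / D) * F)).
 apply: (le_trans aS); apply: (le_trans SE).
 have -> : a * (2 * C0 * B * (4 * C0) `^ (2 / D) * (m `^ (2 / D) * F)) = 2 * C0 * r ^+ 2 * (B * (a * F)).
  by rewrite r2; ring.
 by apply: ler_wpM2l => //; apply: mulr_ge0; [rewrite mulr_ge0// ltW|exact: sqr_ge0].
by move: fin; rewrite expr2 -mulrA ler_pM2l.
Qed.

Lemma sm_pint p f : 0 < p -> sm f -> pint mu p (f : BM -> R).
Proof.
move=> p0 sf; split; first exact: meas_smooth.
have [B B0 fB] := sm_bounded sf.
apply: (integ_bounded mufin (C := B `^ p)).
 apply: (measurableT_comp (measurable_powR _)); apply: measurableT_comp => //. exact: meas_smooth.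
move=> t; rewrite ger0_norm// ge0_ler_powR// ltW//.
Qed.

(** A sum over dyadic levels a_k. The power of the measure in [level_decay] is estimated by
    Chebyshev's inequality against X = int |phi|^t, the remaining sum by int |phi|^c |Delta phi|,
    and this by Hoelder. The powers of X add up to 1 - 1/t, so cancelling them leaves the t-norm; X
    is finite because phi is smooth. *)
Lemma sobolev_step (D s t : R) : d%:R <= D -> 0 < D -> 1 < s -> 0 < t -> t^-1 = s^-1 - 2 / D ->
 exists2 C, 0 < C & forall phi, sm phi ->
  nrm mu t (phi : BM -> R) <= C * (nrm mu s (Lapl phi : BM -> R) + I mu (fun x => `|phi x|)).
Proof.
move=> dD D0 s1 t0 ts; have [C [m0 [C0 m00 HC]]] := level_decay dD D0.
have s0 : 0 < s by exact: lt_trans s1.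
(* [c] is both t - 1 - 2t/D, the power of [a] left over in the dyadic sum, and t(1 - 1/s), the
   exponent that fits Hoelder's inequality with s. *)
pose c := t * (1 - s^-1); have s1' : 0 < 1 - s^-1 by rewrite subr_gt0 invf_lt1.
have c0 : 0 < c by rewrite mulr_gt0.
have cE : c = t - 1 - t * (2 / D).
 have -> : 2 / D = s^-1 - t^-1 by rewrite ts; ring. by rewrite /c; field; rewrite !gt_eqF.
pose K := 2 `^ c / (2 `^ c - 1).
have K0 : 0 <= K.
 have : (1 : R) `^ c < 2 `^ c by rewrite gt0_ltr_powR ?nnegrE// ltr1n.
 by rewrite powR1 => h; rewrite divr_ge0// subr_ge0 ltW.
pose mu1 := I mu (fun=> 1 : R); have mu10 : 0 < mu1 := I1_gt0.
pose B := 4 `^ t * C * K.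
have B0 : 0 <= B by rewrite mulr_ge0// mulr_ge0// ltW.
pose CC := 1 + 2 * B + (2 * mu1) `^ t^-1 * (2 / m0).
have Q0 : 0 <= (2 * mu1) `^ t^-1 * (2 / m0) by rewrite mulr_ge0 ?powR_ge0// divr_ge0// ltW.
have CC0 : 0 < CC by rewrite /CC; lra.
exists CC => //.
move=> phi sp; set N1 := I mu (fun x => `|phi x|); set F := nrm mu s _.
have F0 : 0 <= F by exact: nrm_ge0.
have N10 : 0 <= N1 by apply: I_ge0 => x.
have [Bp Bp0 pB] := sm_bounded sp.
have ip := integ_abs (isi sp).
have RHS0 : 0 <= CC * (F + N1) by rewrite mulr_ge0 ?(ltW CC0)// addr_ge0.
(* In this case phi vanishes identically; otherwise the lowest level [a0] is positive. *)
have [N1z|N1n] := eqVneq N1 0.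
 have p2 : I2 mu phi = 0.
  apply: le_anti; apply/andP; split; last by exact: I2_ge0. rewrite -[leRHS](mulr0 Bp) -N1z -(IZ _ ip).
  have [_ i2] := isq sp; apply: (I_le i2 (integZ _ ip)) => x.
  by rewrite -[X in X <= _]real_normK ?num_real// ler_wpM2r.
 have pz := smooth_sq_eq0 sp p2. suff E : I mu (fun x => `|phi x| `^ t) = 0.
  by rewrite /nrm E powR0// invr_eq0 gt_eqF.
 rewrite -[RHS](mul0r mu1) -(IZ _ (integ_cst mufin 1)); apply: I_eq => x.
 by rewrite pz normr0 powR0 ?mul0r// gt_eqF.
have N1p : 0 < N1 by rewrite lt_def N1n.
(* By Chebyshev's inequality all level sets from [a0] upwards have measure at most [m0]. *)
pose a0 := N1 / m0; have a00 : 0 < a0 by rewrite divr_gt0.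
pose a k := a0 * 2 ^+ k.
have a0k k : 0 < a k by rewrite mulr_gt0//.
have aa k : a0 <= a k by rewrite ler_peMr ?(ltW a00)// exprn_ege1// ler1n.
have ml k : mlev (a k) phi <= m0.
 have h : a k * mlev (a k) phi <= N1.
  rewrite -(IZ _ (ilev _ sp)); apply: (I_le (integZ _ (ilev _ sp)) ip) => x.
  rewrite indicE; case: (boolP (x \in _)) => [|_]; last by rewrite mulr0. by rewrite inE mulr1 => /ltW.
 rewrite -(ler_pM2l (a0k k)) (le_trans h)//. have -> : N1 = a0 * m0 by rewrite divfK// gt_eqF. by rewrite ler_pM2r.
pose X := I mu (fun x => `|phi x| `^ t).
have [_ iX] := sm_pint t0 sp.
have X0 : 0 <= X by apply: I_ge0 => x; exact: powR_ge0.
have mX k : mlev (a k) phi <= X / (a k) `^ t.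
 rewrite ler_pdivlMr ?powR_gt0// mulrC /mlev -(IZ _ (ilev _ sp)). apply: (I_le (integZ _ (ilev _ sp)) iX) => x.
 rewrite indicE; case: (boolP (x \in _)) => [|_]; last by rewrite mulr0 powR_ge0.
 by rewrite inE mulr1 => /ltW h; rewrite ge0_ler_powR ?nnegrE// ltW.
(* Finitely many dyadic levels reach the maximum of |phi|. *)
have [n Hn] : exists n, Bp <= 2 * a n.
 exists (Num.truncn (Bp / (2 * a0))).+1. have a20 : 0 < 2 * a0 by rewrite mulr_gt0.
 rewrite /a mulrA -ler_pdivrMl// mulrC.
 apply: (le_trans (ltW (truncnS_gt _))); by rewrite -natrX ler_nat ltnW// ltn_expl.
pose A := (2 * a0) `^ t * mu1.
have A0 : 0 <= A by rewrite mulr_ge0 ?powR_ge0// ltW.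
have i1 := integ_cst mufin 1.
have ik k := integZ ((4 * a k) `^ t) (ilev (2 * a k) sp).
have iSk : integ mu (fun x => \sum_(k < n) (4 * a k) `^ t * \1_(lev (2 * a k) phi) x) by exact: integ_sum.
have XA : X <= A + \sum_(k < n) (4 * a k) `^ t * mlev (2 * a k) phi.
 have -> : A + \sum_(k < n) (4 * a k) `^ t * mlev (2 * a k) phi =
  I mu (fun x => (2 * a0) `^ t * 1 + \sum_(k < n) (4 * a k) `^ t * \1_(lev (2 * a k) phi) x).
  rewrite (ID (integZ _ i1) iSk) (IZ _ i1) (I_sum _ (fun k : 'I_n => ik k)); congr (_ + _).
  by apply: eq_bigr => k _; rewrite (IZ _ (ilev _ sp)).
 apply: (I_le iX (integD (integZ _ i1) iSk)) => x; rewrite mulr1.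
 apply: (le_trans (dyadic_layer (n := n) a00 t0 (normr_ge0 (phi x)) (le_trans (pB x) Hn))).
 by rewrite lerD2l; apply: ler_sum => k _; rewrite lev_indic.
pose G k := a k `^ c * flev (a k) phi.
have Fk0 k : 0 <= flev (a k) phi by apply: I_ge0 => x; rewrite mulr_ge0// indicE.
have term k : (4 * a k) `^ t * mlev (2 * a k) phi <= 4 `^ t * C * X `^ (2 / D) * G k.
 have ak := a0k k; have an : a k != 0 by rewrite gt_eqF. have D2 : 0 <= 2 / D by rewrite divr_ge0// ltW.
 have h1 : mlev (2 * a k) phi <= (a k)^-1 * (C * (mlev (a k) phi `^ (2 / D) * flev (a k) phi)).
  by rewrite -ler_pdivrMl ?invr_gt0// invrK; exact: HC.
 have h2 : mlev (a k) phi `^ (2 / D) <= X `^ (2 / D) / a k `^ (t * (2 / D)).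
  apply: (@le_trans _ _ ((X / a k `^ t) `^ (2 / D))).
   apply: ge0_ler_powR; rewrite ?nnegrE; [exact: D2|exact: mlev_ge0|exact: (divr_ge0 X0 (powR_ge0 _ _))|exact: mX].
  rewrite powRM ?invr_ge0 ?powR_ge0// -[X in _ * X `^ _]powR_inv1 ?powR_ge0//.
  by rewrite -!powRrM mulN1r mulrN powRN.
 have E : a k `^ c = a k `^ t / a k / a k `^ (t * (2 / D)).
  by rewrite cE !powRB ?an ?implybT// powRr1// ltW.
 rewrite powRM ?(ltW ak)// /G E.
 apply: (@le_trans _ _ (4 `^ t * a k `^ t * ((a k)^-1 * (C * (X `^ (2 / D) / a k `^ (t * (2 / D)) * flev (a k) phi))))).
  rewrite ler_wpM2l ?mulr_ge0 ?powR_ge0//; apply: (le_trans h1).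
  by rewrite ler_wpM2l ?invr_ge0 ?(ltW ak)// ler_wpM2l ?(ltW C0)// ler_wpM2r.
 by apply: eq_le_; ring.
have il := isi (sm_Lapl sp).
have [ml' il'] := sm_pint s0 (sm_Lapl sp).
have mpc : mfun (fun x : BM => `|phi x| `^ c).
 apply: (measurableT_comp (measurable_powR _)); apply: measurableT_comp => //; exact: meas_smooth.
have pc : pint mu (t / c) (fun x : BM => `|phi x| `^ c).
 split=> //; apply: (eq_integ _ iX) => x. by rewrite norm_powRrM.
have tc : (t / c)^-1 + s^-1 = 1.
 by rewrite invf_div /c mulrAC mulfV ?gt_eqF// mul1r subrK.
have [iY Yle] := I_hoelder (divr_gt0 t0 c0) s0 tc pc (conj ml' il').
pose Y := I mu (fun x => `|phi x| `^ c * `|Lapl phi x|).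
have iY' : integ mu (fun x => `|phi x| `^ c * `|Lapl phi x|).
 by apply: (eq_integ _ (integ_abs iY)) => x; rewrite normrM (ger0_norm (powR_ge0 _ _)).
have YF : Y <= X `^ (c / t) * F.
 rewrite (_ : Y = I mu (fun x => `|(`|phi x| `^ c) * Lapl phi x|)); last first.
  by apply: I_eq => x; rewrite normrM (ger0_norm (powR_ge0 _ _)).
 apply: (le_trans Yle); have -> : nrm mu (t / c) (fun x : BM => `|phi x| `^ c) = X `^ (c / t).
  by rewrite /nrm invf_div; congr (_ `^ _); apply: I_eq => x; rewrite norm_powRrM.
 exact: lexx.
have GY : \sum_(k < n) G k <= K * Y.
 have iG k : integ mu (fun x => a k `^ c * (\1_(lev (a k) phi) x * `|Lapl phi x|)).
  exact: integZ (iflev _ sp).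
 rewrite (eq_bigr (fun k : 'I_n => I mu (fun x => a k `^ c * (\1_(lev (a k) phi) x * `|Lapl phi x|)))); last first.
  by move=> k _; rewrite (IZ _ (iflev _ sp)).
 rewrite -(I_sum _ (fun k : 'I_n => iG k)) -(IZ _ iY'); apply: (I_le _ (integZ _ iY')).
  by apply: integ_sum => k; exact: iG.
 move=> x; under eq_bigr do rewrite mulrA. rewrite -mulr_suml [leRHS]mulrA ler_wpM2r//.
 apply: (le_trans _ (dyadic_sum n a00 c0 (normr_ge0 (phi x)))). by apply: ler_sum => k _; rewrite lev_indic.
have main : X <= A + B * (X `^ (2 / D) * X `^ (c / t) * F).
 apply: (le_trans XA); rewrite lerD2l.
 apply: (@le_trans _ _ (4 `^ t * C * X `^ (2 / D) * (K * (X `^ (c / t) * F)))); last first.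
  by apply: eq_le_; rewrite /B; ring.
 apply: (@le_trans _ _ (\sum_(k < n) 4 `^ t * C * X `^ (2 / D) * G k)).
  by apply: ler_sum => k _; exact: term.
 rewrite -mulr_sumr ler_wpM2l ?mulr_ge0 ?powR_ge0 ?(ltW C0)//. by rewrite (le_trans GY)// ler_wpM2l.
rewrite /nrm -/X; set y := X `^ t^-1.
have [Xz|Xn] := eqVneq X 0.
 by rewrite /y Xz powR0 ?invr_eq0 ?gt_eqF.
have Xp : 0 < X by rewrite lt_def Xn.
have yp : 0 < y by exact: powR_gt0.
have XE : X `^ (2 / D) * X `^ (c / t) = X / y.
 rewrite -powRD ?Xn ?implybT// (_ : 2 / D + c / t = 1 - t^-1).
  by rewrite powRB ?Xn ?implybT// powRr1// ltW.
 have -> : 2 / D = s^-1 - t^-1 by rewrite ts; ring. by rewrite /c; field; rewrite !gt_eqF.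
rewrite XE in main.
(* Either the bottom layer [A] dominates, which is bounded by the L1 norm, or it is absorbed. *)
have [XA2|XA2] := leP X (2 * A).
 have : y <= (2 * mu1) `^ t^-1 * (2 / m0 * N1).
  apply: (@le_trans _ _ ((2 * A) `^ t^-1)).
   by rewrite ge0_ler_powR ?nnegrE ?invr_ge0 ?(ltW t0)// mulr_ge0.
  have -> : 2 * A = (2 * mu1) * (2 * a0) `^ t by rewrite /A; ring.
  rewrite powRM ?powR_ge0//; last by rewrite mulr_ge0 ?(ltW mu10).
  rewrite -powRrM mulfV ?gt_eqF// powRr1; last by rewrite mulr_ge0 ?(ltW a00).
  rewrite /a0 (_ : 2 * (N1 / m0) = 2 / m0 * N1); first exact: lexx. by rewrite mulrA mulrAC.
 rewrite mulrA; exact: absorb_le1.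
have h : y <= 2 * B * F by exact: (absorb_div yp Xp XA2 main).
exact: absorb_le2.
Qed.

Lemma nrm2E (f : BM -> R) : nrm mu 2 f = Num.sqrt (I2 mu f).
Proof.
rewrite /nrm powR12_sqrt; last by apply: I_ge0 => x; exact: powR_ge0.
by congr Num.sqrt; apply: I_eq => x; rewrite powR_mulrn// real_normK// num_real.
Qed.

Lemma I_abs_nrm2 (f : M -> R) : sm f ->
 I mu (fun x => `|f x|) <= Num.sqrt (I mu (fun=> 1 : R)) * nrm mu 2 (f : BM -> R).
Proof.
move=> sf; have h := I_abs_sq mufin (isq sf).
have m1 : 0 <= I mu (fun=> 1 : R) by apply: I_ge0.
rewrite nrm2E -sqrtrM// -[leLHS]ger0_norm; last by apply: I_ge0.
by rewrite -sqrtr_sqr ler_wsqrtr.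
Qed.

Lemma nrm2_poincare k : exists2 C, 0 < C & forall v, sm v -> I mu (v : BM -> R) = 0 ->
 nrm mu 2 (v : BM -> R) <= C * nrm mu 2 (iter k (@Lapl) v : BM -> R).
Proof.
move=> *; have [C C0 H] := poincare_iter k.
exists (Num.sqrt C); first by rewrite sqrtr_gt0.
by move=> v sv v0; rewrite !nrm2E -sqrtrM ?(ltW C0)// ler_wsqrtr//; exact: H.
Qed.

(** Each step lowers the reciprocal exponent by 2/D and uses the induction hypothesis for Delta phi,
    which has mean zero; the L1 term is bounded by the Poincare inequality. *)
Lemma sobolev_chain (D : R) j : d%:R <= D -> 0 < D -> 0 < 2^-1 - 2 * j%:R / D ->
 exists2 C, 0 < C & forall phi, sm phi -> I mu (phi : BM -> R) = 0 ->
  nrm mu (2^-1 - 2 * j%:R / D)^-1 (phi : BM -> R) <= C * nrm mu 2 (iter j (@Lapl) phi : BM -> R).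
Proof.
move=> dD D0; elim: j => [|j IH] j0.
 by exists 1 => // phi _ _; rewrite mulr0 mul0r subr0 invrK mul1r.
have e0 : 0 < 2 / D by rewrite divr_gt0.
have jE : 2 * j.+1%:R / D = 2 * j%:R / D + 2 / D :> R by rewrite -natr1; field; rewrite gt_eqF.
have jD0 : 0 <= 2 * j%:R / D by rewrite divr_ge0 ?(ltW D0)// mulr_ge0.
have j1 : 0 < 2^-1 - 2 * j%:R / D by rewrite jE in j0; lra.
have [C C0 HC] := IH j1; have [C' C'0 HC'] := nrm2_poincare j.+1.
have s1 : 1 < (2^-1 - 2 * j%:R / D)^-1 by rewrite invf_gt1//; lra.
have t0 : 0 < (2^-1 - 2 * j.+1%:R / D)^-1 by rewrite invr_gt0.
have ts : ((2^-1 - 2 * j.+1%:R / D)^-1)^-1 = ((2^-1 - 2 * j%:R / D)^-1)^-1 - 2 / D.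
 by rewrite !invrK jE; ring.
have [B B0 HB] := sobolev_step dD D0 s1 t0 ts.
pose S := Num.sqrt (I mu (fun=> 1 : R)); have S0 : 0 <= S by exact: sqrtr_ge0.
exists (B * (C + S * C')); first by rewrite mulr_gt0// ltr_wpDr// mulr_ge0// ltW.
move=> phi sp p0; have sl := sm_Lapl sp.
have l0 := I_laplacian sp.
apply: (le_trans (HB phi sp)); rewrite -[leRHS]mulrA ler_pM2l//.
rewrite [leRHS]mulrDl; apply: lerD.
 by have := HC _ sl l0; rewrite -iterSr.
apply: (le_trans (I_abs_nrm2 sp)); rewrite -[S * _ * _]mulrA; apply: ler_wpM2l => //; exact: HC'.
Qed.

(** For p > 2 the choice of [D] makes the chain end at p. For p <= 2 Hoelder's inequality on a space
    of finite measure and the Poincare inequality suffice. *)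
Lemma embedding (p : R) k : 1 <= p -> (0 < k)%N -> d%:R / 2 * (1 / 2 - 1 / p) <= k%:R ->
 exists2 C, 0 < C & forall phi, sm phi -> I mu (phi : BM -> R) = 0 ->
  nrm mu p (phi : BM -> R) <= C * nrm mu 2 (iter k (@Lapl) phi : BM -> R).
Proof.
move=> p1 k0 dk; have p0 : 0 < p by exact: lt_le_trans p1.
have kp : 0 < k%:R :> R by rewrite ltr0n.
have [p2|p2] := ltP 2 p.
 pose D := 4 * k%:R * p / (p - 2). have p20 : 0 < p - 2 by rewrite subr_gt0.
 have D0 : 0 < D by rewrite divr_gt0// !mulr_gt0. have dD : d%:R <= D.
  have E0 : d%:R * (p - 2) = 4 * p * (d%:R / 2 * (1 / 2 - 1 / p)) by field; rewrite gt_eqF.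
  have E1 : 4 * k%:R * p = 4 * p * k%:R by ring. by rewrite /D ler_pdivlMr// E0 E1 ler_pM2l// mulr_gt0.
 have E : 2^-1 - 2 * k%:R / D = p^-1.
  by rewrite /D; field; rewrite !gt_eqF//= mulr_gt0.
 have [|C C0 H] := sobolev_chain (j := k) dD D0; first by rewrite E invr_gt0.
 by rewrite E invrK in H; exists C; [exact: C0|exact: H].
have [C C0 H] := nrm2_poincare k.
pose m := I mu (fun=> 1 : R); have m0 : 0 <= m by apply: I_ge0.
exists ((1 + m) * C); first by rewrite mulr_gt0// ltr_wpDr.
move=> phi sp v0; apply: (@le_trans _ _ ((1 + m) * nrm mu 2 (phi : BM -> R))); last first.
 by rewrite -mulrA ler_wpM2l ?addr_ge0//; exact: H.
have [->|pn2] := eqVneq p 2.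
 by rewrite ler_peMl ?nrm_ge0// lerDl.
have plt : p < 2 by rewrite lt_neqAle pn2.
pose q := (1 - p / 2)^-1; have q0 : 0 < 1 - p / 2 by lra.
have pq : (2 / p)^-1 + q^-1 = 1 by rewrite /q invrK invf_div; ring.
have [mp ip] := sm_pint p0 sp; have [_ i2] := sm_pint (ltr0Sn R 1) sp.
have P1 : pint mu (2 / p) (fun x : BM => `|phi x| `^ p).
 split; first exact: integ_meas ip. by apply: (eq_integ _ i2) => x; rewrite norm_powRrM.
have P2 : pint mu q (fun=> 1 : R).
 by split=> //; apply: (eq_integ _ (integ_cst mufin 1)) => x; rewrite normr1 powR1.
have q00 : 0 < q by rewrite invr_gt0.
have [_ h] := I_hoelder (divr_gt0 (ltr0Sn R 1) p0) q00 pq P1 P2.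
have h1 : I mu (fun x => `|phi x| `^ p) <= nrm mu 2 (phi : BM -> R) `^ p * m `^ (1 - p / 2).
 apply: (le_trans _ (le_trans h _)).
  by apply: eq_le_; apply: I_eq => x; rewrite mulr1 (ger0_norm (powR_ge0 _ _)).
 rewrite /nrm /q invrK invf_div -powRrM [2^-1 * p]mulrC; apply: eq_le_.
 have -> : I mu (fun x => `| `|phi x| `^ p| `^ (2 / p)) = I mu (fun x => `|phi x| `^ 2).
  by apply: I_eq => x; rewrite norm_powRrM.
 have -> : I mu (fun=> `|1 : R| `^ (1 - p / 2)^-1) = m.
  by apply: I_eq => x; rewrite normr1 powR1.
 reflexivity.
apply: (@le_trans _ _ ((nrm mu 2 (phi : BM -> R) `^ p * m `^ (1 - p / 2)) `^ p^-1)).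
 rewrite /nrm ge0_ler_powR ?nnegrE ?invr_ge0 ?(ltW p0) ?mulr_ge0 ?powR_ge0//.
 by apply: I_ge0 => x; exact: powR_ge0.
exact: (interp_le p1 p2 (nrm_ge0 _ _ _) m0).
Qed.

End chain.

(** * Weak solutions, regularity and uniqueness on the manifold *)

Section manifold_regularity.
Implicit Types (i : chart_index M) (K : set V) (t : M).
Let oi i := @chim_open _ _ M i.

Definition tr i (c : V -> R) (v : BM -> R) (u : BV) : R := c u * v (chart_inv i u).

Lemma pull_tr i K c v : K `<=` chim i -> csm K c ->
 pull i (fun t => v t * push i c t) = tr i (fun u => c u * rho i u) v.
Proof.
move=> Ki [_ c0]; apply/funext => u; rewrite /pull /tr.
case: asboolP => hu; first by rewrite push_inv//; ring.
by rewrite c0 ?mul0r// => /Ki.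
Qed.

Lemma push_off i c t : ~ source i t -> push i c t = 0.
Proof. by move=> h; rewrite /push; case: asboolP. Qed.

Lemma I_tr i K c v : compact K -> K `<=` chim i -> csm K c -> integ mu v ->
 integ lam (tr i (fun u => c u * rho i u) v) /\
 ipr mu v (push i c) = I lam (tr i (fun u => c u * rho i u) v).
Proof.
move=> cK Ki sc iv; have [_ _ sp _] := csupp_push cK Ki sc.
rewrite -(pull_tr v Ki sc); apply: (integ_pull Hmu).
 by move=> t nt; rewrite push_off// mulr0.
exact: integ_mul_sm.
Qed.

Lemma csm_divrho i K c : compact K -> K `<=` chim i -> csm K c -> csm K (fun u => c u * (rho i u)^-1).
Proof.
move=> cK Ki sc; apply: (cutoff_ex (@oi i) cK Ki sc); apply: smc_inv; first exact: smc_rho.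
by move=> u hu; rewrite gt_eqF// rho_gt0.
Qed.

Lemma tr_divrho i K c v : K `<=` chim i -> csm K c ->
 tr i (fun u => c u * (rho i u)^-1 * rho i u) v = tr i c v.
Proof.
move=> Ki [_ c0]; apply/funext => u; rewrite /tr; have [Ku|nK] := pselect (K u); last by rewrite c0// !mul0r.
by rewrite divfK// gt_eqF// rho_gt0//; exact: Ki.
Qed.

Lemma tr_integ i K c v : compact K -> K `<=` chim i -> csm K c -> integ mu v -> integ lam (tr i c v).
Proof.
move=> cK Ki sc iv; rewrite -(tr_divrho v Ki sc).
exact: (I_tr cK Ki (csm_divrho cK Ki sc) iv).1.
Qed.

Lemma tr_L2c i K c v : compact K -> K `<=` chim i -> csm K c -> sqint mu v -> L2c lam (tr i c v).
Proof.
move=> cK Ki sc v2; split.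
 split; first exact: integ_meas (tr_integ cK Ki sc (sqint_integ mufin v2)).
 have := tr_integ cK Ki (csmM sc.1 sc) v2.2; congr integ; apply/funext => u; rewrite /tr; ring.
have [r _ Kr] := compact_norm cK; exists r => u nu; rewrite /tr sc.2 ?mul0r// => /Kr; exact: nu.
Qed.

Lemma Lapl_eq0 f (N : set M) t : sm f -> open N -> N t -> (forall s, N s -> f s = 0) -> Lapl f t = 0.
Proof.
move=> sf oN Nt f0; rewrite (laplacianE sf (@chart_atP _ _ M t)) LapE.
set i := chart_at t; have oW := @chart_open _ _ M i N oN.
have Wt : (chart i @` (N `&` source i)) (chart i t) by exists t => //; split=> //; exact: chart_atP.
rewrite big1 ?mulr0 ?oppr0// => a _; rewrite big1// => b _.
rewrite (pd_eq (g := fun=> 0) a oW Wt); first exact: pd_indep.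
move=> v Wv; rewrite /flux (pd_eq (g := fun=> 0) b oW Wv).
 by rewrite pd_indep ?mulr0.
by move=> y [s [Ns ss] <-]; rewrite chartK//; exact: f0.
Qed.

Lemma Lapl_push_off i K w t : compact K -> K `<=` chim i -> csm K w -> ~ source i t -> Lapl (push i w) t = 0.
Proof.
move=> cK Ki sw nt; have [_ _ sp _] := csupp_push cK Ki sw.
have cL := inv_compact cK Ki.
apply: (@Lapl_eq0 _ (~` (chart_inv i @` K))) => //.
- by apply: closed_openC; apply: compact_closed cL; exact: M_hausdorff.
- by move=> [u Ku ut]; apply: nt; rewrite -ut; apply: chim_source; exact: Ki.
- move=> s ns; rewrite /push; case: asboolP => // ss; apply: sw.2 => Ks; apply: ns.
 by exists (chart i s) => //; exact: chartK.
Qed.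

Section divergence_form.
Variables (i : chart_index M) (K : set V) (O : set V) (A : 'I_d -> 'I_d -> V -> R).
Hypothesis cK : compact K.
Hypothesis Ki : K `<=` chim i.
Hypothesis oO : open O.
Hypothesis KO : K `<=` O.
Hypothesis sA : forall a b, smc setT (A a b).
Hypothesis AE : forall a b u, O u -> A a b u = rho i u * invmx (metric i u) a b.

Lemma divop_csm w : csm K w -> csm K (divop A w).
Proof.
have cl : closed K by apply: (closed_rV).
move=> sw; split; first exact: (smc_divop sA sw.1).
move=> u nu; rewrite /divop big1// => a _; rewrite big1// => b _.
exact: ((csm_pd a cl (csmM (sA a b) (csm_pd b cl sw))).2 u nu).
Qed.

(** Near [K] the matrix [A] is the density times the inverse metric, so both sides are the same
    divergence; off [K] both vanish. *)
Lemma Lap_div w u : csm K w -> chim i u -> Lap i (push i w) u * rho i u = - divop A w u.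
Proof.
move=> sw hu; have r0 : rho i u != 0 by rewrite gt_eqF// rho_gt0.
rewrite mulNr; congr (- _); rewrite mulrAC mulVf// mul1r.
apply: eq_bigr => a _; apply: eq_bigr => b _.
have pE v : chim i v -> pd b (fun y => push i w (chart_inv i y)) v = pd b w v.
 by move=> hv; apply: (pd_eq b (@oi i) hv) => y hy; exact: push_inv.
have cl : closed K by apply: (closed_rV).
have [Ku|nK] := pselect (K u).
 apply: (pd_eq a (openI oO (@oi i)) (conj (KO Ku) hu)) => v [Ov hv]. by rewrite pE// AE.
have oW : open (chim i `&` ~` K) by apply: openI; [exact: oi|exact: closed_openC].
apply: (pd_eq a oW (conj hu nK)) => v [hv nv].
by rewrite pE// (csm_pd b cl sw).2// !mulr0.
Qed.

Lemma Lapl_push w t : csm K w -> source i t -> Lapl (push i w) t = - (divop A w (chart i t) * (rho i (chart i t))^-1).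
Proof.
move=> sw st; have [_ _ sp _] := csupp_push cK Ki sw; have hu := chartP st.
rewrite (laplacianE sp st) -mulNr -Lap_div// mulfK// gt_eqF// rho_gt0//.
Qed.

Lemma I_Lapl_push w v : csm K w -> integ mu v ->
 ipr mu v (Lapl (push i w)) = - I lam (tr i (divop A w) v).
Proof.
move=> sw iv; have sD := divop_csm sw; have sD' := csm_divrho cK Ki sD.
have [_ E] := I_tr cK Ki sD' iv; rewrite (tr_divrho v Ki sD) in E.
rewrite -E -IN; last first.
 by have [_ _ sp _] := csupp_push cK Ki sD'; exact: integ_mul_sm.
apply: I_eq => t; have [st|nt] := pselect (source i t).
 by rewrite Lapl_push// pushE// mulrN.
by rewrite (Lapl_push_off cK Ki sw nt) push_off// mulr0 oppr0.
Qed.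

Lemma divop_mul_arith (x y : R) (B X Y : 'I_d -> 'I_d -> R) (W P : 'I_d -> R) :
 \sum_a \sum_b (x * X a b + Y a b * y + (B a b * W b * P a + B a b * W a * P b)) =
 x * (\sum_a \sum_b X a b) + (\sum_a \sum_b Y a b) * y + \sum_b (\sum_a (B a b + B b a) * W a) * P b.
Proof.
under eq_bigr do rewrite !big_split/=.
rewrite !big_split/= mulr_sumr mulr_suml.
have -> : \sum_b (\sum_a (B a b + B b a) * W a) * P b =
  \sum_a \sum_b B a b * W b * P a + \sum_a \sum_b B a b * W a * P b.
 rewrite [X in _ + X]exchange_big/= -big_split/=; apply: eq_bigr => b _.
 rewrite mulr_suml -big_split/=; apply: eq_bigr => a _; ring.
congr (_ + _ + _); apply: eq_bigr => a _; [by rewrite mulr_sumr|by rewrite mulr_suml].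
Qed.

Lemma divop_mul w psi u : smc setT w -> smc setT psi ->
 divop A (fun v => w v * psi v) u = w u * divop A psi u + divop A w u * psi u +
  \sum_b (\sum_a (A a b u + A b a u) * pd a w u) * pd b psi u.
Proof.
move=> sw sp; have pE b : pd b (fun v => w v * psi v) = fun v => pd b w v * psi v + w v * pd b psi v.
 by apply/funext => v; exact: pdM.
have E a b : pd a (fun v => A a b v * pd b (fun y => w y * psi y) v) u =
  w u * pd a (fun v => A a b v * pd b psi v) u + pd a (fun v => A a b v * pd b w v) u * psi u +
  (A a b u * pd b w u * pd a psi u + A a b u * pd a w u * pd b psi u).
 rewrite pE; have sb := smc_pd b sw; have sb' := smc_pd b sp.
 have -> : (fun v => A a b v * (pd b w v * psi v + w v * pd b psi v)) =
   fun v => (fun v => A a b v * pd b w v) v * psi v + w v * (fun v => A a b v * pd b psi v) v.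
  by apply/funext => v; ring.
 have s1 := smc_mul (sA a b) sb; have s2 := smc_mul (sA a b) sb'.
 apply: (etrans (pd_add a u (smc_mul s1 sp) (smc_mul sw s2))).
 apply: (etrans (congr2 +%R (pdM a u s1 sp) (pdM a u sw s2))).
 move: (pd a (fun u => A a b u * pd b w u) u) (pd a (fun u => A a b u * pd b psi u) u) => x y.
 move: (A a b u) (pd b w u) (pd b psi u) (pd a w u) (pd a psi u) (w u) (psi u) => *; ring.
rewrite -divop_mul_arith; apply: eq_bigr => a _; apply: eq_bigr => b _; exact: E.
Qed.

(** The equation on the manifold is tested with the push-forward of c psi. Commuting the cutoff [c]
    with the operator leaves terms with at most one derivative on psi, which become the data of the
    localised equation. *)
Lemma tr_weak_eq c v g : csm K c -> sqint mu v -> sqint mu g ->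
 (forall psi, sm psi -> ipr mu v (Lapl psi) = ipr mu g psi) ->
 weak_eq lam A (tr i c v) (fun b => tr i (fun u => - \sum_a (A a b u + A b a u) * pd a c u) v)
  (fun u => tr i (fun u => - divop A c u) v u + tr i (fun u => - (c u * rho i u)) g u).
Proof.
move=> sc v2 g2 E psi sp.
have iv := sqint_integ mufin v2; have ig := sqint_integ mufin g2.
have cl : closed K by apply: (closed_rV).
have sN (h : V -> R) : csm K h -> csm K (fun u => - h u).
 move=> sh; have := csmM (smc_cst _ (-1)) sh; congr csm; exact: mulN1r.
have scp : csm K (fun u => c u * psi u).
 by have := csmM sp sc; congr csm; exact: mulrC.
have sD := divop_csm sc; have sr := csm_rho cK Ki sc.
have sF b : csm K (fun u => \sum_a (A a b u + A b a u) * pd a c u).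
 split; last by move=> u nu; rewrite big1// => a _; rewrite (csm_pd a cl sc).2// mulr0.
 apply: smc_sum => a; apply: smc_mul; first by apply: smc_add. exact: smc_pd sc.1.
have [_ _ spu _] := csupp_push cK Ki scp.
have := E _ spu; rewrite (I_Lapl_push scp iv) (I_tr cK Ki scp ig).2.
have k1 := L2c_integM Hl (tr_L2c cK Ki sc v2) (smc_divop sA sp).
have k2 := L2c_integM Hl (tr_L2c cK Ki sD v2) sp.
have k3 b := L2c_integM Hl (tr_L2c cK Ki (sF b) v2) (smc_pd b sp).
have k4 := L2c_integM Hl (tr_L2c cK Ki sr g2) sp.
have -> : I lam (tr i (divop A (fun u => c u * psi u)) v) = ipr lam (tr i c v) (divop A psi) +
  ipr lam (tr i (divop A c) v) psi + \sum_b I lam (fun u => tr i (fun u => \sum_a (A a b u + A b a u) * pd a c u) v u * pd b psi u).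
 rewrite -(I_sum _ k3) -(ID k1 k2) -(ID (integD k1 k2) (integ_sum _ k3)).
 apply: I_eq => u; rewrite /tr divop_mul//; last exact: sc.1.
 have -> : \sum_b (\sum_a (A a b u + A b a u) * pd a c u) * v (chart_inv i u) * pd b psi u =
   (\sum_b (\sum_a (A a b u + A b a u) * pd a c u) * pd b psi u) * v (chart_inv i u).
  by rewrite mulr_suml; apply: eq_bigr => b _; ring.
 move: (\sum_b _) (v _) (divop A psi u) (divop A c u) => x y z q; ring.
have -> : I lam (tr i (fun u => c u * psi u * rho i u) g) = I lam (fun u => tr i (fun u => c u * rho i u) g u * psi u).
 by apply: I_eq => u; rewrite /tr; ring.
have -> : I lam (fun u => (tr i (fun u => - divop A c u) v u + tr i (fun u => - (c u * rho i u)) g u) * psi u) =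
  - ipr lam (tr i (divop A c) v) psi - I lam (fun u => tr i (fun u => c u * rho i u) g u * psi u).
 by rewrite -(IN k2) -(IN k4) -(ID (integN k2) (integN k4)); apply: I_eq => u; rewrite /tr; ring.
have -> : \sum_b I lam (fun u => tr i (fun u => - \sum_a (A a b u + A b a u) * pd a c u) v u * pd b psi u) =
  - \sum_b I lam (fun u => tr i (fun u => \sum_a (A a b u + A b a u) * pd a c u) v u * pd b psi u).
 by rewrite -sumrN; apply: eq_bigr => b _; rewrite -(IN (k3 b)); apply: I_eq => u; rewrite /tr; ring.
move: (I lam _) (I lam _) (I lam _) (\sum_b _) => x y z q h; lra.
Qed.

End divergence_form.

(** Every localisation of [v] in every chart has weak derivatives of all orders. *)
Definition regular (v : BM -> R) := sqint mu v /\ forall s i K c,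
 compact K -> K `<=` chim i -> csm K c -> Hs lam s (tr i c v).

Lemma regular_sm f : sm f -> regular f.
Proof.
move=> sf; split; first exact: (sqint_sm sf).
move=> s i K c cK Ki sc; apply: (Hs_csm Hl s cK).
exact: (cutoff_ex (@oi i) cK Ki sc (sm_smc i sf)).
Qed.

(* The coefficients of the Laplacian near [K], extended to uniformly elliptic ones on the whole space *)
Lemma elliptic_extension i K : compact K -> K `<=` chim i ->
 exists (A : 'I_d -> 'I_d -> V -> R) (c L : R) (O : set V), [/\ open O /\ K `<=` O, forall a b, smc setT (A a b),
  forall a b u, O u -> A a b u = rho i u * invmx (metric i u) a b,
  0 <= L /\ forall a b x y, `|A a b x - A a b y| <= L * `|x - y| &
  0 < c /\ forall u (x : 'I_d -> R), c * \sum_a x a ^+ 2 <= \sum_a \sum_b x a * (A a b u * x b)].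
Proof.
move=> cK Ki; have [k [K' [cK' K'i] [sk k01 kK' [ O oO [KO kO]]]]] := plateau cK (@oi i) Ki.
have csk : csm K' k by split=> // u nK; apply/eqP/negPn/negP => /kK'.
(* [B] is the cut-off difference to the identity matrix; adding the identity back gives coefficients
   that are defined everywhere and constant outside a compact set. *)
pose B a b u := k u * (rho i u * invmx (metric i u) a b + - (a == b)%:R).
have sB a b : csm K' (B a b).
 apply: (cutoff_ex (@oi i) cK' K'i csk); apply: smc_add; last exact: smc_cst.
 by apply: smc_mul; [exact: smc_rho|exact: smc_invmetric].
have /choice[L0 HL0] : forall ab : 'I_d * 'I_d, exists L, 0 <= L /\ forall x y : V, `|B ab.1 ab.2 x - B ab.1 ab.2 y| <= L * `|x - y|.
 by move=> ab; have [L ? ?] := csm_lipschitz cK' (sB ab.1 ab.2); exists L.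
have [m m0 Hm] := metric_bounds cK' K'i.
have c0 : 0 < (1 + m)^-1 by rewrite invr_gt0 ltr_pwDl// ltW.
exists (fun a b u => B a b u + (a == b)%:R), (1 + m)^-1, (\sum_ab L0 ab), O; split=> //.
- move=> a b; apply: smc_add; [exact: (sB a b).1|exact: smc_cst].
- by move=> a b u Ou; rewrite /B kO// mul1r subrK.
- split; first by apply: sumr_ge0 => ab _; case: (HL0 ab).
 move=> a b x y; rewrite opprD addrACA subrr addr0.
 apply: (le_trans ((HL0 (a, b)).2 x y)); rewrite ler_wpM2r// (bigD1 (a, b))//= lerDl.
 by apply: sumr_ge0 => ab _; case: (HL0 ab).
split=> // u x; pose X : V := \row_a x a; set S := \sum_a x a ^+ 2.
have S0 : 0 <= S by apply: sumr_ge0 => a _; exact: sqr_ge0.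
(* The form is a convex combination, with weight [k u], of the metric form and the Euclidean one. *)
have -> : \sum_a \sum_b x a * ((B a b u + (a == b)%:R) * x b) =
  k u * (qf (invmx (metric i u)) X X * rho i u) + (1 - k u) * S.
 rewrite qf_sum mulr_suml mulr_sumr mulr_sumr -big_split/=; apply: eq_bigr => a _.
 have -> : x a ^+ 2 = \sum_b x a * ((a == b)%:R * x b).
  by rewrite (bigD1 a)//= eqxx mul1r big1 ?addr0// => b; rewrite eq_sym => /negbTE ->; rewrite mul0r mulr0.
 rewrite mulr_suml mulr_sumr mulr_sumr -big_split/=; apply: eq_bigr => b _; rewrite !mxE /B; ring.
have /andP[k0 k1] := k01 u.
have cS : (1 + m)^-1 * S <= S by rewrite ler_piMl// invf_le1 ?lerDl ?ltr_pwDl// ltW.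
have [kz|kn] := eqVneq (k u) 0; first by rewrite kz mul0r subr0 mul1r add0r.
have [_ _ /(_ X)] := Hm u (kK' _ kn).
have -> : \sum_a X 0 a ^+ 2 = S by apply: eq_bigr => a _; rewrite mxE.
move: (qf _ _ _ * _) => q hq.
have q1 : (1 + m)^-1 * S <= q.
 rewrite mulrC ler_pdivrMr ?ltr_pwDl// ?(ltW m0)//; apply: (le_trans hq).
 have q0 : 0 <= q by rewrite -(pmulr_rge0 _ m0); exact: le_trans hq. by rewrite mulrC mulrDr mulr1 lerDr.
have h1 := ler_wpM2l k0 q1; have k1' : 0 <= 1 - k u by rewrite subr_ge0.
have h2 := ler_wpM2l k1' cS; nra.
Qed.

(** Bootstrap: the data of the localised equation are again localisations of [v] and [g], so the
    order of all localisations of [v] rises by one. *)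
Lemma regular_solution v g : regular g -> sqint mu v ->
 (forall psi, sm psi -> ipr mu v (Lapl psi) = ipr mu g psi) ->
 regular v.
Proof.
move=> [g2 rg] v2 E; split=> //.
have [eta [C [C0 Heta]]] := mollifiers Hl.
elim=> [|s IH] i K c cK Ki sc; first by split=> //; exact: (tr_L2c cK Ki sc v2).
have [A [e [L [U [[oO KO] sA AE [L0 AL] [e0 ell]]]]]] := elliptic_extension cK Ki.
have cl : closed K by apply: (closed_rV).
have sN (h : V -> R) : csm K h -> csm K (fun u => - h u).
 move=> sh; have := csmM (smc_cst _ (-1)) sh; congr csm; exact: mulN1r.
have W := tr_weak_eq cK Ki oO KO sA AE sc v2 g2 E.
apply: (elliptic_regularity Hl C0 Heta sA L0 AL e0 ell (IH _ _ _ cK Ki sc) _ _ W).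
- move=> b; apply: (IH _ _ _ cK Ki); apply: sN.
 split; last by move=> u nu; rewrite big1// => a _; rewrite (csm_pd a cl sc).2// mulr0.
 apply: smc_sum => a; apply: smc_mul; first by apply: smc_add. exact: smc_pd sc.1.
- have h1 := IH _ _ _ cK Ki (sN _ (divop_csm cK sA sc)).
 have h2 := rg s _ _ _ cK Ki (sN _ (csm_rho cK Ki sc)).
 by have := HsD Hl 1 h1 h2; congr Hs; apply/funext => u; rewrite mul1r.
Qed.

Lemma Lapl_cst (c : R) t : Lapl (fun=> c : R) t = 0 :> R.
Proof.
have s1 := @sm_cst R d M 0.
have h0 : Lapl (fun _ : M => 0) t = 0.
 by apply: (@Lapl_eq0 _ setT) => //; exact: openT.
have sc := @sm_cst R d M c.
have : Lapl (fun _ : M => c) t = 0.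
 rewrite (laplacianE sc (@chart_atP _ _ M t)) LapE big1 ?mulr0 ?oppr0// => a _; rewrite big1// => b _.
 apply: pd_indep => z y; rewrite /flux; set P := pd b _; rewrite (_ : P = fun=> 0) ?mulr0//.
 by apply/funext => x; exact: pd_indep.
by [].
Qed.

(** Riesz' theorem for psi -> Delta psi on functions of mean zero, where the Poincare inequality
    bounds the functional. Other test functions are reduced to these, since Delta kills constants
    and [g] has mean zero; [z] may be centred because Delta psi has mean zero. *)
Lemma weak_solution g : sqint mu g -> I mu g = 0 -> exists v, [/\ sqint mu v, I mu v = 0 &
 forall psi, sm psi -> ipr mu v (Lapl psi) = ipr mu g psi].
Proof.
move=> g2 g0; have [C C0 HC] := poincare_laplacian.
pose E (psi : M -> R^o) := sm psi /\ I mu (psi : BM -> R) = 0.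
pose l (psi : M -> R^o) : R := ipr mu g psi.
have qs f : sm f -> sqint mu (f : BM -> R) := @sqint_sm f.
have is_ f : sm f -> integ mu (f : BM -> R) := @integ_sm f.
have sl f : sm f -> sm (Lapl f) := @sm_Lapl f.
have E0 : E 0.
 split; first exact: sm_cst. have i0 := is_ _ (@sm_cst R d M 0).
 by rewrite -[RHS](mul0r (I mu (fun=> 0 : R))) -(IZ _ i0); rewrite mul0r.
have Elin a p q : E p -> E q -> E (a *: p + q).
 move=> [sp p0] [sq q0]; split; first exact: (smD (smZ a sp) sq).
 transitivity (a * I mu (p : BM -> R) + I mu (q : BM -> R)); last by rewrite p0 q0 mulr0 addr0.
 by rewrite -(IZ _ (is_ _ sp)) -(ID (integZ _ (is_ _ sp)) (is_ _ sq)).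
have [z [p_ [_ z2 _] Hz]] := @riesz_range _ _ _ mu mufin (M -> R^o) E (fun psi => Lapl psi : BM -> R) l
 (I2 mu g * C) E0 Elin
 (fun a p q x Ep Eq => laplacian_lin a x Ep.1 Eq.1)
 (fun a p q Ep Eq => ltac:(idtac; rewrite -(IZ a (sqintM g2 (qs _ Ep.1))) -(ID (integZ a (sqintM g2 (qs _ Ep.1))) (sqintM g2 (qs _ Eq.1)));
   apply: I_eq => t; rewrite mulrCA -mulrDr; exact: erefl))
 (fun p Ep => qs _ (sl _ Ep.1))
 (fun p Ep => ltac:(idtac; apply: (le_trans (CS g2 (qs _ Ep.1))); rewrite -mulrA ler_wpM2l//;
   [by exact: I2_ge0 | exact: (HC _ Ep.1 Ep.2)])).
have i1 := integ_cst mufin 1; have m0 := I1_gt0.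
have iz := sqint_integ mufin z2.
pose m := I mu (fun=> 1 : R); pose zb := I mu z / m.
have qc := qs _ (@sm_cst R d M (- zb)).
exists (fun t => z t + - zb); split; first exact: sqintD.
 rewrite (ID iz (integ_cst mufin (- zb))).
 rewrite (_ : I mu (fun=> - zb) = (- zb) * m); last by rewrite -(IZ _ i1); rewrite mulr1.
 by rewrite mulNr divfK ?subrr// gt_eqF.
move=> psi sp; pose c := I mu (psi : BM -> R) / m.
have sE : E (fun t => psi t - c).
 split; first exact: (smD sp (@sm_cst R d M (- c))). rewrite (ID (is_ _ sp) (integ_cst mufin (- c))).
 rewrite (_ : I mu (fun=> - c) = (- c) * m); last by rewrite -(IZ _ i1); rewrite mulr1.
 by rewrite mulNr divfK ?subrr// gt_eqF.
have LE t : Lapl (fun s => psi s - c) t = Lapl psi t.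
 have := laplacian_lin 1 t sp (@sm_cst R d M (- c)); rewrite Lapl_cst addr0 mul1r => <-.
 by congr (Lapl _ t); apply/funext => s; rewrite mul1r.
have il := sqintM z2 (qs _ (sl _ sp)).
have -> : I mu (fun t => (z t - zb) * Lapl psi t) = ipr mu z (Lapl psi).
 have ib := integZ (- zb) (is_ _ (sl _ sp)).
 transitivity (ipr mu z (Lapl psi) + (- zb) * I mu (Lapl psi : BM -> R)).
  by rewrite -(IZ _ (is_ _ (sl _ sp))) -(ID il ib); apply: I_eq => t; rewrite mulrDl.
 by rewrite (I_laplacian sp) mulr0 addr0.
have ig := sqint_integ mufin g2.
transitivity (ipr mu z (Lapl (fun s => psi s - c))).
 by apply: I_eq => t; rewrite LE.
rewrite -(Hz _ sE).
transitivity (ipr mu g psi + (- c) * I mu g); last by rewrite g0 mulr0 addr0.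
rewrite -(IZ _ ig) -(ID (sqintM g2 (qs _ sp)) (integZ _ ig)); apply: I_eq => t; rewrite mulrDr [g t * - c]mulrC; exact: erefl.
Qed.

Lemma iterated_solution f m : sm f -> I mu (f : BM -> R) = 0 -> exists v, [/\ regular v, I mu v = 0 &
 forall psi, sm psi -> ipr mu v (iter m (@Lapl) psi) = ipr mu f psi].
Proof.
move=> sf f0; elim: m => [|m [v [rv v0 Hv]]].
 by exists f; split=> //; exact: regular_sm.
have [w [w2 w0 Hw]] := weak_solution rv.1 v0.
exists w; split=> //; first exact: (regular_solution rv w2 Hw).
move=> psi sp; rewrite -Hv// -Hw; last exact: (sm_iter m sp).
by [].
Qed.

Lemma Lapl_sum (N : nat) (f : 'I_N -> M -> R) t : (forall l, sm (f l)) ->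
 Lapl (fun s => \sum_l f l s) t = \sum_l Lapl (f l) t.
Proof.
move=> sf; elim: (index_enum _) => [|l r IH].
 transitivity (Lapl (fun _ : M => 0 : R) t); last by rewrite Lapl_cst big_nil.
 by congr (Lapl _ t); apply/funext => s; rewrite big_nil.
rewrite big_cons -IH -[X in X + _]mul1r -(laplacian_lin 1 t (sf l) (sm_sum _ sf)).
by congr (Lapl _ t); apply/funext => s; rewrite big_cons mul1r.
Qed.

(** In coordinates the Laplacian is a differential operator whose coefficients can be cut off away
    from [K], and such an operator preserves uniform bounds on all derivatives. *)
Lemma bfam_Lapl i K (W : nat -> V -> R) : compact K -> K `<=` chim i -> (forall n, csm K (W n)) -> bfam W ->
 exists W' : nat -> V -> R, [/\ forall n, csm K (W' n), bfam W' & forall n t, Lapl (push i (W n)) t = push i (W' n) t].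
Proof.
move=> cK Ki sW bW; have [k [K' [cK' K'i] [sk k01 kK' [ O oO [KO kO]]]]] := plateau cK (@oi i) Ki.
have csk : csm K' k by split=> // u nK; apply/eqP/negPn/negP => /kK'.
pose A a b u := k u * (rho i u * invmx (metric i u) a b).
have sA a b : csm K' (A a b).
 apply: (cutoff_ex (@oi i) cK' K'i csk). by apply: smc_mul; [exact: smc_rho|exact: smc_invmetric].
have AE a b u : O u -> A a b u = rho i u * invmx (metric i u) a b by move=> Ou; rewrite /A kO// mul1r.
pose r u := - 1 * (k u * (rho i u)^-1).
have sr : csm K' r by apply: csmM; [exact: smc_cst|exact: csm_divrho].
have sA' a b := (sA a b).1.
exists (fun n u => r u * divop A (W n) u); split.
- by move=> n; apply: csmM; [exact: sr.1|exact: divop_csm].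
- apply: (bfamM cK' sr); apply: bfam_sum => a; apply: bfam_sum => b; apply: bfam_pd.
 by apply: (bfamM cK' (sA a b)); exact: bfam_pd.
move=> n t; have [st|nt] := pselect (source i t); last first.
 by rewrite (Lapl_push_off cK Ki (sW n) nt) push_off.
rewrite (Lapl_push cK Ki oO KO AE (sW n) st) pushE// /r.
have [Ku|nK] := pselect (K (chart i t)).
 by rewrite kO ; [ring|exact: KO].
by rewrite (divop_csm cK sA' (sW n)).2// !(mul0r, mulr0) oppr0.
Qed.

Lemma bfam_iter m i K (W : nat -> V -> R) : compact K -> K `<=` chim i -> (forall n, csm K (W n)) -> bfam W ->
 exists2 B, 0 <= B & forall n t, `|iter m (@Lapl) (push i (W n)) t| <= B.
Proof.
elim: m W => [|m IH] W cK Ki sW bW.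
 have [B HB] := bW.2 [::]; exists `|B| => // n t /=; rewrite /push; case: asboolP => _; last by rewrite normr0.
 exact: (le_trans (HB n _) (ler_norm _)).
have [W' [sW' bW' E]] := bfam_Lapl cK Ki sW bW; have [B B0 HB] := IH _ cK Ki sW' bW'.
exists B => // n t; rewrite iterSr (_ : Lapl (push i (W n)) = push i (W' n)); first exact: HB.
by apply/funext => s.
Qed.

Lemma iter_Lapl_sum m (N : nat) (f : 'I_N -> M -> R) t : (forall l, sm (f l)) ->
 iter m (@Lapl) (fun s => \sum_l f l s) t = \sum_l iter m (@Lapl) (f l) t.
Proof.
elim: m f t => [|m IH] f t sf //.
rewrite !iterSr (_ : Lapl (fun s => \sum_l f l s) = fun s => \sum_l Lapl (f l) s); last first.
 by apply/funext => s; exact: Lapl_sum.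
rewrite IH; last by move=> l; exact: (sm_Lapl).
by apply: eq_bigr => l _; rewrite iterSr.
Qed.

Lemma cvg_sum_ord (N : nat) (u : 'I_N -> nat -> R) (x : 'I_N -> R) :
 (forall l, u l n @[n --> \oo] --> x l) -> \sum_l u l n @[n --> \oo] --> \sum_l x l.
Proof.
move=> h; elim: (index_enum _) => [|l r IH].
 by rewrite big_nil; under eq_cvg do rewrite big_nil; exact: cvg_cst.
by rewrite big_cons; under eq_cvg do rewrite big_cons; exact: cvgD.
Qed.

(** Each localisation is mollified, cut off and pushed back. Regularity bounds all derivatives
    uniformly, while the convergence to [v] is only weak. *)
Lemma regular_approx v : regular v -> exists phi : nat -> M -> R, [/\ forall n, sm (phi n),
 forall m, exists B, forall n t, `|iter m (@Lapl) (phi n) t| <= B &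
 forall psi, sm psi -> ipr mu (phi n) psi @[n --> \oo] --> ipr mu v psi].
Proof.
move=> [v2 rv]; have [N [ii [chi [K [cs _ s1]]]]] := partition.
have [eta [C [C0 Heta]]] := mollifiers Hl.
have cK l : compact (K l) by case: (cs l). have Ki l : K l `<=` chim (ii l) by case: (cs l).
have /choice[k Hk] : forall l, exists k : V -> R, exists K' : set V, [/\ compact K', K' `<=` chim (ii l), csm K' k & forall u, K l u -> k u = 1].
 move=> l; have [k [K' [cK' K'i] [sk k01 kK' [ O oO [KO kO]]]]] := plateau (cK l) (@oi (ii l)) (Ki l).
 exists k, K'; split=> //; last by move=> u Ku; apply: kO; exact: KO.
 by split=> // u nK; apply/eqP/negPn/negP => /kK'.
have {Hk}/choice[K' Hk] := Hk.
have cK' l : compact (K' l) by case: (Hk l). have K'i l : K' l `<=` chim (ii l) by case: (Hk l).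
have sk l : csm (K' l) (k l) by case: (Hk l).
have sc l := csupp_locf (cs l).
pose w l := tr (ii l) (locf (ii l) (chi l)) v.
have hw l s : Hs lam s (w l) by exact: rv.
pose W l n u := k l u * convol lam (eta n) (w l) u.
have sW l n : csm (K' l) (W l n).
 have [K1 cK1 [s _]] := csm_convk Hl Heta n (Hs_L2c (hw l 0%N)). by have := csmM s (sk l); congr csm; exact: mulrC.
have bW l : bfam (W l) by apply: (bfamM (cK' l) (sk l)); exact: (bfam_conv Hl C0 Heta (hw l)).
have sp l n : sm (push (ii l) (W l n)) by have [] := csupp_push (cK' l) (K'i l) (sW l n).
exists (fun n t => \sum_l push (ii l) (W l n) t); split.
- by move=> n; exact: sm_sum.
- move=> m; have /choice[B HB] : forall l, exists B, forall n t, `|iter m (@Lapl) (push (ii l) (W l n)) t| <= B.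
  by move=> l; have [B _ HB] := bfam_iter m (cK' l) (K'i l) (sW l) (bW l); exists B.
 exists (\sum_l B l) => n t; rewrite iter_Lapl_sum//.
 by apply: (le_trans (ler_norm_sum _ _ _)); apply: ler_sum => l _.
move=> psi sps.
have iv := sqint_integ mufin v2.
have ipl l n : integ mu (fun t => push (ii l) (W l n) t * psi t).
 exact: (integ_sm (smM (sp l n) sps)).
have ivl l : integ mu (fun t => v t * (chi l t * psi t)).
 apply: (integ_mul_sm iv); apply: smM => //; by have [] := cs l.
have -> : ipr mu v psi = \sum_l I mu (fun t => v t * (chi l t * psi t)).
 rewrite -I_sum//; apply: I_eq => t. by rewrite -mulr_sumr -mulr_suml s1 mul1r.
have -> : (fun n => I mu (fun t => (\sum_l push (ii l) (W l n) t) * psi t)) =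
  fun n => \sum_l ipr mu (push (ii l) (W l n)) psi.
 by apply/funext => n; rewrite -I_sum//; apply: I_eq => t; rewrite mulr_suml.
apply: cvg_sum_ord => l.
pose th u := k l u * (psi (chart_inv (ii l) u) * rho (ii l) u).
have sth : csm (K' l) th.
 apply: (cutoff_ex (@oi (ii l)) (cK' l) (K'i l) (sk l)); apply: smc_mul; [exact: sm_smc|exact: smc_rho].
have E1 n : ipr mu (push (ii l) (W l n)) psi = ipr lam (convol lam (eta n) (w l)) th.
 have cs1 : csm (K' l) (fun u => W l n u * psi (chart_inv (ii l) u)).
  exact: (cutoff_ex (@oi (ii l)) (cK' l) (K'i l) (sW l n) (sm_smc (ii l) sps)).
 transitivity (I mu (push (ii l) (fun u => W l n u * psi (chart_inv (ii l) u)) : BM -> R)).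
  apply: I_eq => t; have [st|nt] := pselect (source (ii l) t); last by rewrite !push_off// mul0r.
  by rewrite !pushE// chartK.
 rewrite (I_push (cK' l) (K'i l) cs1).2; apply: I_eq => u; rewrite /W /th; ring.
have E2 : I mu (fun t => v t * (chi l t * psi t)) = ipr lam (w l) th.
 have cs2 : csm (K l) (fun u => locf (ii l) (chi l) u * psi (chart_inv (ii l) u)).
  exact: (cutoff_ex (@oi (ii l)) (cK l) (Ki l) (sc l) (sm_smc (ii l) sps)).
 transitivity (ipr mu v (push (ii l) (fun u => locf (ii l) (chi l) u * psi (chart_inv (ii l) u)))).
  apply: I_eq => t; have [st|nt] := pselect (source (ii l) t).
   by rewrite pushE// chartK// -(push_locf t (cs l)) pushE.
  by rewrite push_off// -(push_locf t (cs l)) push_off// mul0r.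
 rewrite (I_tr (cK l) (Ki l) cs2 iv).2; apply: I_eq => u; rewrite /w /th /tr.
 have [Ku|nK] := pselect (K l u); last by rewrite (sc l).2// !mul0r. have [_ _ _ ->] := Hk l; [ring|exact: Ku].
rewrite E2 (_ : (fun n => ipr mu (push (ii l) (W l n)) psi) =
 fun n => ipr lam (convol lam (eta n) (w l)) th); last by apply/funext => n.
exact: (conv_cvg Hl Heta (Hs_L2c (hw l 0%N)) sth.1).
Qed.

(** With phi_n the approximations of a regular solution of Delta^m v = f, the functions [g n] =
    Delta^m phi_n - f are bounded and tend weakly to 0; their pairing with [u] equals - int u f for
    every n. *)
Lemma laplacian_unique m (u : BM -> R) : integ mu u ->
 (forall psi, sm psi -> ipr mu u (iter m (@Lapl) psi) = 0) ->
 exists c, {ae mu, forall t : BM, u t = c}.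
Proof.
move=> iu Hu; apply: (const_of_orthogonal iu) => f sf f0.
have [v [rv _ Hv]] := iterated_solution m sf f0.
have [phi [sphi bphi cphi]] := regular_approx rv.
have [B HB] := bphi m; have [Bf Bf0 HBf] := sm_bounded sf.
pose g n t := iter m (@Lapl) (phi n) t + -1 * f t.
have sit n := sm_iter m (sphi n).
have sg n : sm (g n) by apply: smD => //; exact: smZ.
have is_ h : sm h -> integ mu (h : BM -> R) := @integ_sm h.
have : ipr mu u (g n) @[n --> \oo] --> (0 : R).
 apply: (@weak_bounded g (B + Bf) u) => //.
 - by move=> n; exact: (integ_meas (is_ _ (sg n))).
 - move=> n t; apply: (le_trans (ler_normD _ _)); rewrite mulN1r normrN; apply: lerD; [exact: HB|exact: HBf].
 move=> psi sp; have E n : ipr mu (g n) psi = ipr mu (phi n) (iter m (@Lapl) psi) - ipr mu f psi.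
  rewrite (iter_laplacian_sym m (sphi n) sp) -(IB (is_ _ (smM (sit n) sp)) (is_ _ (smM sf sp))).
  by apply: I_eq => t; rewrite /g; ring.
 under eq_cvg do rewrite E. have h : ipr mu (phi n) (iter m (@Lapl) psi) - ipr mu f psi @[n --> \oo] -->
   ipr mu f psi - ipr mu f psi.
  apply: cvgB; last exact: cvg_cst. rewrite -(Hv _ sp); apply: cphi; exact: (sm_iter m sp).
 by rewrite subrr in h.
have E n : ipr mu u (g n) = - ipr mu u f.
 have i1 := integ_mul_sm iu (sit n); have i2 := integ_mul_sm iu sf.
 transitivity (ipr mu u (iter m (@Lapl) (phi n)) + -1 * ipr mu u f).
  by rewrite -(IZ _ i2) -(ID i1 (integZ _ i2)); apply: I_eq => t; rewrite /g; ring.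
 by rewrite Hu// add0r mulN1r.
under eq_cvg do rewrite E.
move=> /(cvg_unique (@Rhausdorff R)) h; apply/eqP; rewrite -oppr_eq0; apply/eqP.
by apply: esym; apply: h; exact: cvg_cst.
Qed.

End manifold_regularity.

(** * The inequality for real functions *)

Section exponent.
Variables (p : R) (k : nat).
Hypothesis p1 : 1 <= p.
Hypothesis k0 : (0 < k)%N.
Hypothesis dk : d%:R / 2 * (1 / 2 - 1 / p) <= k%:R.
Local Notation A := (iter k Lapl).
Local Notation q := (hoelder_conjugate p%:E).
Local Notation nc := ComplexField.Normc.normc.
Let p0 : 0 < p. Proof. exact: lt_le_trans p1. Qed.
Let qs psi : sm psi -> sqint mu (psi : BM -> R) := @sqint_sm psi.
Let is_ psi : sm psi -> integ mu (psi : BM -> R) := @integ_sm psi.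
Let sA psi : sm psi -> sm (A psi) := @sm_iter k psi.
Let sp psi : sm psi -> pint mu p (psi : BM -> R). Proof. exact: (sm_pint p0). Qed.

Section real_core.
Implicit Types (x y z : BM -> R) (f psi : M -> R).

(** Expresses |y|_q <= b through the action of [y] on L^p, in the same way for p = 1 and p > 1. *)
Definition dualb y (b : R) := [/\ mfun y, 0 <= b & forall f : BM -> R, pint mu p f ->
 integ mu (fun t => y t * f t) /\ `|ipr mu y f| <= b * nrm mu p f].

Lemma A_lin (a : R) f g t : sm f -> sm g -> A (fun s => a * f s + g s) t = a * A f t + A g t.
Proof.
elim: k f g t => [|m IH] f g t sf sg //; rewrite !iterSr.
have sl h : sm h -> sm (Lapl h) := @sm_Lapl h.
rewrite -(IH _ _ _ (sl _ sf) (sl _ sg)); congr (iter m _ _ t); apply/funext => s.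
exact: (laplacian_lin).
Qed.

Lemma A_mean f t : sm f -> A (fun s => f s - I mu (f : BM -> R) / I mu (fun=> 1 : R)) t = A f t.
Proof.
case: k k0 => // m _ sf; rewrite !iterSr; congr (iter m _ _ t); apply/funext => s.
set c := _ / _; have := laplacian_lin 1 s sf (@sm_cst R d M (- c)).
rewrite (Lapl_cst) addr0 mul1r => <-.
by congr (Lapl _ s); apply/funext => r; rewrite mul1r.
Qed.

Lemma sm_mean f : sm f -> sm (fun s => f s - I mu (f : BM -> R) / I mu (fun=> 1 : R)) /\
 I mu (fun s => f s - I mu (f : BM -> R) / I mu (fun=> 1 : R)) = 0.
Proof.
move=> sf; set c := _ / _; split; first exact: (smD sf (@sm_cst R d M (- c))).
rewrite (IB (is_ sf) (integ_cst mufin c)) (_ : I mu (fun=> c) = c * I mu (fun=> 1 : R)).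
 by rewrite divfK ?subrr// gt_eqF// (I1_gt0).
by rewrite -(IZ _ (integ_cst mufin 1)); rewrite mulr1.
Qed.

Lemma I_A f : sm f -> I mu (A f : BM -> R) = 0.
Proof.
case: k k0 => // m _ sf; apply: (I_laplacian).
exact: (sm_iter).
Qed.

Lemma package : exists2 C, 0 < C & forall y b, dualb y b -> I mu y = 0 -> exists x z,
 [/\ sqint mu x /\ pint mu p x, sqint mu z,
   forall psi, sm psi -> ipr mu x (A psi) = ipr mu z psi,
   forall psi, sm psi -> ipr mu z (A psi) = ipr mu y psi &
   I2 mu z <= C * b ^+ 2 /\
   forall y2 b2 z2, dualb y2 b2 -> sqint mu z2 ->
    (forall psi, sm psi -> ipr mu z2 (A psi) = ipr mu y2 psi) ->
    ipr mu y2 x = ipr mu z2 z].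
Proof.
have [C C0 HC] := embedding p1 k0 dk.
have [P P0 HP] := poincare_iter k.
(* The factor 2 comes from the passage to the limit: eventually int (Delta^k phi_n)^2 is at most
   twice int z^2. *)
exists (2 * C ^+ 2); first by rewrite mulr_gt0// exprn_gt0.
move=> y b [my b0 Hy] y0.
pose E (psi : M -> R^o) := sm psi /\ I mu (psi : BM -> R) = 0.
pose l (psi : M -> R^o) : R := ipr mu y psi.
have iy f : sm f -> integ mu (fun t => y t * f t) by move=> sf; case: (Hy _ (sp sf)).
have E0 : E 0.
 split; first exact: sm_cst. have i0 := is_ (@sm_cst R d M 0).
 by rewrite -[RHS](mul0r (I mu (fun=> 0 : R))) -(IZ _ i0); rewrite mul0r.
have Elin a f g : E f -> E g -> E (a *: f + g).
 move=> [sf f0] [sg g0]; split; first exact: (smD (smZ a sf) sg).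
 transitivity (a * I mu (f : BM -> R) + I mu (g : BM -> R)); last by rewrite f0 g0 mulr0 addr0.
 by rewrite -(IZ _ (is_ sf)) -(ID (integZ _ (is_ sf)) (is_ sg)).
have llin a f g : E f -> E g -> l (a *: f + g) = a * l f + l g.
 move=> [sf _] [sg _]; rewrite -(IZ a (iy _ sf)) -(ID (integZ a (iy _ sf)) (iy _ sg)).
 by apply: I_eq => t; rewrite mulrCA -mulrDr.
have lb f : E f -> l f ^+ 2 <= (b ^+ 2 * C ^+ 2) * I2 mu (A f).
 move=> [sf f0]; have [_ h] := Hy _ (sp sf); have h2 := HC _ sf f0. have S0 : 0 <= I2 mu (A f) by exact: I2_ge0.
 rewrite nrm2E in h2. have {}h : `|l f| <= b * (C * Num.sqrt (I2 mu (A f))).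
  by apply: (le_trans h); rewrite ler_wpM2l.
 rewrite -[leLHS]real_normK ?num_real//. apply: (@le_trans _ _ ((b * (C * Num.sqrt (I2 mu (A f)))) ^+ 2)).
  by rewrite lerXn2r ?nnegrE// !mulr_ge0//// ltW.
 by rewrite !exprMn sqr_sqrtr// mulrA.
have [z [phi [Ephi z2 zphi] Hz]] := @riesz_range _ _ _ mu mufin (M -> R^o) E (fun psi => A psi : BM -> R) l
 (b ^+ 2 * C ^+ 2) E0 Elin (fun a f g t Ef Eg => A_lin a t Ef.1 Eg.1) llin (fun f Ef => qs (sA Ef.1)) lb.
have sphi n : sm (phi n) := (Ephi n).1.
have sAphi n := qs (sA (sphi n)).
have sdiff n m : E (fun t => phi n t - phi m t).
 have := Elin (-1) _ _ (Ephi m) (Ephi n).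
 by congr E; apply/funext => t; rewrite /= !fctE /GRing.scale /= mulN1r addrC.
have Adiff n m t : A (fun s => phi n s - phi m s) t = A (phi n) t - A (phi m) t.
 have := A_lin (-1) t (sphi m) (sphi n); rewrite mulN1r addrC => <-.
 by congr (A _ t); apply/funext => s; rewrite mulN1r addrC.
have Cau e : 0 < e -> exists N, forall n m, (N <= n)%N -> (N <= m)%N -> I2 mu (A (fun s => phi n s - phi m s)) <= e.
 move=> e0; have [N HN] := zphi (e / 4) (divr_gt0 e0 (ltr0n R 4)).
 exists N => n m Nn Nm; have := l2_triangle sAphi z2 (HN n Nn) (HN m Nm).
 rewrite [4 * _]mulrC divfK// => h; apply: (le_trans _ h). by apply: eq_le_; apply: I_eq => t; rewrite Adiff.
have cau2 : cauchy2 mu (fun n => phi n : BM -> R).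
 move=> e e0; have [N HN] := Cau (e / P) (divr_gt0 e0 P0); exists N => n m Nn Nm.
 apply: (le_trans (HP _ (sdiff n m).1 (sdiff n m).2)). by rewrite mulrC -ler_pdivlMr//; exact: HN.
have [x [x2 xphi [s [sk sx]]]] := L2_complete mufin (fun n => qs (sphi n)) cau2.
have mx : mfun x by case: x2.
(* Convergence in L^p: the embedding applied to differences of the sequence, then Fatou's lemma
   along the almost everywhere convergent subsequence. *)
have small e : 0 < e -> exists N, forall n, (N <= n)%N ->
  pint mu p (fun t => phi n t - x t) /\ nrm mu p (fun t => phi n t - x t) <= e.
 move=> e0; have e1 : 0 < (e / C) ^+ 2 by rewrite exprn_gt0// divr_gt0. have [N HN] := Cau _ e1; exists N => n Nn.
 have md : mfun (fun t : BM => phi n t - x t).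
  apply: measurable_funB => //; exact: (integ_meas (is_ (sphi n))).
 have ip m := (sp (sdiff n (s m)).1). have F : (\int[mu]_t (`|phi n t - x t| `^ p)%:E <= (e `^ p)%:E)%E.
  apply: (@fatou_le _ _ _ mu (fun (m : nat) (t : BM) => `|phi n t - phi (s m) t| `^ p) (fun t => `|phi n t - x t| `^ p) (e `^ p)%:E).
  - by move=> m; exact: meas_pow (ip m).1.
  - exact: meas_pow.
  - by [].
  - by [].
  - apply: filterS sx => t ht; apply: powR_cvg => //.
   by apply: cvg_norm; apply: cvgB => //; exact: cvg_cst.
  exists N => m Nm; rewrite -(I_EFin (ip m).2) lee_fin -nrm_eq//.
  rewrite ge0_ler_powR ?nnegrE ?(ltW p0) ?(ltW e0) ?nrm_ge0//.
  apply: (le_trans (HC _ (sdiff n (s m)).1 (sdiff n (s m)).2)); rewrite nrm2E.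
  have h := HN n (s m) Nn (leq_trans Nm (sk m)).
  rewrite mulrC -ler_pdivlMr// -[leRHS](ger0_norm (ltW (divr_gt0 e0 C0))) -sqrtr_sqr. exact: ler_wsqrtr.
 have pi : integ mu (fun t => `|phi n t - x t| `^ p).
  apply: ge0_integP; [exact: meas_pow|by move=> t; exact: powR_ge0|]. by apply: (le_lt_trans F); rewrite ltry.
 split; first by split. by apply: nrm_le => //; [exact: ltW|rewrite -lee_fin I_EFin].
have px : pint mu p x.
 have [N HN] := small 1 ltr01; have [h _] := HN N (leqnn N). have := pintD p0 (sp (sphi N)) (pintN h).
 by congr pint; apply/funext => t; rewrite opprB addrC subrK.
(* Riesz' theorem only sees test functions of mean zero; as [y] has mean zero and Delta^k kills
   constants, the identity extends to all. *)
have zA psi : sm psi -> ipr mu z (A psi) = ipr mu y psi.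
 move=> spsi; have [sm0 m0] := sm_mean spsi. set c := I mu (psi : BM -> R) / I mu (fun=> 1 : R) in sm0 m0.
 transitivity (ipr mu z (A (fun s => psi s - c))).
  by apply: I_eq => t; rewrite A_mean.
 rewrite -(Hz _ (conj sm0 m0)).
 have iy1 : integ mu y by have := iy _ (@sm_cst R d M 1); apply: eq_integ => t; rewrite mulr1.
 transitivity (ipr mu y psi + (- c) * I mu y); last by rewrite y0 mulr0 addr0.
 by rewrite -(IZ _ iy1) -(ID (iy _ spsi) (integZ _ iy1)); apply: I_eq => t; ring.
exists x, z; split=> //.
- move=> psi spsi; have c1 := l2_pair (fun n => qs (sphi n)) x2 (qs (sA spsi)) xphi.
 have c2 := l2_pair sAphi z2 (qs spsi) zphi. apply: (seq_lim_unique c1).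
 rewrite (_ : (fun n => ipr mu (phi n) (A psi)) = fun n => ipr mu (A (phi n)) psi) //.
 by apply/funext => n; exact: (iter_laplacian_sym k (sphi n) spsi).
split.
- have [Z|Z] := eqVneq (I2 mu z) 0.
  by rewrite Z mulr_ge0// mulr_ge0// sqr_ge0.
 have Z0 : 0 < I2 mu z by rewrite lt_def Z I_ge0// => t; exact: sqr_ge0. set S := I2 mu z in Z0 *.
 have c1 : ipr mu (A (phi n)) z ^+ 2 @[n --> \oo] --> S ^+ 2.
  have h := l2_pair sAphi z2 z2 zphi; rewrite /S. rewrite (_ : I2 mu z = ipr mu z z); last by apply: I_eq => t.
  by rewrite expr2; exact: cvgM.
 suff : S ^+ 2 <= (2 * C ^+ 2 * b ^+ 2) * S by rewrite ler_pM2r.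
 have [N HN] := zphi S Z0; rewrite -(cvg_lim (@Rhausdorff R) c1); apply: limr_le.
  by apply/cvg_ex; exists (S ^+ 2).
 have [N1 HN1] : exists N, forall n, (N <= n)%N -> I2 mu (A (phi n)) <= 2 * S.
  have [N1 HN1] := zphi (S / 16) (divr_gt0 Z0 (ltr0n R 16)); exists N1 => n /HN1 h.
  have [_ i1] := sAphi n; have [_ i2] := z2; have [_ i3] := sqintB (sAphi n) z2.
  have : I2 mu (A (phi n)) <= (3 / 2) * S + 4 * I mu (fun t => (A (phi n) t - z t) ^+ 2).
   rewrite -(IZ _ i2) -(IZ _ i3) -(ID (integZ _ i2) (integZ _ i3)).
   apply: (I_le i1 (integD (integZ _ i2) (integZ _ i3))) => t.
   by have := sqr_ge0 (z t - 2 * (A (phi n) t - z t)); nra.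
  by lra.
 exists N1 => // n /= /HN1 h. have -> : ipr mu (A (phi n)) z = l (phi n).
  by rewrite Hz//; apply: I_eq => t; rewrite mulrC.
 apply: (le_trans (lb _ (Ephi n))).
 apply: (@le_trans _ _ (b ^+ 2 * C ^+ 2 * (2 * S))); first by rewrite ler_wpM2l// mulr_ge0// sqr_ge0.
 by apply: eq_le_; ring.
move=> y2 b2 z2' [my2 b20 Hy2] z2'2 Hz2.
have c2 : ipr mu (A (phi n)) z2' @[n --> \oo] --> ipr mu z z2'.
 exact: l2_pair.
have [ix _] := Hy2 _ px.
have c1 : ipr mu y2 (phi n) @[n --> \oo] --> ipr mu y2 x.
 apply/cvgrPdist_le => /= e e0; have b21 : 0 < b2 + 1 by rewrite ltr_wpDl.
 have [N HN] := small (e / (b2 + 1)) (divr_gt0 e0 b21); exists N => // n /= /HN[pn nn].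
 have [ipn _] := Hy2 _ (sp (sphi n)); have [_ h] := Hy2 _ pn.
 rewrite distrC -(IB ipn ix); have -> : I mu (fun t => y2 t * phi n t - y2 t * x t) = I mu (fun t => y2 t * (phi n t - x t)).
  by apply: I_eq => t; rewrite mulrBr.
 apply: (le_trans h); move: nn; rewrite ler_pdivlMr// => nn; apply: (le_trans _ nn).
 by rewrite mulrC ler_wpM2l ?nrm_ge0// lerDl.
rewrite (_ : ipr mu z2' z = ipr mu z z2'); last by apply: I_eq => t; rewrite mulrC.
apply: (seq_lim_unique c1).
rewrite (_ : (fun n => ipr mu y2 (phi n)) = fun n => ipr mu (A (phi n)) z2') //.
apply/funext => n; rewrite -Hz2//; by apply: I_eq => t; rewrite mulrC.
Qed.

End real_core.

(** * Complex-valued functions *)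

Section complex_case.
Implicit Types (f g h : BM -> R) (x y z : M -> R[i]) (psi : M -> R).

Lemma mu_gt0 : (0 < mu [set: BM])%E.
Proof.
have := I1_gt0 => h; rewrite lt0e measure_ge0 andbT; apply/eqP => m0.
have : I mu (fun=> 1 : R) = 0.
 apply/eqP; rewrite -eqe (I_EFin (integ_cst mufin 1)) integral_cst//= m0 mule0//.
by move=> e; rewrite e ltxx in h.
Qed.

Lemma q_real : 1 < p -> q = (p / (p - 1))%:E.
Proof.
move=> pp; rewrite /hoelder_conjugate /= gt_eqF//.
by rewrite inver subr_eq0 gt_eqF.
Qed.

Lemma q_conj : 1 < p -> [/\ 0 < p / (p - 1) , p^-1 + (p / (p - 1))^-1 = 1 & (p - 1) * (p / (p - 1)) = p].
Proof.
move=> pp; have pm : 0 < p - 1 by rewrite subr_gt0.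
split; first by rewrite divr_gt0.
 by rewrite invf_div; field; rewrite gt_eqF.
by rewrite mulrC divfK// gt_eqF.
Qed.

Lemma dual_Lnorm g (b : R) : mfun g -> Lnorm mu q (EFin \o g) = b%:E ->
 forall f, pint mu p f -> integ mu (fun t => g t * f t) /\ I mu (fun t => `|g t * f t|) <= b * nrm mu p f.
Proof.
move=> mg gb f pf; have [pp|pe] := boolP (1 < p).
 have [q0 pq _] := q_conj pp; rewrite (q_real pp) in gb. have pg : pint mu (p / (p - 1)) g.
  split=> //; apply: ge0_integP; [exact: meas_pow|by move=> t; exact: powR_ge0|].
  rewrite ltNge leye_eq; apply/eqP => E; move: gb; rewrite unlock.
  have -> : (\int[mu]_t (`|(EFin \o g) t| `^ (p / (p - 1))) = \int[mu]_t (`|g t| `^ (p / (p - 1)))%:E)%E.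
   by [].
  by rewrite E poweRyr// invr_eq0 gt_eqF.
 have := I_hoelder p0 q0 pq pf pg => -[i1 h1]. have gb' : nrm mu (p / (p - 1)) g = b.
  by apply/EFin_inj; rewrite -gb (LnormE pg.2).
 split; first by apply: (eq_integ _ i1) => t; rewrite mulrC.
 rewrite -gb' mulrC; apply: (le_trans _ h1); apply: eq_le_. by apply: I_eq => t; rewrite mulrC.
have {pe}pe : p = 1 by apply/eqP; rewrite eq_le p1 andbT leNgt.
rewrite pe in pf gb *; rewrite hoelder_conjugate1 in gb.
have b0 : 0 <= b by rewrite -lee_fin -gb Lnorm_ge0.
have gae : {ae mu, forall t, `|g t| <= b}.
 move: gb; rewrite unlock mu_gt0 => gb.
 have := ess_sup_ge mu (abse \o (EFin \o g)); rewrite gb; apply: filterS => t /=. by [].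
have [mf if_] := pf.
have {}if_ : integ mu (fun t => `|f t|) by apply: (eq_integ _ if_) => t; rewrite powRr1.
have nE : nrm mu 1 f = I mu (fun t => `|f t|).
 rewrite /nrm invr1 powRr1; last by apply: I_ge0 => t. by apply: I_eq => t; rewrite powRr1.
(* For p = 1 the bound on [g] holds only almost everywhere; truncating at -b and b changes [g] on a
   null set and makes it hold everywhere. *)
pose g' t := Num.max (- b) (Num.min (g t) b).
have g'b t : `|g' t| <= b.
 by rewrite ler_norml le_max lexx /= ge_max ge_min lexx orbT (le_trans _ b0)// oppr_le0.
have mg' : mfun g'.
 apply: measurable_maxr; first exact: measurable_cst. by apply: measurable_minr => //.
have gg' : {ae mu, forall t, g t * f t = g' t * f t}.
 apply: filterS gae => t; rewrite ler_norml => /andP[h1 h2]. by rewrite /g' (min_l h2) (max_r h1).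
have i2 : integ mu (fun t => g' t * f t).
 apply: (integ_le _ _ (integZ b if_)); first exact: measurable_funM. by move=> t; rewrite normrM ler_wpM2r.
have mgf : mfun (fun t : BM => g t * f t) by exact: measurable_funM.
have [i1 _] := integ_ae mgf i2 gg'.
split=> //; rewrite nE -(IZ _ if_).
have ga : {ae mu, forall t, `|g t * f t| = `|g' t * f t|} by apply: filterS gg' => t ->.
have [_ ->] := integ_ae (integ_meas (integ_abs i1)) (integ_abs i2) ga.
by apply: (I_le (integ_abs i2) (integZ _ if_)) => t; rewrite normrM ler_wpM2r.
Qed.

Lemma ncE (w : R[i]) : nc w = Num.sqrt (complex.Re w ^+ 2 + complex.Im w ^+ 2).
Proof. by case: w. Qed.

Lemma nc_ge0 (w : R[i]) : 0 <= nc w. Proof. by rewrite ncE. Qed.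

Lemma nc_sqr (w : R[i]) : nc w ^+ 2 = complex.Re w ^+ 2 + complex.Im w ^+ 2.
Proof. by rewrite ncE sqr_sqrtr// addr_ge0// sqr_ge0. Qed.

Lemma nc_Re (w : R[i]) : `|complex.Re w| <= nc w.
Proof. by rewrite ncE -sqrtr_sqr ler_wsqrtr// lerDl sqr_ge0. Qed.

Lemma nc_Im (w : R[i]) : `|complex.Im w| <= nc w.
Proof. by rewrite ncE -sqrtr_sqr ler_wsqrtr// lerDr sqr_ge0. Qed.

Lemma nc_le (w : R[i]) : nc w <= `|complex.Re w| + `|complex.Im w|.
Proof.
rewrite -(@ler_pXn2r _ 2%N)// ?nnegrE ?nc_ge0// nc_sqr sqrrD !real_normK ?num_real//.
by rewrite addrAC lerDl//.
Qed.

Lemma nc_CS (w v : R[i]) : complex.Re w * complex.Re v + complex.Im w * complex.Im v <= nc w * nc v.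
Proof.
apply: (le_trans (ler_norm _)); rewrite -(@ler_pXn2r _ 2%N)// ?nnegrE ?mulr_ge0 ?nc_ge0//.
rewrite real_normK ?num_real// exprMn !nc_sqr; move: (complex.Re w) (complex.Im w) (complex.Re v) (complex.Im v) => a b e f.
by have := sqr_ge0 (a * f - b * e); nra.
Qed.

Lemma meas_nc x : cmeasurable x -> mfun (fun t : BM => nc (x t)).
Proof.
move=> [mr mi].
have -> : (fun t => nc (x t)) = fun t => (complex.Re (x t) ^+ 2 + complex.Im (x t) ^+ 2) `^ 2^-1.
 by apply/funext => t; rewrite ncE powR12_sqrt// addr_ge0// sqr_ge0.
apply: (measurableT_comp (measurable_powR _)).
by apply: measurable_funD; exact: measurable_funX.
Qed.

Lemma integ_nc x : cLspace mu 1%:E x <-> cmeasurable x /\ integ mu (fun t => nc (x t)).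
Proof.
have E : cLnorm mu 1%:E x = (\int[mu]_t (nc (x t))%:E)%E.
 by rewrite /cLnorm Lnorm1; apply: eq_integral => t _; rewrite /= ger0_norm ?nc_ge0.
split=> -[mx h]; split=> //.
 by apply: ge0_integP; [exact: meas_nc|by move=> t; exact: nc_ge0|rewrite -E].
rewrite E -(I_EFin h); exact: ltry.
Qed.

Lemma cLspace1_integ x : cLspace mu 1%:E x ->
 integ mu (fun t => complex.Re (x t)) /\ integ mu (fun t => complex.Im (x t)).
Proof.
move=> /integ_nc[[mr mi] h]; split; apply: (integ_le _ _ h) => // t; [exact: nc_Re|exact: nc_Im].
Qed.

Lemma distrP m x y : distr_laplacian mu m x y <-> forall psi, sm psi ->
 I mu (fun t => complex.Re (x t) * iter m (@Lapl) psi t) = I mu (fun t => complex.Re (y t) * psi t) /\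
 I mu (fun t => complex.Im (x t) * iter m (@Lapl) psi t) = I mu (fun t => complex.Im (y t) * psi t).
Proof.
have E (w : R[i]) (a : R) : complex.Re (w * a%:C%C) = complex.Re w * a /\ complex.Im (w * a%:C%C) = complex.Im w * a.
 by case: w => w1 w2 /=; rewrite !mulr0 subr0 add0r.
have F (w : M -> R[i]) (a : M -> R) : cintegral mu (fun t => w t * (a t)%:C%C) =
  Complex (I mu (fun t => complex.Re (w t) * a t)) (I mu (fun t => complex.Im (w t) * a t)).
 rewrite !IU; congr Complex; congr Rintegral; apply/funext => t; [exact: (E _ _).1|exact: (E _ _).2].
rewrite LaplE; split=> h psi spsi.
 by have := h psi (smE spsi); rewrite !F => -[].
by have [h1 h2] := h psi (Sm spsi); rewrite !F h1 h2.
Qed.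

Lemma iter_Lapl0 m : iter m (@Lapl) (fun=> 0) = fun=> 0.
Proof. by elim: m => //= m ->; apply/funext => t; exact: (Lapl_cst). Qed.

Lemma dualb_mean (b : R) (g f : BM -> R) : integ mu f -> dualb g b ->
 (forall psi, sm psi -> ipr mu f (iter (2 * k) (@Lapl) psi) = ipr mu g psi) ->
 integ mu g /\ I mu g = 0.
Proof.
move=> if_ [mg b0 hg] E; have s1 := @sm_cst R d M 1.
have ig : integ mu g by have [h _] := hg _ (sp s1); apply: (eq_integ _ h) => t; rewrite mulr1.
split=> //; have := E _ s1.
have -> : iter (2 * k) (@Lapl) (fun=> 1) = fun=> 0.
 have -> : (2 * k)%N = (2 * k).-1.+1 by rewrite prednK// muln_gt0.
 rewrite iterSr (_ : Lapl (fun=> 1) = fun=> 0) ?iter_Lapl0//. by apply/funext => t; exact: (Lapl_cst).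
have -> : I mu (fun t => f t * 0) = 0.
 by rewrite -[RHS](mul0r (I mu f)) -(IZ _ if_); apply: I_eq => t; rewrite mulr0 mul0r.
by move=> ->; apply: I_eq => t; rewrite mulr1.
Qed.

(** By uniqueness [f] differs by a constant from the solution [x] of [package]. The constant lies in
    L^p and drops out of the pairings, because [g] and Delta^k psi have mean zero. *)
Lemma real_reduction (f g : BM -> R) (b : R) : integ mu f -> dualb g b ->
 (forall psi, sm psi -> ipr mu f (iter (2 * k) (@Lapl) psi) = ipr mu g psi) ->
 exists h, [/\ sqint mu h, pint mu p f,
  forall psi, sm psi -> ipr mu f (A psi) = ipr mu h psi &
  ipr mu g f = I2 mu h].
Proof.
move=> if_ dg E; have [ig g0] := dualb_mean if_ dg E.
have [C C0 HP] := package.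
have [x [z [[x2 px] z2 xA zA [_ pair]]]] := HP _ _ dg g0.
have ix := sqint_integ mufin x2; have mf := integ_meas if_.
have iu := integB if_ ix.
have [c hc] : exists c, {ae mu, forall t : BM, f t - x t = c}.
 apply: (laplacian_unique (m := (2 * k)%N) iu) => psi spsi. have s2 := sm_iter (2 * k)%N spsi.
 have i1 := integ_mul_sm if_ s2; have i2 := integ_mul_sm ix s2.
 transitivity (ipr mu f (iter (2 * k) (@Lapl) psi) - ipr mu x (iter (2 * k) (@Lapl) psi)).
  by rewrite -(IB i1 i2); apply: I_eq => t; rewrite mulrBl.
 rewrite E//; have -> : iter (2 * k) (@Lapl) psi = A (A psi) by rewrite mul2n -addnn iterD.
 by rewrite xA ?zA ?subrr//; exact: sA.
have fx : {ae mu, forall t : BM, f t = x t + c} by apply: filterS hc => t <-; rewrite addrC subrK.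
have pc := sp (@sm_cst R d M c); have pxc := pintD p0 px pc.
exists z; split=> //.
- split=> //; apply: (integ_ae (meas_pow p mf) pxc.2 _).1.
 by apply: filterS fx => t ->.
- move=> psi spsi; have iA := integ_mul_sm ix (sA spsi); have ic := integZ c (is_ (sA spsi)).
 have [_ ->] := @integ_ae _ _ _ mu (fun t => f t * A psi t) (fun t => x t * A psi t + c * A psi t)
  (integ_meas (integ_mul_sm if_ (sA spsi))) (integD iA ic)
  (filterS (fun t (h : f t = x t + c) => etrans (congr1 (fun w => w * A psi t) h) (mulrDl _ _ _)) fx).
 by rewrite (ID iA ic) (IZ _ (is_ (sA spsi))) (I_A spsi) mulr0 addr0 xA.
have [mg b0 hg] := dg; have [igx _] := hg _ px.
have igc := integZ c ig.
have [_ ->] := @integ_ae _ _ _ mu (fun t => g t * f t) (fun t => g t * x t + c * g t)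
  (measurable_funM mg mf) (integD igx igc)
  (filterS (fun t (h : f t = x t + c) => etrans (congr1 (fun w => g t * w) h) (etrans (mulrDr _ _ _) (congr1 (fun w => g t * x t + w) (mulrC _ _)))) fx).
rewrite (ID igx igc) (IZ _ ig) g0 mulr0 addr0 (pair _ _ _ dg z2 zA).
by [].
Qed.

Lemma dualb_le g g' (b : R) : mfun g -> (forall t, `|g t| <= g' t) ->
 mfun g' -> Lnorm mu q (EFin \o g') = b%:E -> dualb g b.
Proof.
move=> mg gg' mg' gb; split=> //; first by rewrite -lee_fin -gb Lnorm_ge0.
move=> f pf; have [i1 h1] := dual_Lnorm mg' gb pf; have [mf _] := pf.
have le t : `|g t * f t| <= `|g' t * f t|.
 rewrite !normrM ler_wpM2r//; exact: (le_trans (gg' t) (ler_norm _)).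
have ig : integ mu (fun t => g t * f t).
 by apply: (integ_le _ le (integ_abs i1)); exact: measurable_funM.
split=> //; apply: (le_trans (I_abs ig)); apply: (le_trans _ h1).
exact: (I_le (integ_abs ig) (integ_abs i1)).
Qed.

(** The real and imaginary identities add up to |z|_2^2 = int Re(y conj(x)), and Re(y conj(x)) <=
    |y| |x| pointwise. *)
Lemma complex_reduction x y (b : R) : cLspace mu 1%:E x -> cmeasurable y -> cLnorm mu q y = b%:E ->
 distr_laplacian mu (2 * k) x y ->
 pint mu p (fun t : BM => nc (x t)) /\ exists z,
 [/\ cLspace mu 1%:E z, cLspace mu 2%:E z, distr_laplacian mu k x z,
   cLnorm mu 2%:E z = (nrm mu 2 (fun t : BM => nc (z t)))%:E &
   nrm mu 2 (fun t : BM => nc (z t)) ^+ 2 <= nrm mu p (fun t : BM => nc (x t)) * b].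
Proof.
move=> lx my yb /distrP E; have mny := meas_nc my.
have [ixr ixi] := cLspace1_integ lx; have [mx _] := lx; have mnx := meas_nc mx.
have dr : dualb (fun t => complex.Re (y t)) b by apply: (dualb_le my.1 _ mny yb) => t; exact: nc_Re.
have di : dualb (fun t => complex.Im (y t)) b by apply: (dualb_le my.2 _ mny yb) => t; exact: nc_Im.
have [zr [zr2 pxr xzr Er]] := real_reduction ixr dr (fun psi spsi => (E psi spsi).1).
have [zi [zi2 pxi xzi Ei]] := real_reduction ixi di (fun psi spsi => (E psi spsi).2).
have px : pint mu p (fun t => nc (x t)).
 have ps : pint mu p (fun t => `|complex.Re (x t)| + `|complex.Im (x t)|).
  apply: pintD => //; [apply: (pint_le p0 _ _ pxr)|apply: (pint_le p0 _ _ pxi)].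
  - by apply: measurableT_comp => //; case: pxr.
  - by move=> t; rewrite normr_id.
  - by apply: measurableT_comp => //; case: pxi.
  - by move=> t; rewrite normr_id.
 apply: (pint_le p0 mnx _ ps) => t. by rewrite (ger0_norm (nc_ge0 _)) [leRHS]ger0_norm// ; exact: nc_le.
split=> //; pose z t := Complex (zr t) (zi t); exists z.
have mz : cmeasurable z by split; [case: zr2|case: zi2].
have mnz := meas_nc mz.
have isq : integ mu (fun t => nc (z t) ^+ 2).
 by apply: (eq_integ _ (integD zr2.2 zi2.2)) => t; rewrite nc_sqr.
have nz2 : sqint mu (fun t => nc (z t)) by [].
have pz : integ mu (fun t => `|nc (z t)| `^ 2).
 by apply: (eq_integ _ isq) => t; rewrite (ger0_norm (nc_ge0 _)) -powR_mulrn ?nc_ge0.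
have nE : cLnorm mu 2%:E z = (nrm mu 2 (fun t => nc (z t)))%:E by exact: LnormE.
split=> //.
- by apply/integ_nc; split=> //; exact: sqint_integ.
- by split=> //; rewrite nE ltry.
- by apply/distrP => psi spsi; split; [exact: xzr|exact: xzi].
rewrite nrm2E sqr_sqrtr; last by exact: I2_ge0.
have -> : I mu (fun t => nc (z t) ^+ 2) = I mu (fun t => complex.Re (y t) * complex.Re (x t)) + I mu (fun t => complex.Im (y t) * complex.Im (x t)).
 by rewrite Er Ei -(ID zr2.2 zi2.2); apply: I_eq => t; rewrite nc_sqr.
have [_ _ hr] := dr; have [_ _ hi] := di.
have [jr _] := hr _ pxr; have [ji _] := hi _ pxi; have [j hj] := dual_Lnorm mny yb px.
rewrite -(ID jr ji) mulrC; apply: (le_trans _ hj).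
apply: (I_le (integD jr ji) (integ_abs j)) => t; apply: (le_trans (nc_CS _ _)); exact: ler_norm.
Qed.

Lemma Lq_sub_L1 y : cLspace mu q y -> cLspace mu 1%:E y /\ exists2 b : R, 0 <= b & cLnorm mu q y = b%:E.
Proof.
move=> [my ly]; have b0 : (0 <= cLnorm mu q y)%E by exact: Lnorm_ge0.
have [b yb] : exists b : R, cLnorm mu q y = b%:E.
 by exists (fine (cLnorm mu q y)); rewrite fineK// ge0_fin_numE.
split; last by exists b => //; rewrite -lee_fin -yb.
apply/integ_nc; split=> //.
have [h _] := dual_Lnorm (meas_nc my) yb (sp (@sm_cst R d M 1)).
by apply: (eq_integ _ h) => t; rewrite mulr1.
Qed.

Lemma laplacian_norm_ge0 m r x : (0 <= laplacian_norm mu m r x)%E.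
Proof. by apply: le_ereal_inf_tmp => _ [y _ <-]; exact: Lnorm_ge0. Qed.

Lemma sobolev_inequality x : sobolev mu (2 * k) q x ->
 [/\ cLspace mu p%:E x, sobolev mu k 2%:E x &
   (laplacian_norm mu k 2%:E x <= sqrte (cLnorm mu p%:E x * laplacian_norm mu (2 * k) q x))%E].
Proof.
move=> [lx [y ly Exy]]; have [ly1 [b b0 yb]] := Lq_sub_L1 ly.
have [px [z [z1 z2 xz zE zb]]] := complex_reduction lx ly.1 yb Exy.
have cx : cLnorm mu p%:E x = (nrm mu p (fun t => nc (x t)))%:E by exact: (LnormE px.2).
split.
- by split; [exact: lx.1|rewrite cx ltry].
- by split=> //; exists z.
(* [laplacian_norm] is an infimum, so the estimate is made for each [y'] that represents Delta^(2k)
   x. *)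
have key y' (b' : R) : cLspace mu 1%:E y' -> cLnorm mu q y' = b'%:E -> distr_laplacian mu (2 * k) x y' ->
  exists2 n : R, 0 <= n & (laplacian_norm mu k 2%:E x <= n%:E)%E /\ n ^+ 2 <= nrm mu p (fun t => nc (x t)) * b'.
 move=> l1 yb' E'; have [_ [z' [z1' _ xz' zE' zb']]] := complex_reduction lx l1.1 yb' E'.
 exists (nrm mu 2 (fun t => nc (z' t))); first exact: nrm_ge0. by split=> //; apply: ereal_inf_lbound; exists z'.
have [n n0 [Ln _]] := key _ _ ly1 yb Exy.
have L0 := laplacian_norm_ge0 k 2%:E x; have D0 := laplacian_norm_ge0 (2 * k) q x.
have Db : (laplacian_norm mu (2 * k) q x <= b%:E)%E by rewrite -yb; apply: ereal_inf_lbound; exists y.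
have Lf : laplacian_norm mu k 2%:E x \is a fin_num by rewrite ge0_fin_numE// (le_lt_trans Ln)// ltry.
have Df : laplacian_norm mu (2 * k) q x \is a fin_num by rewrite ge0_fin_numE// (le_lt_trans Db)// ltry.
pose X := nrm mu p (fun t => nc (x t)); have X0 : 0 <= X by exact: nrm_ge0.
pose Lr := fine (laplacian_norm mu k 2%:E x); pose Dr := fine (laplacian_norm mu (2 * k) q x).
have LE : laplacian_norm mu k 2%:E x = Lr%:E by rewrite fineK.
have DE : laplacian_norm mu (2 * k) q x = Dr%:E by rewrite fineK.
have Lr0 : 0 <= Lr by rewrite -lee_fin -LE.
rewrite cx LE DE lee_fin -[leLHS]ger0_norm// -sqrtr_sqr ler_wsqrtr//.
(* Dividing by X + 1 instead of X covers X = 0. *)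
apply/ler_addgt0Pr => e e0; have e1 : 0 < e / (X + 1) by rewrite divr_gt0// ltr_wpDl.
have [_ [y' [l1 E'] <-] h] := lb_ereal_inf_adherent e1 Df.
rewrite -/(laplacian_norm mu (2 * k) q x) DE in h.
have b0' : (0 <= cLnorm mu q y')%E by exact: Lnorm_ge0.
have yf : cLnorm mu q y' \is a fin_num by rewrite ge0_fin_numE// (lt_trans h)// ltry.
have yE : cLnorm mu q y' = (fine (cLnorm mu q y'))%:E by rewrite fineK.
rewrite yE in h; have [n' n0' [Ln' nb']] := key _ _ l1 yE E'.
rewrite LE in Ln'.
apply: (@le_trans _ _ (n' ^+ 2)); first by rewrite lerXn2r.
apply: (le_trans nb').
apply: (@le_trans _ _ (X * (Dr + e / (X + 1)))); first by rewrite ler_wpM2l// ltW.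
rewrite mulrDr lerD2l mulrA ler_pdivrMr ?ltr_wpDl// mulrDr mulr1 mulrC lerDl; exact: ltW.
Qed.

End complex_case.

(** * Sharpness of the constant *)

Section sharpness.
Hypothesis d0 : (0 < d)%N.
Local Notation q' := (p / (p - 1)).
Implicit Types (x y z w : BM -> R) (f psi : M -> R).

Let spr r psi : 0 < r -> sm psi -> pint mu r (psi : BM -> R).
Proof. by move=> r0; exact: (sm_pint r0). Qed.

(** Since d > 0, a chart contains two points, and a bump separates them. *)
Lemma nonconstant_smooth : exists2 f : M -> R, sm f & exists s t : M, f s != f t.
Proof.
pose t := (point : M); pose i := chart_at t; pose u := chart i t.
have oi : open (chart i @` source i).
 have := @chart_open _ _ M i setT openT; by rewrite setTI.
have : nbhs u (chart i @` source i) by apply: open_nbhs_nbhs; split=> //; exists t => //; exact: chart_atP.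
move=> /nbhs_ballP[e /= e0 he]; have e2 : 0 < e / 2 by rewrite divr_gt0.
pose a := Ordinal d0; pose v := u + (e / 2) *: ev a.
have [|s ss sv] := he v.
 rewrite -ball_normE /= opprD addNKr normrN.
 apply: (@le_lt_trans _ _ (e / 2)); last by rewrite ltr_pdivrMr// mulr_natr ltrDl.
 apply: rV_normP => [|j]; first exact: ltW.
 rewrite !mxE /=; case: eqP => _; rewrite ?mulr1 ?mulr0 ?normr0 ?(ltW e2)//. by rewrite ger0_norm// ltW.
have st : s <> t.
 move=> E; have : v 0 a = u 0 a by rewrite /u -E sv.
 rewrite !mxE mulr1 => /eqP; rewrite -subr_eq0 addrAC subrr add0r => /eqP E'. by rewrite E' ltxx in e2.
have oO : open (~` [set s]).
 by apply: closed_openC; apply: compact_closed; [exact: M_hausdorff|exact: compact_set1].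
have [|b [sb _ b0 b1]] := bump_exists (t := t) oO; first by move=> E; apply: st.
exists b => //; exists t, s; rewrite (nbhs_singleton b1) b0; first by rewrite oner_neq0.
by move=> h; apply: h.
Qed.

(** |y|_q <= b, written pointwise when p = 1 and q is infinite. *)
Definition qbound y (b : R) := [/\ mfun y, 0 <= b &
 if 1 < p then pint mu q' y /\ nrm mu q' y <= b else forall t, `|y t| <= b].

Lemma qbound_dual y b : qbound y b -> dualb y b.
Proof.
move=> [my b0]; have [pp [py yb]|pp yb] := boolP (1 < p).
 have pn : pint mu q' (fun t => `|y t|).
  have [m i] := py; split; first exact: measurableT_comp. by apply: (eq_integ _ i) => t; rewrite normr_id.
 have nE : nrm mu q' (fun t => `|y t|) = nrm mu q' y.
  by rewrite /nrm; congr (_ `^ _); apply: I_eq => t; rewrite normr_id.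
 have [_ _ h] : dualb y (nrm mu q' y).
  apply: (dualb_le my (g' := fun t => `|y t|) _ pn.1) => [t|]; first exact: lexx.
  by rewrite (q_real pp) -nE; exact: (LnormE pn.2).
 split; [exact: my|exact: b0|move=> f pf]; have [j hj] := h _ pf; split; first exact: j.
 apply: (le_trans hj); apply: ler_wpM2r; [exact: nrm_ge0|exact: yb].
have pe : p = 1 by apply/eqP; rewrite eq_le p1 andbT leNgt.
apply: (dualb_le my (g' := fun=> b)) => //.
rewrite pe hoelder_conjugate1 unlock (mu_gt0).
rewrite (_ : abse \o _ = cst b%:E) ?(ess_sup_cst _ (mu_gt0))//.
by apply/funext => t /=; rewrite ger0_norm.
Qed.

Lemma qbound_Lnorm y b : qbound y b -> (Lnorm mu q (EFin \o y) <= b%:E)%E.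
Proof.
move=> [my b0]; have [pp [py yb]|pp yb] := boolP (1 < p).
 by rewrite (q_real pp) (LnormE py.2).
have pe : p = 1 by apply/eqP; rewrite eq_le p1 andbT leNgt.
rewrite pe hoelder_conjugate1 unlock (mu_gt0); apply/ess_supP.
by apply: aeW => t /=; rewrite lee_fin.
Qed.

(* The extremal dual function for [x - c], with [c] chosen such that it has mean zero; for p = 1 the sign
  function has to be smoothed, whence [e]. *)
Lemma almost_dual x e : pint mu p x -> integ mu x -> 0 < e -> exists c,
 nrm mu p (fun t => x t - c) <= e \/
 exists y b, [/\ qbound y b, 0 < b, I mu y = 0 & (nrm mu p (fun t => x t - c) - e) * b <= ipr mu y x].
Proof.
move=> px ix e0; have mu0 := I1_gt0.
have pxc c : pint mu p (fun t => x t - c) by apply: (pintD p0 px); exact: (spr p0 (@sm_cst R d M (- c))).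
have mxc c := (pxc c).1.
have shift y c : integ mu y -> I mu y = 0 -> integ mu (fun t => y t * x t) ->
  ipr mu y x = I mu (fun t => (x t - c) * y t).
 move=> iy y0 iyx; transitivity (ipr mu y x + (- c) * I mu y).
  by rewrite y0 mulr0 addr0.
 by rewrite -(IZ _ iy) -(ID iyx (integZ _ iy)); apply: I_eq => t; ring.
have [pp|pp] := boolP (1 < p).
 have [q0 pq pqE] := q_conj pp; have pm : 0 < p - 1 by rewrite subr_gt0. pose psi := @spow R (p - 1).
 have psiE s : `|psi s| `^ q' = `|s| `^ p by rewrite norm_spow ?gt_eqF// -powRrM pqE.
 have py c : pint mu q' (fun t => psi (x t - c)).
  split; first by apply: (measurableT_comp (meas_spow _) (mxc c)). by apply: (eq_integ _ (pxc c).2) => t.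
 have iy c : integ mu (fun t => psi (x t - c)).
  have [h _] := I_hoelder p0 q0 pq (spr p0 (@sm_cst R d M 1)) (py c).
  by apply: (eq_integ _ h) => t; rewrite mul1r.
 have psi1 : 0 < psi 1 by rewrite /psi spow_ge0// gt_eqF.
 have [c yc] := centering (fun u l => @spow_cvg R (p - 1) u l pm) (fun s t => spow_le (ltW pm))
  (@spowN R (p - 1)) psi1 mufin mu0 iy.
 pose S := I mu (fun t => `|x t - c| `^ p). have S0 : 0 <= S by apply: I_ge0 => t.
 exists c; have [Sz|Sn] := eqVneq S 0.
  by left; rewrite /nrm -/S Sz powR0 ?invr_eq0 ?gt_eqF// ltW.
 have Sp : 0 < S by rewrite lt_def Sn. right; exists (fun t => psi (x t - c)), (S `^ q'^-1).
 have qb : qbound (fun t => psi (x t - c)) (S `^ q'^-1).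
  split; [exact: (py c).1|exact: powR_ge0|rewrite pp; split; first exact: py].
  by apply: eq_le_; congr (_ `^ _); apply: I_eq => t.
 have [_ _ hd] := qbound_dual qb; have [iyx _] := hd _ px. split=> //; first exact: powR_gt0.
 rewrite (shift _ c (iy c) yc iyx). rewrite (_ : I mu _ = S); last by apply: I_eq => t; exact: mul_spow.
 apply: (@le_trans _ _ (nrm mu p (fun t => x t - c) * S `^ q'^-1)).
  by rewrite ler_wpM2r ?powR_ge0// gerBl ltW.
 by rewrite -powRD ?pq ?powRr1// Sn implybT.
have pe : p = 1 by apply/eqP; rewrite eq_le p1 andbT leNgt.
(* Regularising the sign loses at most [r] at each point, hence [e] in total. *)
pose m := I mu (fun=> 1 : R); pose r := e / m; have r0 : 0 < r by rewrite divr_gt0.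
pose psi := @ssgn R r.
have my c : mfun (fun t : BM => psi (x t - c)).
 by apply: (measurableT_comp (meas_ssgn r0) (mxc c)).
have iy c : integ mu (fun t => psi (x t - c)).
 by apply: (integ_bounded mufin (my c)) => t; exact: norm_ssgn.
have psi1 : 0 < psi 1 by rewrite divr_gt0// ltr_wpDl.
have [c yc] := centering (fun u l => @ssgn_cvg R r r0 u l) (ssgn_le r0) (@ssgnN R r) psi1 mufin mu0 iy.
exists c; right; exists (fun t => psi (x t - c)), 1.
have qb : qbound (fun t => psi (x t - c)) 1.
 by split; [exact: my|exact: ler01|rewrite (negbTE pp) => t; exact: norm_ssgn].
have [_ _ hd] := qbound_dual qb; have [iyx _] := hd _ px.
split=> //; rewrite mulr1 (shift _ c (iy c) yc iyx).
have ixc := integB ix (integ_cst mufin c).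
have -> : nrm mu p (fun t => x t - c) = I mu (fun t => `|x t - c|).
 rewrite /nrm pe invr1 powRr1; last by apply: I_ge0 => t. by apply: I_eq => t; rewrite powRr1.
have -> : e = I mu (fun=> r).
 rewrite -[LHS](divfK (lt0r_neq0 mu0)) -(IZ _ (integ_cst mufin 1)). by apply: I_eq => t; rewrite mulr1.
rewrite -(IB (integ_abs ixc) (integ_cst mufin r)).
apply: (I_le (integB (integ_abs ixc) (integ_cst mufin r))) => [|t]; last exact: mul_ssgn.
have := integB iyx (integZ c (iy c)); apply: eq_integ => t; ring.
Qed.

(** Since [laplacian_norm] is an infimum, the lower bound requires that every [v] representing
    Delta^k w has real part [z] almost everywhere, which is the fundamental lemma. *)
Lemma laplacian_norm_real x c y z b : integ mu x -> pint mu p x -> qbound y b -> sqint mu z ->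
 (forall psi, sm psi -> ipr mu x (A psi) = ipr mu z psi) ->
 (forall psi, sm psi -> ipr mu z (A psi) = ipr mu y psi) ->
 let w t := ((x t - c)%:C)%C in
 [/\ sobolev mu (2 * k) q w, cLnorm mu p%:E w = (nrm mu p (fun t => x t - c))%:E,
   (laplacian_norm mu (2 * k) q w <= b%:E)%E &
   ((Num.sqrt (I2 mu z))%:E <= laplacian_norm mu k 2%:E w)%E].
Proof.
move=> ix px qb z2 xz zy w; have [my b0 _] := qb.
have ncr (r : R) : nc (r%:C)%C = `|r| by rewrite /= expr0n addr0 sqrtr_sqr.
have mC (v : BM -> R) : mfun v -> cmeasurable (fun t : M => ((v t)%:C)%C).
 by [].
have iL (v : BM -> R) : integ mu v -> cLspace mu 1%:E (fun t => ((v t)%:C)%C).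
 move=> iv; apply/integ_nc; split; first exact: mC (integ_meas iv). by apply: (eq_integ _ (integ_abs iv)) => t.
have ixc := integB ix (integ_cst mufin c).
have pxc : pint mu p (fun t => x t - c) by apply: (pintD p0 px); exact: (spr p0 (@sm_cst R d M (- c))).
have xcz psi : sm psi -> I mu (fun t => (x t - c) * A psi t) = ipr mu z psi.
 move=> spsi; have s_A := sA spsi. rewrite -xz// -[RHS]subr0 -(mulr0 c) -(I_A spsi) -(IZ _ (is_ s_A)).
 rewrite -(IB (integ_mul_sm ix s_A) (integZ _ (is_ s_A))). by apply: I_eq => t; rewrite mulrBl.
have [_ _ hd] := qbound_dual qb.
have iy : integ mu y by have [h _] := hd _ (spr p0 (@sm_cst R d M 1)); apply: (eq_integ _ h) => t; rewrite mulr1.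
have Ly : (cLnorm mu q (fun t => ((y t)%:C)%C) <= b%:E)%E.
 apply: (le_trans _ (qbound_Lnorm qb)); rewrite -[leRHS]Lnorm_abse; apply: eq_le_.
 by congr Lnorm; apply/funext => t; exact: congr1.
have dwy : distr_laplacian mu (2 * k) w (fun t => ((y t)%:C)%C).
 apply/distrP => psi spsi; have s_A := sA spsi. split; last by apply: I_eq => t; rewrite /= !mul0r.
 by rewrite -zy// -xcz//; have -> : iter (2 * k) (@Lapl) psi = A (A psi) by rewrite mul2n -addnn iterD.
have wE : cLnorm mu p%:E w = (nrm mu p (fun t => x t - c))%:E.
 rewrite -(LnormE pxc.2) -[RHS]Lnorm_abse; congr Lnorm. by apply/funext => t; exact: (congr1 EFin (ncr _)).
split=> //.
- split; first exact: iL.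
 exists (fun t => ((y t)%:C)%C) => //; split; first exact: mC. by apply: (le_lt_trans Ly); rewrite ltry.
- apply: (le_trans _ Ly); apply: ereal_inf_lbound; exists (fun t => ((y t)%:C)%C) => //; split=> //; exact: iL.
apply: le_ereal_inf_tmp => _ [v [lv /distrP dv] <-].
have [iv _] := cLspace1_integ lv; have iz := sqint_integ mufin z2.
have ae0 : {ae mu, forall t : BM, complex.Re (v t) - z t = 0}.
 apply: (fundamental_lemma (integB iv iz)) => psi spsi.
 transitivity (I mu (fun t => complex.Re (v t) * psi t) - ipr mu z psi).
  rewrite -(IB (integ_mul_sm iv spsi) (integ_mul_sm iz spsi)). by apply: I_eq => t; rewrite mulrBl.
 by rewrite -(dv _ spsi).1 -xcz// subrr.
have mv := meas_nc lv.1.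
have z2' : integ mu (fun t => `|z t| `^ 2).
 by apply: (eq_integ _ z2.2) => t; rewrite powR_mulrn// real_normK ?num_real.
rewrite -nrm2E -(LnormE z2') /cLnorm unlock.
apply: gt0_ler_poweR; rewrite ?in_itv /= ?integral_ge0 ?leey//.
apply: ae_ge0_le_integral => //.
- apply/measurable_EFinP; exact: meas_pow z2.1.
- apply/measurable_EFinP; exact: meas_pow mv.
apply: filterS ae0 => t /eqP; rewrite subr_eq0 => /eqP E _ /=.
rewrite lee_fin ge0_ler_powR// -E.
by apply: (le_trans (nc_Re _)); exact: ler_norm.
Qed.

Lemma sharp_constant C : (forall w : M -> R[i], sobolev mu (2 * k) q w ->
  (laplacian_norm mu k 2%:E w <=
   C%:E * sqrte (cLnorm mu p%:E w * laplacian_norm mu (2 * k) q w))%E) -> 1 <= C.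
Proof.
move=> HC; have [K K0 HK] := package.
pose E z := I2 mu z; have E0 z : 0 <= E z by exact: I2_ge0.
pose good y b x z := [/\ sqint mu x /\ pint mu p x, sqint mu z,
 forall psi, sm psi -> ipr mu x (A psi) = ipr mu z psi,
 forall psi, sm psi -> ipr mu z (A psi) = ipr mu y psi &
 E z <= K * b ^+ 2 /\ forall y2 b2 z2, dualb y2 b2 -> sqint mu z2 ->
  (forall psi, sm psi -> ipr mu z2 (A psi) = ipr mu y2 psi) ->
  ipr mu y2 x = ipr mu z2 z].
(* The supremum of these quotients is the best constant; it is finite by the a priori bound [K]. *)
pose S := [set r : R | exists y b x z, [/\ qbound y b, 0 < b, good y b x z & r = E z / b ^+ 2]].
have sol y b : qbound y b -> I mu y = 0 -> exists x z, good y b x z.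
 by move=> qb y0; have [x [z h]] := HK y b (qbound_dual qb) y0; exists x, z.
(* A nonconstant smooth function, centred, gives a positive quotient: z = 0 would make it orthogonal
   to itself. *)
have [r0 r0S r0p] : exists2 r, S r & 0 < r.
 have [f sf [s [t fst]]] := nonconstant_smooth; have [sg g0] := sm_mean sf. set g := (fun _ => _) in sg g0.
 have gst : g s != g t by apply: contra_neq fst => /addIr. have [b b0 qb] : exists2 b, 0 < b & qbound g b.
  have mg := integ_meas (is_ sg); have [pp|pp] := boolP (1 < p).
   have [q0 _ _] := q_conj pp; exists (nrm mu q' g + 1); first by rewrite ltr_wpDl// nrm_ge0.
   split; [exact: mg|by rewrite addr_ge0// nrm_ge0|rewrite pp]. by split; [exact: spr|rewrite lerDl].
  have [B B0 HB] := sm_bounded sg; exists (B + 1); first by rewrite ltr_wpDl.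
  split; [exact: mg|by rewrite addr_ge0|rewrite (negbTE pp) => u]. by apply: (le_trans (HB u)); rewrite lerDl.
 have [x [z gd]] := sol _ _ qb g0; exists (E z / b ^+ 2); first by exists g, b, x, z.
 rewrite divr_gt0 ?exprn_gt0// lt_def E0 andbT; apply/eqP => Ez. have [_ z2 _ zy _] := gd; have s_A := sA sg.
 have g2 : I2 mu g = 0.
  have := CS z2 (qs s_A); rewrite -/(E z) Ez mul0r zy// => h.
  have : ipr mu g g ^+ 2 = 0 by apply/eqP; rewrite eq_le h sqr_ge0. by move=> /eqP; rewrite sqrf_eq0 => /eqP h2.
 have g00 := smooth_sq_eq0 sg g2. by move/eqP: gst; rewrite !g00.
have hS : has_sup S.
 split; first by exists r0. exists K => _ [y [b [x [z [_ b0 [_ _ _ _ [h _]] ->]]]]].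
 by rewrite ler_pdivrMr ?exprn_gt0.
set N := sup S; have N0 : 0 < N by apply: (lt_le_trans r0p); exact: sup_upper_bound.
have EN y b x z : qbound y b -> 0 < b -> good y b x z -> E z <= N * b ^+ 2.
 move=> qb b0 gd; rewrite -ler_pdivrMr ?exprn_gt0//; apply: sup_upper_bound => //. by exists y, b, x, z.
have core y b x z : qbound y b -> 0 < b -> good y b x z -> 0 < E z -> 0 < C /\ E z <= C ^+ 4 * N * b ^+ 2.
 move=> qb b0 [[x2 px] z2 xz zy [_ pair]] Ez; have ix := sqint_integ mufin x2.
 have step c : 0 < C /\ E z <= C ^+ 2 * nrm mu p (fun t => x t - c) * b.
  have [sw wE Dw Lw] := laplacian_norm_real c ix px qb z2 xz zy.
  set w := (fun _ => _) in sw wE Dw Lw; set X := nrm mu p _ in wE *. have X0 : 0 <= X by exact: nrm_ge0.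
  have D0 := laplacian_norm_ge0 (2 * k) q w.
  have Df : laplacian_norm mu (2 * k) q w \is a fin_num by rewrite ge0_fin_numE// (le_lt_trans Dw)// ltry.
  have := le_trans Lw (HC _ sw); rewrite wE -(fineK Df) /= => h.
  rewrite -(fineK Df) in Dw; rewrite -(fineK Df) in D0. move: (fine _) Dw D0 h => D Db D0 h.
  have sE : 0 < Num.sqrt (E z) by rewrite sqrtr_gt0. have C0 : 0 < C.
   rewrite ltNge; apply/negP => Cn; have := lt_le_trans sE h. by rewrite ltNge mulr_le0_ge0//.
  split=> //; rewrite -[leLHS]sqr_sqrtr//. apply: (@le_trans _ _ ((C * Num.sqrt (X * D)) ^+ 2)).
   by rewrite lerXn2r ?nnegrE// mulr_ge0// ltW.
  rewrite exprMn sqr_sqrtr ?mulr_ge0// -mulrA ler_wpM2l ?sqr_ge0//. by rewrite ler_wpM2l.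
 (* [step] is used with the constant [c] of [almost_dual]; the dual function [y'] has its own
    solution [z'], whose energy is at most N b'^2, and [pair] moves the pairing with [x] to [z'] and
    [z]. *)
 have C0 := (step 0).1; split=> //. have key e : 0 < e -> E z <= C ^+ 2 * (Num.sqrt (N * E z) + e) * b.
  move=> e0; have [c hc] := almost_dual px ix e0. suff : nrm mu p (fun t => x t - c) <= Num.sqrt (N * E z) + e.
   move=> h; apply: (le_trans (step c).2). by rewrite ler_wpM2r ?(ltW b0)// ler_wpM2l ?sqr_ge0.
  case: hc => [h|[y' [b' [qb' b0' y0' h]]]]; first by apply: (le_trans h); rewrite lerDr.
  have [x' [z' gd']] := sol _ _ qb' y0'; have h' := EN _ _ _ _ qb' b0' gd'. have [_ z2' _ zy' _] := gd'.
  rewrite -lerBlDr -(ler_pM2r b0'); apply: (le_trans h). rewrite (pair _ _ _ (qbound_dual qb') z2' zy').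
  apply: (le_trans (ler_norm _)); rewrite -(@ler_pXn2r _ 2%N)// ?nnegrE ?mulr_ge0 ?(ltW b0')//.
  rewrite real_normK ?num_real//; apply: (le_trans (CS z2' z2)).
  rewrite exprMn sqr_sqrtr ?mulr_ge0 ?(ltW N0)// mulrAC; apply: ler_wpM2r; [exact: E0|exact: h'].
 have {}key : E z <= C ^+ 2 * Num.sqrt (N * E z) * b.
  apply/ler_addgt0Pr => e e0; have Cb : 0 < C ^+ 2 * b by rewrite mulr_gt0// exprn_gt0.
  apply: (le_trans (key _ (divr_gt0 e0 Cb))). apply: eq_le_; field. by rewrite !gt_eqF.
 have : E z ^+ 2 <= (C ^+ 2 * Num.sqrt (N * E z) * b) ^+ 2.
  by rewrite lerXn2r ?nnegrE// !mulr_ge0// ltW.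
 rewrite !exprMn sqr_sqrtr ?mulr_ge0 ?(ltW N0)// => h2; rewrite -(ler_pM2r Ez).
 by apply: (le_trans h2); apply: eq_le_; ring.
have C0 : 0 < C.
 have [y [b [x [z [qb b0 gd rE]]]]] := r0S; apply: (core y b x z qb b0 gd _).1.
 by move: r0p; rewrite rE pmulr_lgt0// invr_gt0 exprn_gt0.
(* Each quotient is at most C^4 N, hence so is their supremum N, which is positive. *)
have : N <= C ^+ 4 * N.
 apply: ge_sup; first by exists r0. move=> _ [y [b [x [z [qb b0 gd ->]]]]]; rewrite ler_pdivrMr ?exprn_gt0//.
 have [Ez|Ez] := eqVneq (E z) 0.
  by rewrite Ez !mulr_ge0// ltW.
 have Ep : 0 < E z by rewrite lt_def Ez E0. exact: (core y b x z qb b0 gd Ep).2.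
rewrite -[leLHS]mul1r ler_pM2r// leNgt => h; rewrite leNgt; apply/negP => C1; move/negP: h.
by rewrite exprn_ilt1// ltW.
Qed.

End sharpness.

End exponent.

End analysis.

Theorem theorem19 (R : realType) (d : nat) (M : riemannian_manifold R d)
    (mu : {measure set (borel M) -> \bar R}) (p : R) (k : nat) :
  (0 < d)%N ->
  compact [set: M] -> connected [set: M] ->
  is_riemannian_volume mu ->
  1 <= p ->
  (0 < k)%N -> d%:R / 2 * (1 / 2 - 1 / p) <= k%:R ->
  let q := hoelder_conjugate p%:E in
  (forall x : M -> R[i], sobolev mu (2 * k) q x ->
     [/\ cLspace mu p%:E x, sobolev mu k 2%:E x &
         (laplacian_norm mu k 2%:E x <=
          sqrte (cLnorm mu p%:E x * laplacian_norm mu (2 * k) q x))%E]) /\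
  (forall C : R,
     (forall x : M -> R[i], sobolev mu (2 * k) q x ->
        (laplacian_norm mu k 2%:E x <=
         C%:E * sqrte (cLnorm mu p%:E x * laplacian_norm mu (2 * k) q x))%E) ->
     1 <= C).
Proof.
move=> d0 cM kM [lam Hl Hmu] p1 k0 dk q; split=> [x|C].
  exact: (sobolev_inequality cM Hl Hmu kM p1 k0 dk).
exact: (sharp_constant cM Hl Hmu kM p1 k0 dk d0).
Qed.
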